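(* Let $u\in K$ be a minimizer of $I$ (a primal solution). Then the following statements hold. (i) A (Fenchel) dual problem to the minimization of $I$ is given by the maximization of $D\colon \overline{H}_I(\mathrm{div};\Omega)\to\mathbb{R}\cup\{-\infty\}$; that is, writing $I(v)=G(\nabla v)+F(v)$ for $v\in H^1(\Omega)$ with $G(y)=\tfrac12\|y\|_\Omega^2$ for $y\in (L^2(\Omega))^d$ and $F(v)=-(f,v)_\Omega-\langle g,v\rangle_{\Gamma_N}+\tfrac{1}{2m}\|v\|_{1,\Gamma_I}^2$ if $v=u_D$ a.e. on $\Gamma_D$, $F(v)=+\infty$ otherwise, the functional $y\mapsto -G^*(y)-F^*(-\nabla^*y)$ on $(L^2(\Omega))^d$ coincides with $D$ on $\overline{H}_I(\mathrm{div};\Omega)$ and equals $-\infty$ on $(L^2(\Omega))^d\setminus\overline{H}_I(\mathrm{div};\Omega)$. (ii) There exists a unique maximizer $z\in\overline{H}_I(\mathrm{div};\Omega)$ of $D$, and it satisfies $$\mathrm{div}\,z=-f\ \text{ a.e. in }\Omega,\qquad \langle z\cdot n,v\rangle_{\partial\Omega}-(\overline{z\cdot n},v)_{\Gamma_I}=\langle g,v\rangle_{\Gamma_N}\ \text{ for all }v\in H^1_D(\Omega).$$ In addition, the strong duality relation $I(u)=D(z)$ holds. (iii) The following convex optimality relations hold: $$z=\nabla u\ \text{ a.e. in }\Omega,\qquad -(\overline{z\cdot n},u)_{\Gamma_I}=\tfrac{m}{2}\|\overline{z\cdot n}\|_{\infty,\Gamma_I}^2+\tfrac{1}{2m}\|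u\|_{1,\Gamma_I}^2.$$
   Context: Setting. $\Omega\subseteq\mathbb{R}^d$, $d\in\mathbb{N}$, is a bounded simplicial (polyhedral) Lipschitz domain with outward unit normal $n$, whose boundary is split into three relatively open parts $\Gamma_I\neq\emptyset$ (insulated), $\Gamma_D$ (Dirichlet), $\Gamma_N$ (Neumann), with $\partial\Omega=\overline{\Gamma}_I\cup\overline{\Gamma}_D\cup\overline{\Gamma}_N$. $(\cdot,\cdot)_\omega$ is the integral of the (Euclidean) product over $\omega$ (surface measure if $\omega\subseteq\partial\Omega$), $\|\cdot\|_{p,\omega}$ the $L^p(\omega)$-norm, $\|\cdot\|_\omega=\|\cdot\|_{2,\omega}$. Traces are not written explicitly. For $\gamma\in\{\Gamma_I,\Gamma_D,\Gamma_N,\partial\Omega\}$, $H^{1/2}(\gamma)$ is the space of traces on $\gamma$ of functions in $H^1(\Omega)$ (image norm), $H^{-1/2}(\gamma)$ its dual, $\langle\cdot,\cdot\rangle_\gamma$ the duality pairing. $H^1_X(\Omega)=\{v\in H^1(\Omega): v=0\text{ a.e. on }\Gamma_X\}$ for $X\in\{I,D,N\}$. $H(\mathrm{div};\Omega)=\{y\in(L^2(\Omega))^d:\mathrm{div}\,y\in L^2(\Omega)\}$, and $y\cdot n\in H^{-1/2}(\partial\Omega)$ is the normal trace, given by $\langle y\cdot n,v\rangle_{\partial\Omega}=(\nabla v,y)_\Omega+(v,\mathrm{div}\,y)_\Omega$ for $v\in H^1(\Omega)$. $\overline{H}_I(\mathrm{div};\Omega)$ is the set of $y\in H(\mathrm{div};\Omega)$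 for which there exists $\overline{y\cdot n}\in L^\infty(\Gamma_I)$ with $(\overline{y\cdot n},v)_{\Gamma_I}=\langle y\cdot n,v\rangle_{\partial\Omega}$ for all $v\in H^1_D(\Omega)\cap H^1_N(\Omega)$. Data: $m>0$, $f\in L^2(\Omega)$, $g\in H^{-1/2}(\Gamma_N)$, $u_D\in H^{1/2}(\Gamma_D)$ with a lift $\widehat u_D\in H^1(\Omega)$, $\widehat u_D=u_D$ a.e. on $\Gamma_D$. Primal functional $I\colon H^1(\Omega)\to\mathbb{R}\cup\{+\infty\}$: $I(v)=\tfrac12\|\nabla v\|_\Omega^2+\tfrac1{2m}\|v\|_{1,\Gamma_I}^2-(f,v)_\Omega-\langle g,v\rangle_{\Gamma_N}$ if $v=u_D$ a.e. on $\Gamma_D$, and $I(v)=+\infty$ otherwise. Its effective domain is $K=\widehat u_D+H^1_D(\Omega)$. Dual functional $D\colon\overline{H}_I(\mathrm{div};\Omega)\to\mathbb{R}\cup\{-\infty\}$: $D(y)=-\tfrac12\|y\|_\Omega^2-\tfrac m2\|\overline{y\cdot n}\|_{\infty,\Gamma_I}^2+\langle y\cdot n,\widehat u_D\rangle_{\partial\Omega}-(\overline{y\cdot n},\widehat u_D)_{\Gamma_I}-\langle g,\widehat u_D\rangle_{\Gamma_N}$ if $y\in K^*$, and $D(y)=-\infty$ otherwise, where $K^*$ is the set of $y\in\overline{H}_I(\mathrm{div};\Omega)$ with $\mathrm{div}\,y=-f$ a.e. in $\Omega$ and $\langle y\cdot n,v\rangle_{\partial\Omega}=\langle g,v\rangle_{\Gamma_N}$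 for all $v\in H^1_I(\Omega)\cap H^1_D(\Omega)$. Here $G^*,F^*$ are Fenchel conjugates (with $(L^2(\Omega))^d$ identified with its dual) and $\nabla^*\colon(L^2(\Omega))^d\to(H^1(\Omega))^*$ is the adjoint of $\nabla\colon H^1(\Omega)\to(L^2(\Omega))^d$; the (Fenchel) dual problem of minimizing $G(\nabla v)+F(v)$ is maximizing $-G^*(y)-F^*(-\nabla^*y)$ over $(L^2(\Omega))^d$.
   Formalization: It is additionally assumed that the interface of the closures of Γ_I and Γ_N has finite (d−2)-dimensional Minkowski content (true for polyhedral splittings); for arbitrary relatively open parts (i) fails, e.g. for a Cantor-type interface. *)

(* Defs.v *)
From HB Require Import structures.
From mathcomp Require Import all_boot all_order all_algebra.
From mathcomp Require Import all_classical all_reals all_analysis.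

Set Implicit Arguments.
Unset Strict Implicit.
Unset Printing Implicit Defensive.
Import Order.TTheory GRing.Theory Num.Theory.
Import numFieldNormedType.Exports.
Local Open Scope classical_set_scope.
Local Open Scope ring_scope.

(* 'rV[T]_n carries the product sigma-algebra, as n.-tuple T does in the
   library; for T = R this is the Borel sigma-algebra of R^n. *)
Definition measure_rV_display : measure_display -> measure_display.
Proof. exact. Qed.

Section measurable_rV.
Context {d} {T : sigmaRingType d} (n : nat).

Let coors : 'I_n -> 'rV[T]_n -> T := fun i x => x ord0 i.

Let rV_set0 : g_sigma_preimage coors set0.
Proof. exact: sigma_algebra0. Qed.

Let rV_setC A : g_sigma_preimage coors A -> g_sigma_preimage coors (~` A).
Proof. exact: sigma_algebraC. Qed.

Let rV_bigcup (F : _^nat) : (forall i, g_sigma_preimage coors (F i)) ->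
  g_sigma_preimage coors (\bigcup_i (F i)).
Proof. exact: sigma_algebra_bigcup. Qed.

HB.instance Definition _ := @isMeasurable.Build (measure_rV_display d)
  'rV[T]_n (g_sigma_preimage coors) rV_set0 rV_setC rV_bigcup.

End measurable_rV.

Lemma measurable_coord d (T : sigmaRingType d) n (i : 'I_n) :
  measurable_fun [set: 'rV[T]_n] (fun x : 'rV[T]_n => x ord0 i).
Proof.
move=> _ Y mY; rewrite setTI; apply: sub_sigma_algebra => /=.
rewrite -bigcup_seq/=; exists i => /=; first by rewrite mem_index_enum.
by exists Y => //; rewrite setTI.
Qed.

Lemma measurable_fun_rV d1 d2 (T1 : measurableType d1) (T2 : measurableType d2)
    n (f : T1 -> 'rV[T2]_n) :
  (forall i, measurable_fun [set: T1] (fun x => f x ord0 i)) ->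
  measurable_fun [set: T1] f.
Proof.
move=> mf _ A mA; rewrite setTI.
pose co := (fun i (x : 'rV[T2]_n) => x ord0 i).
have : g_sigma_preimage (fun i => co i \o f) `<=` measurable.
  apply: smallest_sub; first exact: sigma_algebra_measurable.
  case: n => [|n] in f mf A mA co *; first by rewrite big_ord0.
  rewrite -bigcup_mkord_ord; apply: bigcup_sub => i Ii.
  by move=> B [C mC <-]; exact: mf.
apply; rewrite g_sigma_preimage_comp; exists A => //; by rewrite setTI.
Qed.

Section lebesgue_rV.
Context {R : realType}.

Definition cons_rV n (p : 'rV[R]_n * R) : 'rV[R]_n.+1 :=
  \row_i (if unlift ord0 i is Some j then p.1 ord0 j else p.2).

Lemma measurable_cons_rV n : measurable_fun setT (@cons_rV n).
Proof.
apply: measurable_fun_rV => i; rewrite /cons_rV.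
under eq_fun do rewrite mxE.
case: unliftP => [j _|_]; last exact: measurable_snd.
exact: (measurableT_comp (measurable_coord j) measurable_fst).
Qed.

Definition image_measure d1 d2 (T1 : measurableType d1)
    (T2 : measurableType d2) (mu : {measure set T1 -> \bar R}) (f : T1 -> T2)
    (mf : measurable_fun setT f) : {measure set T2 -> \bar R} :=
  measure_function_pushforward__canonical__measure_function_Measure mu mf.

(* Lebesgue measure on R^n *)
Fixpoint leb n : {measure set 'rV[R]_n -> \bar R} :=
  match n with
  | 0 => dirac (0 : 'rV[R]_0)
  | n'.+1 =>
      image_measure (leb n' \x @lebesgue_measure R)%E (@measurable_cons_rV n')
  end.

End lebesgue_rV.

(* A facet, i.e. an n-simplex in R^(n+1), is given by the square matrix whose
   rows are its n+1 vertices. *)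
Section facets.
Context {R : realType} {n : nat}.
Implicit Types P : 'M[R]_n.+1.

Definition edges P : 'M[R]_(n, n.+1) :=
  \matrix_(k, j) (P (lift ord0 k) j - P ord0 j).

Definition facet P : set 'rV[R]_n.+1 :=
  [set c *m P | c in
    [set c : 'rV[R]_n.+1 | (forall i, 0 <= c ord0 i) /\ \sum_i c ord0 i = 1]].

Definition relint_facet P : set 'rV[R]_n.+1 :=
  [set c *m P | c in
    [set c : 'rV[R]_n.+1 | (forall i, 0 < c ord0 i) /\ \sum_i c ord0 i = 1]].

Definition unit_simplex : set 'rV[R]_n :=
  [set t | (forall i, 0 <= t ord0 i) /\ \sum_i t ord0 i <= 1].

Definition facet_param P (t : 'rV[R]_n) : 'rV[R]_n.+1 := row ord0 P + t *m edges P.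

Lemma measurable_unit_simplex : measurable unit_simplex.
Proof.
rewrite (_ : unit_simplex = (\bigcap_(i in [set: 'I_n])
    ((fun t : 'rV[R]_n => t ord0 i) @^-1` `[0, +oo[)) `&`
    ((fun t : 'rV[R]_n => \sum_i t ord0 i) @^-1` `]-oo, 1])); last first.
  apply/seteqP; split=> t /=; rewrite in_itv/=.
    by case=> t0 t1; split=> // i _ /=; rewrite in_itv/= t0.
  by case=> t0 t1; split=> // i; have := t0 i I; rewrite /= in_itv/= andbT.
apply: measurableI.
  apply: fin_bigcap_measurable => // i _; rewrite -[X in measurable X]setTI.
  exact: measurable_coord.
rewrite -[X in measurable X]setTI.
apply: (_ : measurable_fun setT (fun t : 'rV[R]_n => \sum_i t ord0 i)) => //.
by apply: measurable_sum => i; exact: measurable_coord.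
Qed.

Lemma measurable_facet_param P : measurable_fun setT (facet_param P).
Proof.
apply: measurable_fun_rV => i; rewrite /facet_param.
under eq_fun do rewrite !mxE.
apply: measurable_realfun.measurable_funD => //; apply: measurable_sum => j.
by apply: measurable_realfun.measurable_funM => //; exact: measurable_coord.
Qed.

(* Area formula: the n-dimensional area of the affine image of the unit simplex
   is weighted by the square root of the Gram determinant. *)
Definition facet_area P : {measure set 'rV[R]_n.+1 -> \bar R} :=
  mscale (NngNum (sqrtr_ge0 (\det (edges P *m (edges P)^T))))
    (image_measure (mrestr (leb n) measurable_unit_simplex)
                   (measurable_facet_param P)).

Definition surface_measure (T : seq 'M[R]_n.+1) :
    {measure set 'rV[R]_n.+1 -> \bar R} :=
  msum (fun k => facet_area T`_k) (size T).

End facets.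

Section domains.
Context {R : realType} {n : nat}.
Local Notation E := 'rV[R]_n.+1.
Implicit Types (Omega G : set E) (T : seq 'M[R]_n.+1) (x y : E).

Definition dotp x y : R := \sum_i x ord0 i * y ord0 i.

Definition bnd Omega : set E := closure Omega `\` interior Omega.

(* Near each boundary point, Omega lies above the graph, in direction e, of a
   Lipschitz function of the coordinates orthogonal to e; such a function is
   encoded as a Lipschitz function on R^(n+1) that is constant along e. *)
Definition lipschitz_boundary Omega :=
  forall x, bnd Omega x ->
  exists (U : set E) (e : E) (phi : E -> R),
    [/\ open U, U x, dotp e e = 1, lipschitz phi &
        (forall y t, phi (y + t *: e) = phi y) /\
        Omega `&` U = [set y | phi y < dotp y e] `&` U].

(* T lists the facets of a decomposition of the boundary of Omega into
   nondegenerate nonoverlapping simplices. *)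
Definition simplicial_boundary Omega T :=
  [/\ forall P, P \in T -> row_free (edges P),
      bnd Omega = \bigcup_(P in [set P | P \in T]) facet P &
      forall i j, (i < j < size T)%N ->
        relint_facet T`_i `&` relint_facet T`_j = set0].

Record simplicial_lipschitz_domain Omega T : Prop := {
  dom_open : open Omega ;
  dom_connected : connected Omega ;
  dom_bounded : bounded_set Omega ;
  dom_lipschitz : lipschitz_boundary Omega ;
  dom_simplicial : simplicial_boundary Omega T }.

Definition relatively_open Omega G :=
  exists2 U : set E, open U & G = U `&` bnd Omega.

(* The last field makes the interface between G_I and G_N a set of codimension 2
   in R^(n+1) (finite Minkowski content), as it is for polyhedral or piecewise
   smooth parts; for n = 0 it says that the two closures are disjoint.  It makes
   functions of H^1_D vanishing near the interface dense in H^1_D: if the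
   interface carries a nonzero singular measure of H^{-1/2}, the conditions on
   G_I and on G_N do not determine the normal flux on H^1_D. *)
Record boundary_splitting Omega G_I G_D G_N : Prop := {
  split_openI : relatively_open Omega G_I ;
  split_openD : relatively_open Omega G_D ;
  split_openN : relatively_open Omega G_N ;
  split_ID : G_I `&` G_D = set0 ;
  split_IN : G_I `&` G_N = set0 ;
  split_DN : G_D `&` G_N = set0 ;
  split_cover : bnd Omega = closure G_I `|` closure G_D `|` closure G_N ;
  split_interface : exists C : R, forall eps : R, 0 < eps <= 1 ->
    (leb n.+1 (\bigcup_(x in closure G_I `&` closure G_N) ball x eps)
      <= (C * eps ^+ 2)%:E)%E }.

End domains.

(* Elements of L^p, H^1, H(div), ... are represented by functions on R^(n+1)
   whose values outside the set under consideration are irrelevant. *)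
Section spaces.
Context {R : realType} {n : nat}.
Local Notation E := 'rV[R]_n.+1.
Implicit Types (mu : {measure set E -> \bar R}) (A : set E) (p : \bar R).

Definition eLpnorm mu A p (w : E -> R) : \bar R :=
  ('N[mu]_p [EFin \o (w \_ A)])%E.

Definition Lpnorm mu A p (w : E -> R) : R := fine (eLpnorm mu A p w).

Definition Lp mu A p : set (E -> R) :=
  [set w | measurable_fun A w /\ (eLpnorm mu A p w < +oo)%E].

Definition ip mu A (v w : E -> R) : R := \int[mu]_(x in A) (v x * w x).

Definition partial (i : 'I_n.+1) (phi : E -> R) (x : E) : R :=
  'D_(delta_mx ord0 i) phi x.

Fixpoint Ck (k : nat) (phi : E -> R) : Prop :=
  continuous phi /\
  if k is k'.+1 then
    forall i, (forall x, derivable phi x (delta_mx ord0 i)) /\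
              Ck k' (partial i phi)
  else True.

Definition smooth phi := forall k, Ck k phi.

Variables (Omega : set E) (T : seq 'M[R]_n.+1).

Local Notation lambda := (leb n.+1).
Local Notation sigma := (surface_measure T).

Definition test_function : set (E -> R) :=
  [set phi | [/\ smooth phi, compact (closure [set x | phi x != 0]) &
                 closure [set x | phi x != 0] `<=` Omega]].

Definition L2 : set (E -> R) := Lp lambda Omega 2%:E.

Definition L2vec : set (E -> E) :=
  [set y | forall i, L2 (fun x => y x ord0 i)].

Definition ipvec (y w : E -> E) : R :=
  \int[lambda]_(x in Omega) dotp (y x) (w x).

Definition normvec (y : E -> E) : R := Num.sqrt (ipvec y y).

Definition is_wgrad (v : E -> R) (w : E -> E) := L2vec w /\
  forall phi, test_function phi -> forall i,
    ip lambda Omega v (partial i phi) =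
    - ip lambda Omega (fun x => w x ord0 i) phi.

Definition H1 : set (E -> R) := [set v | L2 v /\ exists w, is_wgrad v w].

Definition wgrad (v : E -> R) : E -> E := xget (fun=> 0) [set w | is_wgrad v w].

Definition H1norm (v : E -> R) : R :=
  Num.sqrt (Lpnorm lambda Omega 2%:E v ^+ 2 + normvec (wgrad v) ^+ 2).

Definition is_wdiv (y : E -> E) (h : E -> R) := L2 h /\
  forall phi, test_function phi ->
    ipvec y (fun x => \row_i partial i phi x) = - ip lambda Omega h phi.

Definition Hdiv : set (E -> E) := [set y | L2vec y /\ exists h, is_wdiv y h].

Definition wdiv (y : E -> E) : E -> R := xget (fun=> 0) [set h | is_wdiv y h].

(* The trace operator is the continuous extension to H^1(Omega) of the
   restriction to the boundary of functions smooth up to the boundary. *)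
Definition is_trace (v w : E -> R) :=
  Lp sigma (bnd Omega) 2%:E w /\
  exists phi : nat -> E -> R,
    [/\ forall k, smooth (phi k),
        H1norm (phi k \- v) @[k --> \oo] --> (0 : R) &
        Lpnorm sigma (bnd Omega) 2%:E (phi k \- w) @[k --> \oo] --> (0 : R)].

Definition trace (v : E -> R) : E -> R :=
  xget (fun=> 0) [set w | is_trace v w].

Definition H1_0 (G : set E) : set (E -> R) :=
  [set v | H1 v /\ ae_eq sigma G (trace v) (fun=> 0)].

Definition Hhalf (G : set E) : set (E -> R) :=
  [set w | exists2 v, H1 v & ae_eq sigma G (trace v) w].

Definition Hhalf_norm (G : set E) (w : E -> R) : R :=
  inf [set H1norm v | v in [set v | H1 v /\ ae_eq sigma G (trace v) w]].

(* Elements of H^{-1/2}(G): functionals g on the functions of Hhalf G that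
   factor through sigma-a.e. equality on G, linear and bounded. *)
Record Hmhalf (G : set E) (g : (E -> R) -> R) : Prop := {
  Hmhalf_ae : forall w w', Hhalf G w -> Hhalf G w' ->
    ae_eq sigma G w w' -> g w = g w' ;
  Hmhalf_lin : forall a w w', Hhalf G w -> Hhalf G w' ->
    g (fun x => a * w x + w' x) = a * g w + g w' ;
  Hmhalf_bnd : exists C : R, forall w, Hhalf G w ->
    `|g w| <= C * Hhalf_norm G w }.

(* <y.n, v> on the whole boundary *)
Definition nflux (y : E -> E) (v : E -> R) : R :=
  ipvec (wgrad v) y + ip lambda Omega v (wdiv y).

Definition is_bflux (G_I G_D G_N : set E) (y : E -> E) (w : E -> R) :=
  Lp sigma G_I +oo%E w /\
  forall v, H1_0 G_D v -> H1_0 G_N v -> ip sigma G_I w (trace v) = nflux y v.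

Definition HbarI G_I G_D G_N : set (E -> E) :=
  [set y | Hdiv y /\ exists w, is_bflux G_I G_D G_N y w].

Definition bflux G_I G_D G_N (y : E -> E) : E -> R :=
  xget (fun=> 0) [set w | is_bflux G_I G_D G_N y w].

(* Fenchel conjugate of F : X -> ]-oo, +oo], at the linear functional xi *)
Definition fenchel V (X : set V) (F : V -> \bar R) (xi : V -> R) : \bar R :=
  ereal_sup [set ((xi v)%:E - F v)%E | v in X].

Definition grad_adjoint (y : E -> E) (v : E -> R) : R := ipvec y (wgrad v).

Section functionals.
Variables (G_I G_D G_N : set E) (m : R) (f : E -> R) (g : (E -> R) -> R).
Variables (uD uhatD : E -> R).

Definition primalI (v : E -> R) : \bar R :=
  if `[< ae_eq sigma G_D (trace v) uD >] then
    (2^-1 * normvec (wgrad v) ^+ 2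
     + (2 * m)^-1 * Lpnorm sigma G_I 1%:E (trace v) ^+ 2
     - ip lambda Omega f v - g (trace v))%:E
  else +oo%E.

Definition primalK : set (E -> R) :=
  [set v | H1 v /\ H1_0 G_D (v \- uhatD)].

Definition funcG (y : E -> E) : \bar R := (2^-1 * normvec y ^+ 2)%:E.

Definition funcF (v : E -> R) : \bar R :=
  if `[< ae_eq sigma G_D (trace v) uD >] then
    (- ip lambda Omega f v - g (trace v)
     + (2 * m)^-1 * Lpnorm sigma G_I 1%:E (trace v) ^+ 2)%:E
  else +oo%E.

Definition dualK : set (E -> E) :=
  [set y | [/\ HbarI G_I G_D G_N y,
               ae_eq lambda Omega (wdiv y) (fun x => - f x) &
               forall v, H1_0 G_I v -> H1_0 G_D v -> nflux y v = g (trace v)]].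

Definition dualD (y : E -> E) : \bar R :=
  let yn := bflux G_I G_D G_N y in
  if `[< dualK y >] then
    (- (2^-1 * normvec y ^+ 2) - m / 2 * Lpnorm sigma G_I +oo%E yn ^+ 2
     + nflux y uhatD - ip sigma G_I yn (trace uhatD) - g (trace uhatD))%:E
  else -oo%E.

Definition fenchel_dual (y : E -> E) : \bar R :=
  (- fenchel L2vec funcG (ipvec y)
   - fenchel H1 funcF (fun v => - grad_adjoint y v)%R)%E.

End functionals.

End spaces.

(* Main.v *)
Require Import Defs.
From HB Require Import structures.
From mathcomp Require Import all_boot all_order all_algebra.
From mathcomp Require Import all_classical all_reals all_analysis.
From mathcomp Require Import measurable_realfun ess_sup_inf.
From mathcomp Require Import ring lra.

Set Implicit Arguments.
Unset Strict Implicit.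
Unset Printing Implicit Defensive.
Import Order.TTheory GRing.Theory Num.Theory.
Import numFieldNormedType.Exports.
Local Open Scope classical_set_scope.
Local Open Scope ring_scope.

(* Let r_y(v) = - (y, grad v) + (f, v) + <g, v>.  A field y belongs to K* if and only
   if |r_y(v)| <= c ||v||_{1,G_I} on H^1_D for some c: such a functional is represented
   on G_I by some q in L^oo with ||q||_oo <= c, and testing with functions vanishing
   on the boundary, on G_N and on G_I gives div y = - f, the flux - q on G_I and the
   Neumann condition.  Conversely, K* controls r_y on functions that vanish on G_I or
   on G_N; a smooth partition of unity extends this to functions vanishing near the
   interface of G_I and G_N, which are dense in H^1_D because logarithmic cutoffs
   around a set of codimension 2 have small gradients in L^2.

   The conjugate of F at - grad^* y is the supremum of r_y(v) - ||v||_1^2 / 2m, which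
   is finite exactly when r_y is bounded in this sense; this gives (i).  For
   a minimizer u with trace of norm a = ||u||_{1,G_I}, one-sided differentiation of I
   along w gives |r_z(w)| <= (a / m) ||w||_1 for z = grad u, hence z in K* with
   ||zn||_oo <= a / m.  Letting w approximate - u in L^1(G_I) gives
   (zn, u) <= - a^2 / m, which closes the duality gap
   I(v) - D(y) = ||y - grad v||^2 / 2 + (||v||_1^2 / 2m + m ||yn||_oo^2 / 2 + (yn, v)).

   Traces exist since smooth functions are dense in H^1 (near the boundary, translate
   into Omega along the direction of the graph, then mollify) and since the integral of
   the gradient along segments issuing from a facet in that direction bounds the
   boundary values of a smooth function by its H^1 norm. *)

(** * Lebesgue measure on R^n *)

(** On [G_I] only L^1 norms of traces and pairings with bounded functions occur. Hence it is enough
    that test functions of an open set U, where [G_I] is the part of the boundary inside U, are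
    dense in L^2([G_I]), although their H^1 norms may blow up along the approximation. This is
    harmless in the first variation: the gradient of w enters I(u + t w) at second order only with
    the factor t^2, and t tends to 0 while w is fixed. It also makes -u, whose trace on [G_D] need
    not vanish, available as a limit of directions.

    The gradients of logarithmic cutoffs are small in L^2 only, and the product rule multiplies them
    by the function that is cut off, so this function has to be bounded beforehand. The truncation M
    sin(v/M) is chosen because it maps smooth functions to smooth functions; its chain rule then
    passes to H^1 by density.

    All spaces consist of functions, not of classes, and [trace], [wgrad], [wdiv], [bflux] are
    choices fixed up to null sets; hence the semi-inner products and the [ae_eq] steps behind the
    linearity statements. *)

Section lebesgue_measure_rV.
Context {R : realType}.
Local Notation lam := (@lebesgue_measure R).

(** Balls are cubes, because the norm on row vectors is the maximum norm. Positivity of [r] matters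
    in dimension 0, where the right-hand side is everything while a ball of nonpositive radius is
    empty. *)
Lemma ball_rVE n (x : 'rV[R]_n) r : 0 < r ->
  ball x r = [set y | forall i, `|x ord0 i - y ord0 i| < r].
Proof.
move=> r0; apply/seteqP; split=> [y [_ xy] i|y xy]; first exact: xy.
by split=> // i j; rewrite ord1; exact: xy.
Qed.

Lemma measurable_ball_rV n (x : 'rV[R]_n) r : measurable (ball x r).
Proof.
have [r0|r0] := ltP 0 r; last first.
  rewrite (_ : ball x r = set0); first exact: measurable0.
  by apply/seteqP; split=> // y [r0' _]; rewrite ltNge r0 in r0'.
rewrite (_ : ball x r = \bigcap_(i in [set: 'I_n])
  ((fun y : 'rV[R]_n => y ord0 i) @^-1` ball (x ord0 i) r)); last first.
  rewrite ball_rVE//; apply/seteqP; split=> [y xy i _|y xy i]; first exact: xy.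
  exact: xy.
apply: fin_bigcap_measurable => // i _; rewrite -[X in measurable X]setTI.
by apply: (measurable_coord i) => //; exact: measurable_realfun.measurable_ball.
Qed.

(** Measurable sets are those of the product sigma-algebra, so an open set has to be exhibited as a
    countable union: here of the cubes with rational centre and radius 1/(k+1) that it contains. *)
Lemma open_measurable_rV n (U : set 'rV[R]_n) : open U -> measurable U.
Proof.
move=> oU; pose B (q : 'rV[rat]_n) (k : nat) : set 'rV[R]_n :=
  ball (map_mx ratr q : 'rV[R]_n) k.+1%:R^-1.
have -> : U = \bigcup_(p in [set p : 'rV[rat]_n * nat | B p.1 p.2 `<=` U])
    B p.1 p.2.
  apply/seteqP; split; last by move=> x [p /= sU Bx]; exact: sU.
  move=> x Ux; have /nbhs_ballP[e /= e0 xe] : nbhs x U by exact: open_nbhs_nbhs.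
  have e20 : 0 < e / 2 by rewrite divr_gt0.
  have [k ke] : exists k, k.+1%:R^-1 < e / 2.
    have /cvgrPdist_lt /(_ _ e20)[k _ /(_ k (leqnn _))] := @cvg_harmonic R.
    by rewrite sub0r normrN ger0_norm ?invr_ge0//; exists k.
  have k0 : 0 < k.+1%:R^-1 :> R by rewrite invr_gt0.
  have /choice[q qx] : forall i : 'I_n, exists q : rat,
      (x ord0 i - k.+1%:R^-1 < ratr q < x ord0 i + k.+1%:R^-1).
    move=> i; have [|q] := @rat_in_itvoo R (x ord0 i - k.+1%:R^-1)
      (x ord0 i + k.+1%:R^-1).
      by move: (k.+1%:R^-1) k0 => r r0; lra.
    by rewrite in_itv/=; exists q.
  have Bx : B (\row_i q i) k x.
    rewrite /B ball_rVE// => i; rewrite !mxE.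
    have := qx i; rewrite distrC ltr_distl.
    by move: (k.+1%:R^-1) => r /andP[? ?]; apply/andP; split; lra.
  exists (\row_i q i, k) => //= y By; apply: xe.
  apply: (@le_ball _ _ _ (k.+1%:R^-1 + k.+1%:R^-1)).
    by move: (k.+1%:R^-1) ke => r re; lra.
  by apply: ball_triangle By; exact: ball_sym.
rewrite bigcup_mkcond; apply: countable_bigcupT_measurable => [|p].
  exact: countableP.
by case: ifP => _; [exact: measurable_ball_rV|exact: measurable0].
Qed.

Lemma leb_ball n (x : 'rV[R]_n) r : 0 < r ->
  leb n (ball x r) = ((r *+ 2) ^+ n)%:E.
Proof.
elim: n x => [x r0|n IH x r0].
  rewrite /= diracE mem_set //= ?expr0//.
  by rewrite ball_rVE// => -[].
rewrite /= /pushforward.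
have -> : @cons_rV R n @^-1` ball x r =
    ball (\row_i x ord0 (lift ord0 i)) r `*` ball (x ord0 ord0) r.
  apply/seteqP; split => [[y s]|[y s]]/=.
    rewrite !ball_rVE// => xy; split.
      by move=> i; have := xy (lift ord0 i); rewrite !mxE liftK.
    by have := xy ord0; rewrite !mxE unlift_none.
  rewrite !ball_rVE// => -[xy xs] i; rewrite !mxE.
  case: unliftP => [j ->|->]; last exact: xs.
  by have := xy j; rewrite mxE.
rewrite product_measure1E/=; last 2 first.
- exact: measurable_ball_rV.
- exact: measurable_realfun.measurable_ball.
rewrite IH// lebesgue_measure_ball; last exact: ltW.
by rewrite -EFinM exprSr.
Qed.

Lemma leb_sigma_finite n : sigma_finite setT (@leb R n).
Proof.
exists (fun k => ball (0 : 'rV[R]_n) k.+1%:R) => [|k].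
  apply/seteqP; split=> // x _.
  have [k kx] : exists k : nat, `|x| < k.+1%:R.
    by exists (Num.truncn `|x|); rewrite truncnS_gt.
  exists k => //=; rewrite -ball_normE /= sub0r normrN//.
split; first exact: measurable_ball_rV.
by rewrite leb_ball// ltry.
Qed.

(** Tonelli's theorem asks for a sigma-finite instance on its measure; it is attached to this copy,
    since [leb n] is a packed measure computed by recursion. *)
Definition sleb n : set 'rV[R]_n -> \bar R := leb n.

HB.instance Definition _ n := Measure.copy (@sleb n) (leb n).
HB.instance Definition _ n :=
  @Measure_isSigmaFinite.Build _ _ _ (@sleb n) (@leb_sigma_finite n).

Lemma leb_intS n (F : 'rV[R]_n.+1 -> \bar R) :
  measurable_fun setT F -> (forall x, (0 <= F x)%E) ->
  (\int[leb n.+1]_x F x =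
   \int[leb n]_x \int[lam]_s F (cons_rV (x, s)))%E.
Proof.
move=> mF F0.
have F0' : {in setT, forall y, (0 <= F y)%E} by move=> y _; exact: F0.
have := @ge0_integral_pushforward _ _ ('rV[R]_n * measurableTypeR R)%type _ R _ (@measurable_cons_rV R n)
    (product_measure1 (@sleb n) lam) setT F measurableT mF F0'.
rewrite preimage_setT => E.
etransitivity; first exact: E.
rewrite (@fubini_tonelli1 _ _ _ _ _ (@sleb n) lam (F \o @cons_rV R n))//.
  by apply: measurableT_comp => //; exact: measurable_cons_rV.
by move=> x; exact: F0.
Qed.

Lemma leb_intS' n (F : 'rV[R]_n.+1 -> \bar R) :
  measurable_fun setT F -> (forall x, (0 <= F x)%E) ->
  (\int[leb n.+1]_x F x =
   \int[lam]_s \int[leb n]_x F (cons_rV (x, s)))%E.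
Proof.
move=> mF F0.
have F0' : {in setT, forall y, (0 <= F y)%E} by move=> y _; exact: F0.
have := @ge0_integral_pushforward _ _ ('rV[R]_n * measurableTypeR R)%type _ R _ (@measurable_cons_rV R n)
    (product_measure1 (@sleb n) lam) setT F measurableT mF F0'.
rewrite preimage_setT => E.
etransitivity; first exact: E.
rewrite (@fubini_tonelli2 _ _ _ _ _ (@sleb n) lam (F \o @cons_rV R n))//.
  by apply: measurableT_comp => //; exact: measurable_cons_rV.
by move=> x; exact: F0.
Qed.

Lemma lebesgue_measureD (a : R) (A : set R) : measurable A ->
  pushforward lam (+%R a : _ -> measurableTypeR R) A = lam A.
Proof.
move=> mA.
have ma : measurable_fun setT (+%R a : measurableTypeR R -> measurableTypeR R).
  exact: measurable_funD.
apply/esym/(@lebesgue_measure_unique _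
  (measure_function_pushforward__canonical__measure_function_Measure lam ma)).
  move=> _ [[c b]] _ <-.
rewrite /=/pushforward (_ : _ @^-1` _ = `](c - a), (b - a)]%classic); last first.
  apply/seteqP; split=> x /=; rewrite !in_itv/= => /andP[? ?];
  by apply/andP; split; lra.
rewrite !lebesgue_measure_itv/= !lte_fin ltrD2r; case: ifPn => // _.
by congr EFin; lra.
exact: mA.
Qed.

Lemma lebesgue_measureM (a : R) (A : set R) : 0 < a -> measurable A ->
  (a%:E * pushforward lam ( *%R a : _ -> measurableTypeR R) A = lam A)%E.
Proof.
move=> a0 mA.
have ma : measurable_fun setT ( *%R a : measurableTypeR R -> measurableTypeR R).
  exact: measurable_funM.
apply/esym/(@lebesgue_measure_unique _
  (mscale (NngNum (ltW a0))
  (measure_function_pushforward__canonical__measure_function_Measure lam ma))).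
  move=> _ [[c b]] _ <-.
rewrite /= /mscale/= /pushforward (_ : _ @^-1` _ = `](c / a), (b / a)]%classic); last first.
  apply/seteqP; split=> x /=; rewrite !in_itv/=.
    by rewrite ltr_pdivrMr// ler_pdivlMr// mulrC.
  by rewrite ltr_pdivrMr// ler_pdivlMr// mulrC.
rewrite !lebesgue_measure_itv/= !lte_fin ltr_pM2r ?invr_gt0//.
case: ifPn => // _; last by rewrite mule0.
by rewrite -!EFinB -EFinM; congr EFin; field; rewrite gt_eqF.
exact: mA.
Qed.

Lemma lebesgue_integralD (a : R) (f : R -> \bar R) :
  measurable_fun setT f -> (forall x, (0 <= f x)%E) ->
  (\int[lam]_x f (a + x)%R = \int[lam]_x f x)%E.
Proof.
move=> mf f0.
have ma : measurable_fun setT (+%R a : measurableTypeR R -> measurableTypeR R).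
  exact: measurable_funD.
have f0' : {in setT, forall y : measurableTypeR R, (0 <= f y)%E}.
  by move=> y _; exact: f0.
have := ge0_integral_pushforward ma lam measurableT mf f0'.
rewrite preimage_setT => <-.
by apply: eq_measure_integral => //= A mA _; exact: lebesgue_measureD.
Qed.

Lemma lebesgue_integralN (f : R -> \bar R) :
  measurable_fun setT f -> (forall x, (0 <= f x)%E) ->
  (\int[lam]_x f (- x)%R = \int[lam]_x f x)%E.
Proof.
move=> mf f0.
have ma : measurable_fun setT (-%R : measurableTypeR R -> measurableTypeR R).
  exact: oppr_measurable.
have f0' : {in setT, forall y : measurableTypeR R, (0 <= f y)%E}.
  by move=> y _; exact: f0.
have := ge0_integral_pushforward ma lam measurableT mf f0'.
rewrite preimage_setT => <-.
by apply: eq_measure_integral => //= A mA _; exact: lebesgue_measureN.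
Qed.

Lemma lebesgue_integralM (a : R) (f : R -> \bar R) : 0 < a ->
  measurable_fun setT f -> (forall x, (0 <= f x)%E) ->
  (a%:E * \int[lam]_x f (a * x)%R = \int[lam]_x f x)%E.
Proof.
move=> a0 mf f0.
have ma : measurable_fun setT ( *%R a : measurableTypeR R -> measurableTypeR R).
  exact: measurable_funM.
have f0' : {in setT, forall y : measurableTypeR R, (0 <= f y)%E}.
  by move=> y _; exact: f0.
have := ge0_integral_pushforward ma lam measurableT mf f0'.
rewrite preimage_setT => <-.
pose mu := measure_function_pushforward__canonical__measure_function_Measure lam ma.
have := @ge0_integral_mscale _ _ _ mu setT measurableT (NngNum (ltW a0)) f mf.
move=> /(_ (fun x _ => f0 x)) /= <-.
apply: eq_measure_integral => //= A mA _; exact: lebesgue_measureM.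
Qed.

Lemma measurable_addr_rV n (a : 'rV[R]_n) :
  measurable_fun setT (fun x : 'rV[R]_n => a + x).
Proof.
apply: measurable_fun_rV => i; under eq_fun do rewrite mxE.
by apply: measurable_funD => //; exact: measurable_coord.
Qed.

Lemma measurable_mulmxr_rV n m (M : 'M[R]_(n, m)) :
  measurable_fun setT (fun x : 'rV[R]_n => x *m M).
Proof.
apply: measurable_fun_rV => i; under eq_fun do rewrite mxE.
apply: measurable_sum => j.
by apply: measurable_funM => //; exact: measurable_coord.
Qed.

Lemma cons_rVE n (x : 'rV[R]_n) (s : R) :
  cons_rV (x, s) = row_mx s%:M x :> 'rV_(1 + n).
Proof.
apply/rowP => i; rewrite /cons_rV mxE /=; case: (split_ordP i) => j ->.
  rewrite row_mxEl !mxE !ord1 eqxx mulr1n.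
  have -> : lshift n (0 : 'I_1) = ord0 by apply/val_inj.
  by rewrite unlift_none.
have -> : rshift 1 j = lift ord0 j by apply/val_inj.
rewrite liftK (_ : lift ord0 j = rshift 1 j :> 'I_(1 + n)) ?row_mxEr//.
exact/val_inj.
Qed.

Lemma measurable_int_cons n (F : 'rV[R]_n.+1 -> \bar R) :
  measurable_fun setT F -> (forall x, (0 <= F x)%E) ->
  measurable_fun setT (fun x => (\int[lam]_s F (cons_rV (x, s)))%E).
Proof.
move=> mF F0.
apply: (@measurable_fun_fubini_tonelli_F _ _ _ _ _ lam (F \o @cons_rV R n)).
  by apply: measurableT_comp => //; exact: measurable_cons_rV.
by move=> x; exact: F0.
Qed.

Lemma measurable_cons_rV1 n (x : 'rV[R]_n) :
  measurable_fun setT (fun s => cons_rV (x, s)).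
Proof.
apply: measurable_fun_rV => i; rewrite /cons_rV; under eq_fun do rewrite mxE.
case: (unlift ord0 i) => [j|]; [exact: measurable_cst|exact: measurable_id].
Qed.

Lemma measurable_cons_rV2 n (s : R) :
  measurable_fun setT (fun x : 'rV[R]_n => cons_rV (x, s)).
Proof.
apply: measurable_fun_rV => i; rewrite /cons_rV; under eq_fun do rewrite mxE.
case: (unlift ord0 i) => [j|]; [exact: measurable_coord|exact: measurable_cst].
Qed.

Lemma leb_integralD n (a : 'rV[R]_n) (F : 'rV[R]_n -> \bar R) :
  measurable_fun setT F -> (forall x, (0 <= F x)%E) ->
  (\int[leb n]_x F (a + x)%R = \int[leb n]_x F x)%E.
Proof.
elim: n a F => [a F mF F0|n IH a F mF F0].
  by apply: eq_integral => x _; rewrite [a]thinmx0 add0r.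
have mFa : measurable_fun setT (fun x => F (a + x)).
  by apply: measurableT_comp => //; exact: measurable_addr_rV.
rewrite (leb_intS mFa (fun x => F0 _)) (leb_intS mF F0).
rewrite -(IH (\row_i a ord0 (lift ord0 i))
  (fun x => \int[lam]_s F (cons_rV (x, s)))%E); last 2 first.
- by apply: measurable_int_cons.
- by move=> x; exact: integral_ge0.
apply: eq_integral => x _.
rewrite -(@lebesgue_integralD (a ord0 ord0) (fun s => F (cons_rV (_, s)))).
- apply: eq_integral => s _; congr F; apply/rowP => i.
  rewrite /cons_rV !mxE; case: unliftP => [j ->|->] //=.
  by rewrite !mxE.
- by apply: measurableT_comp => //; exact: measurable_cons_rV1.
- by move=> s.
Qed.

(* An inequality up to a constant replaces the change of variables formula, so that
   no Jacobian determinant is needed. *)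
Definition lin_bdd n (M : 'M[R]_n) := exists2 C : R, 0 <= C &
  forall F : 'rV[R]_n -> \bar R, measurable_fun setT F ->
    (forall x, (0 <= F x)%E) ->
    (\int[leb n]_x F (x *m M) <= C%:E * \int[leb n]_x F x)%E.

Lemma lin_bddM n (M N : 'M[R]_n) :
  lin_bdd M -> lin_bdd N -> lin_bdd (M *m N).
Proof.
move=> [C C0 hC] [D D0 hD]; exists (C * D); first exact: mulr_ge0.
move=> F mF F0; under eq_integral do rewrite mulmxA.
have := hC (fun x => F (x *m N)).
move=> /(_ _ _)/le_trans; apply.
- by apply: measurableT_comp => //; exact: measurable_mulmxr_rV.
- by move=> x.
by rewrite EFinM -muleA; apply: lee_wpmul2l; [rewrite lee_fin|exact: hD].
Qed.

Lemma lin_bdd_ll n (c : 'cV[R]_n) :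
  lin_bdd (block_mx 1 0 c 1%:M : 'M[R]_(1 + n)).
Proof.
exists 1 => // F mF F0; rewrite mul1e.
have mFM : measurable_fun setT
    (fun x : 'rV[R]_(1 + n) => F (x *m (block_mx 1 0 c 1%:M : 'M[R]_(1 + n)))).
  by apply: measurableT_comp => //; exact: measurable_mulmxr_rV.
rewrite (leb_intS mFM)// (leb_intS mF)// le_eqVlt; apply/orP; left.
apply/eqP/eq_integral => x _.
rewrite -[RHS](@lebesgue_integralD ((x *m c) ord0 ord0)); last 2 first.
- by apply: measurableT_comp => //; exact: measurable_cons_rV1.
- by move=> s.
apply: eq_integral => s _; congr F; rewrite !cons_rVE mul_row_block.
rewrite mulmx0 mulmx1 add0r mulmx1; congr row_mx.
by apply/matrixP => i j; rewrite !ord1 !mxE eqxx !mulr1n addrC.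
Qed.

Lemma lin_bdd_ur n (b : 'rV[R]_n) :
  lin_bdd (block_mx 1 b 0 1%:M : 'M[R]_(1 + n)).
Proof.
exists 1 => // F mF F0; rewrite mul1e.
have mFM : measurable_fun setT
    (fun x : 'rV[R]_(1 + n) => F (x *m (block_mx 1 b 0 1%:M : 'M[R]_(1 + n)))).
  by apply: measurableT_comp => //; exact: measurable_mulmxr_rV.
rewrite (leb_intS' mFM)// (leb_intS' mF)// le_eqVlt; apply/orP; left.
apply/eqP/eq_integral => s _.
rewrite -[RHS](@leb_integralD n (s *: b)); last 2 first.
- by apply: measurableT_comp => //; exact: measurable_cons_rV2.
- by move=> x.
apply: eq_integral => x _; congr F; rewrite !cons_rVE mul_row_block.
by rewrite mulmx0 !mulmx1 addr0 mul_scalar_mx.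
Qed.

Lemma lebesgue_integralM_neq0 (a : R) (f : R -> \bar R) : a != 0 ->
  measurable_fun setT f -> (forall x, (0 <= f x)%E) ->
  (\int[lam]_x f (x * a)%R = `|a|^-1%:E * \int[lam]_x f x)%E.
Proof.
move=> a0 mf f0.
have pos b g : 0 < b -> measurable_fun setT g -> (forall x, (0 <= g x)%E) ->
    (\int[lam]_x g (x * b)%R = b^-1%:E * \int[lam]_x g x)%E.
  move=> b0 mg g0; rewrite -(lebesgue_integralM b0 mg g0) muleA -EFinM.
  by rewrite mulVf ?gt_eqF// mul1e; under eq_integral do rewrite mulrC.
have [a1|a1|a1] := ltgtP a 0; last by rewrite a1 eqxx in a0.
  rewrite ltr0_norm// -(lebesgue_integralN mf f0).
  rewrite -(pos (- a) (fun x => f (- x)))//; last 2 first.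
  - by rewrite oppr_gt0.
  - by apply: (measurableT_comp mf); exact: oppr_measurable.
  by under [RHS]eq_integral do rewrite mulrN opprK.
by rewrite gtr0_norm// pos.
Qed.

Lemma lin_bdd_diag n (a : R) (D : 'M[R]_n) : a != 0 -> lin_bdd D ->
  lin_bdd (block_mx a%:M 0 0 D : 'M[R]_(1 + n)).
Proof.
move=> a0 [C C0 hC]; exists (`|a|^-1 * C).
  by rewrite mulr_ge0// invr_ge0.
move=> F mF F0.
have mFM : measurable_fun setT
    (fun x : 'rV[R]_(1 + n) => F (x *m (block_mx a%:M 0 0 D : 'M[R]_(1 + n)))).
  by apply: measurableT_comp => //; exact: measurable_mulmxr_rV.
rewrite (leb_intS mFM)// (leb_intS mF)//.
pose G x := (\int[lam]_s F (cons_rV (x, s)))%E.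
have mG : measurable_fun setT G by exact: measurable_int_cons.
have G0 x : (0 <= G x)%E by exact: integral_ge0.
rewrite [leLHS](_ : _ = \int[leb n]_x (`|a|^-1%:E * G (x *m D)))%E; last first.
  apply: eq_integral => x _; rewrite -lebesgue_integralM_neq0//.
    apply: eq_integral => s _; congr F; rewrite !cons_rVE mul_row_block.
    rewrite !mulmx0 addr0 add0r; congr row_mx.
    by apply/matrixP => i j; rewrite !ord1 !mxE big_ord1 !mxE eqxx !mulr1n.
  by apply: measurableT_comp => //; exact: measurable_cons_rV1.
have mGD : measurable_fun setT (fun x : 'rV[R]_n => G (x *m D)).
  by apply: (measurableT_comp mG); exact: measurable_mulmxr_rV.
have a1 : (0 <= `|a|^-1%:E)%E by rewrite lee_fin invr_ge0.
rewrite (ge0_integralZl (leb n) measurableT mGD (fun x _ => G0 _) a1).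
rewrite EFinM -muleA; apply: lee_wpmul2l; first exact: a1.
exact: hC.
Qed.

(** Block elimination, by induction on the dimension. With a nonzero corner entry the matrix is a
    product of two unipotent block matrices and a block diagonal one; the unipotent factors are
    shears, which translate each fiber and therefore preserve integrals. *)
Lemma unitmx_lin_bdd n (M : 'M[R]_n) : M \in unitmx -> lin_bdd M.
Proof.
elim: n M => [M _|n IH M].
  exists 1 => // F mF F0; rewrite mul1e le_eqVlt; apply/orP; left.
  by apply/eqP; apply: eq_integral => x _; rewrite !thinmx0.
rewrite -[n.+1]/(1 + n)%N in M *.
have pivot (N : 'M[R]_(1 + n)) : N ord0 ord0 != 0 -> N \in unitmx -> lin_bdd N.
  move=> N0 uN; set a := N ord0 ord0 in N0.
  have ul : ulsubmx N = a%:M.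
    apply/matrixP => i j; rewrite !ord1 !mxE eqxx mulr1n.
    by rewrite /a; congr (fun_of_matrix N _ _); apply/val_inj.
  pose D := drsubmx N - a^-1 *: (dlsubmx N *m ursubmx N).
  have NE : N = (block_mx 1 0 (a^-1 *: dlsubmx N) 1%:M : 'M[R]_(1 + n)) *m
      ((block_mx a%:M 0 0 D : 'M[R]_(1 + n)) *m
       (block_mx 1 (a^-1 *: ursubmx N) 0 1%:M : 'M[R]_(1 + n))).
    rewrite !mulmx_block !mulmx0 !mul0mx !mul1mx !mulmx1 !addr0 !add0r.
    rewrite mul_scalar_mx scalerA divff// scale1r -[LHS]submxK ul.
    rewrite mul_mx_scalar scalerA divff// scale1r.
    by rewrite /D -scalemxAl addrC subrK.
  rewrite NE; apply: lin_bddM; first exact: lin_bdd_ll.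
  apply: lin_bddM; last exact: lin_bdd_ur.
  apply: lin_bdd_diag => //; apply: IH.
  move: uN; rewrite NE !unitmxE !det_mulmx det_lblock det_ublock det_ublock.
  by rewrite !det1 !mul1r mulr1 det_scalar1 unitrM => /andP[].
have [M0|M0 uM] := eqVneq (M ord0 ord0) 0; last exact: pivot.
move=> uM.
have [i Mi] : exists i : 'I_n, M (rshift 1 i) ord0 != 0.
  apply: contrapT => /forallNP Mi; move: uM; rewrite unitmxE.
  rewrite (expand_det_col _ ord0) big1 ?unitr0// => j _.
  case: (split_ordP (j : 'I_(1 + n))) => k ->.
    by rewrite ord1 (_ : lshift n 0 = ord0) ?M0 ?mul0r//; apply/val_inj.
  by have /negP := Mi k; rewrite negbK => /eqP ->; rewrite mul0r.
(* If the corner entry vanishes, the row with a nonzero first entry is added to the first row;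
   [B (-1)] undoes this. *)
pose B (s : R) : 'M[R]_(1 + n) := block_mx 1 (s *: delta_mx ord0 i) 0 1%:M.
have -> : M = B (-1) *m (B 1 *m M).
  rewrite mulmxA mulmx_block !mulmx0 !mul0mx !mul1mx !mulmx1 !addr0 !add0r.
  by rewrite scaleN1r scale1r subrr -scalar_mx_block mul1mx.
apply: lin_bddM; first exact: lin_bdd_ur.
apply: pivot; last first.
  rewrite unitmx_mul uM andbT unitmxE det_ublock !det1 mulr1; exact: unitr1.
rewrite mxE big_split_ord/= big_ord1.
have e0 : lshift n 0 = ord0 :> 'I_(1 + n) by exact/val_inj.
rewrite e0 M0 mulr0 add0r (bigD1 i)//= big1.
  rewrite -e0 block_mxEur !mxE !eqxx mulr1 mul1r addr0 e0; exact: Mi.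
move=> j ji; rewrite -e0 block_mxEur !mxE (negbTE ji) andbF mulr0.
by rewrite mul0r.
Qed.

End lebesgue_measure_rV.

(** * Smooth functions *)

Section smooth_functions.
Context {R : realType}.

Section calculus.
Context {n : nat}.
Local Notation E := 'rV[R]_n.+1.
Local Notation e_ i := (delta_mx ord0 i : E).
Implicit Types (phi psi : E -> R) (x v : E).

Lemma rV_norm_le x (r : R) : 0 <= r ->
  `|x| <= r <-> forall i, `|x ord0 i| <= r.
Proof.
move=> r0; rewrite [`|x|]mx_normrE; split=> [/bigmax_leP[_ h] i|h].
  exact: (h (ord0, i)).
by apply/bigmax_leP; split=> // -[i j] _ /=; rewrite ord1.
Qed.

Lemma is_derive_lin (a b : R) (t : R) : is_derive t 1 (fun s => a + s * b) b.
Proof.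
apply: is_derive_eq.
by rewrite add0r mul1r scaler0 add0r /GRing.scale/= mulr1.
Qed.

(** Both sides have the same difference quotients, so the rules of one-variable calculus carry over
    to directional derivatives. *)
Lemma is_derive_line phi x v t (d : R) :
  is_derive (x + t *: v) v phi d <-> is_derive t 1 (fun s => phi (x + s *: v)) d.
Proof.
have E0 : (fun h : R => h^-1 *: ((phi \o shift (x + t *: v)) (h *: v) - phi (x + t *: v)))
    = (fun h : R => h^-1 *: (((fun s => phi (x + s *: v)) \o shift t) (h *: 1) - phi (x + t *: v))).
  apply/funext => h /=; congr (_ *: (phi _ - _)).
  by rewrite scalerDl addrCA /GRing.scale/= mulr1.
by split=> -[D E1]; apply: DeriveDef; move: D E1; rewrite /derivable /derive E0.
Qed.

Lemma is_derive_pt phi x v (d : R) :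
  is_derive x v phi d <-> is_derive (0:R) 1 (fun s => phi (x + s *: v)) d.
Proof.
have := is_derive_line phi x v 0 d; rewrite scale0r addr0; apply.
Qed.

Lemma is_derive_compl (h : R -> R) phi x v (d d' : R) :
  is_derive x v phi d -> is_derive (phi x) 1 h d' ->
  is_derive x v (h \o phi) (d' * d).
Proof.
move=> /is_derive_pt D D'; apply/is_derive_pt.
apply: (@is_derive1_comp _ h (fun s => phi (x + s *: v))) => //.
by rewrite scale0r addr0.
Qed.

Lemma is_derive_affine phi (a : R) c x v (d : R) :
  is_derive (a *: x + c) v phi d -> is_derive x v (fun y => phi (a *: y + c)) (a * d).
Proof.
move=> /is_derive_pt D; apply/is_derive_pt.
rewrite (_ : (fun s => _) = (fun s => phi (a *: x + c + s *: v)) \o (fun s => a * s)).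
  rewrite mulrC; apply: is_derive1_comp; rewrite ?mulr0//.
  by apply: is_derive_eq; rewrite /GRing.scale/= mulr1.
apply/funext => s /=; congr phi.
by rewrite scalerDr scalerA addrAC.
Qed.

Lemma Ck_continuous k phi : Ck k phi -> continuous phi.
Proof. by case: k => [|k] []. Qed.

Lemma CkS k phi : Ck k.+1 phi -> Ck k phi.
Proof.
elim: k phi => [phi [//]|k IH phi [cphi dphi]].
by split=> // i; have [d C] := dphi i; split=> //; exact: IH.
Qed.

Lemma smooth_continuous phi : smooth phi -> continuous phi.
Proof. by move=> /(_ 0%N)/Ck_continuous. Qed.

Lemma smooth_is_derive phi i x : smooth phi ->
  is_derive x (e_ i) phi (partial i phi x).
Proof. by move=> /(_ 1%N)[_ /(_ i)[/(_ x)? _]]; exact: DeriveDef. Qed.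

Lemma smooth_partial phi i : smooth phi -> smooth (partial i phi).
Proof. by move=> sphi k; have [_ /(_ i)[]] := sphi k.+1. Qed.

Lemma partial_eq phi (d : E -> R) i :
  (forall x, is_derive x (e_ i) phi (d x)) -> partial i phi = d.
Proof. by move=> D; apply/funext => x; have [] := D x. Qed.

Lemma Ck_is_derive k phi (d : 'I_n.+1 -> E -> R) : continuous phi ->
  (forall i x, is_derive x (e_ i) phi (d i x)) ->
  (forall i, Ck k (d i)) -> Ck k.+1 phi.
Proof.
move=> c D C; split=> // i; split=> [x|]; first by have [] := D i x.
by rewrite (partial_eq (D i)).
Qed.

Lemma Ck_cst k (c : R) : Ck k (fun _ : E => c).
Proof.
elim: k c => [c|k IH c]; first by split=> // x; exact: cst_continuous.
apply: (@Ck_is_derive _ _ (fun _ _ => 0)) => // x; exact: cst_continuous.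
Qed.

Lemma smooth_cst (c : R) : smooth (fun _ : E => c).
Proof. by move=> k; exact: Ck_cst. Qed.

Lemma smooth_coord i : smooth (fun x : E => x ord0 i).
Proof.
case=> [|k]; first by split=> // x; exact: coord_continuous.
apply: (@Ck_is_derive _ _ (fun j _ => (j == i)%:R)) => [x|j x|j].
- exact: coord_continuous.
- apply/is_derive_pt; rewrite (_ : (fun s => _) = (fun s => x ord0 i + s * (j == i)%:R)).
    exact: is_derive_lin.
  by apply/funext => s; rewrite !mxE eq_sym.
- exact: Ck_cst.
Qed.

Lemma CkD k phi psi : Ck k phi -> Ck k psi -> Ck k (fun x => phi x + psi x).
Proof.
elim: k phi psi => [phi psi [cf _] [cg _]|k IH phi psi [cf df] [cg dg]].
  by split=> // x; apply: continuousD; [exact: cf|exact: cg].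
apply: (@Ck_is_derive _ _ (fun i x => partial i phi x + partial i psi x)).
- by move=> x; apply: continuousD; [exact: cf|exact: cg].
- move=> i x; have [df' _] := df i; have [dg' _] := dg i.
  by apply: is_deriveD; exact: derivableP.
- by move=> i; apply: IH; [have [] := df i|have [] := dg i].
Qed.

Lemma CkM k phi psi : Ck k phi -> Ck k psi -> Ck k (fun x => phi x * psi x).
Proof.
elim: k phi psi => [phi psi [cf _] [cg _]|k IH phi psi Cf Cg].
  by split=> // x; apply: continuousM; [exact: cf|exact: cg].
have [cf df] := Cf; have [cg dg] := Cg.
apply: (@Ck_is_derive _ _
  (fun i x => phi x * partial i psi x + psi x * partial i phi x)).
- by move=> x; apply: continuousM; [exact: cf|exact: cg].
- move=> i x; have [df' _] := df i; have [dg' _] := dg i.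
  by apply: is_deriveM; exact: derivableP.
- move=> i; have [_ ?] := df i; have [_ ?] := dg i.
  by apply: CkD; apply: IH => //; exact: CkS.
Qed.

Lemma smoothD phi psi : smooth phi -> smooth psi -> smooth (fun x => phi x + psi x).
Proof. by move=> f g k; exact: CkD. Qed.

Lemma smoothM phi psi : smooth phi -> smooth psi -> smooth (fun x => phi x * psi x).
Proof. by move=> f g k; exact: CkM. Qed.

Lemma smoothZ (a : R) phi : smooth phi -> smooth (fun x => a * phi x).
Proof. by apply: smoothM; exact: smooth_cst. Qed.

Lemma smoothN phi : smooth phi -> smooth (fun x => - phi x).
Proof.
by move=> /(smoothZ (-1)); under eq_fun do rewrite mulN1r.
Qed.

Lemma smoothB phi psi : smooth phi -> smooth psi -> smooth (fun x => phi x - psi x).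
Proof. by move=> ? ?; apply: smoothD => //; exact: smoothN. Qed.

Lemma smooth_sum I (s : seq I) (f : I -> E -> R) : (forall i, smooth (f i)) ->
  smooth (fun x => \sum_(i <- s) f i x).
Proof.
move=> sf; elim: s => [|a s IH].
  by under eq_fun do rewrite big_nil; exact: smooth_cst.
by under eq_fun do rewrite big_cons; exact: smoothD.
Qed.

Lemma smooth_prod I (s : seq I) (f : I -> E -> R) : (forall i, smooth (f i)) ->
  smooth (fun x => \prod_(i <- s) f i x).
Proof.
move=> sf; elim: s => [|a s IH].
  by under eq_fun do rewrite big_nil; exact: smooth_cst.
by under eq_fun do rewrite big_cons; exact: smoothM.
Qed.

Lemma smooth_comp (h : nat -> R -> R) phi :
  (forall k (t : R), is_derive t 1 (h k) (h k.+1 t)) -> smooth phi ->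
  smooth (h 0%N \o phi).
Proof.
move=> dh sphi k.
suff : forall j, Ck k (h j \o phi) by exact.
have ch j : continuous (h j).
  move=> t; apply: differentiable_continuous; apply/derivable1_diffP.
  by have [] := dh j t.
have c j : continuous (h j \o phi).
  by move=> x; apply: continuous_comp; [exact: smooth_continuous|exact: ch].
elim: k => [|k IH] j; first by split.
apply: (@Ck_is_derive _ _ (fun i x => (h j.+1 \o phi) x * partial i phi x)) => //.
  by move=> i x; exact: (is_derive_compl (smooth_is_derive i x sphi) (dh j _)).
by move=> i; apply: CkM; [exact: IH|exact: smooth_partial].
Qed.

Lemma partial_comp (h : nat -> R -> R) phi i x :
  (forall k (t : R), is_derive t 1 (h k) (h k.+1 t)) -> smooth phi ->
  partial i (h 0%N \o phi) x = h 1%N (phi x) * partial i phi x.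
Proof.
move=> dh sphi; have D y : is_derive y (e_ i) (h 0%N \o phi) (h 1%N (phi y) * partial i phi y).
  exact: (is_derive_compl (smooth_is_derive i y sphi) (dh 0%N _)).
by rewrite (partial_eq D).
Qed.

Lemma partialM phi psi i x : smooth phi -> smooth psi ->
  partial i (fun x => phi x * psi x) x = phi x * partial i psi x + psi x * partial i phi x.
Proof.
move=> sf sg; have D y : is_derive y (e_ i) (fun x => phi x * psi x)
    (phi y * partial i psi y + psi y * partial i phi y).
  by apply: is_deriveM; exact: smooth_is_derive.
by rewrite (partial_eq D).
Qed.

Lemma partialD phi psi i x : smooth phi -> smooth psi ->
  partial i (fun x => phi x + psi x) x = partial i phi x + partial i psi x.
Proof.
move=> sf sg; have D y : is_derive y (e_ i) (fun x => phi x + psi x)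
    (partial i phi y + partial i psi y).
  by apply: is_deriveD; exact: smooth_is_derive.
by rewrite (partial_eq D).
Qed.

Lemma partial_cst (c : R) i x : partial i (fun _ => c) x = 0.
Proof. by rewrite (@partial_eq _ (fun _ => 0) i). Qed.

Lemma partialZ (a : R) phi i x : smooth phi ->
  partial i (fun x => a * phi x) x = a * partial i phi x.
Proof.
by move=> sf; rewrite partialM ?partial_cst ?mulr0 ?addr0//; exact: smooth_cst.
Qed.

Lemma partial_affine phi (a : R) c i x : smooth phi ->
  partial i (fun x => phi (a *: x + c)) x = a * partial i phi (a *: x + c).
Proof.
move=> sf; have D y : is_derive y (e_ i) (fun x => phi (a *: x + c))
    (a * partial i phi (a *: y + c)).
  by apply: is_derive_affine; exact: smooth_is_derive.
by rewrite (partial_eq D).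
Qed.

Lemma smooth_affine phi (a : R) c : smooth phi -> smooth (fun x => phi (a *: x + c)).
Proof.
move=> sphi k; elim: k phi sphi => [|k IH] phi sphi.
  split=> // x; apply: (@continuous_comp _ _ _ (fun x => a *: x + c) phi).
    by apply: continuousD; [exact: scaler_continuous|exact: cst_continuous].
  exact: smooth_continuous.
apply: (@Ck_is_derive _ _ (fun i x => a * partial i phi (a *: x + c))).
- exact: Ck_continuous (IH _ sphi).
- by move=> i x; apply: is_derive_affine; exact: smooth_is_derive.
- by move=> i; apply: CkM; [exact: Ck_cst|apply: IH; exact: smooth_partial].
Qed.

(** The coordinates are changed one after another and the one-dimensional mean value theorem is
    applied on each edge of the resulting path; hence a separate point [xi i] for every
    coordinate. *)
Lemma MVT_rV phi x (h : E) : smooth phi ->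
  exists xi : 'I_n.+1 -> E, (forall i, `|xi i - x| <= `|h|) /\
    phi (x + h) - phi x = \sum_i h ord0 i * partial i phi (xi i).
Proof.
move=> sphi.
pose z (k : nat) : E := x + \row_j (if (j < k)%N then h ord0 j else 0).
have zS (i : 'I_n.+1) : z i.+1 = z i + h ord0 i *: e_ i.
  apply/rowP => j; rewrite !mxE -addrA; congr +%R.
  rewrite ltnS leq_eqVlt; have [->|ji] := eqVneq j i.
    by rewrite eqxx ltnn/= mulr1 add0r.
  by rewrite (_ : (j == i :> nat) = false) ?mulr0 ?addr0//; exact/negbTE.
have /choice[xi xiP] : forall i : 'I_n.+1, exists xi : E, `|xi - x| <= `|h| /\
    phi (z i.+1) - phi (z i) = h ord0 i * partial i phi xi.
  move=> i; pose f t := phi (z i + (h ord0 i * t) *: e_ i).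
  have df (t : R) : is_derive t 1 f (h ord0 i * partial i phi (z i + (h ord0 i * t) *: e_ i)).
    rewrite mulrC.
    apply: (@is_derive1_comp _ (fun s => phi (z i + s *: e_ i)) (fun t => h ord0 i * t)).
      by apply/is_derive_line; exact: smooth_is_derive.
    by apply: is_derive_eq; rewrite /GRing.scale/= mulr1.
  have [|c c01 fE] := @MVT_segment R f _ 0 1 ler01 (fun t _ => df t).
    apply: derivable_within_continuous => t _; by have [] := df t.
  exists (z i + (h ord0 i * c) *: e_ i); split; last first.
    by rewrite zS; move: fE; rewrite /f mulr1 mulr0 scale0r addr0 subr0 mulr1.
  apply/rV_norm_le => // j; rewrite !mxE.
  rewrite addrAC [x ord0 j + _]addrC addrK.
  have hj : `|h ord0 j| <= `|h| by exact: (proj1 (rV_norm_le h (normr_ge0 _))).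
  have [ji|ji] := eqVneq j i.
    rewrite ji ltnn add0r mulr1 normrM -ji (le_trans _ hj)//.
    move: c01; rewrite in_itv/= => /andP[c0 c1].
    by rewrite (ger0_norm c0) mulrC ler_piMl.
  by rewrite mulr0 addr0; case: ifP => // _; rewrite normr0.
exists xi; split=> [i|]; first by have [] := xiP i.
under eq_bigr => i _ do rewrite -(proj2 (xiP i)).
rewrite -(big_mkord xpredT (fun i => phi (z i.+1) - phi (z i))) telescope_sumr//.
congr (phi _ - phi _); apply/rowP => j; rewrite !mxE ?ltn0 ?addr0//.
by rewrite ltn_ord.
Qed.

(** [smooth] speaks of coordinate directions only, whereas the direction of a boundary chart is
    oblique. The points of the mean value formula tend to x and the partial derivatives are
    continuous there. *)
Lemma is_derive_dir phi x v : smooth phi ->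
  is_derive x v phi (\sum_i v ord0 i * partial i phi x).
Proof.
move=> sphi.
have /choice[xi xiP] := fun h : R => MVT_rV x (h *: v) sphi.
have xi_cvg i : xi h i @[h --> 0^'] --> x.
  apply/cvgrPdist_le => e e0; near=> h.
  rewrite distrC (le_trans ((xiP h).1 i))// normrZ.
  have v1 : 0 < `|v| + 1 by rewrite ltr_wpDl.
  rewrite (@le_trans _ _ (`|h| * (`|v| + 1)))//.
    by rewrite ler_wpM2l// lerDl.
  rewrite -ler_pdivlMr//.
  near: h; apply: dnbhs0_le; exact: divr_gt0.
suff C : h^-1 *: ((phi \o shift x) (h *: v) - phi x) @[h --> 0^'] -->
    \sum_i v ord0 i * partial i phi x.
  apply: DeriveDef; first by apply/cvg_ex; eexists; exact: C.
  exact/cvg_lim.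
have S : \sum_i v ord0 i * partial i phi (xi h i) @[h --> 0^'] -->
    \sum_i v ord0 i * partial i phi x.
  apply: cvg_big => // [|i _]; first exact: add_continuous.
  apply: cvgMr.
  apply: (cvg_comp _ _ (xi_cvg i)).
  exact/smooth_continuous/smooth_partial.
apply: cvg_trans S; apply: near_eq_cvg; near=> h.
have h0 : h != 0 by near: h; exact: nbhs_dnbhs_neq.
rewrite /= [h *: v + x]addrC (xiP h).2 /GRing.scale/= mulr_sumr.
by apply: eq_bigr => i _; rewrite mxE !mulrA mulVf// mul1r.
Unshelve. all: end_near. Qed.

Lemma partial_near phi psi i x : (\near x, phi x = psi x) ->
  partial i phi x = partial i psi x.
Proof. exact: near_eq_derive. Qed.

Lemma closed_le_norm (r : R) : closed [set x : E | `|x| <= r].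
Proof.
by apply: (@closed_comp _ _ (fun x : E => `|x|) [set y | y <= r]) => [x _|];
  [exact: norm_continuous|exact: closed_le].
Qed.

Lemma compact_le_norm (r : R) : compact [set x : E | `|x| <= r].
Proof.
apply: bounded_closed_compact; last exact: closed_le_norm.
by exists r; split; [exact: num_real|move=> s rs x /= /le_trans; apply; exact: ltW].
Qed.

Lemma continuous_bounded phi (r : R) : continuous phi ->
  exists2 M, 0 <= M & forall x, `|x| <= r -> `|phi x| <= M.
Proof.
move=> cphi; have [r0|r0] := ltP r 0.
  exists 0 => // x xr; have := le_lt_trans xr r0.
  by rewrite normr_lt0.
have [||c _ h] := @EVT_max_rV R _ (fun x => `|phi x|) [set x | `|x| <= r] _ (@compact_le_norm r).
- by exists 0; rewrite /= normr0.
- apply: continuous_subspaceT => x; apply: continuous_comp; first exact: cphi.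
  exact: norm_continuous.
by exists `|phi c| => // x xr; apply: h; rewrite inE.
Qed.

Lemma support_bounded phi (r : R) : continuous phi ->
  (forall x, r < `|x| -> phi x = 0) -> exists2 M, 0 <= M & forall x, `|phi x| <= M.
Proof.
move=> cphi phi0; have [M M0 hM] := continuous_bounded r cphi.
exists M => // x; have [xr|rx] := leP `|x| r; first exact: hM.
by rewrite phi0// normr0.
Qed.

Lemma partial_support phi i (r : R) :
  (forall x, r < `|x| -> phi x = 0) -> forall x, r < `|x| -> partial i phi x = 0.
Proof.
move=> phi0 x rx; rewrite (@partial_near _ (fun=> 0)) ?partial_cst//.
have : open [set x : E | r < `|x|].
  rewrite (_ : mkset _ = ~` [set x | `|x| <= r]).
    by apply: closed_openC; exact: closed_le_norm.
  by apply/seteqP; split => y /=; rewrite ltNge => /negP.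
by rewrite openE => /(_ _ rx); apply: filterS => y; exact: phi0.
Qed.

Lemma smooth_lipschitz phi (c : R) : smooth phi ->
  (forall i x, `|partial i phi x| <= c) ->
  forall x h, `|phi (x + h) - phi x| <= n.+1%:R * c * `|h|.
Proof.
move=> sphi hc x h; have [xi [_ ->]] := MVT_rV x h sphi.
rewrite (le_trans (ler_norm_sum _ _ _))//.
rewrite (@le_trans _ _ (\sum_(i < n.+1) c * `|h|))//.
  apply: ler_sum => i _; rewrite normrM mulrC ler_pM//.
  exact: (proj1 (rV_norm_le h (normr_ge0 _))).
by rewrite sumr_const card_ord -mulrA mulr_natl.
Qed.

End calculus.

(* The derivatives of exp (- 1 / t), extended by 0 to t <= 0, stay in this class. *)
Definition expoly (p : {poly R}) (t : R) : R :=
  if 0 < t then p.[t^-1] * expR (- t^-1) else 0.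

(** With s = 1/t, the derivative of p(s) exp(-s) in t is s^2 (p(s) - p'(s)) exp(-s). *)
Definition expoly_next (p : {poly R}) : {poly R} := 'X^2 * (p - p^`()).

(** The factor t^2 is what differentiability at 0 needs: the difference quotient there is at most C
    |t|, for every polynomial p at once. *)
Lemma expoly_bound p : exists2 C, 0 <= C &
  forall t, t <= 1 -> `|expoly p t| <= C * t ^+ 2.
Proof.
pose k := size p; pose A := \sum_(i < k) `|p`_i|.
have A0 : 0 <= A by exact: sumr_ge0.
exists (A * k.+2`!%:R); first by rewrite mulr_ge0.
move=> t t1; rewrite /expoly; case: ifPn => [t0|_]; last first.
  by rewrite normr0 mulr_ge0 ?sqr_ge0// mulr_ge0.
set s := t^-1; have s1 : 1 <= s by rewrite /s invf_ge1.
have s0 : 0 < s by rewrite invr_gt0.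
have pA : `|p.[s]| <= A * s ^+ k.
  rewrite horner_coef (le_trans (ler_norm_sum _ _ _))// mulr_suml.
  apply: ler_sum => i _; rewrite normrM ler_wpM2l// normrX gtr0_norm//.
  by apply: ler_weXn2l => //; exact: ltnW.
(* The exponential dominates the term s^(k+2)/(k+2)! of its series; the two powers beyond those of p
   become t^2. *)
have ek : s ^+ k.+2 * expR (- s) <= k.+2`!%:R.
  rewrite expRN ler_pdivrMr ?expR_gt0//.
  have := @expR_ge1Dxn R s k.+1 (ltW s0).
  rewrite -lerBrDl => h; rewrite mulrC -ler_pdivrMr ?ltr0n ?fact_gt0//.
  by rewrite (le_trans h)// lerBlDr lerDl.
rewrite normrM (ger0_norm (expR_ge0 _)).
have -> : t ^+ 2 = s ^- 2 by rewrite /s exprVn invrK.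
rewrite ler_pdivlMr ?exprn_gt0// (le_trans _ (ler_wpM2l A0 ek))//.
have -> : A * (s ^+ k.+2 * expR (- s)) = A * s ^+ k * (expR (- s) * s ^+ 2).
  by rewrite -addn2 exprD; ring.
by rewrite -[leLHS]mulrA ler_wpM2r// mulr_ge0 ?expR_ge0// exprn_ge0// ltW.
Qed.

Lemma is_derive_expoly p (t : R) : is_derive t 1 (expoly p) (expoly (expoly_next p) t).
Proof.
have [t0|t0|->] := ltgtP t 0.
- apply: (@near_eq_is_derive R R R (cst 0) _ t 1); last first.
    by rewrite /expoly ltNge (ltW t0)/=; exact: is_derive_cst.
  near=> s; have s0 : s < 0 by near: s; exact: lt_nbhsl.
  by rewrite /expoly ltNge (ltW s0).
- apply: (@near_eq_is_derive R R R (fun t : R => p.[t^-1] * expR (- t^-1)) _ t 1); last first.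
    have tn0 : t != 0 by rewrite gt_eqF.
    have Dv : is_derive t 1 (fun t : R => t^-1) (- t ^- 2).
      apply: is_derive_eq; first exact: is_deriveV.
      by rewrite /GRing.scale/= mulr1.
    have D1 : is_derive t 1 (fun t => p.[t^-1]) (p^`().[t^-1] * (- t ^- 2)).
      exact: (@is_derive1_comp _ (horner p) (fun t => t^-1)).
    have D2 : is_derive t 1 (fun t => expR (- t^-1)) (expR (- t^-1) * (t ^- 2)).
      apply: (@is_derive1_comp _ expR (fun t => - t^-1)).
      by rewrite -[t ^- 2]opprK; exact: is_deriveN.
    apply: (is_derive_eq (is_deriveM D1 D2)).
    rewrite /expoly t0 /expoly_next /GRing.scale/= !hornerE /= exprVn; ring.
  near=> s; have s0 : 0 < s by near: s; exact: lt_nbhsr.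
  by rewrite /expoly s0.
have [C C0 hC] := expoly_bound p.
have G0 q : expoly q 0 = 0 by rewrite /expoly ltxx.
suff K : h^-1 *: ((expoly p \o shift 0) (h *: (1:R)) - expoly p 0) @[h --> (0:R)^'] --> (0:R).
  apply: DeriveDef; first by apply/cvg_ex; eexists; exact: K.
  by rewrite G0; exact/cvg_lim.
have C1 : 0 < C + 1 by rewrite ltr_wpDl.
apply/cvgrPdist_le => e e0.
have eC : 0 < e / (C + 1) by rewrite divr_gt0.
near=> h.
have h0 : h != 0 by near: h; exact: nbhs_dnbhs_neq.
rewrite sub0r normrN G0 subr0 /= addr0 /GRing.scale/= mulr1 normrM normfV.
have h1 : `|h| <= 1 by near: h; apply: dnbhs0_le.
rewrite mulrC ler_pdivrMr ?normr_gt0//.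
rewrite (le_trans (hC _ _))//; first by rewrite (le_trans (ler_norm _)).
have he : `|h| <= e / (C + 1) by near: h; exact: dnbhs0_le.
rewrite ler_pdivlMr// in he.
rewrite -real_normK ?num_real// expr2 mulrA ler_wpM2r// (le_trans _ he)//.
by rewrite mulrC ler_wpM2l// lerDl.
Unshelve. all: end_near. Qed.

Definition bump (t : R) : R := expoly 1 t.

Lemma bump_ge0 t : 0 <= bump t.
Proof. by rewrite /bump /expoly; case: ifP => // _; rewrite hornerC mul1r expR_ge0. Qed.

Lemma bump_le0 t : t <= 0 -> bump t = 0.
Proof. by move=> t0; rewrite /bump /expoly ltNge t0. Qed.

Lemma bump_ge t : 3 / 4 <= t -> expR (- (4 / 3)) <= bump t.
Proof.
move=> t34; have t0 : 0 < t by lra.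
rewrite /bump /expoly t0 hornerC mul1r ler_expR lerN2.
by rewrite -[4 / 3]invrK lef_pV2 ?posrE ?invr_gt0 ?divr_gt0// invf_div.
Qed.

Lemma smooth_bump n (phi : 'rV[R]_n.+1 -> R) : smooth phi -> smooth (fun x => bump (phi x)).
Proof.
apply: (@smooth_comp _ (fun k => expoly (iter k expoly_next 1))) => k t.
exact: is_derive_expoly.
Qed.

Section kernel.
Variable n : nat.
Local Notation E := 'rV[R]_n.+1.

(** A product over the coordinates, because the unit ball of the maximum norm is a cube. *)
Definition ker (x : E) : R := \prod_i bump (1 - x ord0 i ^+ 2).

Lemma smooth_ker : smooth ker.
Proof.
apply: smooth_prod => i; apply: smooth_bump; apply: smoothB; first exact: smooth_cst.
by apply: (@smoothM _ _ _); exact: smooth_coord.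
Qed.

Lemma ker_ge0 x : 0 <= ker x.
Proof. by apply: prodr_ge0 => i _; exact: bump_ge0. Qed.

Lemma ker_eq0 x : 1 <= `|x| -> ker x = 0.
Proof.
move=> x1; have [i xi] : exists i, 1 <= `|x ord0 i|.
  apply: contrapT => /forallNP h; move: x1; rewrite leNgt => /negP; apply.
  rewrite [`|x|]mx_normrE; apply/bigmax_ltP; split=> // -[a i] _ /=.
  by rewrite ord1 ltNge; apply/negP; exact: h.
rewrite /ker (bigD1 i)//= bump_le0 ?mul0r//.
by rewrite subr_le0 -real_normK ?num_real// exprn_ege1.
Qed.

Lemma kerN x : ker (- x) = ker x.
Proof. by apply: eq_bigr => i _; rewrite !mxE sqrrN. Qed.

(** This bounds the mass of the kernel scaled to radius r from below by a multiple of r^(n+1), so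
    that gradients of normalized kernels and of cutoffs scale like 1/r. For coordinates at most 1/2
    the argument of [bump] is at least 3/4. *)
Lemma ker_ge : exists2 c : R, 0 < c & forall x, `|x| <= 1 / 2 -> c <= ker x.
Proof.
exists (expR (- (4 / 3)) ^+ n.+1); first by rewrite exprn_gt0// expR_gt0.
move=> x x2; rewrite -[n.+1 in X in X <= _]card_ord -prodr_const.
apply: ler_prod => i _; rewrite expR_ge0/=; apply: bump_ge.
have : `|x ord0 i| <= 1 / 2 by move: x2 => /rV_norm_le; apply.
by rewrite -real_normK ?num_real//; have := normr_ge0 (x ord0 i); nra.
Qed.

End kernel.

End smooth_functions.

(** * Spaces of square integrable functions *)

Section semi_inner_product.
Context {R : realType} {V : Type}.
Variables (X : set V) (lc : R -> V -> V -> V) (b : V -> V -> R).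

(** Functions equal almost everywhere are not identified, so [b u u = 0] does not force u = 0 and
    only a semi-inner product is available. [lc a u v] stands for a * u + v, the one operation under
    which X has to be closed; the instances are L^2, L^2 vector fields and H^1. *)
Record sip : Prop := {
  sip_lc : forall a u v, X u -> X v -> X (lc a u v) ;
  sip_sym : forall u v, X u -> X v -> b u v = b v u ;
  sip_lin : forall a u v w, X u -> X v -> X w ->
    b (lc a u v) w = a * b u w + b v w ;
  sip_ge0 : forall u, X u -> 0 <= b u u }.

Definition snorm (v : V) : R := Num.sqrt (b v v).

Hypothesis Hb : sip.

Lemma snorm_ge0 v : 0 <= snorm v.
Proof. exact: sqrtr_ge0. Qed.

Lemma sqr_snorm v : X v -> snorm v ^+ 2 = b v v.
Proof. by move=> Xv; rewrite sqr_sqrtr// (sip_ge0 Hb). Qed.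

Lemma sip_lcE a u v : X u -> X v ->
  b (lc a u v) (lc a u v) = a ^+ 2 * b u u + a *+ 2 * b u v + b v v.
Proof.
move=> Xu Xv; have Xl := sip_lc Hb a Xu Xv.
rewrite (sip_lin Hb)// (sip_sym Hb Xu)// (sip_sym Hb Xv)// !(sip_lin Hb)//.
by rewrite (sip_sym Hb Xv Xu); ring.
Qed.

Lemma cauchy_schwarz_sqr u v : X u -> X v -> b u v ^+ 2 <= b u u * b v v.
Proof.
move=> Xu Xv; have h t : 0 <= t ^+ 2 * b u u + t *+ 2 * b u v + b v v.
  by rewrite -sip_lcE//; apply: (sip_ge0 Hb); exact: (sip_lc Hb).
have [u0|u0] := eqVneq (b u u) 0.
  have [->|uv0] := eqVneq (b u v) 0; first by rewrite u0 expr0n/= mul0r.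
  (* If [b u u] vanishes, the quadratic polynomial in t is affine, and at this t it equals -1. *)
  have := h (- (b v v + 1) / (b u v *+ 2)).
  rewrite u0 mulr0 add0r.
  have -> : - (b v v + 1) * (b u v *+ 2)^-1 *+ 2 * b u v = - (b v v + 1).
    by field.
  by lra.
have ub : 0 < b u u by rewrite lt0r u0 (sip_ge0 Hb).
have := h (- b u v / b u u).
have -> : (- b u v / b u u) ^+ 2 * b u u + (- b u v / b u u) *+ 2 * b u v + b v v
  = (b u u * b v v - b u v ^+ 2) / b u u by field.
by rewrite pmulr_lge0 ?invr_gt0// subr_ge0.
Qed.

Lemma cauchy_schwarz u v : X u -> X v -> `|b u v| <= snorm u * snorm v.
Proof.
move=> Xu Xv; rewrite -[leRHS]ger0_norm ?mulr_ge0 ?snorm_ge0//.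
by rewrite -ler_sqr ?nnegrE// !real_normK ?num_real// exprMn !sqr_snorm// cauchy_schwarz_sqr.
Qed.

Lemma snorm_lc a u v : X u -> X v -> snorm (lc a u v) <= `|a| * snorm u + snorm v.
Proof.
move=> Xu Xv; have Xl := sip_lc Hb a Xu Xv.
rewrite -ler_sqr ?nnegrE ?addr_ge0 ?mulr_ge0 ?snorm_ge0//.
rewrite sqr_snorm// sip_lcE// sqrrD exprMn real_normK ?num_real// !sqr_snorm//.
rewrite lerD2r lerD2l -mulrA mulrnAl -mulrnAr -!mulrnAr.
rewrite (le_trans (ler_norm _))// normrM ler_wpM2l// normrMn.
by rewrite mulrnAr lerMn2r cauchy_schwarz.
Qed.

End semi_inner_product.

Section real_integrable.
Context d (T : measurableType d) {R : realType} (mu : {measure set T -> \bar R}).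
Variables (D : set T) (mD : measurable D).
Implicit Types f g : T -> R.

Lemma integrableRZ (c : R) f : mu.-integrable D (EFin \o f) ->
  mu.-integrable D (EFin \o (fun x => c * f x)).
Proof. by move=> /(integrableZl mD c). Qed.

Lemma integrableRD f g : mu.-integrable D (EFin \o f) ->
  mu.-integrable D (EFin \o g) -> mu.-integrable D (EFin \o (fun x => f x + g x)).
Proof. by move=> /(integrableD mD)/[apply]. Qed.

Lemma integrableRB f g : mu.-integrable D (EFin \o f) ->
  mu.-integrable D (EFin \o g) -> mu.-integrable D (EFin \o (fun x => f x - g x)).
Proof. by move=> /(integrableB mD)/[apply]. Qed.

Lemma integrableRabs f : mu.-integrable D (EFin \o f) ->
  mu.-integrable D (EFin \o (fun x => `|f x|)).
Proof. exact: integrable_abse. Qed.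

Lemma integrableR_measurable f : mu.-integrable D (EFin \o f) -> measurable_fun D f.
Proof. by move=> /integrableP[/measurable_EFinP]. Qed.

End real_integrable.

Definition lcf {R : realType} {T : Type} (a : R) (u v : T -> R) : T -> R :=
  fun x => a * u x + v x.

Lemma limn_einf_le {R : realType} (u : (\bar R)^nat) (c : \bar R) :
  (forall j, (u j <= c)%E) -> (limn_einf u <= c)%E.
Proof.
move=> uc; rewrite limn_einf_lim; apply: lime_le; first exact: is_cvg_einfs.
apply: nearW => m; apply: le_trans (uc m).
by apply: ereal_inf_lbound; exists m => /=.
Qed.

Section square_integrable.
Context {R : realType} {n : nat}.
Local Notation E := 'rV[R]_n.+1.
Variables (mu : {measure set E -> \bar R}) (A : set E).
Hypothesis mA : measurable A.
Local Notation L2s := (Lp mu A 2%:E).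
Local Notation nrm := (snorm (ip mu A)).
Implicit Types v w : E -> R.

Lemma eLpnorm2E w :
  eLpnorm mu A 2%:E w = ((\int[mu]_(x in A) (w x ^+ 2)%:E) `^ 2^-1)%E.
Proof.
rewrite /eLpnorm unlock; congr (_ `^ _)%E; rewrite [RHS]integral_mkcond.
apply: eq_integral => x _; rewrite /= /patch; case: ifPn => _.
  by rewrite powR_mulrn// real_normK ?num_real.
by rewrite normr0 powR0// pnatr_eq0.
Qed.

Lemma sqr_int_ge0 w : (0 <= \int[mu]_(x in A) (w x ^+ 2)%:E)%E.
Proof. by apply: integral_ge0 => x _; rewrite lee_fin sqr_ge0. Qed.

Lemma Lpnorm2E w : Lpnorm mu A 2%:E w = nrm w.
Proof.
rewrite /Lpnorm eLpnorm2E /snorm /ip /Rintegral.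
under [in RHS]eq_integral do rewrite -expr2.
have := sqr_int_ge0 w; case: (\int[mu]_(x in A) _)%E => [r|_|]//=.
  by rewrite lee_fin => r0; rewrite powR12_sqrt.
by rewrite sqrtr0 invr_eq0 pnatr_eq0.
Qed.

Lemma L2P w : L2s w <->
  measurable_fun A w /\ (\int[mu]_(x in A) (w x ^+ 2)%:E < +oo)%E.
Proof.
split=> -[mw h]; split=> //; move: h; rewrite eLpnorm2E.
  have := sqr_int_ge0 w; case: (\int[mu]_(x in A) _)%E => [r|_|]//=.
  by move=> _ _; rewrite ltry.
  by rewrite invr_eq0 pnatr_eq0.
have := sqr_int_ge0 w; case: (\int[mu]_(x in A) _)%E => [r|_|]//=.
by move=> _ _; rewrite ltry.
Qed.

Lemma measurable_sqr w : measurable_fun A w ->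
  measurable_fun A (fun x => (w x ^+ 2)%:E).
Proof. by move=> mw; apply/measurable_EFinP; exact: measurable_funX. Qed.

Lemma L2_integrable w : L2s w <->
  measurable_fun A w /\ mu.-integrable A (EFin \o (fun x => w x ^+ 2)).
Proof.
split=> [/L2P[mw h]|[mw /integrableP[_ h]]]; [split=> //|apply/L2P; split=> //].
  apply/integrableP; split; first exact: measurable_sqr.
  apply: le_lt_trans h; apply: ge0_le_integral => //.
  - by apply: measurableT_comp => //; exact: measurable_sqr.
  - exact: measurable_sqr.
  - by move=> x _; rewrite /= ger0_norm ?sqr_ge0.
apply: le_lt_trans h; apply: ge0_le_integral => //.
- by move=> x _; rewrite lee_fin sqr_ge0.
- exact: measurable_sqr.
- by apply: measurableT_comp => //; exact: measurable_sqr.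
- by move=> x _; rewrite /= ger0_norm ?sqr_ge0.
Qed.

Lemma L2_measurable w : L2s w -> measurable_fun A w.
Proof. by case. Qed.

Lemma L2M v w : L2s v -> L2s w -> mu.-integrable A (EFin \o (fun x => v x * w x)).
Proof.
move=> /L2_integrable[mv iv] /L2_integrable[mw iw].
apply: (le_integrable mA _ _ (integrableD mA iv iw)).
  by apply/measurable_EFinP; exact: measurable_funM.
move=> x _ /=; rewrite lee_fin normrM [leRHS]ger0_norm ?addr_ge0 ?sqr_ge0//.
rewrite -[v x ^+ 2]real_normK ?num_real// -[w x ^+ 2]real_normK ?num_real//.
by have := sqr_ge0 (`|v x| - `|w x|); have := mulr_ge0 (normr_ge0 (v x)) (normr_ge0 (w x)); nra.
Qed.

Lemma L2_lc a v w : L2s v -> L2s w -> L2s (lcf a v w).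
Proof.
move=> Lv Lw; have vw := L2M Lv Lw; move: Lv Lw => /L2_integrable[mv iv] /L2_integrable[mw iw].
apply/L2_integrable; split.
  by apply: measurable_funD => //; exact: measurable_funM.
rewrite (_ : EFin \o _ = (fun x => (a ^+ 2)%:E * (EFin \o (fun x => v x ^+ 2)%R) x) \+
   ((fun x => (a *+ 2)%:E * (EFin \o (fun x => v x * w x)%R) x) \+
   (EFin \o (fun x => w x ^+ 2)%R)))%E; last first.
  by apply/funext => x /=; rewrite -!EFinM -!EFinD; congr EFin; rewrite /lcf; ring.
by do 2?[apply: integrableD => //]; exact: integrableZl.
Qed.

Lemma sip_ip : sip L2s lcf (ip mu A).
Proof.
split=> [a v w|v w _ _|a u v w Lu Lv Lw|u _]; first exact: L2_lc.
- by rewrite /ip; under eq_Rintegral do rewrite mulrC.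
- rewrite /ip /lcf; under eq_Rintegral do rewrite mulrDl -mulrA.
  rewrite RintegralD//; last 2 first.
  + rewrite (_ : EFin \o _ = (fun x => a%:E * (EFin \o (fun x => u x * w x)%R) x))%E//.
    by apply: integrableZl => //; exact: L2M.
  + exact: L2M.
  by congr +%R; rewrite RintegralZl//; exact: L2M.
- by apply: Rintegral_ge0 => x _; rewrite -expr2 sqr_ge0.
Qed.

Lemma ip_ae v v' w w' : measurable_fun A v -> measurable_fun A v' ->
  measurable_fun A w -> measurable_fun A w' ->
  ae_eq mu A v v' -> ae_eq mu A w w' -> ip mu A v w = ip mu A v' w'.
Proof.
move=> mv mv' mw mw' vv ww; rewrite /ip /Rintegral; congr fine.
apply: ae_eq_integral => //.
- by apply/measurable_EFinP; exact: measurable_funM.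
- by apply/measurable_EFinP; exact: measurable_funM.
- by apply: filterS2 vv ww => x vv ww Ax; rewrite vv// ww.
Qed.

Lemma eq_ip v v' w w' : {in A, v =1 v'} -> {in A, w =1 w'} ->
  ip mu A v w = ip mu A v' w'.
Proof. by move=> vv ww; apply: eq_Rintegral => x Ax; rewrite vv// ww. Qed.

Lemma eq_L2 v w : {in A, v =1 w} -> L2s v -> L2s w.
Proof.
move=> vw /L2P[mv h]; apply/L2P; split; first exact: eq_measurable_fun vw mv.
by under eq_integral => x xA do rewrite -vw//.
Qed.

Lemma L2_fin w : L2s w ->
  (\int[mu]_(x in A) (w x ^+ 2)%:E)%E = (ip mu A w w)%:E.
Proof.
move=> /L2P[_ h]; rewrite /ip /Rintegral fineK.
  by under [in RHS]eq_integral do rewrite -expr2.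
under eq_integral do rewrite -expr2.
by rewrite ge0_fin_numE// sqr_int_ge0.
Qed.

Lemma ip_eq0_ae w : L2s w -> ip mu A w w = 0 -> ae_eq mu A w (fun=> 0).
Proof.
move=> Lw w0; have mw := L2_measurable Lw.
have := L2_fin Lw; rewrite w0 => I0.
have /(ae_eq_integral_abs mu mA (measurable_sqr mw)) : (\int[mu]_(x in A) `|(w x ^+ 2)%:E| = 0)%E.
  rewrite -[RHS]I0; apply: eq_integral => x _ /=; rewrite ger0_norm ?sqr_ge0//.
apply: filterS => x h Ax; have := h Ax.
by case=> /eqP; rewrite sqrf_eq0 => /eqP.
Qed.

Lemma ae_ip_eq0 w : measurable_fun A w -> ae_eq mu A w (fun=> 0) -> ip mu A w w = 0.
Proof.
move=> mw w0; rewrite (@ip_ae w (fun=> 0) w (fun=> 0))//.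
by rewrite /ip; under eq_Rintegral do rewrite mulr0; rewrite /Rintegral integral0.
Qed.

Lemma L2_le_bound v w (C : R) : measurable_fun A w -> L2s v ->
  (forall x, A x -> `|w x| <= C * `|v x|) -> L2s w.
Proof.
move=> mw Lv h; apply/L2_integrable; split=> //.
have [mv iv] := (L2_integrable v).1 Lv.
apply: (le_integrable mA (measurable_sqr mw) _ (integrableZl mA (C ^+ 2) iv)).
move=> x Ax /=; rewrite lee_fin (ger0_norm (sqr_ge0 _)).
have CV : 0 <= C ^+ 2 * v x ^+ 2 by apply: mulr_ge0; exact: sqr_ge0.
rewrite (ger0_norm CV).
rewrite -real_normK ?num_real// -[v x ^+ 2]real_normK ?num_real// -exprMn.
by rewrite ler_sqr ?nnegrE// ?h// (le_trans _ (h _ Ax)).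
Qed.

Lemma nrm_le_bound v w (C : R) : 0 <= C -> measurable_fun A w -> L2s v ->
  (forall x, A x -> `|w x| <= C * `|v x|) -> nrm w <= C * nrm v.
Proof.
move=> C0 mw Lv h; have Lw := L2_le_bound mw Lv h.
rewrite -ler_sqr ?nnegrE ?mulr_ge0 ?snorm_ge0//.
rewrite exprMn !(sqr_snorm sip_ip)// -lee_fin EFinM -!L2_fin//.
rewrite -ge0_integralZl//; last 3 first.
- exact: measurable_sqr (L2_measurable Lv).
- by move=> x _; rewrite lee_fin sqr_ge0.
- by rewrite lee_fin sqr_ge0.
apply: ge0_le_integral => //.
- by move=> x _; rewrite lee_fin sqr_ge0.
- exact: measurable_sqr.
- by apply: measurable_funeM; exact: measurable_sqr (L2_measurable Lv).
move=> x Ax; rewrite -EFinM lee_fin -real_normK ?num_real//.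
rewrite -[v x ^+ 2]real_normK ?num_real// -exprMn.
by rewrite ler_sqr ?nnegrE ?mulr_ge0// h.
Qed.

Lemma L2_bounded w (C : R) : (mu A < +oo)%E -> measurable_fun A w ->
  (forall x, A x -> `|w x| <= C) -> L2s w.
Proof.
move=> muA mw h; apply: (@L2_le_bound (fun=> 1) w C) => //; last first.
  by move=> x Ax; rewrite normr1 mulr1 h.
apply/L2P; split=> //; under eq_integral do rewrite expr1n.
by rewrite integral_cst// mul1e.
Qed.

Lemma ip_abs_le v w : L2s v -> L2s w ->
  \int[mu]_(x in A) `|v x * w x| <= nrm v * nrm w.
Proof.
move=> Lv Lw.
have La u : L2s u -> L2s (fun x => `|u x|).
  move=> Lu; apply: (@L2_le_bound u _ 1) => //.
    by apply: measurableT_comp => //; exact: L2_measurable.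
  by move=> x _; rewrite mul1r normr_id.
have Na u : nrm (fun x => `|u x|) = nrm u.
  rewrite /snorm; congr Num.sqrt; apply: eq_Rintegral => x _.
  by rewrite -!expr2 real_normK ?num_real.
rewrite -(Na v) -(Na w).
rewrite (_ : Rintegral _ _ _ = ip mu A (fun x => `|v x|) (fun x => `|w x|)); last first.
  by apply: eq_Rintegral => x _; rewrite normrM.
by rewrite (le_trans (ler_norm _))// (cauchy_schwarz sip_ip)//; exact: La.
Qed.

Lemma chebyshev_series_cvg (d : nat -> R) (C : R) :
  (forall j, d j ^+ 2 *+ (4 ^ j) <= C) ->
  forall u : nat -> R, (forall j, u j.+1 - u j = d j) -> cvgn u.
Proof.
move=> hd u ud.
have C0 : 0 <= C by apply: le_trans (hd 0%N); rewrite mulr1n sqr_ge0.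
have hdj j : `|d j| <= Num.sqrt C * (2^-1) ^+ j.
  rewrite -ler_sqr ?nnegrE ?mulr_ge0 ?sqrtr_ge0 ?exprn_ge0//.
  rewrite real_normK ?num_real// exprMn sqr_sqrtr// exprAC.
  have -> : (2^-1 : R) ^+ 2 = 4^-1 by field.
  by rewrite exprVn ler_pdivlMr ?exprn_gt0// -natrX mulr_natr.
have -> : u = (fun k => u 0%N + series d k).
  apply/funext => k; rewrite /series/= -(eq_bigr _ (fun i _ => ud i)).
  by rewrite telescope_sumr// addrC subrK.
apply: is_cvgD; first exact: is_cvg_cst.
apply: normed_cvg; apply: (@series_le_cvg _ _ (geometric (Num.sqrt C) 2^-1)) => [k|k|k|].
- exact: normr_ge0.
- by rewrite /geometric/= mulr_ge0 ?sqrtr_ge0// exprn_ge0.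
- exact: hdj.
- by apply: is_cvg_geometric_series; rewrite gtr0_norm// invf_lt1// ltr1n.
Qed.

(** Along a subsequence with rapidly decreasing increments the functions converge almost everywhere;
    Fatou's lemma then transfers the Cauchy bounds of the whole sequence to the limit. *)
Lemma Riesz_Fischer (u : nat -> E -> R) : (forall k, L2s (u k)) ->
  (forall e : R, 0 < e -> exists K : nat, forall i j, (K <= i)%N -> (K <= j)%N ->
     nrm (lcf (-1) (u i) (u j)) <= e) ->
  exists2 w, L2s w &
    forall e : R, 0 < e -> exists K : nat, forall i, (K <= i)%N ->
      nrm (lcf (-1) (u i) w) <= e.
Proof.
move=> Lu Cu.
have mu_ k := L2_measurable (Lu k).
have e0 j : 0 < (4 ^- j : R) by rewrite invr_gt0 exprn_gt0.
have /choice[K hK] := fun j : nat => Cu _ (e0 j).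
pose k j := (\sum_(i < j.+1) (K i).+1)%N.
have kK j : (K j <= k j)%N by rewrite /k big_ord_recr/= (leq_trans (leqnSn _))// leq_addl.
have kS j : (k j <= k j.+1)%N by rewrite /k [leqRHS]big_ord_recr/= leq_addr.
pose v j := u (k j).
have mv j : measurable_fun A (v j) := mu_ _.
pose d j := lcf (-1) (v j) (v j.+1).
have Ld j : L2s (d j) := L2_lc _ (Lu _) (Lu _).
have Nd j : nrm (d j) <= 4 ^- j.
  by apply: hK => //; rewrite (leq_trans (kK j)).
(* Since A may have infinite measure, squared increments are summed. The weight 4^j leaves integrals
   of at most 4^-j, and where the sum is finite it forces increments of order 2^-j. *)
pose F j x : \bar R := (d j x ^+ 2 *+ (4 ^ j))%:E.
have mF j : measurable_fun A (F j).
  apply/measurable_EFinP; under eq_fun do rewrite -mulr_natr.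
  by apply: measurable_funM => //; apply: measurable_funX; exact: (L2_measurable (Ld j)).
have F0 j x : A x -> (0 <= F j x)%E by rewrite lee_fin mulrn_wge0// sqr_ge0.
have IF : (\int[mu]_(x in A) (\sum_(0 <= j <oo) F j x) < +oo)%E.
  rewrite integral_nneseries//.
  apply: (@le_lt_trans _ _ (\sum_(0 <= j <oo) (4 ^- j)%:E)%E).
    apply: lee_nneseries => [j _ _|j _].
      by apply: integral_ge0 => x Ax; exact: F0.
    rewrite /F; under eq_integral do rewrite -mulr_natl EFinM.
    rewrite ge0_integralZl//; last 2 first.
    + exact: measurable_sqr (L2_measurable (Ld j)).
    + by move=> x _; rewrite lee_fin sqr_ge0.
    rewrite L2_fin// -EFinM lee_fin natrX.
    have := Nd j; have := sqr_snorm sip_ip (Ld j) => <- Nj.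
    have := ler_pM (snorm_ge0 _ _) (snorm_ge0 _ _) Nj Nj; rewrite -expr2 => h.
    rewrite (le_trans (ler_wpM2l _ h))// ?exprn_ge0//.
    by rewrite mulrA divff ?mul1r// expf_neq0.
  rewrite (_ : (fun _ => _) = EFin \o (fun m => series (geometric 1 4^-1) m)); last first.
    apply/funext => m; rewrite /series/= sumEFin; congr EFin.
    by apply: eq_bigr => i _; rewrite mul1r exprVn.
  have Cg : cvgn (series (geometric (1:R) 4^-1)).
    by apply: is_cvg_geometric_series; rewrite gtr0_norm// invf_lt1// ltr1n.
  by rewrite EFin_lim// ltry.
have aeC : {ae mu, forall x, A x -> cvgn (v ^~ x)}.
  have iF : mu.-integrable A (fun x => \sum_(0 <= j <oo) F j x)%E.
    apply/integrableP; split.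
      apply: ge0_emeasurable_sum => [j x Ax _|j _]; [exact: F0|exact: mF].
    apply: le_lt_trans IF; rewrite le_eqVlt; apply/orP; left; apply/eqP.
    apply: eq_integral => x; rewrite inE => Ax.
    by rewrite gee0_abs//; apply: nneseries_ge0 => j _ _; exact: F0.
  apply: filterS (integrable_ae mA iF) => x h Ax; have := h Ax => hx.
  apply: (@chebyshev_series_cvg (d ^~ x) (fine (\sum_(0 <= j <oo) F j x)%E)).
    move=> j; rewrite -lee_fin fineK//.
    apply: (@le_trans _ _ (\sum_(0 <= i < j.+1) F i x)%E).
      rewrite big_nat_recr//= leeDr// sume_ge0// => i _; exact: F0.
    by apply: nneseries_lim_ge => i _ _; exact: F0.
  by move=> j; rewrite /d /lcf mulN1r addrC.
(* A limsup is measurable irrespective of convergence; [fine] gives it the value 0 where it is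
   infinite, which happens on a null set only. *)
pose w x := fine (limn_esup (fun j => (v j x)%:E)).
have mw : measurable_fun A w.
  apply: (measurableT_comp (@fine_measurable R setT measurableT)) => //.
  by apply: measurable_fun_limn_esup => j; exact/measurable_EFinP.
have aew : {ae mu, forall x, A x -> v j x @[j --> \oo] --> w x}.
  apply: filterS aeC => x h Ax; have /cvg_ex[l vl] := h Ax.
  suff -> : w x = l by [].
  rewrite /w; have /cvg_limn_einf_sup -> // : (v j x)%:E @[j --> \oo] --> l%:E.
  by apply: cvg_EFin => //; exact: nearW.

have kj j : (j <= k j)%N.
  elim: j => // j IH; rewrite /k big_ord_recr/= -/(k j) addnS ltnS.
  by rewrite (leq_trans IH)// leq_addr.
(* Fatou's lemma for fixed i: the distance from [u i] to the limit inherits the bound on the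
   distances from [u i] to later terms. The shift by [K0] discards the earlier ones. *)
have fat (e : R) i K0 : 0 <= e ->
    (forall j, (K0 <= j)%N -> nrm (lcf (-1) (u i) (u j)) <= e) ->
    (\int[mu]_(x in A) ((lcf (-1) (u i) w x) ^+ 2)%:E <= (e ^+ 2)%:E)%E.
  move=> e1 hK0; pose G j x := ((lcf (-1) (u i) (v (j + K0)%N) x) ^+ 2)%:E.
  have mG j : measurable_fun A (G j).
    by apply: measurable_sqr; exact: (L2_measurable (L2_lc _ (Lu i) (Lu (k (j + K0)%N)))).
  have G0 j x : A x -> (0 <= G j x)%E by rewrite lee_fin sqr_ge0.
  have mlw : measurable_fun A (lcf (-1) (u i) w).
    by apply: measurable_funD => //; exact: measurable_funM.
  have -> : (\int[mu]_(x in A) ((lcf (-1) (u i) w x) ^+ 2)%:E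
      = \int[mu]_(x in A) limn_einf (G ^~ x))%E.
    apply: ae_eq_integral => //.
    - exact: measurable_sqr.
    - rewrite (_ : (fun x => _) = (fun x => - limn_esup (fun j => - G j x))%E).
        apply: measurableT_comp => //; apply: measurable_fun_limn_esup => j.
        exact: measurableT_comp.
      apply/funext => x; rewrite -limn_einfN; congr limn_einf.
      by apply/funext => j; exact/esym/oppeK.
    apply: filterS aew => x h Ax; have hx := h Ax.
    apply/esym; apply: (cvg_limn_einf_sup _).1.
    apply: cvg_EFin; first exact: nearW.
    apply: (@continuous_cvg _ _ _ _ _ _ (fun y : R => y ^+ 2)); first exact: exprn_continuous.
    apply: cvgD; first exact: cvg_cst.
    by move: hx; rewrite -(cvg_shiftn K0).
  apply: (le_trans (fatou mu mA mG G0)).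
  apply: limn_einf_le => j.
  rewrite /G (L2_fin (L2_lc _ (Lu i) (Lu (k (j + K0)%N)))).
  rewrite lee_fin -(sqr_snorm sip_ip (L2_lc _ (Lu i) (Lu (k (j + K0)%N)))).
  rewrite ler_sqr ?nnegrE ?snorm_ge0//; apply: hK0.
  by rewrite (leq_trans _ (kj _))// leq_addl.
have mlw i : measurable_fun A (lcf (-1) (u i) w).
  by apply: measurable_funD => //; exact: measurable_funM.
have Llw e i K0 : 0 <= e -> (forall j, (K0 <= j)%N -> nrm (lcf (-1) (u i) (u j)) <= e) ->
    L2s (lcf (-1) (u i) w) /\ nrm (lcf (-1) (u i) w) <= e.
  move=> e1 h; have := fat e i K0 e1 h => f.
  have L : L2s (lcf (-1) (u i) w).
    by apply/L2P; split=> //; rewrite (le_lt_trans f)// ltry.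
  split=> //; rewrite -ler_sqr ?nnegrE ?snorm_ge0// (sqr_snorm sip_ip L).
  by rewrite -lee_fin -L2_fin.
exists w.
  have [K1 hK1] := Cu 1 ltr01.
  have [L _] := Llw 1 K1 K1 ler01 (fun j => hK1 K1 j (leqnn _)).
  apply: eq_L2 (L2_lc 1 L (Lu K1)) => x _.
  by rewrite /lcf; ring.
move=> e he; have [K1 hK1] := Cu e he; exists K1 => i Ki.
by have [] := Llw e i K1 (ltW he) (fun j => hK1 i j Ki).
Qed.

End square_integrable.

(** * Mollification *)

Section convolution.
Context {R : realType} {n : nat}.
Local Notation E := 'rV[R]_n.+1.
Local Notation e_ i := (delta_mx ord0 i : E).
Local Notation lambda := (leb n.+1 : {measure set E -> \bar R}).
Implicit Types (phi V : E -> R) (x y : E).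

Lemma continuous_measurable_rV m (f : 'rV[R]_m -> R) : continuous f ->
  measurable_fun setT f.
Proof.
move=> cf; apply: (measurability _ (RGenOpens.measurableE R)) => _ [_ [a [b ->]] <-].
rewrite setTI; apply: open_measurable_rV.
by apply: open_comp => // x _; exact: cf.
Qed.

Lemma lip_continuous (f : E -> R) (L : R) :
  (forall x x', `|f x' - f x| <= L * `|x' - x|) -> continuous f.
Proof.
move=> lip x B /nbhs_ballP[e /= e0 he].
have L1 : 0 < `|L| + 1 by rewrite ltr_wpDl.
apply/nbhs_ballP; exists (e / (`|L| + 1)) => /=; first by rewrite divr_gt0.
move=> y; rewrite -ball_normE /ball_ /= => xy; apply: he.
rewrite -ball_normE /ball_ /= distrC (le_lt_trans (lip _ _))// distrC.
rewrite ltr_pdivlMr// in xy; rewrite (le_lt_trans _ xy)// mulrC ler_wpM2l//.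
by rewrite (le_trans (ler_norm _))// lerDl.
Qed.

Lemma measurable_subr_rV m (x : 'rV[R]_m) :
  measurable_fun setT (fun y : 'rV[R]_m => x - y).
Proof.
apply: measurable_fun_rV => i; under eq_fun do rewrite !mxE.
by apply: measurable_funB => //; exact: measurable_coord.
Qed.

Lemma leb_bounded (A : set E) (r : R) : measurable A ->
  (forall x, A x -> `|x| <= r) -> (lambda A < +oo)%E.
Proof.
move=> mA Ar; pose s := `|r| + 1.
have s0 : 0 < s by rewrite ltr_wpDl.
apply: (@le_lt_trans _ _ (lambda (ball (0 : E) s))).
  apply: le_measure; rewrite ?inE//; first exact: measurable_ball_rV.
  move=> x /Ar xr; rewrite -ball_normE /ball_ /= sub0r normrN.
  by rewrite (le_lt_trans xr)// (le_lt_trans (ler_norm _))// ltrDl.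
by rewrite leb_ball// ltry.
Qed.

Lemma measurable_le_norm (r : R) : measurable [set x : E | `|x| <= r].
Proof.
rewrite -[X in measurable X]setCK; apply: measurableC; apply: open_measurable_rV.
by apply: closed_openC; exact: closed_le_norm.
Qed.

Lemma integrableR_indic (B : set E) : measurable B -> (lambda B < +oo)%E ->
  lambda.-integrable setT (EFin \o \1_B).
Proof.
move=> mB B1; apply/integrableP; split; first exact/measurable_EFinP.
rewrite (eq_integral (fun x => (\1_B x)%:E)); last first.
  by move=> t _; rewrite gee0_abs// lee_fin.
by rewrite integral_indic// setIT.
Qed.

Lemma support_integrable phi (r M : R) : measurable_fun setT phi ->
  (forall x, `|phi x| <= M) -> (forall x, r < `|x| -> phi x = 0) ->
  lambda.-integrable setT (EFin \o phi).
Proof.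
move=> mphi phiM phi0.
have mB := @measurable_le_norm r.
have iB : lambda.-integrable setT (EFin \o (fun x => M * \1_[set x : E | `|x| <= r] x)).
  apply: integrableRZ => //; apply: integrableR_indic => //.
  exact: (@leb_bounded _ r).
apply: (le_integrable measurableT _ _ iB); first exact/measurable_EFinP.
move=> x _ /=; rewrite lee_fin indicE; case: (boolP (x \in _)) => [_|].
  by rewrite mulr1 (le_trans (phiM x))// ler_norm.
by rewrite notin_setE /= => /negP; rewrite -ltNge => /phi0 ->; rewrite normr0.
Qed.

Definition conv phi V x : R := \int[lambda]_y (phi (x - y) * V y).

Lemma conv_integrable phi V (M : R) x : measurable_fun setT phi ->
  (forall x, `|phi x| <= M) -> lambda.-integrable setT (EFin \o V) ->
  lambda.-integrable setT (EFin \o (fun y => phi (x - y) * V y)).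
Proof.
move=> mphi phiM iV.
have iM : lambda.-integrable setT (fun y => M%:E * (EFin \o V) y)%E by exact: integrableZl.
apply: (le_integrable measurableT _ _ iM).
  apply/measurable_EFinP; apply: measurable_funM.
    by apply: (measurableT_comp mphi); exact: measurable_subr_rV.
  by have /integrableP[/measurable_EFinP] := iV.
move=> y _ /=; rewrite lee_fin !normrM ler_wpM2r// (le_trans (phiM _))//.
exact: ler_norm.
Qed.

Section conv_smooth.
Variables (phi V : E -> R) (r : R).
Hypothesis iV : lambda.-integrable setT (EFin \o V).

Lemma partials_bounded psi : smooth psi -> (forall x, r < `|x| -> psi x = 0) ->
  exists2 M, 0 <= M & forall i x, `|partial i psi x| <= M.
Proof.
move=> spsi psi0.
have /choice[M hM] : forall i : 'I_n.+1, exists M : R, 0 <= M /\ forall x, `|partial i psi x| <= M.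
  move=> i; have [M M0 hM] := support_bounded (smooth_continuous (smooth_partial i spsi))
    (partial_support i psi0).
  by exists M.
exists (\sum_i M i); first by apply: sumr_ge0 => i _; have [] := hM i.
move=> i x; rewrite (le_trans ((hM i).2 x))// (bigD1 i)//= lerDl.
by apply: sumr_ge0 => j _; have [] := hM j.
Qed.

Hypothesis sphi : smooth phi.
Hypothesis phi0 : forall x, r < `|x| -> phi x = 0.

Lemma conv_continuous : continuous (conv phi V).
Proof.
have [M M0 hM] := support_bounded (smooth_continuous sphi) phi0.
have [c c0 hc] := partials_bounded sphi phi0.
have mphi := continuous_measurable_rV (smooth_continuous sphi).
have iphi x : lambda.-integrable setT (EFin \o (fun y => phi (x - y) * V y)).
  exact: conv_integrable hM iV.
pose L := n.+1%:R * c; pose N := \int[lambda]_y `|V y|.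
have N0 : 0 <= N by exact: Rintegral_ge0.
have L0 : 0 <= L by rewrite mulr_ge0.
have iN : lambda.-integrable setT (EFin \o (fun y => `|V y|)).
  exact: integrable_abse iV.
have lip x x' : `|conv phi V x' - conv phi V x| <= L * `|x' - x| * N.
  rewrite /conv -RintegralB//.
  rewrite (le_trans (le_normr_Rintegral _ _))//.
    exact: integrableRB.
  rewrite /N -RintegralZl//; apply: le_Rintegral => //.
  - by apply: integrableRabs; exact: integrableRB.
  - exact: integrableRZ.
  move=> y _; rewrite -mulrBl normrM ler_wpM2r//.
  have := smooth_lipschitz sphi hc (x - y) (x' - x).
  by rewrite (_ : x - y + (x' - x) = x' - y)// addrC addrA subrK.
apply: (@lip_continuous _ (L * N)) => x x'.
by rewrite mulrAC.
Qed.

(** The derivative along an axis is the derivative at 0 of an integral depending on one parameter,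
    dominated by c |V| for parameters in ]-1, 1[. *)
Lemma conv_is_derive i x : is_derive x (e_ i) (conv phi V) (conv (partial i phi) V x).
Proof.
have [M M0 hM] := support_bounded (smooth_continuous sphi) phi0.
have [c c0 hc] := partials_bounded sphi phi0.
have mphi := continuous_measurable_rV (smooth_continuous sphi).
apply/is_derive_pt.
pose f (t : R) (y : E) := phi (x + t *: e_ i - y) * V y.
have df (t : R) y : is_derive t 1 (f ^~ y) (partial i phi (x + t *: e_ i - y) * V y).
  have -> : (fun t => f t y) = (fun s => s * V y) \o (fun t => phi (x - y + t *: e_ i)).
    by apply/funext => s; rewrite /f /= addrAC.
  rewrite mulrC; apply: is_derive1_comp.
    rewrite (_ : (fun s => _) = (fun s => 0 + s * V y)); first exact: is_derive_lin.
    by apply/funext => s; rewrite add0r.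
  by apply/is_derive_line; rewrite addrAC; exact: smooth_is_derive.
have I0 : (`]-1, 1[%classic : set R) 0 by rewrite /= in_itv/= ltrN10 ltr01.
have intf t : (`]-1, 1[%classic : set R) t -> lambda.-integrable setT (EFin \o f t).
  by move=> _; exact: conv_integrable hM iV.
have derf t y : (`]-1, 1[%classic : set R) t -> setT y -> derivable (f ^~ y) t 1.
  by move=> _ _; have [] := df t y.
have G0 y : 0 <= c * `|V y| by rewrite mulr_ge0.
have iG : lambda.-integrable setT (EFin \o (fun y => c * `|V y|)).
  by apply: integrableRZ => //; exact: integrableRabs.
have d1E t y : partial1of2 f t y = partial i phi (x + t *: e_ i - y) * V y.
  by rewrite partial1of2E; have [] := df t y.
have Gub t y : (`]-1, 1[%classic : set R) t -> setT y -> `|partial1of2 f t y| <= c * `|V y|.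
  by move=> _ _; rewrite d1E normrM ler_wpM2r.
have D := derivable_under_integral measurableT I0 intf derf G0 iG Gub.
have V1 := differentiation_under_integral measurableT I0 intf derf G0 iG Gub.
apply: DeriveDef; first exact: D.
rewrite -derive1E [LHS]V1 /conv; apply: eq_Rintegral => y _.
by rewrite d1E scale0r addr0.
Qed.

End conv_smooth.

Lemma conv_smooth phi V (r : R) : lambda.-integrable setT (EFin \o V) ->
  smooth phi -> (forall x, r < `|x| -> phi x = 0) -> smooth (conv phi V).
Proof.
move=> iV sphi phi0 k; elim: k phi sphi phi0 => [|k IH] phi sphi phi0.
  by split=> //; exact: conv_continuous phi0.
apply: (@Ck_is_derive _ _ _ _ (fun i => conv (partial i phi) V)).
- exact: conv_continuous phi0.
- by move=> i x; exact: conv_is_derive phi0 _ _.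
- move=> i; apply: IH; [exact: smooth_partial|exact: partial_support].
Qed.

Lemma conv_partial phi V (r : R) i x : lambda.-integrable setT (EFin \o V) ->
  smooth phi -> (forall x, r < `|x| -> phi x = 0) ->
  partial i (conv phi V) x = conv (partial i phi) V x.
Proof. by move=> iV sphi phi0; have [] := conv_is_derive iV sphi phi0 i x. Qed.

Section mollifier.
Variable r : R.
Hypothesis r0 : 0 < r.

Definition sker x : R := ker (r^-1 *: x + 0).
Definition sker_int : R := \int[lambda]_x sker x.
Definition moll x : R := sker_int^-1 * sker x.

Lemma smooth_sker : smooth sker.
Proof. by apply: smooth_affine; exact: smooth_ker. Qed.

Lemma sker_eq0 x : r <= `|x| -> sker x = 0.
Proof.
move=> rx; rewrite /sker addr0 ker_eq0// normrZ gtr0_norm ?invr_gt0//.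
by rewrite mulrC ler_pdivlMr// mul1r.
Qed.

Lemma sker_ge0 x : 0 <= sker x. Proof. exact: ker_ge0. Qed.

Lemma sker_integrable : lambda.-integrable setT (EFin \o sker).
Proof.
have s0 x : r < `|x| -> sker x = 0 by move=> /ltW; exact: sker_eq0.
have [M M0 hM] := support_bounded (smooth_continuous smooth_sker) s0.
apply: support_integrable hM s0.
exact: continuous_measurable_rV (smooth_continuous smooth_sker).
Qed.

Lemma integral_le_sker c : (forall x : E, `|x| <= 1 / 2 -> c <= ker x) -> 0 < c ->
  c * r ^+ n.+1 <= sker_int.
Proof.
move=> hc c0; have r2 : 0 < r / 2 by rewrite divr_gt0.
have mB := measurable_ball_rV (0 : E) (r / 2).
have B : lambda (ball (0 : E) (r / 2)) = (r ^+ n.+1)%:E.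
  have r22 : r / 2 *+ 2 = r by rewrite -mulr_natr divfK.
  by rewrite leb_ball// r22.
have -> : c * r ^+ n.+1 = \int[lambda]_x (c * \1_(ball (0 : E) (r / 2)) x).
  rewrite RintegralZl//; last by apply: integrableR_indic; rewrite // B ltry.
  by rewrite /Rintegral integral_indic// setIT B.
apply: le_Rintegral => //.
- by apply: integrableRZ => //; apply: integrableR_indic; rewrite // B ltry.
- exact: sker_integrable.
move=> x _; rewrite indicE; case: (boolP (x \in _)) => [|_]; last first.
  by rewrite mulr0 sker_ge0.
rewrite inE -ball_normE /ball_ /= sub0r normrN mulr1 => xr.
apply: hc; rewrite addr0 normrZ gtr0_norm ?invr_gt0//.
by rewrite mulrC ler_pdivrMr// mulrC mulrA mulr1 ltW.
Qed.

Lemma sker_int_gt0 : 0 < sker_int.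
Proof.
have [c c0 hc] := @ker_ge R n.
by apply: lt_le_trans (integral_le_sker hc c0); rewrite mulr_gt0// exprn_gt0.
Qed.

Lemma smooth_moll : smooth moll.
Proof. by apply: smoothZ; exact: smooth_sker. Qed.

Lemma moll_ge0 x : 0 <= moll x.
Proof. by rewrite mulr_ge0 ?sker_ge0// invr_ge0 ltW// sker_int_gt0. Qed.

Lemma moll_eq0 x : r <= `|x| -> moll x = 0.
Proof. by move=> rx; rewrite /moll sker_eq0// mulr0. Qed.

Lemma moll_eq0' x : r < `|x| -> moll x = 0.
Proof. by move=> /ltW; exact: moll_eq0. Qed.

Lemma mollN x : moll (- x) = moll x.
Proof. by rewrite /moll /sker !addr0 scalerN kerN. Qed.

Lemma measurable_moll : measurable_fun setT moll.
Proof. exact: continuous_measurable_rV (smooth_continuous smooth_moll). Qed.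

Lemma moll_integral_shift x : (\int[lambda]_y (moll (x - y))%:E = 1)%E.
Proof.
have m0 y : (0 <= (moll y)%:E)%E by rewrite lee_fin moll_ge0.
have mm : measurable_fun setT (EFin \o moll) by apply/measurable_EFinP; exact: measurable_moll.
transitivity (\int[lambda]_y (moll (- x + y))%:E)%E.
  by apply: eq_integral => y _; rewrite -mollN opprB addrC.
rewrite (leb_integralD (- x) mm)//.
rewrite /moll; under eq_integral do rewrite /= EFinM.
rewrite ge0_integralZl//; last 3 first.
- by apply/measurable_EFinP; exact: continuous_measurable_rV (smooth_continuous smooth_sker).
- by move=> y _; rewrite lee_fin sker_ge0.
- by rewrite lee_fin invr_ge0 ltW// sker_int_gt0.
have /integrableP[_ h] := sker_integrable.
have -> : (\int[lambda]_x (sker x)%:E = sker_int%:E)%E.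
  rewrite /sker_int /Rintegral fineK//; apply: integrable_fin_num => //.
  exact: sker_integrable.
by rewrite -EFinM mulVf// gt_eqF// sker_int_gt0.
Qed.

Lemma moll_integral_shiftl y : (\int[lambda]_x (moll (x - y))%:E = 1)%E.
Proof.
rewrite -[RHS](moll_integral_shift y); apply: eq_integral => x _.
by rewrite -mollN opprB.
Qed.

Lemma moll_integrable x : lambda.-integrable setT (EFin \o (fun y => moll (x - y))).
Proof.
have [M M0 hM] := support_bounded (smooth_continuous smooth_moll) moll_eq0'.
apply: (@support_integrable _ (r + `|x|) M) => //.
  by apply: (measurableT_comp measurable_moll); exact: measurable_subr_rV.
move=> y ry; apply: moll_eq0; rewrite distrC.
by have := lerB_dist y x; move: ry; lra.
Qed.

Lemma moll_Rintegral x : \int[lambda]_y moll (x - y) = 1.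
Proof. by rewrite /Rintegral moll_integral_shift. Qed.

End mollifier.

(** The cutoff is the indicator of A mollified at scale r. The constant is chosen before A and r, so
    that cutoffs of tubes at different scales are comparable. *)
Lemma smooth_cutoff : exists2 C : R, 0 <= C &
  forall (A : set E) (r rho : R), measurable A -> (forall x, A x -> `|x| <= rho) ->
  0 < r -> exists zeta : E -> R,
  [/\ smooth zeta, forall x, 0 <= zeta x <= 1,
      forall x, ball x r `<=` A -> zeta x = 1,
      forall x, (forall y, ball x r y -> ~ A y) -> zeta x = 0 &
      forall i x, `|partial i zeta x| <= C / r].
Proof.
have k0 (x : E) : 1 < `|x| -> ker x = 0 by move=> /ltW; exact: ker_eq0.
have [c c0 hc] := partials_bounded (@smooth_ker R n) k0.
have [c1 c10 hc1] := @ker_ge R n.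
(* The derivative of the normalized kernel is at most c / r divided by its mass, the mass is at
   least c1 r^(n+1), and the integral extends over a cube of volume (4 r)^(n+1). *)
exists (c1^-1 * c * 4 ^+ n.+1).
  by rewrite !mulr_ge0 ?exprn_ge0// invr_ge0 ltW.
move=> A r rho mA Arho r0.
have lA : (lambda A < +oo)%E by exact: leb_bounded Arho.
have iA := integrableR_indic mA lA.
have sm := smooth_moll r; have m0 := @moll_eq0' r r0.
have im := moll_integrable r0.
have mm := measurable_moll r.
have imA x : lambda.-integrable setT (EFin \o (fun y => moll r (x - y) * \1_A y)).
  have [M M0 hM] := support_bounded (smooth_continuous sm) m0.
  exact: conv_integrable hM iA.
have far x y : ~ ball x r y -> moll r (x - y) = 0.
  rewrite -ball_normE /ball_ /= => /negP; rewrite -leNgt => h; exact: moll_eq0.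
exists (conv (moll r) \1_A); split.
- exact: conv_smooth iA sm m0.
- move=> x; apply/andP; split.
    by apply: Rintegral_ge0 => y _; rewrite mulr_ge0// moll_ge0.
  rewrite -(moll_Rintegral r0 x); apply: le_Rintegral => // y _.
  by rewrite ler_piMr ?moll_ge0// indicE; case: (_ \in _).
- move=> x xA; rewrite -(moll_Rintegral r0 x); apply: eq_Rintegral => y _.
  rewrite indicE; case: (boolP (y \in A)) => [|yA]; rewrite ?mulr1// mulr0 far//.
  by move=> /xA Ay; move: yA; rewrite notin_setE.
- move=> x xA; rewrite /conv (@eq_Rintegral _ _ _ lambda setT (fun=> 0)).
    by rewrite /Rintegral integral0.
  move=> y _; rewrite indicE; case: (boolP (y \in A)) => [|yA]; rewrite ?mulr0//.
  by rewrite inE => Ay; rewrite mulr1 far// => /xA.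
- move=> i x; rewrite (conv_partial _ _ iA sm m0).
  pose K := (sker_int r)^-1 * (r^-1 * c).
  have s0 := sker_int_gt0 r0.
  have K0 : 0 <= K by rewrite !mulr_ge0// invr_ge0 ltW.
  have pK y : `|partial i (moll r) y| <= K.
    rewrite /moll partialZ; last exact: smooth_sker.
    rewrite normrM ger0_norm ?invr_ge0 ?(ltW s0)// ler_wpM2l ?invr_ge0 ?(ltW s0)//.
    rewrite /sker partial_affine; last exact: smooth_ker.
    have ri0 : 0 <= r^-1 by rewrite invr_ge0 ltW.
    by rewrite normrM (ger0_norm ri0) ler_wpM2l.
  have pm0 := partial_support i m0.
  have ipA : lambda.-integrable setT (EFin \o (fun y => partial i (moll r) (x - y) * \1_A y)).
    apply: conv_integrable pK iA.
    exact: continuous_measurable_rV (smooth_continuous (smooth_partial i sm)).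
  have r20 : 0 < r *+ 2 by rewrite mulrn_wgt0.
  have lB : lambda (ball x (r *+ 2)) = ((r *+ 2 *+ 2) ^+ n.+1)%:E by rewrite leb_ball.
  have mB := measurable_ball_rV x (r *+ 2).
  have iB : lambda.-integrable setT (EFin \o \1_(ball x (r *+ 2))).
    by apply: integrableR_indic => //; rewrite lB ltry.
  apply: (@le_trans _ _ (\int[lambda]_y (K * \1_(ball x (r *+ 2)) y))).
    apply: le_trans (le_normr_Rintegral _ _) _ => //.
    apply: le_Rintegral => //; first exact: integrableRabs.
      exact: integrableRZ.
    move=> y _; rewrite normrM.
    have A1 : `|\1_A y| <= 1 :> R by rewrite indicE; case: (_ \in _); rewrite ?normr1 ?normr0.
    rewrite (le_trans (ler_wpM2l (normr_ge0 _) A1))// mulr1 indicE.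
    case: (boolP (y \in _)) => [_|]; first by rewrite mulr1.
    rewrite notin_setE -ball_normE /ball_ /= => /negP; rewrite -leNgt => h.
    by rewrite pm0 ?normr0 ?mulr0// (lt_le_trans _ h)// mulr2n ltrDl.
  rewrite RintegralZl// /Rintegral integral_indic// setIT lB /=.
  have -> : r *+ 2 *+ 2 = 4 * r by ring.
  have -> : K * (4 * r) ^+ n.+1 = ((sker_int r)^-1 * r ^+ n.+1) * (c * 4 ^+ n.+1 / r).
    by rewrite /K exprMn; ring.
  have -> : c1^-1 * c * 4 ^+ n.+1 / r = c1^-1 * (c * 4 ^+ n.+1 / r) by ring.
  rewrite ler_wpM2r//.
    by rewrite !mulr_ge0 ?exprn_ge0// invr_ge0 ltW.
  rewrite mulrC ler_pdivrMr// mulrC -ler_pdivrMr ?invr_gt0// invrK mulrC.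
  exact: integral_le_sker hc1 c10.
Qed.

End convolution.

(** * Test functions and the exhaustion of open sets *)

Section test_functions.
Context {R : realType} {n : nat}.
Local Notation E := 'rV[R]_n.+1.
Implicit Types (phi psi : E -> R) (x y : E) (U : set E).

Lemma test_function_smooth U phi : test_function U phi -> smooth phi.
Proof. by case. Qed.

Lemma test_function_sub U V phi : U `<=` V -> test_function U phi -> test_function V phi.
Proof. by move=> UV [s c i]; split=> // x /i /UV. Qed.

Lemma test_function_supp U phi : test_function U phi -> forall x, ~ U x -> phi x = 0.
Proof.
move=> [_ _ i] x nUx; apply: contrapT => /eqP p0; apply: nUx; apply: i.
exact: subset_closure.
Qed.

Lemma test_function_le U phi psi : smooth psi -> test_function U phi ->
  (forall x, phi x = 0 -> psi x = 0) -> test_function U psi.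
Proof.
move=> spsi [_ c i] h.
have cl : closure [set x | psi x != 0] `<=` closure [set x | phi x != 0].
  apply: closure_subset => x /=; apply: contra_neq; exact: h.
split=> //; last by move=> x /cl /i.
by apply: subclosed_compact cl => //; exact: closed_closure.
Qed.

Lemma test_function_lc U a phi psi : test_function U phi -> test_function U psi ->
  test_function U (lcf a phi psi).
Proof.
move=> [s1 c1 i1] [s2 c2 i2].
have cl : closure [set x | lcf a phi psi x != 0] `<=`
    closure [set x | phi x != 0] `|` closure [set x | psi x != 0].
  rewrite -closureU; apply: closure_subset => x /=.
  have [p0|p0] := eqVneq (phi x) 0; last by left.
  by rewrite /lcf p0 mulr0 add0r; right.
split; first by apply: smoothD => //; exact: smoothZ.
- by apply: subclosed_compact cl; [exact: closed_closure|exact: compactU].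
- by move=> x /cl [/i1|/i2].
Qed.

Lemma test_functionM U phi psi : smooth phi -> test_function U psi ->
  test_function U (fun x => phi x * psi x).
Proof.
move=> s1 t2; have t2' := t2; apply: test_function_le t2 _ => [|x ->]; last by rewrite mulr0.
by apply: smoothM => //; case: t2'.
Qed.

Lemma test_function_cst0 U : test_function U (fun=> 0 : R).
Proof.
have e : [set x : E | (0 : R) != 0] = set0 by apply/seteqP; split=> x //=; rewrite eqxx.
by split; [exact: smooth_cst|rewrite e closure0; exact: compact0|rewrite e closure0].
Qed.

Lemma smooth_test_function U phi (r s : R) : smooth phi -> 0 < r ->
  (forall x, phi x != 0 -> ball x r `<=` U /\ `|x| <= s) -> test_function U phi.
Proof.
move=> sphi r0 h; split=> //.
- apply: (@subclosed_compact _ _ [set x | `|x| <= s]).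
  + exact: closed_closure.
  + exact: compact_le_norm.
  rewrite [X in _ `<=` X](closure_id _).1; last exact: closed_le_norm.
  by apply: closure_subset => x /= /h[].
- move=> x cx; have [|y [/= /h[yU _] xy]] := cx (ball x r).
    by apply: nbhsx_ballx.
  by apply: yU; exact: ball_sym.
Qed.

Lemma ball_open_rV x (s : R) : open (ball x s).
Proof.
have [s0|s0] := ltP 0 s; first exact: ball_open.
by rewrite (_ : ball x s = set0); [exact: open0|apply/seteqP; split=> // y [s0' _]; rewrite ltNge s0 in s0'].
Qed.

Lemma open_ball_measurable (V : set E) (s : R) :
  measurable [set x : E | ball x s `<=` V].
Proof.
rewrite -[X in measurable X]setCK; apply: measurableC; apply: open_measurable_rV.
rewrite (_ : ~` _ = \bigcup_(y in ~` V) ball y s).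
  by apply: bigcup_open => y _; exact: ball_open_rV.
apply/seteqP; split=> [x /= /existsNP[y /not_implyP[xy Vy]]|x [y Vy yx] h].
  by exists y => //; exact: ball_sym.
by apply: Vy; apply: h; exact: ball_sym.
Qed.

(** Each cutoff belongs to the points of norm at most k whose distance to the complement of V
    exceeds a scale tending to 0; every point of V eventually lies well inside. *)
Lemma test_function_approx (V : set E) : open V ->
  exists psi : nat -> E -> R, [/\ forall k, test_function V (psi k),
    forall k x, 0 <= psi k x <= 1 &
    forall x, V x -> exists K, forall k, (K <= k)%N -> psi k x = 1].
Proof.
move=> oV; have [C _ hC] := @smooth_cutoff R n.
pose e k : R := k.+1%:R^-1.
have e0 k : 0 < e k by rewrite invr_gt0.
(* Of the two [e k], one is lost by mollifying and the other keeps the support away from the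
   complement of V. *)
pose A k := [set x : E | `|x| <= k%:R] `&` [set x | ball x (e k *+ 2) `<=` V].
have mA k : measurable (A k).
  by apply: measurableI; [exact: measurable_le_norm|exact: open_ball_measurable].
have A1 k x : A k x -> `|x| <= k%:R by case.
have /choice[psi hpsi] := fun k => hC (A k) (e k) k%:R (mA k) (A1 k) (e0 k).
exists psi; split=> [k|k x|x Vx].
- have [s _ _ z _] := hpsi k.
  apply: (@smooth_test_function _ _ (e k) (k%:R + e k)) => // x px.
  have [y [xy [yk yV]]] : exists y, ball x (e k) y /\ A k y.
    apply: contrapT => /forallNP h; move/eqP: px; apply; apply: z => y xy Ay.
    by apply: (h y).
  split.
    move=> w xw; apply: yV; rewrite mulr2n.
    by apply: ball_triangle xw; exact: ball_sym.
  move: xy; rewrite -ball_normE /ball_ /= => xy.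
  have := ler_normD (x - y) y; rewrite subrK => h.
  by rewrite (le_trans h)// addrC lerD// ltW.
- by have [] := hpsi k.
have /nbhs_ballP[s /= s0 xs] : nbhs x V by exact: open_nbhs_nbhs.
have s30 : 0 < s / 3 by rewrite divr_gt0.
have [K1 hK1] : exists K1, forall k, (K1 <= k)%N -> e k < s / 3.
  have /cvgrPdist_lt /(_ _ s30)[k _ hk] := @cvg_harmonic R.
  by exists k => j /hk; rewrite sub0r normrN ger0_norm ?invr_ge0.
pose K2 := (Num.truncn (`|x| + 1)).+1.
exists (maxn K1 K2) => k; rewrite geq_max => /andP[/hK1 ek k2].
have [_ _ o _ _] := hpsi k; apply: o => y xy; split=> /=.
  move: xy; rewrite -ball_normE /ball_ /= => xy.
  have := ler_normD x (y - x); rewrite addrC subrK => h.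
  have e1 : e k <= 1 by rewrite invf_le1// ler1n.
  have xk : `|x| + 1 <= k%:R.
    by rewrite (le_trans (ltW (truncnS_gt _)))// ler_nat.
  by rewrite (le_trans h)// (le_trans _ xk)// lerD2l distrC (le_trans (ltW xy)).
apply: subset_trans xs => w yw.
apply: (@le_ball _ _ _ (e k + e k *+ 2)); last exact: ball_triangle yw.
by rewrite -mulrS -mulr_natr -ler_pdivlMr// ltW.
Qed.

End test_functions.

(** * Density of test functions in L^2 of a finite measure *)

Section density.
Context {R : realType} {n : nat}.
Local Notation E := 'rV[R]_n.+1.
Variables (mu : {measure set E -> \bar R}) (U A : set E).
Hypothesis mA : measurable A.
Hypothesis oU : open U.
Hypothesis AU : A `<=` U.
Hypothesis muA : (mu A < +oo)%E.
Local Notation L2s := (Lp mu A 2%:E).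
Local Notation nrm := (snorm (ip mu A)).
Implicit Types (q u v phi : E -> R).

Lemma L2_dominated (v : nat -> E -> R) q h : (forall k, measurable_fun A (v k)) ->
  measurable_fun A q -> L2s h ->
  (forall k x, A x -> `|v k x - q x| <= h x) ->
  (forall x, A x -> v k x @[k --> \oo] --> q x) ->
  forall e, 0 < e -> exists K : nat, forall k, (K <= k)%N -> nrm (lcf (-1) (v k) q) <= e.
Proof.
move=> mv mq Lh vq cv e e0.
have mvq k : measurable_fun A (lcf (-1) (v k) q).
  by apply: measurable_funD => //; exact: measurable_funM.
have Lvq k : L2s (lcf (-1) (v k) q).
  apply: (@L2_le_bound _ _ mu A mA h _ 1) => // x Ax.
  by rewrite mul1r /lcf mulN1r addrC distrC (le_trans (vq k x Ax))// ler_norm.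
have [_ ih] := (L2_integrable mu mA h).1 Lh.
have [|||||_ C _] := @dominated_convergence _ _ _ mu A mA
  (fun k x => (lcf (-1) (v k) q x ^+ 2)%:E) (fun=> 0%E) (EFin \o (fun x => h x ^+ 2)).
- by move=> k; exact: measurable_sqr.
- exact: measurable_cst.
- apply: aeW => x Ax; apply: cvg_EFin; first exact: nearW.
  have -> : 0 = (q x - q x) ^+ 2 by rewrite subrr expr0n.
  apply: (@continuous_cvg _ _ _ _ _ _ (fun y : R => y ^+ 2)); first exact: exprn_continuous.
  rewrite /lcf; under eq_fun do rewrite mulN1r addrC.
  by apply: cvgB; [exact: cvg_cst|exact: cv].
- exact: ih.
- apply: aeW => x k Ax; rewrite /= lee_fin ger0_norm ?sqr_ge0//.
  rewrite -real_normK ?num_real// ler_sqr ?nnegrE//.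
    by rewrite /lcf mulN1r addrC distrC vq.
  by rewrite (le_trans _ (vq k x Ax)).
have e20 : 0 < e ^+ 2 by rewrite exprn_gt0.
move: C => /fine_cvgP[_ /cvgrPdist_le/(_ _ e20)[K _ hK]].
exists K => k /hK /=; rewrite sub0r normrN => hk.
rewrite -ler_sqr ?nnegrE ?snorm_ge0 ?(ltW e0)// (sqr_snorm (sip_ip mu mA) (Lvq k)).
apply: le_trans hk; rewrite /ip /Rintegral (le_trans _ (ler_norm _))//.
rewrite le_eqVlt; apply/orP; left; apply/eqP; congr fine; apply: eq_integral => x _.
by rewrite subr0 ger0_norm ?sqr_ge0// expr2.
Qed.

Lemma L2_cst (c : R) : L2s (fun=> c).
Proof. by apply: (@L2_bounded _ _ mu A mA _ `|c|). Qed.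

Lemma L2_continuous_bounded v (M : R) : continuous v -> (forall x, A x -> `|v x| <= M) -> L2s v.
Proof.
move=> cv vM; apply: L2_bounded vM => //.
by apply: measurable_funTS; exact: continuous_measurable_rV.
Qed.

Lemma L2_test_function V phi : test_function V phi -> L2s phi.
Proof.
move=> [s c _].
have [M M0 hM] : exists2 M, 0 <= M & forall x, `|phi x| <= M.
  have [r0 [_ /(_ (r0 + 1))]] := compact_bounded c.
  rewrite ltrDl ltr01 => /(_ isT); set r := r0 + 1 => hr.
  apply: (@support_bounded _ _ phi r); first exact: smooth_continuous.
  move=> x rx; apply: contrapT => /eqP px; have : `|x| <= r by apply: hr; exact: subset_closure.
  by rewrite leNgt rx.
by apply: (L2_continuous_bounded (smooth_continuous s)) => x _; exact: hM.
Qed.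

Definition approx q := L2s q /\ forall e : R, 0 < e ->
  exists2 phi, test_function U phi & nrm (lcf (-1) phi q) <= e.

Lemma nrm_tri u v w : L2s u -> L2s v -> L2s w ->
  nrm (lcf (-1) u w) <= nrm (lcf (-1) u v) + nrm (lcf (-1) v w).
Proof.
move=> Lu Lv Lw; have := snorm_lc (sip_ip mu mA) 1 (L2_lc mA (-1) Lu Lv) (L2_lc mA (-1) Lv Lw).
rewrite normr1 mul1r; congr (_ <= _); congr snorm.
by apply/funext => x; rewrite /lcf; ring.
Qed.

Lemma approx_lc a u v : approx u -> approx v -> approx (lcf a u v).
Proof.
move=> [Lu hu] [Lv hv]; split=> [|e e0]; first exact: L2_lc.
have a1 : 0 < `|a| + 1 by rewrite ltr_wpDl.
have e20 : 0 < e / 2 by rewrite divr_gt0.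
have [phi tphi hphi] := hu (e / 2 / (`|a| + 1)) (divr_gt0 e20 a1).
have [psi tpsi hpsi] := hv (e / 2) e20.
exists (lcf a phi psi); first exact: test_function_lc.
have Lp := L2_test_function tphi; have Lq := L2_test_function tpsi.
have := snorm_lc (sip_ip mu mA) a (L2_lc mA (-1) Lp Lu) (L2_lc mA (-1) Lq Lv).
have -> : lcf a (lcf (-1) phi u) (lcf (-1) psi v) = lcf (-1) (lcf a phi psi) (lcf a u v).
  by apply/funext => x; rewrite /lcf; ring.
move=> h; rewrite (le_trans h)// [leRHS]splitr lerD//.
rewrite ler_pdivlMr// in hphi.
by rewrite mulrC (le_trans _ hphi)// ler_wpM2l ?snorm_ge0// lerDl.
Qed.

Lemma approx_lim q : L2s q -> (forall e : R, 0 < e ->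
  exists2 v, approx v & nrm (lcf (-1) v q) <= e) -> approx q.
Proof.
move=> Lq h; split=> // e e0; have e20 : 0 < e / 2 by rewrite divr_gt0.
have [v [Lv hv] vq] := h _ e20; have [phi tphi hphi] := hv _ e20.
exists phi => //; have Lp := L2_test_function tphi.
by rewrite (le_trans (nrm_tri Lp Lv Lq))// [leRHS]splitr lerD.
Qed.

Lemma approx_eq u v : {in A, u =1 v} -> approx u -> approx v.
Proof.
move=> uv [Lu hu]; split; first exact: eq_L2 uv Lu.
move=> e /hu[phi t h]; exists phi => //; apply: le_trans h.
rewrite /snorm (@eq_ip _ _ _ _ _ (lcf (-1) phi v) _ (lcf (-1) phi v))// => x xA;
by rewrite /lcf uv.
Qed.

Lemma approx_open (B : set E) : open B -> approx \1_B.
Proof.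
move=> oB; have oBU : open (B `&` U) by exact: openI.
apply: (@approx_eq \1_(B `&` U)).
  move=> x; rewrite inE => /AU Ux; rewrite !indicE; congr (_%:R : R); congr nat_of_bool.
  by apply/idP/idP; rewrite !inE; [case|split].
have [psi [tpsi psi01 psi1]] := test_function_approx oBU.
have mI : measurable_fun A (\1_(B `&` U) : E -> R).
  by apply: measurable_funTS; apply: measurable_indic; exact: open_measurable_rV.
have I01 x : 0 <= (\1_(B `&` U) x : R) <= 1 by rewrite indicE; case: (_ \in _); rewrite /= ?lexx ler01.
split.
  apply: (L2_bounded mA (C := 1)) => // x _; have /andP[? ?] := I01 x.
  by rewrite ger0_norm.
move=> e e0.
have [|||||K hK] := @L2_dominated psi \1_(B `&` U) (fun=> 1) _ _ _ _ _ e e0.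
- by move=> k; exact: L2_measurable (L2_test_function (tpsi k)).
- exact: mI.
- exact: L2_cst.
- move=> k x _; have /andP[? ?] := I01 x; have /andP[? ?] := psi01 k x.
  by rewrite ler_norml; apply/andP; split; lra.
- move=> x Ax; rewrite indicE; case: (boolP (x \in _)) => [|].
    rewrite inE => /psi1[K hK]; apply: cvg_near_cst; exists K => //.
  rewrite notin_setE => Bx; apply: cvg_near_cst; apply: nearW => k.
  exact: test_function_supp (tpsi k) _ Bx.
exists (psi K); last exact: hK.
by apply: test_function_sub (tpsi K) => x [].
Qed.

Lemma approx_sum (I : Type) (s : seq I) (c : I -> R) (u : I -> E -> R) :
  (forall k, approx (u k)) -> approx (fun x => \sum_(k <- s) c k * u k x).
Proof.
move=> hu; elim: s => [|a s IH].
  apply: (@approx_eq (\1_set0)); last exact: approx_open open0.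
  by move=> x _; rewrite big_nil indic0.
apply: (@approx_eq (lcf (c a) (u a) (fun x => \sum_(k <- s) c k * u k x))).
  by move=> x _; rewrite big_cons.
exact: approx_lc.
Qed.

Lemma measurable_rV_gen_open : @measurable _ E = <<s @open E >>.
Proof.
apply/seteqP; split; last first.
  apply: smallest_sub; first exact: sigma_algebra_measurable.
  by move=> B; exact: open_measurable_rV.
apply: smallest_sub; first exact: smallest_sigma_algebra.
move=> B; rewrite -bigcup_seq => -[i _ [C mC <-]]; rewrite setTI.
have mf : @measurable_fun _ _ (g_sigma_algebraType (@open E)) R setT (fun x : E => x ord0 i).
  apply: (measurability _ (RGenOpens.measurableE R)) => _ [_ [a [b ->]] <-].
  rewrite setTI; apply: sub_sigma_algebra; apply: open_comp => // x _.
  exact: coord_continuous.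
by have := mf measurableT C mC; rewrite setTI.
Qed.

(** Induction over the Dynkin system generated by the open sets: a complement is a linear
    combination with the constant 1, and a disjoint countable union is a dominated limit of finite
    sums. *)
Lemma approx_indic (B : set E) : measurable B -> approx \1_B.
Proof.
move=> mB; have : <<s @open E >> B by rewrite -measurable_rV_gen_open.
have I01 (C : set E) x : 0 <= (\1_C x : R) <= 1.
  by rewrite indicE; case: (_ \in _); rewrite /= ?lexx ler01.
have LI (C : set E) : measurable C -> L2s (\1_C).
  move=> mC; apply: (L2_bounded mA (C := 1)) => //.
  by move=> x _; have /andP[? ?] := I01 C x; rewrite ger0_norm.
apply: (@dynkin_induction _ E (@open E) (fun B => approx \1_B)).
- exact: measurable_rV_gen_open.
- by move=> C D; exact: openI.
- exact/approx_open/openT.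
- by move=> C; exact: approx_open.
- move=> C mC aC; apply: (@approx_eq (lcf (-1) \1_C \1_setT)).
    move=> x _; rewrite /lcf !indicE in_setT in_setC mulN1r.
    by case: (_ \in _) => /=; rewrite ?addNr ?oppr0 ?add0r.
  by apply: approx_lc => //; exact/approx_open/openT.
move=> F mF tF aF.
have mU : measurable (\bigcup_k F k) by exact: bigcupT_measurable.
pose v (m : nat) x : R := \sum_(k < m) 1 * \1_(F k) x.
have av m : approx (v m) by apply: (approx_sum _ (fun=> 1)).
have v1 j x : F j x -> forall m, v m x = (j < m)%N%:R.
  move=> Fj m; have [jm|jm] := ltnP j m.
    rewrite /v (bigD1 (Ordinal jm))//= big1 ?addr0 ?mul1r ?indicE ?mem_set// => k kj.
    rewrite indicE memNset ?mulr0// => Fk.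
    have /eqP := kj; apply; apply/val_inj.
    by apply: (tF k j I I); exists x.
  rewrite /v big1// => k _; rewrite indicE memNset ?mulr0// => Fk.
  have kj : k = j :> nat by apply: (tF k j I I); exists x.
  by have := ltn_ord k; rewrite kj ltnNge jm.
have v0 x m : ~ (\bigcup_k F k) x -> v m x = 0.
  move=> nF; rewrite /v big1// => k _; rewrite indicE memNset ?mulr0// => Fk.
  by apply: nF; exists k.
apply: approx_lim; first exact: LI.
move=> e e0; have [|||||K hK] := @L2_dominated v \1_(\bigcup_k F k) (fun=> 1) _ _ _ _ _ e e0.
- by move=> k; have [] := av k => /L2_measurable.
- by apply: L2_measurable; exact: LI.
- exact: L2_cst.
- move=> k x _; have [[j _ Fj]|nF] := pselect ((\bigcup_k F k) x).
    rewrite (v1 j)// indicE mem_set; last by exists j.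
    by case: (_ < _)%N; rewrite ?subrr ?normr0// sub0r normrN normr1.
  by rewrite v0// indicE memNset// subrr normr0.
- move=> x _; have [[j _ Fj]|nF] := pselect ((\bigcup_k F k) x).
    rewrite indicE mem_set; last by exists j.
    apply: cvg_near_cst; exists j.+1 => // m /= jm.
    by rewrite (v1 j)// jm.
  rewrite indicE memNset//; apply: cvg_near_cst; apply: nearW => m; exact: v0.
by exists (v K) => //; exact: hK.
Qed.

Import HBNNSimple.

Lemma approx_nnsfun (f : {nnsfun E >-> R}) : approx f.
Proof.
pose s : seq R := finmap.enum_fset (fset_set (range f)).
have h : {in A, (fun x => \sum_(y <- s) y * \1_(f @^-1` [set y]) x) =1 f}.
  by move=> x _; rewrite [RHS]fimfunE fsbig_finite.
apply: (approx_eq h).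
apply: (approx_sum _ (fun y => y) (u := fun y => \1_(f @^-1` [set y]))) => y.
by apply: approx_indic; exact: measurable_sfunP.
Qed.

Lemma approx_ge0 q : L2s q -> (forall x, 0 <= q x) -> approx q.
Proof.
move=> Lq q0; have mq := L2_measurable Lq.
have mEq : measurable_fun A (EFin \o q) by exact/measurable_EFinP.
have Eq0 x : A x -> (0 <= (EFin \o q) x)%E by move=> _; rewrite lee_fin.
pose g := nnsfun_approx mA mEq.
apply: approx_lim => // e e0.
have [|||||K hK] := @L2_dominated (fun k => g k) q q _ _ _ _ _ e e0.
- by move=> k; exact: measurable_funTS.
- exact: mq.
- exact: Lq.
- move=> k x Ax.
  have gq : g k x <= q x.
    have /fine_cvgP[_ c] := cvg_nnsfun_approx mA mEq Eq0 Ax.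
    have nd : nondecreasing_seq (fun k => g k x).
      by move=> i j ij; have /lefP := nd_nnsfun_approx mA mEq ij; exact.
    have /= -> : q x = limn (fun k => g k x) by apply/esym/cvg_lim.
    by apply: nondecreasing_cvgn_le => //; apply/cvg_ex; exists (q x).
  have g0 : 0 <= g k x by [].
  by rewrite distrC ger0_norm ?subr_ge0// gerBl.
- move=> x Ax; have := cvg_nnsfun_approx mA mEq Eq0 Ax.
  by move=> /fine_cvgP[_].
by exists (g K); [exact: approx_nnsfun|exact: hK].
Qed.

(** The measure is left general because the result serves both Lebesgue measure on Omega and the
    surface measure on [G_I]. In the second case A is the part of the boundary inside the open set
    U, and functions on the boundary are approximated by restrictions of test functions of U. *)
Theorem test_function_dense q : L2s q -> forall e : R, 0 < e ->
  exists2 phi, test_function U phi & nrm (lcf (-1) phi q) <= e.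
Proof.
move=> Lq; suff [] : approx q by [].
have mq := L2_measurable Lq.
apply: (@approx_eq (lcf (-1) q^\- q^\+)%R).
  by move=> x _; rewrite -[RHS](congr1 (@^~ x) (funrposBneg q)) /lcf mulN1r addrC.
apply: approx_lc; apply: approx_ge0.
- apply: (@L2_le_bound _ _ mu A mA q _ 1) => //; first exact: measurable_funrneg.
  move=> x _; rewrite mul1r ger0_norm ?funrneg_ge0//.
  by rewrite /funrneg ge_max normr_ge0 andbT -normrN ler_norm.
- by move=> x; exact: funrneg_ge0.
- apply: (@L2_le_bound _ _ mu A mA q _ 1) => //; first exact: measurable_funrpos.
  move=> x _; rewrite mul1r ger0_norm ?funrpos_ge0//.
  by rewrite /funrpos ge_max normr_ge0 andbT ler_norm.
- by move=> x; exact: funrpos_ge0.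
Qed.

End density.

(** * Convergence of mollifications in L^2 *)

Section mollification.
Context {R : realType} {n : nat}.
Local Notation E := 'rV[R]_n.+1.
Local Notation lambda := (leb n.+1 : {measure set E -> \bar R}).
Implicit Types (kappa V W phi : E -> R) (x y c : E).

Lemma fundamental_lemma (mu : {measure set E -> \bar R}) (U A : set E) w :
  measurable A -> open U -> A `<=` U -> (mu A < +oo)%E -> Lp mu A 2%:E w ->
  (forall phi, test_function U phi -> ip mu A w phi = 0) -> ae_eq mu A w (fun=> 0).
Proof.
move=> mA oU AU muA Lw h; apply: ip_eq0_ae => //.
have S := sip_ip mu mA.
apply/eqP; rewrite -normr_le0; apply/ler_addgt0Pr => e e0; rewrite add0r.
pose N := snorm (ip mu A) w.
have N1 : 0 < N + 1 by rewrite ltr_wpDl// snorm_ge0.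
have [phi tphi hphi] := test_function_dense mA oU AU muA Lw (divr_gt0 e0 N1).
have Lp := L2_test_function mA muA tphi.
have := sip_lin S (-1) Lp Lw Lw; rewrite (sip_sym S Lp Lw) h// mulr0 add0r => <-.
rewrite (le_trans (cauchy_schwarz S (L2_lc mA (-1) Lp Lw) Lw))//.
rewrite ler_pdivlMr// in hphi; rewrite (le_trans _ hphi)// ler_wpM2l ?snorm_ge0//.
by rewrite lerDl.
Qed.

Lemma nrm_subset (mu : {measure set E -> \bar R}) (A B : set E) w :
  measurable A -> measurable B -> A `<=` B -> Lp mu B 2%:E w ->
  Lp mu A 2%:E w /\ snorm (ip mu A) w <= snorm (ip mu B) w.
Proof.
move=> mA mB AB Lw; have mw := L2_measurable Lw.
have mwA : measurable_fun A w by exact: measurable_funS mw.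
have le : (\int[mu]_(x in A) (w x ^+ 2)%:E <= \int[mu]_(x in B) (w x ^+ 2)%:E)%E.
  apply: ge0_subset_integral => //; first exact: measurable_sqr.
  by move=> x _; rewrite lee_fin sqr_ge0.
have LA : Lp mu A 2%:E w.
  apply/L2P => //; split=> //; apply: le_lt_trans le _.
  by have [] := (L2P mu B w).1 Lw.
split=> //; rewrite ler_sqrt; last by apply: (sip_ge0 (sip_ip mu mB)).
by rewrite -lee_fin -!L2_fin.
Qed.

Lemma L2_supp_integrable V (rho : R) : Lp lambda setT 2%:E V ->
  (forall x, rho < `|x| -> V x = 0) -> lambda.-integrable setT (EFin \o V).
Proof.
move=> LV V0; pose B := [set x : E | `|x| <= rho].
have mB : measurable B := @measurable_le_norm R n rho.
have LB : Lp lambda setT 2%:E (\1_B : E -> R).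
  apply/L2_integrable => //; split; first exact: measurable_indic.
  rewrite (_ : _ \o _ = EFin \o \1_B).
    by apply: integrableR_indic => //; exact: (@leb_bounded _ _ _ rho).
  by apply/funext => x /=; rewrite indicE; case: (_ \in _); rewrite ?expr1n ?expr0n.
have := L2M measurableT LV LB; congr (_.-integrable _ _); apply/funext => x /=.
rewrite indicE; case: (boolP (x \in B)) => [_|]; first by rewrite mulr1.
by rewrite notin_setE /B /= => /negP; rewrite -ltNge => /V0 ->; rewrite mul0r.
Qed.

(** The kernel need not be even: near the boundary mollifiers shifted by a vector are used. Unit
    mass in y makes the convolution an average, unit mass in x gives the L^2 bound by Tonelli's
    theorem. *)
Record mkernel kappa (s : R) : Prop := {
  mker_smooth : smooth kappa ;
  mker_ge0 : forall x, 0 <= kappa x ;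
  mker_supp : forall x, s < `|x| -> kappa x = 0 ;
  mker_int1 : forall x, (\int[lambda]_y (kappa (x - y))%:E = 1)%E ;
  mker_int2 : forall y, (\int[lambda]_x (kappa (x - y))%:E = 1)%E }.

Lemma moll_mkernel (r : R) c : 0 < r -> mkernel (fun h => moll r (1 *: h + c)) (r + `|c|).
Proof.
move=> r0; split=> [|x|x xr|x|y].
- by apply: smooth_affine; exact: smooth_moll.
- exact: moll_ge0.
- apply: moll_eq0'; rewrite // scale1r.
  have := ler_normB (x + c) c; rewrite addrK => h.
  by rewrite -(ltrD2r `|c|) (lt_le_trans xr).
- rewrite -[RHS](moll_integral_shift r0 (x + c)); apply: eq_integral => y _.
  by rewrite scale1r addrAC.
- rewrite -[RHS](moll_integral_shiftl r0 (y - c)); apply: eq_integral => x _.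
  by rewrite scale1r opprB addrA addrAC.
Qed.

Section mker.
Variables (kappa : E -> R) (s : R).
Hypothesis K : mkernel kappa s.

Let mk : measurable_fun setT kappa.
Proof. exact: continuous_measurable_rV (smooth_continuous (mker_smooth K)). Qed.

Lemma mker_bounded : exists2 M, 0 <= M & forall x, `|kappa x| <= M.
Proof. exact: support_bounded (smooth_continuous (mker_smooth K)) (mker_supp K). Qed.

Lemma mker_integrable x : lambda.-integrable setT (EFin \o (fun y => kappa (x - y))).
Proof.
apply/integrableP; split.
  by apply/measurable_EFinP; apply: (measurableT_comp mk); exact: measurable_subr_rV.
rewrite (eq_integral (fun y => (kappa (x - y))%:E)) ?(mker_int1 K) ?ltry// => y _.
by rewrite /= ger0_norm// (mker_ge0 K).
Qed.

Lemma mker_Rintegral x : \int[lambda]_y kappa (x - y) = 1.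
Proof. by rewrite /Rintegral (mker_int1 K). Qed.

Lemma conv_integrableM W x : lambda.-integrable setT (EFin \o W) ->
  lambda.-integrable setT (EFin \o (fun y => kappa (x - y) * W y)).
Proof. by have [M _ hM] := mker_bounded; move=> iW; exact: conv_integrable hM iW. Qed.

(** Jensen's inequality for squares, obtained from the nonnegative variance of W under the
    probability density kappa(x - y). *)
Lemma conv_jensen W x : lambda.-integrable setT (EFin \o W) ->
  lambda.-integrable setT (EFin \o (fun y => W y ^+ 2)) ->
  conv kappa W x ^+ 2 <= \int[lambda]_y (kappa (x - y) * W y ^+ 2).
Proof.
move=> iW iW2; pose a := conv kappa W x.
have i1 := conv_integrableM x iW; have i2 := conv_integrableM x iW2.
have i0 := mker_integrable x.
have : 0 <= \int[lambda]_y (kappa (x - y) * (W y - a) ^+ 2).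
  by apply: Rintegral_ge0 => y _; rewrite mulr_ge0 ?sqr_ge0// (mker_ge0 K).
have -> : (fun y => kappa (x - y) * (W y - a) ^+ 2) =
    (fun y => (kappa (x - y) * W y ^+ 2 - (a *+ 2) * (kappa (x - y) * W y)) +
      a ^+ 2 * kappa (x - y)).
  by apply/funext => y; ring.
rewrite RintegralD//; [|by apply: integrableRB => //; exact: integrableRZ|exact: integrableRZ].
rewrite RintegralB//; last exact: integrableRZ.
rewrite !RintegralZl// mker_Rintegral -/(conv kappa W x) -/a => h.
by rewrite -subr_ge0; move: h; congr (_ <= _); ring.
Qed.

Lemma measurable_conv_prod W : measurable_fun setT W ->
  measurable_fun setT (fun p : E * E => (kappa (p.1 - p.2) * W p.2 ^+ 2)%:E).
Proof.
move=> mW; apply/measurable_EFinP; apply: measurable_funM.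
  apply: (measurableT_comp mk); apply: measurable_fun_rV => i.
  under eq_fun do rewrite !mxE; apply: measurable_funB.
    exact: (measurableT_comp (measurable_coord i) measurable_fst).
  exact: (measurableT_comp (measurable_coord i) measurable_snd).
by apply: measurable_funX; exact: (measurableT_comp mW measurable_snd).
Qed.

Lemma conv_measurable W : lambda.-integrable setT (EFin \o W) ->
  measurable_fun setT (conv kappa W).
Proof.
move=> iW; apply: continuous_measurable_rV; apply: smooth_continuous.
exact: conv_smooth iW (mker_smooth K) (mker_supp K).
Qed.

Lemma conv_young W : lambda.-integrable setT (EFin \o W) ->
  lambda.-integrable setT (EFin \o (fun y => W y ^+ 2)) ->
  (\int[lambda]_x (conv kappa W x ^+ 2)%:E <= \int[lambda]_x (W x ^+ 2)%:E)%E.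
Proof.
move=> iW iW2; have mW := integrableR_measurable iW.
have mF := measurable_conv_prod mW.
have F0 (p : E * E) : (0 <= (kappa (p.1 - p.2) * W p.2 ^+ 2)%:E)%E.
  by rewrite lee_fin mulr_ge0 ?sqr_ge0// (mker_ge0 K).
apply: (@le_trans _ _ (\int[lambda]_x \int[lambda]_y (kappa (x - y) * W y ^+ 2)%:E)%E).
  apply: ge0_le_integral => //.
  - by move=> x _; rewrite lee_fin sqr_ge0.
  - by apply: measurable_sqr; exact: conv_measurable.
  - exact: (@measurable_fun_fubini_tonelli_F _ _ _ _ R (@sleb R n.+1) _ mF F0).
  move=> x _; rewrite (le_trans _ (_ : (\int[lambda]_y (kappa (x - y) * W y ^+ 2))%:E <= _)%E)//.
    by rewrite lee_fin conv_jensen.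
  by rewrite /Rintegral fineK//; apply: integrable_fin_num => //; exact: conv_integrableM.
rewrite (@fubini_tonelli _ _ _ _ _ (@sleb R n.+1) (@sleb R n.+1) _ mF F0).
rewrite le_eqVlt; apply/orP; left; apply/eqP; apply: eq_integral => y _ /=.
under eq_integral do rewrite mulrC EFinM.
rewrite ge0_integralZl//; last 3 first.
- apply/measurable_EFinP; apply: (measurableT_comp mk).
  apply: measurable_fun_rV => i; under eq_fun do rewrite !mxE.
  by apply: measurable_funB => //; exact: measurable_coord.
- by move=> x _; rewrite lee_fin (mker_ge0 K).
- by rewrite lee_fin sqr_ge0.
by rewrite (mker_int2 K) mule1.
Qed.

Lemma conv_lip phi (L : R) x : continuous phi -> lambda.-integrable setT (EFin \o phi) ->
  0 <= L -> (forall y, `|phi y - phi x| <= L * `|y - x|) ->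
  `|conv kappa phi x - phi x| <= L * s.
Proof.
move=> cphi iphi L0 lip.
have i1 := conv_integrableM x iphi; have i0 := mker_integrable x.
have i2 : lambda.-integrable setT (EFin \o (fun y => kappa (x - y) * (phi y - phi x))).
  rewrite (_ : (fun y => _) = (fun y => kappa (x - y) * phi y - phi x * kappa (x - y))).
    by apply: integrableRB => //; exact: integrableRZ.
  by apply/funext => y; ring.
have -> : conv kappa phi x - phi x = \int[lambda]_y (kappa (x - y) * (phi y - phi x)).
  rewrite -[X in _ - X]mulr1 -(mker_Rintegral x) -RintegralZl// -RintegralB//; last first.
    exact: integrableRZ.
  by apply: eq_Rintegral => y _; ring.
rewrite (le_trans (le_normr_Rintegral _ _))//.
rewrite -[leRHS]mulr1 -(mker_Rintegral x) -RintegralZl//; apply: le_Rintegral => //.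
- exact: integrableRabs.
- exact: integrableRZ.
move=> y _; rewrite normrM ger0_norm ?(mker_ge0 K)// mulrC.
have [ys|ys] := leP `|x - y| s.
  rewrite ler_wpM2r ?(mker_ge0 K)// (le_trans (lip y))//.
  by rewrite ler_wpM2l// distrC.
by rewrite (mker_supp K)// !mulr0.
Qed.

End mker.

(** V is compared with a test function phi: the kernel moves the Lipschitz function phi by at most L
    * s and does not increase the L^2 norm of phi - V. The threshold depends on the support radius
    of the kernel only, so shift and scale can be chosen afterwards. *)
Lemma conv_approx V (rho rho' : R) (A : set E) (e : R) : 0 < rho ->
  Lp lambda setT 2%:E V -> (forall x, rho < `|x| -> V x = 0) ->
  measurable A -> (forall x, A x -> `|x| <= rho') -> 0 < e ->
  exists2 s0 : R, 0 < s0 & forall kappa s, mkernel kappa s -> s <= s0 ->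
    snorm (ip lambda A) (lcf (-1) (conv kappa V) V) <= e.
Proof.
move=> rho0 LV V0 mA Arho e0.
have lA : (lambda A < +oo)%E by exact: leb_bounded Arho.
pose U : set E := ball (0 : E) (rho + 1).
have U1 : 0 < rho + 1 by rewrite ltr_wpDl// ltW.
have oU : open U by exact: ball_open.
have mU : measurable U by exact: measurable_ball_rV.
have lU : (lambda U < +oo)%E by rewrite leb_ball// ltry.
have [LVU _] := nrm_subset mU measurableT (@subsetT _ U) LV.
have e30 : 0 < e / 3 by rewrite divr_gt0.
have [phi tphi hphi] := test_function_dense mU oU (@subset_refl _ U) lU LVU e30.
have sphi := test_function_smooth tphi.
have cphi := smooth_continuous sphi.
have outU x : rho + 1 < `|x| -> ~ U x.
  move=> xr; rewrite /U -ball_normE /ball_ /= sub0r normrN => xr'.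
  by have := lt_trans xr xr'; rewrite ltxx.
have phi0 x : rho + 1 < `|x| -> phi x = 0 by move=> /outU; exact: test_function_supp tphi x.
have [M M0 hM] := support_bounded cphi phi0.
have [c c0 hc] := partials_bounded sphi phi0.
have mphi := continuous_measurable_rV cphi.
have iphi := support_integrable mphi hM phi0.
have iphi2 : lambda.-integrable setT (EFin \o (fun x => phi x ^+ 2)).
  apply: (@support_integrable _ _ _ (rho + 1) (M ^+ 2)).
  - exact: measurable_funX.
  - by move=> x; rewrite normrX ler_sqr ?nnegrE.
  - by move=> x /phi0 ->; rewrite expr0n.
have Lphi : Lp lambda setT 2%:E phi by apply/L2_integrable.
pose W := lcf (-1) phi V.
have LW : Lp lambda setT 2%:E W by exact: L2_lc.
have V0' x : rho + 1 < `|x| -> V x = 0.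
  by move=> xr; apply: V0; rewrite (lt_trans _ xr)// ltrDl.
have W0 x : rho + 1 < `|x| -> W x = 0.
  by move=> xr; rewrite /W /lcf phi0// V0'// mulr0 addr0.
have iV := L2_supp_integrable LV V0.
have iW := L2_supp_integrable LW W0.
have [mW iW2] := (L2_integrable lambda measurableT W).1 LW.
have WU : snorm (ip lambda setT) W = snorm (ip lambda U) W.
  rewrite /snorm /ip; congr Num.sqrt; rewrite [RHS]Rintegral_mkcond.
  apply: eq_Rintegral => x _; rewrite /patch; case: ifPn => //.
  rewrite notin_setE => Ux; rewrite /W /lcf (test_function_supp tphi Ux).
  have xr : rho < `|x|.
    move: Ux; rewrite /U -ball_normE /ball_ /= sub0r normrN => /negP; rewrite -leNgt.
    by move=> h; rewrite (lt_le_trans _ h)// ltrDl.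
  by rewrite V0// mulr0 addr0 mulr0.
pose L := n.+1%:R * c.
have L0 : 0 <= L by rewrite mulr_ge0.
pose sA := Num.sqrt (fine (lambda A)).
have LA1 : 0 < L * sA + 1 by rewrite ltr_wpDl// mulr_ge0// sqrtr_ge0.
exists (e / 3 / (L * sA + 1)); first by rewrite divr_gt0.
move=> kappa s K ss0.
have [_ WA] := nrm_subset mA measurableT (@subsetT _ A) LW.
have Lcp u (ru : R) : lambda.-integrable setT (EFin \o u) -> Lp lambda A 2%:E (conv kappa u).
  move=> iu; have sc := conv_smooth iu (mker_smooth K) (mker_supp K).
  have [M' _ hM'] := continuous_bounded rho' (smooth_continuous sc).
  exact: (L2_continuous_bounded mA lA (smooth_continuous sc) (fun x Ax => hM' x (Arho x Ax))).
have L1 := Lcp phi 0 iphi; have L2 := Lcp W 0 iW; have L3 := Lcp V 0 iV.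
have [LphiA _] := nrm_subset mA measurableT (@subsetT _ A) Lphi.
have [LVA _] := nrm_subset mA measurableT (@subsetT _ A) LV.
have [LWA _] := nrm_subset mA measurableT (@subsetT _ A) LW.
have SA := sip_ip lambda mA.
have t1 : snorm (ip lambda A) (lcf (-1) (conv kappa phi) phi) <= e / 3.
  apply: (@le_trans _ _ (L * s * snorm (ip lambda A) (fun=> 1))).
    (* A kernel of negative radius would vanish identically, against its unit mass. *)
    have s0 : 0 <= s.
      rewrite leNgt; apply/negP => s0.
      have := mker_int1 K 0; under eq_integral do rewrite (mker_supp K) ?(lt_le_trans s0)//.
      by rewrite integral0 => /eqP; rewrite eqe eq_sym oner_eq0.
    apply: (nrm_le_bound mA); first exact: mulr_ge0.
    + exact: L2_measurable (L2_lc mA _ L1 LphiA).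
    + exact: L2_cst.
    move=> x _; rewrite normr1 mulr1 /lcf mulN1r addrC distrC.
    apply: (conv_lip K) => // y.
    by have := smooth_lipschitz sphi hc x (y - x); rewrite addrCA subrr addr0.
  have -> : snorm (ip lambda A) (fun=> 1) = sA.
    rewrite /snorm /ip /sA; congr Num.sqrt.
    by rewrite /Rintegral; under eq_integral do rewrite mulr1; rewrite integral_cst// mul1e.
  rewrite mulrAC; rewrite ler_pdivlMr// in ss0.
  rewrite mulrC (le_trans _ ss0)//.
  have s0 : 0 <= s.
    rewrite leNgt; apply/negP => s0.
    have := mker_int1 K 0; under eq_integral do rewrite (mker_supp K) ?(lt_le_trans s0)//.
    by rewrite integral0 => /eqP; rewrite eqe eq_sym oner_eq0.
  by rewrite ler_wpM2l// lerDl.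
have t2 : snorm (ip lambda A) (conv kappa W) <= e / 3.
  apply: le_trans (_ : snorm (ip lambda setT) W <= _); last by rewrite WU.
  have cW2 : Lp lambda setT 2%:E (conv kappa W).
    apply/L2P => //; split; first exact: conv_measurable K _ iW.
    apply: le_lt_trans (conv_young K iW iW2) _.
    by have [] := (L2P lambda setT W).1 LW.
  have [_ le] := nrm_subset mA measurableT (@subsetT _ A) cW2.
  apply: le_trans le _; rewrite ler_sqrt; last exact: (sip_ge0 (sip_ip lambda measurableT)).
  by rewrite -lee_fin -!L2_fin//; exact: (conv_young K iW iW2).
have t3 : snorm (ip lambda A) W <= e / 3 by rewrite (le_trans WA)// WU.
have cE x : conv kappa V x = conv kappa W x + conv kappa phi x.
  rewrite /conv -RintegralD//; try exact: (conv_integrableM K).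
  by apply: eq_Rintegral => y _; rewrite /W /lcf; ring.
have -> : lcf (-1) (conv kappa V) V =
    lcf (-1) (conv kappa W) (lcf 1 (lcf (-1) (conv kappa phi) phi) W).
  by apply/funext => x; rewrite /lcf cE /W /lcf; ring.
have b1 := snorm_lc SA (-1) L2 (L2_lc mA 1 (L2_lc mA (-1) L1 LphiA) LWA).
have b2 := snorm_lc SA 1 (L2_lc mA (-1) L1 LphiA) LWA.
move: b1 b2; rewrite normrN1 normr1 !mul1r => b1 b2.
by rewrite (le_trans b1)//; lra.
Qed.

End mollification.

(** * Sobolev spaces *)

Section integration_by_parts.
Context {R : realType} {n : nat}.
Local Notation E := 'rV[R]_n.+1.
Local Notation lambda := (leb n.+1 : {measure set E -> \bar R}).

Lemma leb_RintegralD (a : E) (f : E -> R) : measurable_fun setT f ->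
  \int[lambda]_x f (a + x) = \int[lambda]_x f x.
Proof.
move=> mf; rewrite /Rintegral; congr fine; rewrite integralE [RHS]integralE.
have mEf : measurable_fun setT (EFin \o f) by exact/measurable_EFinP.
congr (_ - _)%E.
- rewrite -[RHS](leb_integralD a (measurable_funepos mEf))//.
  by apply: eq_integral => x _; rewrite !funeposE.
- rewrite -[RHS](leb_integralD a (measurable_funeneg mEf))//.
  by apply: eq_integral => x _; rewrite !funenegE.
Qed.

(** The convolution of the reflected function with the indicator of a large ball is constant near 0,
    because integrals are translation invariant. Its partial derivative at 0 vanishes, and is minus
    the integral in question. *)
Lemma Rintegral_partial_eq0 (theta : E -> R) (r : R) i : 0 <= r -> smooth theta ->
  (forall x, r < `|x| -> theta x = 0) -> \int[lambda]_x partial i theta x = 0.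
Proof.
move=> r0 stheta theta0.
pose th (x : E) := theta (-1 *: x + 0).
have sth : smooth th by exact: smooth_affine.
have th0 x : r < `|x| -> th x = 0 by move=> rx; apply: theta0; rewrite addr0 scaleN1r normrN.
pose B := [set x : E | `|x| <= r + 1].
have mB : measurable B := @measurable_le_norm R n (r + 1).
have iB : lambda.-integrable setT (EFin \o \1_B).
  by apply: integrableR_indic => //; exact: (@leb_bounded _ _ _ (r + 1)).
have inB (f : E -> R) x y : (forall x, r < `|x| -> f x = 0) -> `|x| <= 1 ->
    f (x - y) * \1_B y = f (x - y).
  move=> f0 x1; rewrite indicE; case: (boolP (y \in B)) => [_|]; first by rewrite mulr1.
  rewrite notin_setE /B /= => /negP; rewrite -ltNge => yr; rewrite mulr0 f0//.
  by have := lerB_dist y x; rewrite distrC; move: x1 yr; lra.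
have mth := continuous_measurable_rV (smooth_continuous sth).
have C x : `|x| <= 1 -> conv th \1_B x = \int[lambda]_y th (- y).
  move=> x1; rewrite /conv; under eq_Rintegral do rewrite (inB th)//.
  rewrite -(leb_RintegralD (- x) (f := fun y => th (- y))).
    by apply: eq_Rintegral => y _; rewrite opprD opprK.
  apply: (measurableT_comp mth); have := measurable_subr_rV (0 : E).
  by under eq_fun do rewrite sub0r.
have P0 : partial i (conv th \1_B) 0 = 0.
  rewrite (@partial_near _ _ _ (fun=> \int[lambda]_y th (- y))) ?partial_cst//.
  apply/nbhs_ballP; exists 1 => //= x; rewrite -ball_normE /ball_ /= sub0r normrN => /ltW.
  exact: C.
move: P0; rewrite (conv_partial _ _ iB sth th0) /conv.
have pth0 := partial_support i th0.
under eq_Rintegral do rewrite (inB (partial i th))// ?normr0//.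
have E1 y : partial i th (0 - y) = - partial i theta y.
  by rewrite /th partial_affine// sub0r scaleN1r opprK addr0 mulN1r.
under eq_Rintegral do rewrite E1 -mulN1r.
have [c c0 hc] := partials_bounded stheta theta0.
rewrite RintegralZl//; last first.
  apply: (support_integrable _ (hc i) (partial_support i theta0)).
  exact: continuous_measurable_rV (smooth_continuous (smooth_partial i stheta)).
by rewrite mulN1r => /eqP; rewrite oppr_eq0 => /eqP.
Qed.

Lemma Rintegral_sum (mu : {measure set E -> \bar R}) (A : set E) I (s : seq I) (f : I -> E -> R) :
  measurable A -> (forall i, mu.-integrable A (EFin \o f i)) ->
  \int[mu]_(x in A) (\sum_(i <- s) f i x) = \sum_(i <- s) \int[mu]_(x in A) f i x /\
  mu.-integrable A (EFin \o (fun x => \sum_(i <- s) f i x)).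
Proof.
move=> mA If; elim: s => [|a s [IH1 IH2]].
  split; first by rewrite big_nil; under eq_Rintegral do rewrite big_nil; rewrite /Rintegral integral0.
  by rewrite (_ : _ \o _ = cst 0%E); [exact: integrable0|apply/funext => x /=; rewrite big_nil].
have E1 : (fun x => \sum_(i <- a :: s) f i x) = (fun x => f a x + \sum_(i <- s) f i x).
  by apply/funext => x; rewrite big_cons.
by rewrite E1; split; [rewrite RintegralD// IH1 big_cons|exact: integrableRD].
Qed.

End integration_by_parts.

Definition lcv {R : realType} {T : Type} {m : nat} (a : R) (u v : T -> 'rV[R]_m) : T -> 'rV[R]_m :=
  fun x => a *: u x + v x.

Definition comp_rV {R : realType} {T : Type} {m : nat} (w : T -> 'rV[R]_m) i : T -> R :=
  fun x => w x ord0 i.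

Definition grad {R : realType} {n : nat} (phi : 'rV[R]_n.+1 -> R) : 'rV[R]_n.+1 -> 'rV[R]_n.+1 :=
  fun x => \row_i partial i phi x.

(** * Weak gradients, weak divergences and the space H^1 *)

Section sobolev.
Context {R : realType} {n : nat}.
Local Notation E := 'rV[R]_n.+1.
Local Notation lambda := (leb n.+1 : {measure set E -> \bar R}).
Variables (Omega : set E) (rho : R).
Hypothesis oO : open Omega.
Hypothesis bO : forall x, Omega x -> `|x| <= rho.
Implicit Types (u v phi psi h : E -> R) (w y : E -> E).

Local Notation nO := (snorm (ip lambda Omega)).
Local Notation H1 := (H1 Omega).
Local Notation L2 := (L2 Omega).
Local Notation L2vec := (L2vec Omega).
Local Notation ipvec := (ipvec Omega).
Local Notation wgrad := (wgrad Omega).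
Local Notation wdiv := (wdiv Omega).
Local Notation test := (test_function Omega).

Lemma domain_measurable : measurable Omega. Proof. exact: open_measurable_rV. Qed.
Let mO := domain_measurable.

Lemma domain_leb : (lambda Omega < +oo)%E. Proof. exact: leb_bounded bO. Qed.
Let lO := domain_leb.

Let S := sip_ip lambda mO.

Lemma L2_smooth phi : continuous phi -> L2 phi.
Proof.
move=> cphi; have [M _ hM] := continuous_bounded rho cphi.
exact: (L2_continuous_bounded mO lO cphi (fun x Ox => hM x (bO Ox))).
Qed.

Lemma L2_test phi : test phi -> L2 phi.
Proof. by move=> /test_function_smooth/smooth_continuous; exact: L2_smooth. Qed.

Lemma L2_smoothM phi v : continuous phi -> L2 v -> L2 (fun x => phi x * v x).
Proof.
move=> cphi Lv; have [M M0 hM] := continuous_bounded rho cphi.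
apply: (L2_le_bound mO (C := M) _ Lv).
  apply: measurable_funM; last exact: L2_measurable Lv.
  by apply: measurable_funTS; exact: continuous_measurable_rV.
by move=> x Ox; rewrite normrM ler_wpM2r// hM// bO.
Qed.

Lemma L2vec_measurable y i : L2vec y -> measurable_fun Omega (comp_rV y i).
Proof. by move=> /(_ i) /L2_measurable. Qed.

Lemma ipvecE y w : L2vec y -> L2vec w ->
  ipvec y w = \sum_i ip lambda Omega (comp_rV y i) (comp_rV w i).
Proof.
move=> Ly Lw; rewrite /ipvec /dotp.
by have [-> _] := Rintegral_sum (index_enum 'I_n.+1) mO (fun i => L2M mO (Ly i) (Lw i)).
Qed.

Lemma L2vec_lc a y w : L2vec y -> L2vec w -> L2vec (lcv a y w).
Proof.
move=> Ly Lw i; rewrite (_ : (fun x => _) = lcf a (comp_rV y i) (comp_rV w i)).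
  by apply: L2_lc => //; [exact: Ly|exact: Lw].
by apply/funext => x; rewrite /lcv /lcf !mxE.
Qed.

Lemma comp_lcv a y w i : comp_rV (lcv a y w) i = lcf a (comp_rV y i) (comp_rV w i).
Proof. by apply/funext => x; rewrite /lcv /lcf /comp_rV !mxE. Qed.

Lemma sip_ipvec : sip L2vec lcv ipvec.
Proof.
split=> [a y w|y w Ly Lw|a u v w Lu Lv Lw|y Ly]; first exact: L2vec_lc.
- by rewrite !ipvecE//; apply: eq_bigr => i _; rewrite (sip_sym S)//; [exact: Ly|exact: Lw].
- rewrite !ipvecE//; last exact: L2vec_lc.
  rewrite mulr_sumr -big_split/=; apply: eq_bigr => i _.
  by rewrite comp_lcv (sip_lin S)//; [exact: Lu|exact: Lv|exact: Lw].
- by rewrite ipvecE//; apply: sumr_ge0 => i _; exact: (sip_ge0 S) (Ly i).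
Qed.

Lemma normvecE y : normvec Omega y = snorm ipvec y. Proof. by []. Qed.

Lemma comp_nrm_le y i : L2vec y -> nO (comp_rV y i) <= snorm ipvec y.
Proof.
move=> Ly; rewrite ler_sqrt; last exact: (sip_ge0 sip_ipvec).
rewrite ipvecE// (bigD1 i)//= lerDl; apply: sumr_ge0 => j _.
exact: (sip_ge0 S) (Ly j).
Qed.

Lemma nrm_comp_le y (c : R) : L2vec y -> 0 <= c -> (forall i, nO (comp_rV y i) <= c) ->
  snorm ipvec y <= n.+1%:R * c.
Proof.
move=> Ly c0 h; rewrite -ler_sqr ?nnegrE ?mulr_ge0 ?snorm_ge0//.
rewrite (sqr_snorm sip_ipvec)// ipvecE//.
apply: (@le_trans _ _ (\sum_(i < n.+1) c ^+ 2)).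
  apply: ler_sum => i _; rewrite -(sqr_snorm S); last exact: Ly.
  by rewrite ler_sqr ?nnegrE ?snorm_ge0.
rewrite sumr_const card_ord exprMn -[X in X <= _]mulr_natl ler_wpM2r ?sqr_ge0//.
by rewrite expr2 ler_peMl// ler1n.
Qed.

Lemma ipvec_eq0_ae y : L2vec y -> ipvec y y = 0 -> ae_eq lambda Omega y (fun=> 0).
Proof.
move=> Ly; rewrite ipvecE// => /eqP; rewrite psumr_eq0; last first.
  by move=> i _; exact: (sip_ge0 S) (Ly i).
move=> /allP h.
have hi i : ae_eq lambda Omega (comp_rV y i) (fun=> 0).
  apply: ip_eq0_ae => //; first exact: Ly.
  by apply/eqP; have := h i; rewrite mem_index_enum => /(_ isT).
have : \forall x \ae lambda, forall i, Omega x -> comp_rV y i x = 0.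
  by apply: filter_forall => i; exact: hi.
by apply: filterS => x hx Ox; apply/rowP => i; rewrite mxE; exact: hx.
Qed.

Lemma ipvec_ae y y' w w' : L2vec y -> L2vec y' -> L2vec w -> L2vec w' ->
  ae_eq lambda Omega y y' -> ae_eq lambda Omega w w' -> ipvec y w = ipvec y' w'.
Proof.
move=> Ly Ly' Lw Lw' yy ww; rewrite !ipvecE//; apply: eq_bigr => i _.
apply: ip_ae => //; try exact: L2vec_measurable.
- by apply: filterS yy => x h Ox; rewrite /comp_rV h.
- by apply: filterS ww => x h Ox; rewrite /comp_rV h.
Qed.

Lemma wgrad_unique v w w' : is_wgrad Omega v w -> is_wgrad Omega v w' ->
  ae_eq lambda Omega w w'.
Proof.
move=> [Lw hw] [Lw' hw'].
have Ld : L2vec (lcv (-1) w w') by exact: L2vec_lc.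
suff : ae_eq lambda Omega (lcv (-1) w w') (fun=> 0).
  by apply: filterS => x h Ox; have := h Ox; rewrite /lcv scaleN1r addrC => /eqP; rewrite subr_eq0 => /eqP.
apply: ipvec_eq0_ae => //; rewrite ipvecE//; apply: big1 => i _.
have Li := Ld i.
apply: ae_ip_eq0 => //; first exact: L2_measurable Li.
apply: (fundamental_lemma mO oO (@subset_refl _ _) lO Li) => phi tphi.
have Lp := L2_test tphi.
rewrite -/(comp_rV _ i) comp_lcv (sip_lin S)//; [|exact: Lw|exact: Lw'].
have := hw phi tphi i; rewrite (hw' phi tphi i) => /oppr_inj.
by rewrite /comp_rV => ->; rewrite mulN1r addNr.
Qed.

Lemma wgradP v : H1 v -> is_wgrad Omega v (wgrad v).
Proof. by move=> [_ [w hw]]; exact: (xgetPex _ (ex_intro _ w hw)). Qed.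

Lemma wgrad_L2 v : H1 v -> L2vec (wgrad v).
Proof. by move=> /wgradP[]. Qed.

Lemma H1_L2 v : H1 v -> L2 v. Proof. by case. Qed.

Lemma is_wgradP v w : L2 v -> is_wgrad Omega v w -> H1 v /\ ae_eq lambda Omega (wgrad v) w.
Proof.
move=> Lv hw; have Hv : H1 v by split=> //; exists w.
by split=> //; exact: wgrad_unique (wgradP Hv) hw.
Qed.

Lemma test_partial phi i : test phi -> test (partial i phi).
Proof.
move=> [s c k]; have cl : closure [set x | partial i phi x != 0] `<=` closure [set x | phi x != 0].
  rewrite [X in _ `<=` X](closure_id _).1; last exact: closed_closure.
  apply: closure_subset => x /= px; apply: contrapT => nx; move/eqP: px; apply.
  rewrite (@partial_near _ _ _ (fun=> 0)) ?partial_cst//.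
  have : open (~` closure [set x | phi x != 0]) by apply: closed_openC; exact: closed_closure.
  rewrite openE => /(_ _ nx); apply: filterS => z nz.
  by apply: contrapT => /eqP pz; apply: nz; exact: subset_closure.
split; first exact: smooth_partial.
- by apply: subclosed_compact cl => //; exact: closed_closure.
- by move=> x /cl /k.
Qed.

Lemma is_wgrad_lc a u v w w' : L2 u -> L2 v -> is_wgrad Omega u w -> is_wgrad Omega v w' ->
  is_wgrad Omega (lcf a u v) (lcv a w w').
Proof.
move=> Lu Lv [Lw hw] [Lw' hw']; split; first exact: L2vec_lc.
move=> phi tphi i.
have Lp := L2_test tphi; have Ldp := L2_test (test_partial i tphi).
rewrite -/(comp_rV _ i) comp_lcv !(sip_lin S)//; [|exact: Lw|exact: Lw'].
by rewrite (hw _ tphi) (hw' _ tphi) /comp_rV mulrN opprD.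
Qed.

Lemma H1_lc a u v : H1 u -> H1 v ->
  H1 (lcf a u v) /\ ae_eq lambda Omega (wgrad (lcf a u v)) (lcv a (wgrad u) (wgrad v)).
Proof.
move=> Hu Hv; apply: is_wgradP; first by apply: L2_lc => //; [case: Hu|case: Hv].
by apply: is_wgrad_lc; [case: Hu|case: Hv|exact: wgradP|exact: wgradP].
Qed.

Definition h1ip u v : R := ip lambda Omega u v + ipvec (wgrad u) (wgrad v).

Lemma sip_h1ip : sip H1 lcf h1ip.
Proof.
split=> [a u v Hu Hv|u v Hu Hv|a u v w Hu Hv Hw|u Hu].
- by have [] := H1_lc a Hu Hv.
- rewrite /h1ip (sip_sym S (H1_L2 Hu) (H1_L2 Hv)).
  by rewrite (sip_sym sip_ipvec (wgrad_L2 Hu) (wgrad_L2 Hv)).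
- have [Hl El] := H1_lc a Hu Hv.
  rewrite /h1ip (sip_lin S)//; try exact: H1_L2.
  rewrite (@ipvec_ae _ (lcv a (wgrad u) (wgrad v)) _ (wgrad w))//; try exact: wgrad_L2; last exact: ae_eq_refl.
    rewrite (sip_lin sip_ipvec a (wgrad_L2 Hu) (wgrad_L2 Hv) (wgrad_L2 Hw)).
    by rewrite mulrDr addrACA.
  by apply: L2vec_lc; exact: wgrad_L2.
- by rewrite addr_ge0//; [exact: (sip_ge0 S) (H1_L2 Hu)|exact: (sip_ge0 sip_ipvec) (wgrad_L2 Hu)].
Qed.

Lemma H1normE v : H1 v -> H1norm Omega v = snorm h1ip v.
Proof.
move=> Hv; rewrite /H1norm Lpnorm2E (sqr_snorm S (H1_L2 Hv)).
by rewrite normvecE (sqr_snorm sip_ipvec (wgrad_L2 Hv)).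
Qed.

Lemma h1_le v w (a b : R) : H1 v -> ae_eq lambda Omega (wgrad v) w -> L2vec w ->
  0 <= a -> 0 <= b ->
  nO v <= a -> (forall i, nO (comp_rV w i) <= b) -> snorm h1ip v <= a + n.+1%:R * b.
Proof.
move=> Hv Ew Lw a0 b0 va wb.
have wb' := nrm_comp_le Lw b0 wb.
have nb0 : 0 <= n.+1%:R * b by rewrite mulr_ge0.
have Eg : ipvec (wgrad v) (wgrad v) = ipvec w w by apply: ipvec_ae => //; exact: wgrad_L2.
rewrite -ler_sqr ?nnegrE ?addr_ge0 ?snorm_ge0//.
rewrite (sqr_snorm sip_h1ip)// /h1ip Eg -(sqr_snorm S (H1_L2 Hv)) -(sqr_snorm sip_ipvec Lw).
apply: (@le_trans _ _ (a ^+ 2 + (n.+1%:R * b) ^+ 2)).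
  by apply: lerD; rewrite ler_sqr ?nnegrE ?snorm_ge0.
by rewrite sqrrD lerD2r lerDl mulrn_wge0// mulr_ge0.
Qed.

Lemma nO_le_h1 v : H1 v -> nO v <= snorm h1ip v.
Proof.
move=> Hv; rewrite ler_sqrt; last exact: (sip_ge0 sip_h1ip).
by rewrite lerDl; exact: (sip_ge0 sip_ipvec) (wgrad_L2 Hv).
Qed.

Lemma wgrad_le_h1 v : H1 v -> snorm ipvec (wgrad v) <= snorm h1ip v.
Proof.
move=> Hv; rewrite ler_sqrt; last exact: (sip_ge0 sip_h1ip).
by rewrite lerDr; exact: (sip_ge0 S) (H1_L2 Hv).
Qed.

Lemma is_wgradM v w psi : smooth psi -> L2 v -> is_wgrad Omega v w ->
  is_wgrad Omega (fun x => psi x * v x) (fun x => psi x *: w x + v x *: grad psi x).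
Proof.
move=> spsi Lv [Lw hw].
have Lcomp i : L2 (fun x => psi x * comp_rV w i x).
  by apply: L2_smoothM; [exact: smooth_continuous|exact: Lw].
have Lcomp' i : L2 (fun x => partial i psi x * v x).
  by apply: L2_smoothM => //; exact: smooth_continuous (smooth_partial i spsi).
have CE i : (fun x => (psi x *: w x + v x *: grad psi x) ord0 i) =
    lcf 1 (fun x => psi x * comp_rV w i x) (fun x => partial i psi x * v x).
  by apply/funext => x; rewrite /lcf /comp_rV /grad !mxE; ring.
split=> [i|phi tphi i]; first by rewrite CE; exact: (L2_lc mO _ (Lcomp i) (Lcomp' i)).
have Lp := L2_test tphi; have Ldp := L2_test (test_partial i tphi).
have sphi := test_function_smooth tphi.
have tpp : test (fun x => psi x * phi x) by exact: test_functionM.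
rewrite CE (sip_lin S 1 (Lcomp i) (Lcomp' i) Lp) mul1r.
have := hw _ tpp i.
have PE : (fun x => partial i (fun x => psi x * phi x) x) =
    lcf 1 (fun x => psi x * partial i phi x) (fun x => partial i psi x * phi x).
  by apply/funext => x; rewrite partialM// /lcf; ring.
have L1 : L2 (fun x => psi x * partial i phi x).
  by apply: L2_smoothM => //; exact: smooth_continuous.
have L2' : L2 (fun x => partial i psi x * phi x).
  by apply: L2_smoothM => //; exact: smooth_continuous (smooth_partial i spsi).
rewrite (_ : partial i _ = lcf 1 (fun x => psi x * partial i phi x) (fun x => partial i psi x * phi x))//.
rewrite (sip_sym S Lv); last exact: L2_lc.
rewrite (sip_lin S)// mul1r.
rewrite (_ : ip lambda Omega (fun x => psi x * partial i phi x) v =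
  ip lambda Omega (fun x => psi x * v x) (partial i phi)); last first.
  by apply: eq_Rintegral => x _; ring.
rewrite (_ : ip lambda Omega (fun x => partial i psi x * phi x) v =
  ip lambda Omega (fun x => partial i psi x * v x) phi); last first.
  by apply: eq_Rintegral => x _; ring.
rewrite (_ : ip lambda Omega (fun x => w x ord0 i) (fun x => psi x * phi x) =
  ip lambda Omega (fun x => psi x * comp_rV w i x) phi); last first.
  by apply: eq_Rintegral => x _; rewrite /comp_rV; ring.
by move=> h; rewrite opprD -h; ring.
Qed.

Lemma is_wgrad_smooth phi : smooth phi -> is_wgrad Omega phi (grad phi).
Proof.
move=> sphi; have Lg i : L2 (fun x => grad phi x ord0 i).
  rewrite (_ : (fun x => _) = partial i phi); last by apply/funext => x; rewrite mxE.
  by apply: L2_smooth; exact: smooth_continuous (smooth_partial i sphi).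
split=> // psi tpsi i.
have spsi := test_function_smooth tpsi.
have tpp : test (fun x => phi x * psi x) by exact: test_functionM.
have Lp := L2_test tpsi; have Ldp := L2_test (test_partial i tpsi).
have Lphi := L2_smooth (smooth_continuous sphi).
apply/eqP; rewrite -addr_eq0 -RintegralD//; [|exact: (L2M mO Lphi Ldp)|exact: (L2M mO (Lg i) Lp)].
rewrite Rintegral_mkcond (_ : Rintegral _ _ _ = \int[lambda]_x partial i (fun x => phi x * psi x) x).
  apply/eqP; apply: (@Rintegral_partial_eq0 _ _ _ `|rho|) => //.
    exact: test_function_smooth tpp.
  move=> x rx; apply: (test_function_supp tpp) => /bO xr.
  by have := le_lt_trans (le_trans xr (ler_norm _)) rx; rewrite ltxx.
apply: eq_Rintegral => x _; rewrite /patch; case: ifPn => [_|].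
  by rewrite partialM// mxE; ring.
by rewrite notin_setE => /(test_function_supp (test_partial i tpp)) ->.
Qed.

Lemma H1_smooth phi : smooth phi -> H1 phi.
Proof.
move=> sphi; split; first exact: L2_smooth (smooth_continuous sphi).
by exists (grad phi); exact: is_wgrad_smooth.
Qed.

Lemma wgrad_smooth phi : smooth phi -> ae_eq lambda Omega (wgrad phi) (grad phi).
Proof.
move=> sphi; apply: (wgrad_unique (wgradP (H1_smooth sphi))).
exact: is_wgrad_smooth.
Qed.

(** The weak gradient is a closed operator; this carries the chain rule for the truncation from
    smooth functions to H^1. *)
Lemma is_wgrad_lim v w : L2 v -> L2vec w ->
  (forall e : R, 0 < e -> exists v' w', [/\ L2 v', is_wgrad Omega v' w',
     nO (lcf (-1) v' v) <= e & forall i, nO (lcf (-1) (comp_rV w' i) (comp_rV w i)) <= e]) ->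
  is_wgrad Omega v w.
Proof.
move=> Lv Lw h; split=> // phi tphi i.
have Lp := L2_test tphi; have Ldp := L2_test (test_partial i tphi).
apply/eqP; rewrite -subr_eq0 opprK -normr_le0; apply/ler_addgt0Pr => e e0; rewrite add0r.
pose N := nO (partial i phi) + nO phi.
have N1 : 0 < N + 1 by rewrite ltr_wpDl// addr_ge0// snorm_ge0.
have [v' [w' [Lv' [Lw' hw'] vv ww]]] := h _ (divr_gt0 e0 N1).
have := hw' phi tphi i => /eqP; rewrite -subr_eq0 opprK => /eqP E1.
have -> : ip lambda Omega v (partial i phi) + ip lambda Omega (fun x => w x ord0 i) phi =
    ip lambda Omega (lcf (-1) v' v) (partial i phi) +
    ip lambda Omega (lcf (-1) (comp_rV w' i) (comp_rV w i)) phi.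
  rewrite !(sip_lin S)//; [|exact: Lw'|exact: Lw].
  by rewrite /comp_rV !mulN1r addrACA -opprD E1 oppr0 add0r.
have b1 := cauchy_schwarz S (L2_lc mO (-1) Lv' Lv) Ldp.
have b2 := cauchy_schwarz S (L2_lc mO (-1) (Lw' i) (Lw i)) Lp.
rewrite (le_trans (ler_normD _ _))//.
have c1 := le_trans b1 (ler_wpM2r (snorm_ge0 _ _) vv).
have c2 := le_trans b2 (ler_wpM2r (snorm_ge0 _ _) (ww i)).
apply: (le_trans (lerD c1 c2)); rewrite -mulrDr -/N mulrAC ler_pdivrMr//.
by rewrite ler_wpM2l ?(ltW e0)// lerDl.
Qed.

Lemma wdiv_unique y h h' : is_wdiv Omega y h -> is_wdiv Omega y h' -> ae_eq lambda Omega h h'.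
Proof.
move=> [Lh hh] [Lh' hh'].
suff : ae_eq lambda Omega (lcf (-1) h h') (fun=> 0).
  by apply: filterS => x k Ox; have := k Ox; rewrite /lcf mulN1r addrC => /eqP; rewrite subr_eq0 => /eqP.
apply: (fundamental_lemma mO oO (@subset_refl _ _) lO (L2_lc mO _ Lh Lh')) => phi tphi.
rewrite (sip_lin S)//; last exact: L2_test.
have := hh phi tphi; rewrite (hh' phi tphi) => /oppr_inj ->.
by rewrite mulN1r addNr.
Qed.

Lemma wdivP y : Hdiv Omega y -> is_wdiv Omega y (wdiv y).
Proof. by move=> [_ [h hh]]; exact: (xgetPex _ (ex_intro _ h hh)). Qed.

Lemma wdiv_L2 y : Hdiv Omega y -> L2 (wdiv y).
Proof. by move=> /wdivP[]. Qed.

Lemma is_wdivP y h : L2vec y -> is_wdiv Omega y h ->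
  Hdiv Omega y /\ ae_eq lambda Omega (wdiv y) h.
Proof.
move=> Ly hh; have Hy : Hdiv Omega y by split=> //; exists h.
by split=> //; exact: wdiv_unique (wdivP Hy) hh.
Qed.

End sobolev.

(** Finite subcovers packaged as an induction principle. Density of smooth functions, the trace
    inequality and the separation of closed sets are each reduced by it to a local statement. *)
Lemma compact_ind (X : ptopologicalType) (K : set X) (P : set X -> Prop) :
  compact K -> P set0 -> (forall A B, P A -> P B -> P (A `|` B)) ->
  (forall A B, A `<=` B -> P B -> P A) ->
  (forall x, K x -> exists2 U, open U & U x /\ P U) -> P K.
Proof.
move=> cK P0 PU PS h.
have /choice [U HU] x : exists V, K x -> [/\ open V, V x & P V].
  have [/h[V oV [Vx PV]]|nK] := pselect (K x); first by exists V.
  by exists set0.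
have := cK; rewrite compact_cover => /(_ X K U) [|x Kx|D DK KU].
- by move=> x /HU [].
- by exists x => //; have [] := HU x Kx.
apply: (PS _ _ KU); rewrite /cover bigcup_fset big_seq.
apply: (big_ind P) => // i /DK; rewrite inE => /HU[] //.
Qed.

Lemma L2_patch {R : realType} {n : nat} (mu : {measure set 'rV[R]_n.+1 -> \bar R})
    (A : set 'rV[R]_n.+1) w : measurable A -> Lp mu A 2%:E w -> Lp mu setT 2%:E (w \_ A).
Proof.
move=> mA /(L2P mu A)[mw iw]; apply/(L2P mu setT); split.
  by apply/(measurable_restrictT _ mA).
rewrite (_ : (\int[mu]_x _)%E = (\int[mu]_(x in A) (w x ^+ 2)%:E)%E)//.
rewrite [RHS]integral_mkcond; apply: eq_integral => x _.
by rewrite /patch; case: ifP => // _; rewrite expr0n.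
Qed.

(** * Density of smooth functions in H^1 *)

Section density.
Context {R : realType} {n : nat}.
Local Notation E := 'rV[R]_n.+1.
Local Notation lambda := (leb n.+1 : {measure set E -> \bar R}).
Variables (Omega : set E) (rho : R).
Hypothesis oO : open Omega.
Hypothesis bO : forall x, Omega x -> `|x| <= rho.
Implicit Types (u v phi psi h chi : E -> R).

Local Notation nO := (snorm (ip lambda Omega)).
Local Notation h1 := (snorm (h1ip Omega)).

Let mO : measurable Omega := domain_measurable oO.

(** The two functions have the same set of weak gradients, so the chosen representatives are
    literally equal and not only almost everywhere. *)
Lemma wgrad_ae v v' : L2 Omega v -> L2 Omega v' -> ae_eq lambda Omega v v' ->
  wgrad Omega v = wgrad Omega v'.
Proof.
move=> Lv Lv' vv; congr (xget _ _); apply/funext => w; apply/propext.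
have E1 phi i : test_function Omega phi ->
    ip lambda Omega v (partial i phi) = ip lambda Omega v' (partial i phi).
  move=> tphi; have Ld := L2_test oO bO (test_partial i tphi).
  by apply: ip_ae => //; [exact: L2_measurable Lv|exact: L2_measurable Lv'|
    exact: L2_measurable Ld|exact: L2_measurable Ld|exact: ae_eq_refl].
by split=> -[Lw hw]; split=> // phi tphi i; rewrite -hw// E1.
Qed.

Lemma h1_ae v v' : L2 Omega v -> L2 Omega v' -> ae_eq lambda Omega v v' -> h1 v = h1 v'.
Proof.
move=> Lv Lv' vv; rewrite /snorm /h1ip (wgrad_ae Lv Lv' vv); congr (Num.sqrt (_ + _)).
by apply: ip_ae => //; [exact: L2_measurable Lv|exact: L2_measurable Lv'|
    exact: L2_measurable Lv|exact: L2_measurable Lv'].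
Qed.

Definition approximable chi := forall v, H1 Omega v -> forall e : R, 0 < e ->
  exists2 phi, smooth phi & h1 (lcf (-1) phi (fun x => chi x * v x)) <= e.

Lemma H1M psi v : smooth psi -> H1 Omega v -> H1 Omega (fun x => psi x * v x).
Proof.
move=> spsi Hv; have := is_wgradM oO bO spsi (H1_L2 Hv) (wgradP Hv).
move=> h; split; last by eexists; exact: h.
by apply: (L2_smoothM oO bO) (H1_L2 Hv); exact: smooth_continuous.
Qed.

(** The combination equals 1 wherever one of the two functions does, so it serves the union of two
    sets of a cover. *)
Lemma approximableU chi1 chi2 : smooth chi1 -> smooth chi2 ->
  approximable chi1 -> approximable chi2 ->
  approximable (fun x => chi1 x + chi2 x * (1 - chi1 x)).
Proof.
move=> s1 s2 a1 a2 v Hv e e0.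
have e2 : 0 < e / 2 by rewrite divr_gt0.
have sd : smooth (fun x => 1 - chi1 x) by apply: smoothB => //; exact: smooth_cst.
have [p1 sp1 h1'] := a1 v Hv _ e2.
have [p2 sp2 h2'] := a2 _ (H1M sd Hv) _ e2.
exists (fun x => p1 x + p2 x); first exact: smoothD.
have S1 := sip_h1ip oO bO.
have H11 := sip_lc S1 (-1) (H1_smooth oO bO sp1) (H1M s1 Hv).
have H12 := sip_lc S1 (-1) (H1_smooth oO bO sp2) (H1M s2 (H1M sd Hv)).
have := snorm_lc S1 1 H11 H12; rewrite normr1 mul1r.
have -> : lcf 1 (lcf (-1) p1 (fun x => chi1 x * v x))
   (lcf (-1) p2 (fun x => chi2 x * ((1 - chi1 x) * v x))) =
   lcf (-1) (fun x => p1 x + p2 x) (fun x => (chi1 x + chi2 x * (1 - chi1 x)) * v x).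
  by apply/funext => x; rewrite /lcf; ring.
move=> h; rewrite (splitr e); exact: le_trans h (lerD h1' h2').
Qed.

(** The product chi * v, extended by 0, is convolved with a mollifier centred at -d * e, so that the
    value at x averages values near x + d * e. Although the extension by 0 need not belong to H^1,
    on Omega the gradient of the convolution is the convolution of the weak gradient, since the
    averaging region keeps away from the boundary wherever chi does not vanish. *)
Lemma approximable_shift chi (e : E) (d0 : R) : smooth chi -> 0 < d0 ->
  (forall d, 0 < d -> d <= d0 -> exists2 ep, 0 < ep & forall x y, Omega x -> chi y != 0 ->
     `|y - (x + d *: e)| < ep -> ball y ep `<=` Omega) ->
  approximable chi.
Proof.
move=> schi d00 hd v Hv eps eps0.
have Lv := H1_L2 Hv; have [Lw hw] := wgradP Hv.
set w := wgrad Omega v in Lw hw.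
pose V0 x := chi x * v x.
pose w' x := chi x *: w x + v x *: grad chi x.
have IG : is_wgrad Omega V0 w' := is_wgradM oO bO schi Lv (conj Lw hw).
have Lw' : L2vec Omega w' by case: IG.
have LV0 : L2 Omega V0 by apply: (L2_smoothM oO bO) => //; exact: smooth_continuous.
have rho0 : 0 < `|rho| + 1 by rewrite ltr_wpDl.
have supp F x : `|rho| + 1 < `|x| -> (F \_ Omega) x = 0 :> R.
  move=> rx; rewrite patchE; case: ifPn => //; rewrite inE => /bO xr.
  by have := ler_norm rho; move: rx xr; lra.
(* [h1_le] adds the L^2 error and n + 1 times the error of one gradient component. *)
pose c := eps / (1 + n.+1%:R).
have n0 : 0 < 1 + n.+1%:R :> R by rewrite ltr_wpDl.
have c0 : 0 < c by rewrite divr_gt0.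
have [sV sV0 hV] := conv_approx rho0 (L2_patch mO LV0) (supp V0) mO bO c0.
have /choice [sW hsW] : forall i, exists s, 0 < s /\ forall kappa s', mkernel kappa s' ->
    s' <= s -> nO (lcf (-1) (conv kappa ((fun x => w' x ord0 i) \_ Omega))
                           ((fun x => w' x ord0 i) \_ Omega)) <= c.
  move=> i; have [s ss hs] := conv_approx rho0 (L2_patch mO (Lw' i))
    (supp (fun x => w' x ord0 i)) mO bO c0.
  by exists s.
pose s0 := \big[Num.min/sV]_i sW i.
have s00 : 0 < s0 by apply: lt_bigmin => // i _; have [] := hsW i.
(* Shift and radius are balanced so that the support radius of the shifted kernel is at most [s0].
   The denominator [|e| + 1] also covers e = 0, which is used at interior points. *)
pose d := Num.min d0 (s0 / 2 / (`|e| + 1)).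
have e1 : 0 < `|e| + 1 by rewrite ltr_wpDl.
have d1 : 0 < d by rewrite lt_min d00 divr_gt0// divr_gt0.
have [|ep1 ep10 hep] := hd d d1; first by rewrite ge_min lexx.
pose ep := Num.min ep1 (s0 / 2).
have ep0 : 0 < ep by rewrite lt_min ep10 divr_gt0.
have partial_refl (k : E -> R) i x y : smooth k ->
    partial i k (x - y) = - partial i (fun y => k (-1 *: y + x)) y.
  by move=> sk; rewrite partial_affine// mulN1r opprK scaleN1r addrC.
pose kappa (h : E) := moll ep (1 *: h + d *: e).
have K : mkernel kappa (ep + `|d *: e|) := moll_mkernel _ ep0.
have Ks : ep + `|d *: e| <= s0.
  rewrite [leRHS]splitr lerD//; first by rewrite ge_min lexx orbT.
  rewrite normrZ gtr0_norm//.
  apply: (@le_trans _ _ (s0 / 2 / (`|e| + 1) * `|e|)).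
    by rewrite ler_wpM2r// ge_min lexx orbT.
  by rewrite mulrAC ler_pdivrMr// ler_wpM2l ?lerDl// divr_ge0 ?ltW.
have iV F : L2 Omega F -> lambda.-integrable setT (EFin \o (F \_ Omega)).
  by move=> LF; exact: (L2_supp_integrable (L2_patch mO LF) (supp F)).
pose Phi := conv kappa (V0 \_ Omega).
have sPhi : smooth Phi := conv_smooth (iV _ LV0) (mker_smooth K) (mker_supp K).
have convE k F x : conv k (F \_ Omega) x = ip lambda Omega F (fun y => k (x - y)).
  rewrite /conv /ip [RHS]Rintegral_mkcond; apply: eq_Rintegral => y _.
  by rewrite !patchE; case: ifP => _; [rewrite mulrC|rewrite mulr0].
have keyE i x : Omega x ->
    partial i Phi x = conv kappa ((fun x => w' x ord0 i) \_ Omega) x.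
  move=> Ox; rewrite (conv_partial _ _ (iV _ LV0) (mker_smooth K) (mker_supp K)) !convE.
  pose th y := kappa (-1 *: y + x).
  have thE y : kappa (x - y) = th y by rewrite /th scaleN1r addrC.
  have sth : smooth th := smooth_affine _ _ (mker_smooth K).
  have dth y : partial i kappa (x - y) = - partial i th y.
    exact: partial_refl (mker_smooth K).
  (* The effect of the shift: seen from a point x of Omega, the kernel lives near x + d * e, where
     the points with chi nonzero keep the distance [ep1] from the complement of Omega. Hence the
     weak gradient of v may be tested with this function. *)
  have tpsi : test_function Omega (fun y => chi y * th y).
    apply: (@smooth_test_function _ _ _ _ ep1 rho) => //; first exact: smoothM.
    move=> y; rewrite mulf_eq0 negb_or => /andP[cy ty].
    have yO : ball y ep1 `<=` Omega.
      apply: (hep x y) => //; rewrite distrC ltNge; apply/negP => h; move/eqP: ty; apply.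
      apply: (@moll_eq0 _ _ _ ep0); apply: le_trans (_ : ep1 <= _); first by rewrite ge_min lexx.
      by rewrite (le_trans h)// scale1r scaleN1r addrAC (addrC x) -addrA addrC.
    by split=> //; apply/bO/yO/ballxx.
  have Lth : L2 Omega th by apply: L2_smooth bO _ _ => //; exact: smooth_continuous.
  have Ldth : L2 Omega (partial i th).
    by apply: L2_smooth bO _ _ => //; exact: smooth_continuous (smooth_partial i sth).
  have La : L2 Omega (fun y => partial i chi y * v y).
    by apply: (L2_smoothM oO bO) => //; exact: smooth_continuous (smooth_partial i schi).
  have Lb : L2 Omega (fun y => chi y * w y ord0 i).
    by apply: (L2_smoothM oO bO); [exact: smooth_continuous|exact: Lw].
  have := hw _ tpsi i.
  rewrite (_ : ip lambda Omega v _ = ip lambda Omega V0 (partial i th) +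
     ip lambda Omega (fun y => partial i chi y * v y) th); last first.
    rewrite -RintegralD//; [|exact: (L2M mO)..].
    by apply: eq_Rintegral => y _; rewrite partialM// /V0; ring.
  rewrite (_ : ip lambda Omega (fun y => w y ord0 i) _ =
     ip lambda Omega (fun y => chi y * w y ord0 i) th); last first.
    by apply: eq_Rintegral => y _; ring.
  rewrite (_ : (fun y => partial i kappa (x - y)) = (fun y => -1 * partial i th y)); last first.
    by apply/funext => y; rewrite dth mulN1r.
  rewrite (_ : (fun y => kappa (x - y)) = th); last exact/funext.
  have -> : ip lambda Omega V0 (fun y => -1 * partial i th y) = - ip lambda Omega V0 (partial i th).
    rewrite -[RHS]mulN1r /ip -RintegralZl//; last exact: (L2M mO).
    by apply: eq_Rintegral => y _; ring.
  rewrite (_ : ip lambda Omega (fun y => w' y ord0 i) th =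
    ip lambda Omega (fun y => chi y * w y ord0 i) th +
    ip lambda Omega (fun y => partial i chi y * v y) th).
    by lra.
  rewrite -RintegralD//; [|exact: (L2M mO)..].
  by apply: eq_Rintegral => y _; rewrite /w' /grad !mxE; ring.
exists Phi => //.
have LPhi : L2 Omega Phi by apply: L2_smooth bO _ _ => //; exact: smooth_continuous.
have IG2 := is_wgrad_lc oO bO (-1) LPhi LV0 (is_wgrad_smooth oO bO sPhi) IG.
have [H3 E3] := is_wgradP oO bO (L2_lc mO (-1) LPhi LV0) IG2.
have -> : eps = c + n.+1%:R * c by rewrite -{1}(mul1r c) -mulrDl mulrC divfK ?gt_eqF.
apply: (h1_le oO bO H3 E3) => //; [by case: IG2|exact: ltW|exact: ltW| |].
  rewrite /snorm (_ : ip _ _ _ _ =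
    ip lambda Omega (lcf (-1) Phi (V0 \_ Omega)) (lcf (-1) Phi (V0 \_ Omega))).
    by apply: hV K _; rewrite (le_trans Ks)// bigmin_le_id.
  by apply: eq_ip => x xO; rewrite /lcf patchE xO.
move=> i; rewrite comp_lcv /snorm; pose W := (fun x => w' x ord0 i) \_ Omega.
rewrite (_ : ip _ _ _ _ = ip lambda Omega (lcf (-1) (conv kappa W) W) (lcf (-1) (conv kappa W) W)).
  have [_ hs] := hsW i; apply: hs K _; exact: le_trans Ks (bigmin_le _ _ _).
have WE x : x \in Omega -> W x = w' x ord0 i by move=> xO; rewrite /W patchE xO.
by apply: eq_ip => x xO; rewrite /lcf /comp_rV /grad mxE (keyE _ _ (set_mem xO)) -/W WE.
Qed.

Record chart (x0 e : E) (phi : E -> R) (L r : R) : Prop := {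
  ch_r : 0 < r ;
  ch_L : 0 <= L ;
  ch_e : dotp e e = 1 ;
  ch_lip : forall x y, `|phi x - phi y| <= L * `|x - y| ;
  ch_shift : forall y t, phi (y + t *: e) = phi y ;
  ch_in : forall y, ball x0 r y -> Omega y <-> phi y < dotp y e }.

Lemma dotpDl (x y z : E) : dotp (x + y) z = dotp x z + dotp y z.
Proof. by rewrite /dotp -big_split; apply: eq_bigr => i _; rewrite mxE mulrDl. Qed.

Lemma dotpZl (a : R) (x y : E) : dotp (a *: x) y = a * dotp x y.
Proof. by rewrite /dotp mulr_sumr; apply: eq_bigr => i _; rewrite mxE mulrA. Qed.

Lemma dotp_unit (e : E) i : dotp e e = 1 -> `|e ord0 i| <= 1.
Proof.
move=> e1; rewrite -(@ler_sqr R) ?nnegrE// expr1n real_normK ?num_real// -e1.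
rewrite /dotp (bigD1 i)//= -expr2 lerDl; apply: sumr_ge0 => j _.
by rewrite -expr2 sqr_ge0.
Qed.

Lemma dotp_le (h e : E) : dotp e e = 1 -> `|dotp h e| <= n.+1%:R * `|h|.
Proof.
move=> e1; rewrite (le_trans (ler_norm_sum _ _ _))//.
apply: (@le_trans _ _ (\sum_(i < n.+1) `|h|)).
  apply: ler_sum => i _; rewrite normrM -[leRHS]mulr1 ler_pM//; last exact: dotp_unit.
  by have /(rV_norm_le h (normr_ge0 h)) := lexx `|h|.
by rewrite sumr_const card_ord mulr_natl.
Qed.

Lemma lipschitz_chart x0 : lipschitz_boundary Omega -> bnd Omega x0 ->
  exists e phi L r, chart x0 e phi L r.
Proof.
move=> lip /lip[U [e [phi [oU Ux e1 lphi [sh OU]]]]].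
have [r r0 rU] : exists2 r : R, 0 < r & ball x0 r `<=` U.
  by move: oU; rewrite openE => /(_ _ Ux)/nbhs_ballP[r r0 h]; exists r.
have [L L0 hL] : exists2 L, 0 <= L & forall x y, `|phi x - phi y| <= L * `|x - y|.
  have [M [_ hM]] := lphi.
  exists (`|M| + 1); first by rewrite addr_ge0.
  by move=> x y; apply: (hM (`|M| + 1) _ (x, y)) => //; rewrite ltr_pwDr// ler_norm.
exists e, phi, L, r; split=> // y /rU Uy; split=> [Oy|py].
  by have : (Omega `&` U) y by []; rewrite OU => -[].
by have : ([set y | phi y < dotp y e] `&` U) y by []; rewrite -OU => -[].
Qed.

Lemma ball_cutoff (x0 : E) (r : R) : 0 < r ->
  exists chi, [/\ smooth chi, forall x, ball x0 r x -> chi x = 1 &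
    forall x, 3 * r <= `|x - x0| -> chi x = 0].
Proof.
move=> r0; have [C _ /(_ (ball x0 (2 * r)) r (`|x0| + 2 * r))] := @smooth_cutoff R n.
case=> //.
- exact: measurable_ball_rV.
- move=> x; rewrite -ball_normE /= => h; rewrite -(subrK x0 x) addrC.
  by rewrite (le_trans (ler_normD _ _))// lerD2l distrC ltW.
move=> zeta [sz _ z1 z0 _]; exists zeta; split=> // x; rewrite -?ball_normE /= => xr.
  apply: z1 => y; rewrite -!ball_normE /= => yr.
  by rewrite -(subrKA x) (le_lt_trans (ler_normD _ _))//; lra.
apply: z0 => y; rewrite -!ball_normE /= => yr y2.
by have := ler_distD y x x0; rewrite (distrC y x0); lra.
Qed.

Lemma approximable_chart x0 e phi L r : chart x0 e phi L r ->
  exists chi, [/\ smooth chi, approximable chi & exists2 s, 0 < s & forall x, ball x0 s x -> chi x = 1].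
Proof.
(* The cutoff vanishes beyond 3 s, and shift and radius are at most s, so with s = r / 12 all points
   that occur stay in the chart. *)
case=> r0 L0 e1 lip sh inO; pose s := r / 12.
have s0 : 0 < s by rewrite divr_gt0.
have [chi [schi chi1 chi0]] := ball_cutoff x0 s0.
exists chi; split=> //; last by exists s.
apply: (@approximable_shift chi e s) => // d d0 ds.
(* Moving by d along e gains the height d over the graph; an error below d / C in the position loses
   at most L + n + 1 times this error, which is less than d. *)
pose C := n.+1%:R + L + 1.
have C0 : 0 < C by rewrite ltr_wpDl// addr_ge0.
have en : `|e| <= 1 by apply/rV_norm_le => // i; exact: dotp_unit.
exists (Num.min s (d / C / 2)); first by rewrite lt_min s0 !divr_gt0.
move=> x y Ox cy; rewrite lt_min => /andP[y1 y2] z; rewrite -ball_normE /= lt_min => /andP[z1 z2].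
have ys : `|y - x0| < 3 * s by rewrite ltNge; apply/negP => /chi0 /eqP; exact/negP.
have zx : `|z - (x + d *: e)| < d / C.
  have := ler_distD y z (x + d *: e); rewrite (distrC z y); lra.
have de : `|d *: e| <= s by rewrite normrZ gtr0_norm// -[leRHS]mulr1 ler_pM// ltW.
have bx : ball x0 r x.
  rewrite -ball_normE /= distrC.
  have : `|x - x0| <= `|y - x0| + (`|y - (x + d *: e)| + `|d *: e|).
    rewrite -[x - x0](subrKA y) addrC (le_trans (ler_normD _ _))// lerD2l.
    rewrite (_ : x - y = - ((y - (x + d *: e)) + d *: e)); last by rewrite opprD opprB addrAC addrK.
    by rewrite normrN ler_normD.
  by rewrite /s in ys y1 de *; lra.
have bz : ball x0 r z.
  rewrite -ball_normE /=; have := ler_distD y x0 z; rewrite (distrC x0 y).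
  by rewrite /s in ys z1 *; lra.
apply/(inO _ bz); have /(inO _ bx) hx := Ox.
have h1' := lip z (x + d *: e); rewrite sh in h1'.
have h2' := dotp_le (z - (x + d *: e)) e1.
have h3 : dotp z e = dotp x e + d + dotp (z - (x + d *: e)) e.
  have := dotpDl (z - (x + d *: e)) (x + d *: e) e; rewrite subrK => ->.
  by rewrite (dotpDl x) dotpZl e1 mulr1 addrC.
have h4 : L * `|z - (x + d *: e)| + n.+1%:R * `|z - (x + d *: e)| <= d.
  rewrite -mulrDl; apply: (@le_trans _ _ (C * (d / C))); last by rewrite mulrC divfK// gt_eqF.
  by rewrite ler_pM// ?addr_ge0// ?ltW// /C; lra.
rewrite h3; move: h1' h2' h4; rewrite !ler_norml => /andP[a1 a2] /andP[b1 b2].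
by move: a2 b1 hx; lra.
Qed.

Lemma approximable_interior x0 : Omega x0 ->
  exists chi, [/\ smooth chi, approximable chi & exists2 s, 0 < s & forall x, ball x0 s x -> chi x = 1].
Proof.
move=> Ox; have [r r0 rO] : exists2 r : R, 0 < r & ball x0 r `<=` Omega.
  by move: oO; rewrite openE => /(_ _ Ox)/nbhs_ballP[r r0 h]; exists r.
pose s := r / 4; have s0 : 0 < s by rewrite divr_gt0.
have [chi [schi chi1 chi0]] := ball_cutoff x0 s0.
exists chi; split=> //; last by exists s.
apply: (@approximable_shift chi 0 s) => // d d0 ds; exists s => // x y _ cy _ z yz.
apply: rO; rewrite -ball_normE /=.
have ys : `|y - x0| < 3 * s by rewrite ltNge; apply/negP => /chi0 /eqP; exact/negP.
move: yz; rewrite -ball_normE /= => yz.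
by have := ler_distD y x0 z; rewrite (distrC x0 y) /s in ys yz *; lra.
Qed.

Lemma closure_bnd x : closure Omega x -> Omega x \/ bnd Omega x.
Proof.
move=> cx; have [Ox|nOx] := pselect (Omega x); [by left|right; split=> //].
by move/interior_subset.
Qed.

Lemma closure_domain_le x : closure Omega x -> `|x| <= rho.
Proof.
move=> cx; have : closure [set x : E | `|x| <= rho] x by apply: closure_subset cx.
by rewrite -(closure_id _).1//; exact: closed_le_norm.
Qed.

Lemma compact_closure_domain : compact (closure Omega).
Proof.
apply: (subclosed_compact _ (@compact_le_norm R n rho)); first exact: closed_closure.
by move=> x; exact: closure_domain_le.
Qed.

Lemma smooth_dense_H1 v (e : R) : lipschitz_boundary Omega -> H1 Omega v -> 0 < e ->
  exists2 phi, smooth phi & h1 (lcf (-1) phi v) <= e.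
Proof.
move=> lip Hv e0.
have [chi [schi ap c1]] : exists chi, [/\ smooth chi, approximable chi &
    forall x, closure Omega x -> chi x = 1].
  apply: (@compact_ind _ _ (fun A : set E => exists chi, [/\ smooth chi, approximable chi &
    forall x, A x -> chi x = 1]) compact_closure_domain).
  - exists (fun=> 0); split=> //; first exact: smooth_cst.
    move=> w Hw d d0; exists (fun=> 0); first exact: smooth_cst.
    have Ln : L2 Omega (fun=> 0 : R) by apply: L2_smooth bO _ _ => //; exact: cst_continuous.
    rewrite (_ : lcf _ _ _ = lcf (-1) (fun=> 0) (fun=> 0)); last first.
      by apply/funext => x; rewrite /lcf mul0r.
    have S1 := sip_h1ip oO bO.
    have H0 : H1 Omega (fun=> 0 : R) by apply: H1_smooth bO _ _ => //; exact: smooth_cst.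
    rewrite /snorm (sip_lcE S1 (-1) H0 H0) sqrrN expr1n mul1r mulr2n mulrDl mulN1r.
    by rewrite (_ : _ + _ = 0) ?sqrtr0 ?ltW//; ring.
  - move=> A B [c1 [s1 a1 h1']] [c2 [s2 a2 h2']].
    exists (fun x => c1 x + c2 x * (1 - c1 x)); split.
    + by apply: smoothD => //; apply: smoothM => //; apply: smoothB => //; exact: smooth_cst.
    + exact: approximableU.
    + by move=> x [/h1'|/h2'] ->; ring.
  - by move=> A B AB [c [s a h]]; exists c; split=> // x /AB /h.
  - move=> x /closure_bnd xO.
    have [chi [schi ap [s s0 hs]]] : exists chi, [/\ smooth chi, approximable chi &
        exists2 s, 0 < s & forall y, ball x s y -> chi y = 1].
      case: xO => [|bx]; first exact: approximable_interior.
      have [d [phi [L [r c]]]] := lipschitz_chart lip bx; exact: approximable_chart c.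
    exists (ball x s); first exact: ball_open_rV.
    by split; [exact: ballxx|exists chi].
have [phi sphi hphi] := ap v Hv e e0; exists phi; first exact: sphi.
rewrite (@h1_ae _ (lcf (-1) phi (fun x => chi x * v x)))//.
- by apply: (L2_lc mO) (H1_L2 Hv); apply: L2_smooth bO _ _ => //; exact: smooth_continuous.
- apply: (L2_lc mO); last exact: H1_L2 (H1M schi Hv).
  by apply: L2_smooth bO _ _ => //; exact: smooth_continuous.
- by apply: aeW => x Ox; rewrite /lcf c1 ?mul1r//; exact: subset_closure.
Qed.

End density.

(** * Traces *)

Section fiber.
Context {R : realType} {n : nat}.
Local Notation E := 'rV[R]_n.+1.
Local Notation lam := (@lebesgue_measure R).
Implicit Types (phi : E -> R).

Lemma coord_le (x : E) i : `|x ord0 i| <= `|x|.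
Proof. by have /(rV_norm_le x (normr_ge0 x)) := lexx `|x|. Qed.

Definition energy (c : R) phi (x : E) : R := c * phi x ^+ 2 + dotp (grad phi x) (grad phi x).

Lemma dotp_ge0 (x : E) : 0 <= dotp x x.
Proof. by apply: sumr_ge0 => i _; rewrite -expr2 sqr_ge0. Qed.

Lemma energy_ge0 c phi x : 0 <= c -> 0 <= energy c phi x.
Proof. by move=> c0; rewrite addr_ge0 ?dotp_ge0// mulr_ge0 ?sqr_ge0. Qed.

Lemma energyE c phi : energy c phi =
  (fun x => c * (phi x * phi x) + \sum_i partial i phi x * partial i phi x).
Proof.
apply/funext => x; rewrite /energy expr2; congr (_ + _).
by apply: eq_bigr => i _; rewrite /grad !mxE.
Qed.

Lemma energy_smooth c phi : smooth phi -> smooth (energy c phi).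
Proof.
move=> sphi; rewrite energyE; apply: smoothD; first by apply: smoothZ; exact: smoothM.
by apply: smooth_sum => i; apply: smoothM; exact: smooth_partial.
Qed.

Lemma dir_derive_le phi (x e : E) : dotp e e = 1 ->
  `|2 * phi x * \sum_i e ord0 i * partial i phi x| <= energy n.+1%:R phi x.
Proof.
move=> e1; rewrite energyE -mulrA [X in `|2 * X|]mulr_sumr mulr_sumr.
rewrite (le_trans (ler_norm_sum _ _ _))//.
rewrite (_ : n.+1%:R * _ = \sum_(i < n.+1) phi x * phi x); last by rewrite sumr_const card_ord mulr_natl.
rewrite -big_split/=.
apply: ler_sum => i _.
have ei := dotp_unit i e1.
rewrite !normrM (ger0_norm (ler0n _ 2)).
apply: (@le_trans _ _ (2 * (`|phi x| * `|partial i phi x|))).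
  by rewrite ler_wpM2l// ler_wpM2l// ler_piMl.
rewrite -!expr2 -(real_normK (num_real (phi x))) -(real_normK (num_real (partial i phi x))).
rewrite -subr_ge0 (_ : _ - _ = (`|phi x| - `|partial i phi x|) ^+ 2) ?sqr_ge0//; ring.
Qed.

(** The function (t / t0 - 1) phi(y + t e)^2 increases from -phi(y)^2 at t = 0 to 0 at t = t0 in
    total, and its derivative is integrated. The slope of the weight contributes 1 / t0, and the
    estimate of 2 phi times the directional derivative contributes n + 1. *)
Lemma fiber_ineq phi (y e : E) (t0 : R) : smooth phi -> dotp e e = 1 -> 0 < t0 ->
  ((phi y ^+ 2)%:E <=
   \int[lam]_(t in `]0%R, t0[) (energy (t0^-1 + n.+1%:R) phi (y + t *: e))%:E)%E.
Proof.
move=> sphi e1 t00.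
pose p t := phi (y + t *: e).
pose q t := \sum_i e ord0 i * partial i phi (y + t *: e).
have dp (t : R) : is_derive t 1 p (q t) by apply/is_derive_line; exact: is_derive_dir.
pose F t := (t / t0 - 1) * p t ^+ 2.
pose f t := t0^-1 * (p t * p t) + (t / t0 - 1) * (2 * p t * q t).
have dF (t : R) : is_derive t 1 F (f t).
  apply: is_derive_eq; rewrite /f /GRing.scale/= !(mulr1, mulr0, mul0r, addr0, expr1); ring.
have cline g : continuous g -> continuous (fun t : R => g (y + t *: e) : R).
  move=> cg t; apply: continuous_comp; last exact: cg.
  apply: continuousD; first exact: cst_continuous.
  exact: scalel_continuous.
have cp : continuous p by apply: cline; exact: smooth_continuous.
have cq : continuous q.
  apply: (cline (fun x => \sum_i e ord0 i * partial i phi x)); apply: smooth_continuous; apply: smooth_sum => i; apply: smoothZ; exact: smooth_partial.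
have cf : continuous f.
  move=> t; apply: cvgD.
    by apply: cvgM; [exact: cvg_cst|apply: cvgM; exact: cp].
  apply: cvgM.
    apply: cvgB; last exact: cvg_cst.
    by apply: cvgM; [exact: cvg_id|exact: cvg_cst].
  by apply: cvgM; [apply: cvgM; [exact: cvg_cst|exact: cp]|exact: cq].
have cg := cline _ (smooth_continuous (energy_smooth (t0^-1 + n.+1%:R) sphi)).
have icc (g : R -> R) : continuous g -> lam.-integrable `[0, t0]%classic (EFin \o g).
  move=> ccg; apply: continuous_compact_integrable; first exact: segment_compact.
  by apply: continuous_subspaceT => t; exact: ccg.
have cF : continuous F by move=> t; apply: differentiable_continuous; apply/derivable1_diffP; have [] := dF t.
have FTC : (\int[lam]_(x in `[0%R, t0]) (f x)%:E = (F t0)%:E - (F 0%R)%:E)%E.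
  apply: continuous_FTC2 => //.
  - by apply: continuous_subspaceT => t; exact: cf.
  - split; first by move=> t _; have [] := dF t.
    + by apply: cvg_at_right_filter; exact: cF.
    + by apply: cvg_at_left_filter; exact: cF.
  - by move=> t _; rewrite derive1E; have [] := dF t.
have F0 : F 0 = - phi y ^+ 2 by rewrite /F /p mul0r sub0r scale0r addr0 mulN1r.
have Ft : F t0 = 0 by rewrite /F divff ?gt_eqF// subrr mul0r.
have -> : (phi y ^+ 2)%:E = (\int[lam]_(x in `[0%R, t0]) (f x)%:E)%E.
  by rewrite FTC F0 Ft -EFinB sub0r opprK.
rewrite [leRHS](_ : _ = (\int[lam]_(t in `[0%R, t0]) (energy (t0^-1 + n.+1%:R) phi (y + t *: e))%:E)%E).
  apply: le_integral => //; [exact: icc|exact: icc|].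
  move=> t; rewrite inE/= in_itv/= => /andP[t1 t2]; rewrite lee_fin /f -expr2.
  rewrite (_ : energy (t0^-1 + _) phi _ = t0^-1 * p t ^+ 2 + energy n.+1%:R phi (y + t *: e)); last first.
    by rewrite /energy /p; ring.
  apply: lerD => //.
  have := dir_derive_le phi (y + t *: e) e1; rewrite -/(p t) -/(q t) -/(energy _ phi _).
  apply: le_trans; rewrite (le_trans (ler_norm _))// normrM ler_piMl//.
  rewrite ler_norml lerBlDr lerBrDr addNr addrC; apply/andP; split.
    by rewrite divr_ge0// ltW.
  by rewrite ler_pdivrMr// (le_trans t2)// mulrDl mul1r lerDl ltW.
apply/esym; apply: integral_itv_bndoo.
by apply/measurable_EFinP; apply: measurable_funTS; exact: continuous_measurable_fun.
Qed.

Lemma cons_rV0 (x : 'rV[R]_n) (s : R) : cons_rV (x, s) ord0 ord0 = s.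
Proof. by rewrite mxE unlift_none. Qed.

Lemma cons_rVS (x : 'rV[R]_n) (s : R) i : cons_rV (x, s) ord0 (lift ord0 i) = x ord0 i.
Proof. by rewrite mxE liftK. Qed.

Lemma sum_cons_rV (x : 'rV[R]_n) (s : R) (Q : 'I_n.+1 -> R) :
  \sum_i cons_rV (x, s) ord0 i * Q i = s * Q ord0 + \sum_i x ord0 i * Q (lift ord0 i).
Proof.
rewrite big_ord_recl cons_rV0; congr (_ + _).
by apply: eq_bigr => i _; rewrite cons_rVS.
Qed.

Lemma sum_cons_rV1 (x : 'rV[R]_n) (s : R) :
  \sum_i cons_rV (x, s) ord0 i = s + \sum_i x ord0 i.
Proof.
have := sum_cons_rV x s (fun=> 1); rewrite mulr1.
by under eq_bigr do rewrite mulr1; under [in RHS]eq_bigr do rewrite mulr1.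
Qed.

Lemma facet_paramE (P : 'M[R]_n.+1) (t : 'rV[R]_n) :
  facet_param P t = cons_rV (t, 1 - \sum_i t ord0 i) *m P.
Proof.
apply/rowP => j; rewrite /facet_param !mxE (sum_cons_rV _ _ (fun i => P i j)).
rewrite mulrBl mul1r mulr_suml -addrA; congr (_ + _).
rewrite addrC -sumrB; apply: eq_bigr => i _; rewrite mxE; ring.
Qed.

Lemma facet_param_facet (P : 'M[R]_n.+1) t : unit_simplex t -> facet P (facet_param P t).
Proof.
move=> [t0 t1]; rewrite facet_paramE; eexists; last reflexivity; split.
  by move=> i; rewrite mxE; case: unliftP => [j _|_] //=; rewrite subr_ge0.
by rewrite sum_cons_rV1 subrK.
Qed.

Lemma small_factor (d N : R) : 0 < d -> 0 <= N -> exists2 s, 0 < s <= 1 & s * N < d.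
Proof.
move=> d0 N0; exists (Num.min 1 (d / (N + 1))).
  by rewrite lt_min ltr01 ge_min lexx divr_gt0// ltr_wpDl.
apply: (@le_lt_trans _ _ (d / (N + 1) * N)).
  by rewrite ler_wpM2r// ge_min lexx orbT.
by rewrite mulrAC ltr_pdivrMr ?ltr_wpDl// ltr_pM2l// ltrDl.
Qed.

(** A boundary point does not lie above the graph, since Omega is open, and not below it, since it
    is a limit of points of Omega. *)
Lemma chart_boundary (Omega : set E) x0 e phi L r y : open Omega -> chart Omega x0 e phi L r ->
  ball x0 r y -> bnd Omega y -> dotp y e = phi y.
Proof.
move=> oO [r0 L0 e1 lip sh inO] yr [cy ny].
have nOy : ~ Omega y by move=> Oy; apply: ny; rewrite (interior_id _).1.
apply/eqP; rewrite eq_le; apply/andP; split.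
  by rewrite leNgt; apply/negP => /(inO _ yr).
apply/ler_addgt0Pr => eps eps0.
pose C := L + n.+1%:R.
have C0 : 0 <= C by rewrite addr_ge0.
have [s /andP[s0 _] sC] := small_factor eps0 C0.
have [d d0 dr] : exists2 d : R, 0 < d & ball y d `<=` ball x0 r.
  have := @ball_open_rV R n x0 r; rewrite openE => /(_ _ yr)/nbhs_ballP[d d0 h]; by exists d.
have m0 : 0 < Num.min s d by rewrite lt_min s0.
have [z [Oz]] := cy _ (nbhsx_ballx y _ m0).
rewrite -ball_normE /= lt_min => /andP[zs zd].
have zr : ball x0 r z by apply: dr; rewrite -ball_normE.
have /(inO _ zr) hz := Oz.
have h1 := lip y z; have h2 := dotp_le (y - z) e1.
have h3 : dotp y e = dotp (y - z) e + dotp z e by rewrite -dotpDl subrK.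
have h4 : L * `|y - z| + n.+1%:R * `|y - z| <= eps.
  by rewrite -mulrDl mulrC (le_trans _ (ltW sC))// ler_wpM2r// ltW.
move: h1 h2 h4; rewrite !ler_norml => /andP[a1 a2] /andP[b1 b2].
by move: a2 b1 hz; rewrite h3; lra.
Qed.

Lemma facet_convex (P : 'M[R]_n.+1) (l : 'rV[R]_n.+1) : (forall i, 0 <= l ord0 i) ->
  \sum_i l ord0 i = 1 -> facet P (l *m P).
Proof. by move=> l0 l1; exists l. Qed.

(* Omega lies strictly above its boundary in the direction e, which a segment of the
   boundary parallel to e would contradict. *)
Lemma chart_transversal (Omega : set E) (P : 'M[R]_n.+1) x0 e phi L r (c : 'rV[R]_n) :
  open Omega -> facet P `<=` bnd Omega -> chart Omega x0 e phi L r ->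
  facet P `&` ball x0 r !=set0 -> e = c *m edges P -> False.
Proof.
move=> oO Pb ch [x1 [[l0 [l00 l01] <-] br]] ec.
have [r0 L0 e1 lip sh inO] := ch.
have [d d0 dr] : exists2 d : R, 0 < d & ball (l0 *m P) d `<=` ball x0 r.
  have := @ball_open_rV R n x0 r; rewrite openE => /(_ _ br)/nbhs_ballP[d d0 h]; by exists d.
(* Moving the given point of the facet slightly towards the barycentre makes all its barycentric
   coordinates at least s / (n + 1), which leaves room for a further move along e inside the facet
   and the chart. *)
pose b : 'rV[R]_n.+1 := const_mx n.+1%:R^-1.
have n0 : 0 < n.+1%:R^-1 :> R by rewrite invr_gt0.
have d2 : 0 < d / 2 by rewrite divr_gt0.
have [s /andP[s0 s1] sN] := small_factor d2 (normr_ge0 ((b - l0) *m P)).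
pose l := l0 + s *: (b - l0).
have lE i : l ord0 i = (1 - s) * l0 ord0 i + s * n.+1%:R^-1 by rewrite /l /b !mxE; ring.
have l1 : \sum_i l ord0 i = 1.
  under eq_bigr do rewrite lE.
  rewrite big_split/= -mulr_sumr l01 sumr_const card_ord -mulrnAr -(mulr_natr n.+1%:R^-1) mulVf ?pnatr_eq0//.
  by ring.
have lge i : s * n.+1%:R^-1 <= l ord0 i.
  by rewrite lE lerDr mulr_ge0// subr_ge0.
(* The direction e in barycentric form: coefficients of sum 0 on the vertices. *)
pose c' := cons_rV (c, - \sum_i c ord0 i).
have c'0 : \sum_i c' ord0 i = 0.
  by rewrite sum_cons_rV1 addNr.
have c'e : c' *m P = e.
  rewrite ec; apply/rowP => j; rewrite !mxE (sum_cons_rV _ _ (fun i => P i j)).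
  rewrite mulNr mulr_suml addrC -sumrB; apply: eq_bigr => i _; rewrite mxE; ring.
have m0 : 0 < Num.min (d / 2) (s * n.+1%:R^-1) by rewrite lt_min d2 mulr_gt0.
have [t /andP[t0 _] tN] := small_factor m0 (addr_ge0 (normr_ge0 c') (normr_ge0 e)).
have tc : t * `|c'| < s * n.+1%:R^-1.
  apply: le_lt_trans (_ : t * (`|c'| + `|e|) < _); first by rewrite mulrDr lerDl mulr_ge0// ltW.
  by rewrite (lt_le_trans tN)// ge_min lexx orbT.
have te : t * `|e| < d / 2.
  apply: le_lt_trans (_ : t * (`|c'| + `|e|) < _); first by rewrite mulrDr lerDr mulr_ge0// ltW.
  by rewrite (lt_le_trans tN)// ge_min lexx.
pose x := l *m P; pose x' := (l + t *: c') *m P.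
have x'E : x' = x + t *: e by rewrite /x' mulmxDl -scalemxAl c'e.
have xE : x = l0 *m P + s *: ((b - l0) *m P) by rewrite /x mulmxDl -scalemxAl.
have bx : bnd Omega x.
  by apply/Pb/facet_convex => // i; rewrite (le_trans _ (lge i))// mulr_ge0// ltW.
have bx' : bnd Omega x'.
  apply/Pb/facet_convex => [i|]; last first.
    under eq_bigr do rewrite mxE [X in _ + X]mxE.
    by rewrite big_split/= -mulr_sumr l1 c'0 mulr0 addr0.
  rewrite mxE [X in _ + X]mxE.
  have := lge i; have := coord_le c' i.
  have : `|t * c' ord0 i| <= t * `|c'|.
    by rewrite normrM gtr0_norm// ler_wpM2l ?coord_le// ltW.
  rewrite ler_norml => /andP[b1 _] _ b2; rewrite -lerBlDr sub0r.
  by rewrite (le_trans _ b2)// lerNl (le_trans _ b1)// lerN2 ltW.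
have rx : ball x0 r x.
  apply: dr; rewrite -ball_normE /= xE opprD addNKr normrN normrZ gtr0_norm//.
  by rewrite (lt_trans sN)// gtr_pMr// invf_lt1// ltr1n.
have rx' : ball x0 r x'.
  apply: dr; rewrite -ball_normE /= x'E xE -addrA opprD addNKr normrN.
  rewrite (le_lt_trans (ler_normD _ _))// !normrZ (gtr0_norm s0) (gtr0_norm t0).
  by rewrite [ltRHS]splitr ltrD.
have := chart_boundary oO ch rx' bx'; rewrite x'E sh dotpDl dotpZl e1 mulr1.
by rewrite (chart_boundary oO ch rx bx); move: t0; lra.
Qed.

End fiber.

(** * The trace inequality for smooth functions *)

Section trace_inequality.
Context {R : realType} {n : nat}.
Local Notation E := 'rV[R]_n.+1.
Local Notation lambda := (leb n.+1 : {measure set E -> \bar R}).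
Local Notation lam := (@lebesgue_measure R).
Variables (Omega : set E) (rho : R) (T : seq 'M[R]_n.+1).
Hypothesis oO : open Omega.
Hypothesis bO : forall x, Omega x -> `|x| <= rho.
Implicit Types (phi : E -> R) (P : 'M[R]_n.+1).
Local Notation h1 := (snorm (h1ip Omega)).
Local Notation sigma := (surface_measure T).

Let mO : measurable Omega := domain_measurable oO.

Lemma measurable_closed_rV (A : set E) : closed A -> measurable A.
Proof. by move=> cA; rewrite -[A]setCK; apply: measurableC; apply: open_measurable_rV; exact: closed_openC. Qed.

Lemma bnd_measurable : measurable (bnd Omega).
Proof.
apply: measurableD; first by apply: measurable_closed_rV; exact: closed_closure.
by apply: open_measurable_rV; exact: open_interior.
Qed.

Lemma compact_bnd : compact (bnd Omega).
Proof.
apply: (subclosed_compact _ (compact_closure_domain bO)); last by move=> x [].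
rewrite /bnd setDE; apply: closedI; first exact: closed_closure.
by apply: open_closedC; exact: open_interior.
Qed.

Lemma energy_integral phi c : smooth phi -> 0 <= c ->
  (\int[lambda]_(x in Omega) (energy c phi x)%:E <= (Num.max c 1 * h1 phi ^+ 2)%:E)%E.
Proof.
move=> sphi c0; have Lphi := L2_smooth oO bO (smooth_continuous sphi).
have [Lg _] := is_wgrad_smooth oO bO sphi.
have i1 : lambda.-integrable Omega (EFin \o (fun x => phi x * phi x)) := L2M mO Lphi Lphi.
have i1' := integrableRZ mO c i1.
have i2 : lambda.-integrable Omega (EFin \o (fun x => dotp (grad phi x) (grad phi x))).
  have [_] := Rintegral_sum (index_enum 'I_n.+1) mO (fun i => L2M mO (Lg i) (Lg i)).
  by [].
rewrite (_ : (\int[lambda]_(x in Omega) _)%E = (\int[lambda]_(x in Omega) energy c phi x)%:E); last first.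
  rewrite /Rintegral fineK//; apply: integrable_fin_num => //.
  by have := integrableRD mO i1' i2; apply: eq_integrable => // x _; rewrite /energy /= expr2.
rewrite lee_fin (_ : Rintegral _ _ _ = c * ip lambda Omega phi phi + ipvec Omega (grad phi) (grad phi)).
  rewrite (sqr_snorm (sip_h1ip oO bO) (H1_smooth oO bO sphi)) /h1ip mulrDr.
  have Eg := ae_eq_sym (wgrad_smooth oO bO sphi).
  have Lwg := wgrad_L2 (H1_smooth oO bO sphi).
  rewrite (ipvec_ae oO Lg Lwg Lg Lwg Eg Eg).
  apply: lerD; apply: ler_wpM2r || apply: ler_peMl; rewrite ?le_max ?lexx ?orbT//.
  - exact: (sip_ge0 (sip_ip lambda mO)).
  - exact: (sip_ge0 (sip_ipvec oO)) (wgrad_L2 (H1_smooth oO bO sphi)).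
by rewrite -RintegralZl// -RintegralD//.
Qed.

Lemma facet_chart_unit P x0 e phi0 L r : row_free (edges P) -> facet P `<=` bnd Omega ->
  chart Omega x0 e phi0 L r -> facet P `&` ball x0 r !=set0 ->
  (col_mx e (edges P) : 'M[R]_(1 + n)) \in unitmx.
Proof.
move=> fP Pb ch ne; rewrite -row_free_unit; apply: inj_row_free => v.
rewrite -[v]hsubmxK; set s := lsubmx v; set t := rsubmx v.
rewrite mul_row_col [s]mx11_scalar mul_scalar_mx.
have [->|s0] := eqVneq (s 0 0) 0.
  rewrite scale0r add0r => h; have := row_free_inj fP; rewrite -(mul0mx _ (edges P)) in h.
  by move=> /(_ _ _ _ h) ->; rewrite raddf0 -[RHS](@row_mx0 R 1 1 n).
move=> /eqP; rewrite addr_eq0 => /eqP h.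
exfalso; apply: (chart_transversal (c := - ((s 0 0)^-1 *: t)) oO Pb ch ne).
by rewrite mulNmx -scalemxAl -scalerN -h scalerA mulVf// scale1r.
Qed.

(** The segments of direction e starting on the facet form the image of an affine map with linear
    part [col_mx e (edges P)], invertible because e is not parallel to the facet. Integrating
    [fiber_ineq] over the facet therefore gives an integral over a part of Omega, up to the constant
    of [lin_bdd]. *)
Lemma facet_chart_trace P x0 e phi0 L r : row_free (edges P) -> facet P `<=` bnd Omega ->
  chart Omega x0 e phi0 L r -> facet P `&` ball x0 r !=set0 ->
  exists2 C, 0 <= C & forall phi, smooth phi ->
    (\int[facet_area P]_(x in bnd Omega `&` ball x0 (r / 2)) (phi x ^+ 2)%:E
      <= (C * h1 phi ^+ 2)%:E)%E.
Proof.
move=> fP Pb ch ne; have uM := facet_chart_unit fP Pb ch ne.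
set M := col_mx _ _ in uM; have [C1 C10 hC1] := unitmx_lin_bdd uM.
have [r0 L0 e1 lip sh inO] := ch.
(* The Euclidean unit vector e has maximum norm at most 1, so segments of parameter length r / 2
   that start within r / 2 of [x0] stay in the chart. *)
pose t0 := r / 2; have t00 : 0 < t0 by rewrite divr_gt0.
pose c := t0^-1 + n.+1%:R; have c0 : 0 <= c by rewrite addr_ge0// invr_ge0 ltW.
pose k := Num.sqrt (\det (edges P *m (edges P)^T)).
exists (k * (C1 * Num.max c 1)); first by rewrite !mulr_ge0// ?sqrtr_ge0// le_max ler01 orbT.
move=> phi sphi; pose D := bnd Omega `&` ball x0 (r / 2).
have mD : measurable D by apply: measurableI; [exact: bnd_measurable|exact: measurable_ball_rV].
have mphi : measurable_fun setT (fun x => (phi x ^+ 2)%:E).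
  apply/measurable_EFinP/measurable_funX.
  exact: continuous_measurable_rV (smooth_continuous sphi).
rewrite -/D /facet_area ge0_integral_mscale//=; last 2 first.
- exact: measurable_funTS.
- by move=> x _; rewrite lee_fin sqr_ge0.
rewrite -mulrA EFinM lee_wpmul2l// ?lee_fin ?sqrtr_ge0//.
have mpar := @measurable_facet_param R n P.
rewrite ge0_integral_pushforward//; last 2 first.
- exact: measurable_funTS.
- by move=> x _; rewrite lee_fin sqr_ge0.
have mD' : measurable (facet_param P @^-1` D) by rewrite -[X in measurable X]setTI; exact: mpar.
have mphi' : measurable_fun setT ((fun x => (phi x ^+ 2)%:E) \o facet_param P).
  exact: measurableT_comp.
apply: (@le_trans _ _ (\int[leb n]_(t in facet_param P @^-1` D) ((fun x => (phi x ^+ 2)%:E) \o facet_param P) t)%E).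
  apply: ge0_le_measure_integral => //.
  - move=> S mS; rewrite /mrestr /=; apply: le_measure; rewrite ?inE//.
    by apply: measurableI => //; exact: measurable_unit_simplex.
  - by move=> x; rewrite lee_fin sqr_ge0.
pose G := (EFin \o energy c phi) \_ Omega.
have G0 x : (0 <= G x)%E by rewrite /G patchE; case: ifP => // _; rewrite lee_fin energy_ge0.
have mG : measurable_fun setT G.
  have mE : measurable_fun setT (EFin \o energy c phi).
    by apply/measurable_EFinP; exact: continuous_measurable_rV (smooth_continuous (energy_smooth c sphi)).
  exact: (measurable_restrictT _ mO).1 (measurable_funTS mE).
pose F z := G (row ord0 P + z *m M).
have mF : measurable_fun setT F.
  apply: (measurableT_comp mG); apply: measurableT_comp; first exact: measurable_addr_rV.
  exact: measurable_mulmxr_rV.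
have F0 z : (0 <= F z)%E by exact: G0.
have FE t s : F (cons_rV (t, s)) = G (facet_param P t + s *: e).
  by rewrite /F cons_rVE mul_row_col mul_scalar_mx /facet_param -addrA [in RHS](addrC (t *m _)).
apply: (@le_trans _ _ (\int[leb n]_t \int[lam]_s F (cons_rV (t, s)))%E).
  apply: (@le_trans _ _ (\int[leb n]_(t in facet_param P @^-1` D) \int[lam]_s F (cons_rV (t, s)))%E).
    apply: ge0_le_integral => //.
    - by move=> x _; rewrite lee_fin sqr_ge0.
    - exact: measurable_funTS.
    - by apply: measurable_funTS; exact: measurable_int_cons.
    - move=> t [bt rt]; apply: (le_trans (fiber_ineq _ sphi e1 t00)).
      rewrite -/c integral_mkcond; apply: ge0_le_integral => //.
      + by move=> s _; rewrite patchE; case: ifP => // _; rewrite lee_fin energy_ge0.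
      + apply: (measurable_restrictT _ (measurable_itv _)).1; apply: measurable_funTS; apply/measurable_EFinP.
        apply: (measurableT_comp (continuous_measurable_rV (smooth_continuous (energy_smooth c sphi)))).
        apply: measurable_fun_rV => i; under eq_fun do rewrite !mxE.
        by apply: measurable_funD => //; exact: measurable_funM.
      + by apply: (measurableT_comp mF); exact: measurable_cons_rV1.
      + move=> s _; rewrite patchE FE; case: ifPn => // sI.
        move: sI; rewrite inE /= in_itv /= => /andP[s0 s1].
        have rt' : ball x0 r (facet_param P t).
          by apply: le_ball rt; move: r0; lra.
        have rs : ball x0 r (facet_param P t + s *: e).
          rewrite -ball_normE /= opprD addrA (le_lt_trans (ler_normB _ _))//.
          rewrite [ltRHS]splitr normrZ gtr0_norm// ltr_leD//.
            by move: rt; rewrite -ball_normE.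
          rewrite (le_trans _ (ltW s1))// ler_piMr ?(ltW s0)//.
          by apply/rV_norm_le => // i; exact: dotp_unit.
        have Os : Omega (facet_param P t + s *: e).
          apply/(inO _ rs); rewrite sh -(chart_boundary oO ch rt' bt) dotpDl dotpZl e1 mulr1.
          by rewrite ltrDl.
        by rewrite /G patchE mem_set.
  apply: ge0_subset_integral => //.
  - exact: measurable_int_cons.
  - by move=> t _; apply: integral_ge0.
rewrite -leb_intS//.
have mGP : measurable_fun setT (fun x => G (row ord0 P + x)).
  by apply: (measurableT_comp mG); exact: measurable_addr_rV.
apply: le_trans (hC1 _ mGP (fun x => G0 _)) _.
rewrite (leb_integralD (row ord0 P) mG G0) -mulrA EFinM; apply: lee_wpmul2l; first by rewrite lee_fin.
rewrite /G -integral_mkcond; exact: energy_integral.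
Qed.

Lemma ge0_integralU_le (mu : {measure set E -> \bar R}) (A B : set E) (f : E -> \bar R) :
  measurable A -> measurable B -> measurable_fun setT f -> (forall x, (0 <= f x)%E) ->
  (\int[mu]_(x in A `|` B) f x <= \int[mu]_(x in A) f x + \int[mu]_(x in B) f x)%E.
Proof.
move=> mA mB mf f0.
have mBA : measurable (B `\` A) by exact: measurableD.
rewrite (_ : A `|` B = A `|` (B `\` A)); last first.
  apply/seteqP; split=> x; last by case=> [|[]]; [left|right].
  by have [Ax|nAx] := pselect (A x); [left|case=> // Bx; right].
rewrite ge0_integral_setU//; first last.
- by rewrite disj_set2E setDE setICA setICr setI0.
- exact: measurable_funTS.
apply: leeD => //; apply: ge0_subset_integral => //; first exact: measurable_funTS.
Qed.

Lemma facet_trace P : lipschitz_boundary Omega -> row_free (edges P) ->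
  facet P `<=` bnd Omega -> exists2 C, 0 <= C & forall phi, smooth phi ->
    (\int[facet_area P]_(x in bnd Omega) (phi x ^+ 2)%:E <= (C * h1 phi ^+ 2)%:E)%E.
Proof.
move=> lip fP Pb; have mb := bnd_measurable.
have mphi phi : smooth phi -> measurable_fun setT (fun x => (phi x ^+ 2)%:E).
  move=> sphi; apply/measurable_EFinP/measurable_funX.
  exact: continuous_measurable_rV (smooth_continuous sphi).
have sq0 phi (x : E) : (0 <= (phi x ^+ 2)%:E)%E by rewrite lee_fin sqr_ge0.
have h0 phi : 0 <= h1 phi ^+ 2 by rewrite sqr_ge0.
have [B [mB bB [C C0 hC]]] : exists B, [/\ measurable B, bnd Omega `<=` B &
    exists2 C, 0 <= C & forall phi, smooth phi ->
    (\int[facet_area P]_(x in bnd Omega `&` B) (phi x ^+ 2)%:E <= (C * h1 phi ^+ 2)%:E)%E].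
  apply: (@compact_ind _ _ (fun A : set E => exists B, [/\ measurable B, A `<=` B &
    exists2 C, 0 <= C & forall phi, smooth phi ->
    (\int[facet_area P]_(x in bnd Omega `&` B) (phi x ^+ 2)%:E <= (C * h1 phi ^+ 2)%:E)%E]) compact_bnd).
  - exists set0; split=> //; exists 0 => // phi _.
    by rewrite setI0 integral_set0 mul0r.
  - move=> A A' [B [mB AB [C C0 hC]]] [B' [mB' AB' [C' C0' hC']]].
    exists (B `|` B'); split; [exact: measurableU|exact: setUSS|].
    exists (C + C'); first exact: addr_ge0.
    move=> phi sphi; rewrite setIUr.
    apply: (le_trans (ge0_integralU_le _ _ _ (mphi _ sphi) (sq0 phi))); try exact: measurableI.
    by rewrite mulrDl EFinD leeD ?hC ?hC'.
  - move=> A A' AA' [B [mB AB hB]]; exists B; split=> //; exact: subset_trans AB.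
  - move=> x /(lipschitz_chart lip)[e [phi0 [L [r ch]]]].
    have r0 := ch_r ch.
    exists (ball x (r / 2)); first exact: ball_open_rV.
    split; first by apply: ballxx; rewrite divr_gt0.
    exists (ball x (r / 2)); split=> //; first exact: measurable_ball_rV.
    have [ne|/set0P/negP/negPn/eqP em] := pselect (facet P `&` ball x r !=set0).
      exact: facet_chart_trace ch ne.
    exists 0 => // phi sphi; rewrite mul0r null_set_integral//.
    + by apply: measurableI => //; exact: measurable_ball_rV.
    + exact: measurable_funTS (mphi _ sphi).
    rewrite /facet_area /= /mscale /= /pushforward /= /mrestr /= (_ : _ `&` _ = set0) ?measure0 ?mule0//.
    apply/seteqP; split=> // t [[_ bt] st]; suff : set0 (facet_param P t) by [].
    rewrite -em; split; first exact: facet_param_facet.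
    by apply: le_ball bt; move: r0; lra.
exists C => // phi sphi; rewrite (_ : bnd Omega = bnd Omega `&` B); first exact: hC.
by apply/seteqP; split=> [x bx|x []//]; split=> //; exact: bB.
Qed.

Lemma trace_ineq : lipschitz_boundary Omega -> simplicial_boundary Omega T ->
  exists2 C, 0 <= C & forall phi, smooth phi ->
    snorm (ip sigma (bnd Omega)) phi <= C * h1 phi.
Proof.
move=> lip [fT bT _]; have mb := bnd_measurable.
have /choice[C hC] : forall k : 'I_(size T), exists C, 0 <= C /\ forall phi, smooth phi ->
    (\int[facet_area T`_k]_(x in bnd Omega) (phi x ^+ 2)%:E <= (C * h1 phi ^+ 2)%:E)%E.
  move=> k; have kT : T`_k \in T by rewrite mem_nth.
  have [|C C0 hC] := facet_trace lip (fT _ kT).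
    by move=> x fx; rewrite bT; exists T`_k.
  by exists C.
pose c := \sum_k C k.
have c0 : 0 <= c by apply: sumr_ge0 => k _; have [] := hC k.
exists (Num.sqrt c); first exact: sqrtr_ge0.
move=> phi sphi.
have mphi : measurable_fun setT (fun x => (phi x ^+ 2)%:E).
  apply/measurable_EFinP/measurable_funX.
  exact: continuous_measurable_rV (smooth_continuous sphi).
have le : (\int[sigma]_(x in bnd Omega) (phi x ^+ 2)%:E <= (c * h1 phi ^+ 2)%:E)%E.
  rewrite ge0_integral_measure_sum//; last 2 first.
  - by move=> x _; rewrite lee_fin sqr_ge0.
  - exact: measurable_funTS.
  rewrite /c mulr_suml -sumEFin; apply: lee_sum => k _.
  by have [_] := hC k; apply.
have Lphi : Lp sigma (bnd Omega) 2%:E phi.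
  apply/L2P; split; last by rewrite (le_lt_trans le)// ltry.
  apply: measurable_funTS; exact: continuous_measurable_rV (smooth_continuous sphi).
move: le; rewrite L2_fin// lee_fin => le.
rewrite -[h1 phi]ger0_norm ?snorm_ge0// -sqrtr_sqr -sqrtrM// ler_sqrt//.
by rewrite mulr_ge0// sqr_ge0.
Qed.

Lemma surface_finite A : measurable A -> (sigma A < +oo)%E.
Proof.
move=> mA; rewrite /surface_measure /= /msum; apply: lte_sum_pinfty => k _.
rewrite /facet_area /= /mscale /=; apply: lte_mul_pinfty; rewrite ?lee_fin ?sqrtr_ge0//.
rewrite /pushforward /mrestr /=.
have mp := @measurable_facet_param R n T`_k.
have mA' : measurable (facet_param T`_k @^-1` A) by rewrite -[X in measurable X]setTI; exact: mp.
apply: (@le_lt_trans _ _ (leb n (ball (0 : 'rV[R]_n) 2))); last by rewrite leb_ball// ltry.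
apply: le_measure; rewrite ?inE.
- by apply: measurableI => //; exact: measurable_unit_simplex.
- exact: measurable_ball_rV.
move=> t [_ [t0 t1]]; rewrite ball_rVE//= => i; rewrite mxE sub0r normrN ger0_norm//.
rewrite (@le_lt_trans _ _ 1)// ?ltr1n//; apply: le_trans t1.
by rewrite (bigD1 i)//= lerDl; apply: sumr_ge0.
Qed.

End trace_inequality.

Lemma snorm_sym {R : realType} {V : Type} (X : set (V -> R)) b u v :
  sip X lcf b -> X u -> X v -> snorm b (lcf (-1) u v) = snorm b (lcf (-1) v u).
Proof.
by move=> S Xu Xv; rewrite /snorm !(sip_lcE S)// (sip_sym S Xu Xv) sqrrN expr1n !mul1r addrAC addrC addrA addrC -addrA; congr Num.sqrt; ring.
Qed.

Lemma snorm0 {R : realType} {V : Type} (X : set (V -> R)) b u :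
  sip X lcf b -> X u -> snorm b (lcf (-1) u u) = 0.
Proof.
move=> S Xu; rewrite /snorm (sip_lcE S)// sqrrN expr1n mul1r (_ : _ + _ = 0) ?sqrtr0//; ring.
Qed.

Lemma snorm_tri {R : realType} {V : Type} (X : set (V -> R)) b u v w :
  sip X lcf b -> X u -> X v -> X w ->
  snorm b (lcf (-1) u w) <= snorm b (lcf (-1) u v) + snorm b (lcf (-1) v w).
Proof.
move=> S Xu Xv Xw.
have -> : lcf (-1) u w = lcf 1 (lcf (-1) u v) (lcf (-1) v w).
  by apply/funext => x; rewrite /lcf; ring.
by have := snorm_lc S 1 (sip_lc S (-1) Xu Xv) (sip_lc S (-1) Xv Xw); rewrite normr1 mul1r.
Qed.

Lemma cvg0P {R : realType} (u : nat -> R) : (forall k, 0 <= u k) ->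
  (u k @[k --> \oo] --> (0 : R)) <->
  (forall e, 0 < e -> exists K, forall k, (K <= k)%N -> u k <= e).
Proof.
move=> u0; split=> [/cvgrPdist_le h e e0|h].
  have [K _ hK] := h e e0; exists K => k Kk.
  by have := hK k Kk; rewrite sub0r normrN ger0_norm.
apply/cvgrPdist_le => e /h [K hK]; exists K => // k Kk /=.
by rewrite sub0r normrN ger0_norm// hK.
Qed.

Lemma inv_succ_le {R : realType} (e : R) : 0 < e -> exists K, forall k, (K <= k)%N -> k.+1%:R^-1 <= e.
Proof.
move=> e0; exists (Num.truncn e^-1) => k Kk.
rewrite -[leRHS]invrK lef_pV2 ?posrE ?invr_gt0//.
by rewrite ltW// (lt_le_trans (truncnS_gt _))// ler_nat.
Qed.

(** * The trace operator on H^1 *)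

Section trace.
Context {R : realType} {n : nat}.
Local Notation E := 'rV[R]_n.+1.
Local Notation lambda := (leb n.+1 : {measure set E -> \bar R}).
Variables (Omega : set E) (rho : R) (T : seq 'M[R]_n.+1).
Hypothesis oO : open Omega.
Hypothesis bO : forall x, Omega x -> `|x| <= rho.
Hypothesis lip : lipschitz_boundary Omega.
Hypothesis simp : simplicial_boundary Omega T.
Implicit Types (phi psi u v w q : E -> R).
Local Notation h1 := (snorm (h1ip Omega)).
Local Notation nO := (snorm (ip lambda Omega)).
Local Notation sigma := (surface_measure T).
Local Notation bd := (bnd Omega).
Local Notation nb := (snorm (ip sigma bd)).
Local Notation L2b := (Lp sigma bd 2%:E).
Local Notation trace := (trace Omega T).

Let mO : measurable Omega := domain_measurable oO.
Let mb : measurable bd := bnd_measurable Omega.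
Let sb : (sigma bd < +oo)%E := surface_finite T mb.
Let S1 := sip_h1ip oO bO.
Let Sb := sip_ip sigma mb.
Let S := sip_ip lambda mO.

Lemma bnd_le x : bd x -> `|x| <= rho.
Proof. by move=> [cx _]; exact: (closure_domain_le bO cx). Qed.

Lemma L2b_continuous phi : continuous phi -> L2b phi.
Proof.
move=> cphi; have [M _ hM] := continuous_bounded rho cphi.
exact: (L2_continuous_bounded mb sb cphi (fun x Ox => hM x (bnd_le Ox))).
Qed.

Lemma L2b_smooth phi : smooth phi -> L2b phi.
Proof. by move=> /smooth_continuous; exact: L2b_continuous. Qed.

(** A form of the definition without sequences; these are recovered by choosing phi with precision 1
    / (k + 1). *)
Lemma is_traceP v w : H1 Omega v -> L2b w -> is_trace Omega T v w <->
  forall e : R, 0 < e -> exists phi, [/\ smooth phi, h1 (lcf (-1) v phi) <= e &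
    nb (lcf (-1) w phi) <= e].
Proof.
move=> Hv Lw; have E1 phi u : phi \- u = lcf (-1) u phi.
  by apply/funext => x; rewrite /lcf /= mulN1r addrC.
have HE phi : smooth phi -> H1norm Omega (phi \- v) = h1 (lcf (-1) v phi).
  by move=> sphi; rewrite E1 H1normE//; exact: (sip_lc S1 (-1) Hv (H1_smooth oO bO sphi)).
split=> [[_ [phi [sphi c1 c2]]] e e0|h].
  have [K1 hK1] := (cvg0P (fun k => sqrtr_ge0 _)).1 c1 e e0.
  have c2' : nb (lcf (-1) w (phi k)) @[k --> \oo] --> (0 : R).
    by move: c2; under eq_fun do rewrite E1 Lpnorm2E.
  have [K2 hK2] := (cvg0P (fun k => snorm_ge0 _ _)).1 c2' e e0.
  exists (phi (maxn K1 K2)); split=> //.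
  - by rewrite -HE// hK1// leq_maxl.
  - by rewrite hK2// leq_maxr.
split=> //.
have /choice[phi hphi] : forall k : nat, exists phi, [/\ smooth phi,
    h1 (lcf (-1) v phi) <= k.+1%:R^-1 & nb (lcf (-1) w phi) <= k.+1%:R^-1].
  by move=> k; apply: h; rewrite invr_gt0.
exists phi; split=> [k||]; first by have [] := hphi k.
- apply/cvg0P => [k|e /inv_succ_le[K hK]]; first exact: sqrtr_ge0.
  exists K => k Kk; have [sphi h1' _] := hphi k.
  by rewrite HE//; exact: le_trans h1' (hK k Kk).
- under eq_fun do rewrite E1 Lpnorm2E.
  apply/cvg0P => [k|e /inv_succ_le[K hK]]; first exact: snorm_ge0.
  exists K => k Kk; have [_ _ h2] := hphi k.
  exact: le_trans h2 (hK k Kk).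
Qed.

Lemma is_trace_le : exists2 C, 0 <= C & forall v v' w w', H1 Omega v -> H1 Omega v' ->
  is_trace Omega T v w -> is_trace Omega T v' w' ->
  nb (lcf (-1) w w') <= C * h1 (lcf (-1) v v').
Proof.
have [C C0 hC] := trace_ineq oO bO lip simp.
exists C => // v v' w w' Hv Hv' tw tw'.
have Lw : L2b w by case: tw. have Lw' : L2b w' by case: tw'.
apply/ler_addgt0Pr => e e0.
have D0 : 0 < 2 + 2 * C by rewrite ltr_wpDr// mulr_ge0.
(* Each of the two smooth approximations costs d once on the boundary and C * d once through the H^1
   norm. *)
pose d := e / (2 + 2 * C); have d0 : 0 < d by rewrite divr_gt0.
have [phi [sphi p1 p2]] := (is_traceP Hv Lw).1 tw _ d0.
have [psi [spsi q1 q2]] := (is_traceP Hv' Lw').1 tw' _ d0.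
have Lphi := L2b_smooth sphi. have Lpsi := L2b_smooth spsi.
have Hphi := H1_smooth oO bO sphi. have Hpsi := H1_smooth oO bO spsi.
have t1 := snorm_tri Sb Lw Lphi Lw'.
have t2 := snorm_tri Sb Lphi Lpsi Lw'.
rewrite (snorm_sym Sb Lpsi Lw') in t2.
have t3 : nb (lcf (-1) phi psi) <= C * h1 (lcf (-1) phi psi).
  apply: hC; rewrite (_ : lcf _ _ _ = fun x => psi x - phi x); first exact: smoothB.
  by apply/funext => x; rewrite /lcf; ring.
have t4 := snorm_tri S1 Hphi Hv Hpsi.
have t5 := snorm_tri S1 Hv Hv' Hpsi.
rewrite (snorm_sym S1 Hphi Hv) in t4.
have t6 : C * h1 (lcf (-1) phi psi) <= C * (d + (h1 (lcf (-1) v v') + d)).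
  exact: (ler_wpM2l C0 (le_trans t4 (lerD p1 (le_trans t5 (lerD (lexx _) q1))))).
have de : e = 2 * d + 2 * (C * d).
  by rewrite mulrA -mulrDl mulrC divfK// gt_eqF.
apply: (le_trans t1); apply: (le_trans (lerD p2 t2)).
apply: (@le_trans _ _ (d + (C * (d + (h1 (lcf (-1) v v') + d)) + d))).
  exact: (lerD (lexx _) (lerD (le_trans t3 t6) q2)).
rewrite de le_eqVlt; apply/orP; left; apply/eqP; ring.
Qed.

Lemma nb_eq0_ae w w' : L2b w -> L2b w' -> nb (lcf (-1) w w') = 0 -> ae_eq sigma bd w w'.
Proof.
move=> Lw Lw' h; have Ld := L2_lc mb (-1) Lw Lw'.
have : ip sigma bd (lcf (-1) w w') (lcf (-1) w w') = 0 by rewrite -(sqr_snorm Sb Ld) h expr0n.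
move=> /(ip_eq0_ae mb Ld); apply: filterS => x k bx; have := k bx.
by rewrite /lcf mulN1r addrC => /eqP; rewrite subr_eq0 => /eqP.
Qed.

Lemma is_trace_unique v w w' : H1 Omega v ->
  is_trace Omega T v w -> is_trace Omega T v w' -> ae_eq sigma bd w w'.
Proof.
move=> Hv tw tw'; have [C C0 hC] := is_trace_le.
apply: nb_eq0_ae; [by case: tw|by case: tw'|].
apply/eqP; rewrite eq_le snorm_ge0 andbT (le_trans (hC _ _ _ _ Hv Hv tw tw'))//.
by rewrite (snorm0 S1 Hv) mulr0.
Qed.

Lemma is_trace_exists v : H1 Omega v -> exists w, is_trace Omega T v w.
Proof.
move=> Hv; have [C C0 hC] := trace_ineq oO bO lip simp.
have /choice[phi hphi] : forall k : nat, exists phi, smooth phi /\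
    h1 (lcf (-1) v phi) <= k.+1%:R^-1.
  move=> k; have k0 : 0 < k.+1%:R^-1 :> R by rewrite invr_gt0.
  have [phi sphi h] := smooth_dense_H1 oO bO lip Hv k0; exists phi; split; first exact: sphi.
  by rewrite (snorm_sym S1 Hv (H1_smooth oO bO sphi)).
have sphi k : smooth (phi k) by have [] := hphi k.
have Hphi k := H1_smooth oO bO (sphi k).
have Lphi k := L2b_smooth (sphi k).
have small (e : R) : 0 < e -> exists K, forall k, (K <= k)%N -> h1 (lcf (-1) v (phi k)) <= e.
  move=> /inv_succ_le[K hK]; exists K => k /hK; have [_] := hphi k; exact: le_trans.
have [e e0|w Lw hw] := Riesz_Fischer mb Lphi.
  have e1 : 0 < e / (2 * C + 1) by rewrite divr_gt0// ltr_wpDl// mulr_ge0.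
  have [K hK] := small _ e1; exists K => i j /hK hi /hK hj.
  have : nb (lcf (-1) (phi i) (phi j)) <= C * h1 (lcf (-1) (phi i) (phi j)).
    apply: hC; rewrite (_ : lcf _ _ _ = fun x => phi j x - phi i x); first exact: smoothB.
    by apply/funext => x; rewrite /lcf; ring.
  move=> /le_trans; apply.
  have t := snorm_tri S1 (Hphi i) Hv (Hphi j).
  rewrite (snorm_sym S1 (Hphi i) Hv) in t.
  apply: (le_trans (ler_wpM2l C0 (le_trans t (lerD hi hj)))).
  have D0 : 0 < 2 * C + 1 by rewrite ltr_wpDl// mulr_ge0.
  rewrite (_ : C * _ = e * (2 * C) / (2 * C + 1)); last by field; rewrite gt_eqF.
  by rewrite ler_pdivrMr// ler_wpM2l ?(ltW e0)// lerDl.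
exists w; apply/(is_traceP Hv Lw) => e e0.
have [K1 h1'] := small e e0; have [K2 h2'] := hw e e0.
exists (phi (maxn K1 K2)); split; [exact: sphi|by apply: h1'; rewrite leq_maxl|].
by rewrite (snorm_sym Sb Lw (Lphi _)) h2'// leq_maxr.
Qed.

Lemma traceP v : H1 Omega v -> is_trace Omega T v (trace v).
Proof. by move=> /is_trace_exists[w hw]; exact: (xgetPex _ (ex_intro _ w hw)). Qed.

Lemma trace_L2 v : H1 Omega v -> L2b (trace v).
Proof. by move=> /traceP[]. Qed.

Lemma is_trace_ae v w : H1 Omega v -> is_trace Omega T v w -> ae_eq sigma bd (trace v) w.
Proof. by move=> Hv; apply: is_trace_unique => //; exact: traceP. Qed.

Lemma trace_smooth phi : smooth phi -> ae_eq sigma bd (trace phi) phi.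
Proof.
move=> sphi; have Hphi := H1_smooth oO bO sphi; have Lphi := L2b_smooth sphi.
apply: is_trace_ae => //; apply/(is_traceP Hphi Lphi) => e e0; exists phi.
by rewrite (snorm0 S1 Hphi) (snorm0 Sb Lphi) !ltW.
Qed.

Lemma trace_lc a v v' : H1 Omega v -> H1 Omega v' ->
  ae_eq sigma bd (trace (lcf a v v')) (lcf a (trace v) (trace v')).
Proof.
move=> Hv Hv'; have Hl := sip_lc S1 a Hv Hv'.
have Lv := trace_L2 Hv; have Lv' := trace_L2 Hv'; have Ll := L2_lc mb a Lv Lv'.
apply: is_trace_ae => //; apply/(is_traceP Hl Ll) => e e0.
have a1 : 0 < `|a| + 1 by rewrite ltr_wpDl.
have d0 : 0 < e / (`|a| + 1) by rewrite divr_gt0.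
have [phi [sphi p1 p2]] := (is_traceP Hv Lv).1 (traceP Hv) _ d0.
have [psi [spsi q1 q2]] := (is_traceP Hv' Lv').1 (traceP Hv') _ d0.
have de : e = `|a| * (e / (`|a| + 1)) + e / (`|a| + 1).
  by rewrite -{2}(mul1r (e / _)) -mulrDl mulrC divfK// gt_eqF.
have E1 f f' h h' : lcf (-1) (lcf a f f') (lcf a h h') = lcf a (lcf (-1) f h) (lcf (-1) f' h') :> (E -> R).
  by apply/funext => x; rewrite /lcf; ring.
exists (lcf a phi psi); split.
- by apply: smoothD => //; exact: smoothZ.
- rewrite E1; have Hphi := H1_smooth oO bO sphi. have Hpsi := H1_smooth oO bO spsi.
  apply: (le_trans (snorm_lc S1 a (sip_lc S1 _ Hv Hphi) (sip_lc S1 _ Hv' Hpsi))).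
  rewrite [leRHS]de; exact: (lerD (ler_wpM2l (normr_ge0 a) p1) q1).
- rewrite E1; have Lphi := L2b_smooth sphi. have Lpsi := L2b_smooth spsi.
  apply: (le_trans (snorm_lc Sb a (sip_lc Sb _ Lv Lphi) (sip_lc Sb _ Lv' Lpsi))).
  rewrite [leRHS]de; exact: (lerD (ler_wpM2l (normr_ge0 a) p2) q2).
Qed.

Lemma trace_le : exists2 C, 0 <= C & forall v v', H1 Omega v -> H1 Omega v' ->
  nb (lcf (-1) (trace v) (trace v')) <= C * h1 (lcf (-1) v v').
Proof.
have [C C0 hC] := is_trace_le; exists C => // v v' Hv Hv'.
by apply: hC => //; exact: traceP.
Qed.

Lemma L2b_smoothM psi w : smooth psi -> L2b w -> L2b (fun x => psi x * w x).
Proof.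
move=> spsi Lw; have cpsi := smooth_continuous spsi.
have [M M0 hM] := continuous_bounded rho cpsi.
apply: (L2_le_bound mb (C := M) _ Lw).
  apply: measurable_funM; last exact: L2_measurable Lw.
  by apply: measurable_funTS; exact: continuous_measurable_rV.
by move=> x bx; rewrite normrM ler_wpM2r// hM// bnd_le.
Qed.

Lemma h1M_le psi : smooth psi -> exists2 C, 0 <= C & forall v, H1 Omega v ->
  h1 (fun x => psi x * v x) <= C * h1 v.
Proof.
move=> spsi; have [M M0 hM] := continuous_bounded rho (smooth_continuous spsi).
have /choice[D hD] : forall i, exists D, 0 <= D /\ forall x, `|x| <= rho -> `|partial i psi x| <= D.
  move=> i; have [D D0 hD] := continuous_bounded rho (smooth_continuous (smooth_partial i spsi)).
  by exists D.
pose D' := \sum_i D i.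
have D'0 : 0 <= D' by apply: sumr_ge0 => i _; have [] := hD i.
exists (M + n.+1%:R * (M + D')); first by rewrite addr_ge0// mulr_ge0// addr_ge0.
move=> v Hv; have Lv := H1_L2 Hv; have [Lw _] := wgradP Hv.
have IG := is_wgradM oO bO spsi Lv (wgradP Hv).
have [H3 E3] := is_wgradP oO bO (L2_smoothM oO bO (smooth_continuous spsi) Lv) IG.
rewrite mulrDl -mulrA.
have hv0 : 0 <= h1 v := snorm_ge0 _ _.
apply: (h1_le oO bO H3 E3).
- by case: IG.
- exact: mulr_ge0.
- by rewrite mulr_ge0// addr_ge0.
- apply: (@le_trans _ _ (M * nO v)); last exact: (ler_wpM2l _ (nO_le_h1 oO bO Hv)).
  apply: (nrm_le_bound mO M0 _ Lv); last by move=> x Ox; rewrite normrM ler_wpM2r// hM// bO.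
  by have [] := H1_L2 H3.
move=> i; rewrite (_ : comp_rV _ i = lcf 1 (fun x => psi x * comp_rV (wgrad Omega v) i x)
    (fun x => partial i psi x * v x)); last first.
  by apply/funext => x; rewrite /comp_rV /lcf /grad !mxE; ring.
have LA : L2 Omega (fun x => psi x * comp_rV (wgrad Omega v) i x).
  by apply: (L2_smoothM oO bO); [exact: smooth_continuous|exact: Lw].
have LB : L2 Omega (fun x => partial i psi x * v x).
  by apply: (L2_smoothM oO bO) => //; exact: smooth_continuous (smooth_partial i spsi).
apply: (le_trans (snorm_lc S 1 LA LB)); rewrite normr1 mul1r mulrDl; apply: lerD.
  apply: (@le_trans _ _ (M * nO (comp_rV (wgrad Omega v) i))).
    apply: (nrm_le_bound mO M0 _ (Lw i)); first by case: LA.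
    by move=> x Ox; rewrite normrM ler_wpM2r// hM// bO.
  rewrite ler_wpM2l//; exact: le_trans (comp_nrm_le oO i Lw) (wgrad_le_h1 oO bO Hv).
apply: (@le_trans _ _ (D' * nO v)); last exact: (ler_wpM2l _ (nO_le_h1 oO bO Hv)).
apply: (nrm_le_bound mO D'0 _ Lv); first by case: LB.
move=> x Ox; rewrite normrM ler_wpM2r//; have [_ hi] := hD i.
apply: (le_trans (hi x (bO Ox))); rewrite /D' (bigD1 i)//= lerDl.
by apply: sumr_ge0 => j _; have [] := hD j.
Qed.

Lemma traceM psi v : smooth psi -> H1 Omega v ->
  ae_eq sigma bd (trace (fun x => psi x * v x)) (fun x => psi x * trace v x).
Proof.
move=> spsi Hv; have Lv := trace_L2 Hv.
have Hp := H1M oO bO spsi Hv; have Lp := L2b_smoothM spsi Lv.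
apply: is_trace_ae => //; apply/(is_traceP Hp Lp) => e e0.
have [M M0 hM] := continuous_bounded rho (smooth_continuous spsi).
have [C C0 hC] := h1M_le spsi.
have D0 : 0 < C + M + 1 by rewrite ltr_wpDl// addr_ge0.
have d0 : 0 < e / (C + M + 1) by rewrite divr_gt0.
have [phi [sphi p1 p2]] := (is_traceP Hv Lv).1 (traceP Hv) _ d0.
have E1 f h : lcf (-1) (fun x => psi x * f x) (fun x => psi x * h x) = (fun x => psi x * lcf (-1) f h x).
  by apply/funext => x; rewrite /lcf; ring.
have le c : 0 <= c -> c <= C + M -> c * (e / (C + M + 1)) <= e.
  move=> c0 cC; rewrite mulrA ler_pdivrMr// mulrC ler_wpM2l ?ltW//.
  by rewrite (le_lt_trans cC)// ltrDl.
exists (fun x => psi x * phi x); split.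
- exact: smoothM.
- rewrite E1; have Hphi := H1_smooth oO bO sphi.
  apply: (le_trans (hC _ (sip_lc S1 (-1) Hv Hphi))).
  by apply: le_trans (ler_wpM2l C0 p1) (le _ C0 _); rewrite lerDl.
- rewrite E1; have Lphi := L2b_smooth sphi; have Ld := L2_lc mb (-1) Lv Lphi.
  apply: (@le_trans _ _ (M * nb (lcf (-1) (trace v) phi))).
    apply: (nrm_le_bound mb M0 _ Ld); first by case: (L2b_smoothM spsi Ld).
    by move=> x bx; rewrite normrM ler_wpM2r// hM// bnd_le.
  by apply: le_trans (ler_wpM2l M0 p2) (le _ M0 _); rewrite lerDr.
Qed.

End trace.

#[local] Opaque Defs.trace Defs.wgrad Defs.wdiv Defs.bflux.

(** * Smooth truncation *)

Section sine.
Context {R : realType}.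
Implicit Types (f df : R -> R) (a b s t M : R).

(** The derivative is bounded only up to the larger of |a| and |b|; applied to sin x - x this local
    form yields the quadratic error of [sin_sub_le]. *)
Lemma derive_lip f df (L : R) : (forall t, is_derive t 1 f (df t)) ->
  forall a b, (forall t, `|t| <= Num.max `|a| `|b| -> `|df t| <= L) -> `|f a - f b| <= L * `|a - b|.
Proof.
move=> fd a b; wlog ab : a b / b <= a => [h|] hL.
  have [|ba] := leP b a; first by move=> ba; exact: h.
  by rewrite distrC (distrC a); apply: h; [exact: ltW|rewrite maxC].
have [|c cI ->] := @MVT_segment R f df b a ab => //.
- apply: derivable_within_continuous => x _; by have [] := fd x.
rewrite normrM ler_wpM2r//; apply: hL.
move: cI; rewrite in_itv/= => /andP[bc ca]; rewrite ler_norml; apply/andP; split.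
  rewrite (le_trans _ bc)// lerNl le_max orbC -normrN ler_norm//.
by rewrite (le_trans ca)// le_max ler_norm.
Qed.

Lemma sin_lip a b : `|sin a - sin b| <= `|a - b|.
Proof.
rewrite -[leRHS]mul1r; apply: (@derive_lip sin cos) => // t _.
by rewrite ler_norml cos_geN1 cos_le1.
Qed.

Lemma cos_lip a b : `|cos a - cos b| <= `|a - b|.
Proof.
rewrite -[leRHS]mul1r; apply: (@derive_lip cos (fun x => - sin x)) => // t _.
by rewrite normrN ler_norml sin_geN1 sin_le1.
Qed.

Lemma cos_sub1_le s : `|cos s - 1| <= `|s|.
Proof. by have := cos_lip s 0; rewrite cos0 subr0. Qed.

Lemma sin_sub_le s : `|sin s - s| <= s ^+ 2.
Proof.
have := @derive_lip (fun x => sin x - x) (fun x => cos x - 1) `|s| _ s 0.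
rewrite sin0 !subr0 normr0 -expr2 real_normK ?num_real//; apply.
by move=> t; rewrite max_l// => ts; exact: le_trans (cos_sub1_le t) ts.
Qed.

(* The k-th derivative of t |-> M * sin (t / M), which plays the role of a smooth
   truncation of the identity at height M. *)
Definition sinf M (k : nat) t : R := M * M^-1 ^+ k * sin (M^-1 * t + pi / 2 *+ k).

Lemma is_derive_sinf M k t : is_derive t 1 (sinf M k) (sinf M k.+1 t).
Proof.
rewrite /sinf; apply: is_derive_eq; rewrite (mulrSr (pi / 2)) addrA sinDpihalf exprSr /GRing.scale/=.
by rewrite !(mulr1, mulr0, mul0r, addr0); ring.
Qed.

Lemma sinf0 M t : sinf M 0 t = M * sin (t / M).
Proof. by rewrite /sinf expr0 mulr1 mulr0n addr0 (mulrC M^-1). Qed.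

Lemma sinf1 M t : M != 0 -> sinf M 1 t = cos (t / M).
Proof. by move=> M0; rewrite /sinf expr1 mulfV// mul1r mulr1n sinDpihalf mulrC. Qed.

Lemma sinf_lip M a b : 0 < M -> `|sinf M 0 a - sinf M 0 b| <= `|a - b|.
Proof.
move=> M0; rewrite !sinf0 -mulrBr normrM gtr0_norm//.
apply: le_trans (ler_wpM2l (ltW M0) (sin_lip _ _)) _.
by rewrite -mulrBl normrM (gtr0_norm (x := M^-1)) ?invr_gt0// mulrC divfK ?gt_eqF.
Qed.

Lemma sinf_le M t : 0 < M -> `|sinf M 0 t| <= `|t|.
Proof. by move=> M0; have := sinf_lip t 0 M0; rewrite !sinf0 mul0r sin0 mulr0 !subr0. Qed.

Lemma sinf_bound M t : 0 < M -> `|sinf M 0 t| <= M.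
Proof.
move=> M0; rewrite sinf0 normrM gtr0_norm// -[leRHS]mulr1 ler_pM2l//.
by rewrite ler_norml sin_geN1 sin_le1.
Qed.

Lemma sinf_sub_le M t : 0 < M -> `|sinf M 0 t - t| <= t ^+ 2 / M.
Proof.
move=> M0; rewrite sinf0 (_ : _ - t = M * (sin (t / M) - t / M)); last first.
  by field; rewrite gt_eqF.
rewrite normrM gtr0_norm//; apply: le_trans (ler_wpM2l (ltW M0) (sin_sub_le _)) _.
by rewrite le_eqVlt; apply/orP; left; apply/eqP; field; rewrite gt_eqF.
Qed.

Lemma cosM_lip M a b : 0 < M -> `|cos (a / M) - cos (b / M)| <= `|a - b| / M.
Proof.
move=> M0; rewrite (le_trans (cos_lip _ _))//.
by rewrite -mulrBl normrM (gtr0_norm (x := M^-1)) ?invr_gt0.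
Qed.

Lemma continuous_sinf M k : continuous (sinf M k).
Proof.
move=> t; apply: differentiable_continuous; apply/derivable1_diffP.
by have [] := is_derive_sinf M k t.
Qed.

End sine.

(** * Truncation in H^1 and its trace *)

Section truncation.
Context {R : realType} {n : nat}.
Local Notation E := 'rV[R]_n.+1.
Local Notation lambda := (leb n.+1 : {measure set E -> \bar R}).
Variables (Omega : set E) (rho : R) (T : seq 'M[R]_n.+1).
Hypothesis oO : open Omega.
Hypothesis bO : forall x, Omega x -> `|x| <= rho.
Hypothesis lip : lipschitz_boundary Omega.
Hypothesis simp : simplicial_boundary Omega T.
Implicit Types (phi psi u v w q f g h : E -> R).
Local Notation h1 := (snorm (h1ip Omega)).
Local Notation nO := (snorm (ip lambda Omega)).
Local Notation sigma := (surface_measure T).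
Local Notation bd := (bnd Omega).
Local Notation trace := (trace Omega T).

Let mO : measurable Omega := domain_measurable oO.
Let lO := domain_leb oO bO.
Let mb : measurable bd := bnd_measurable Omega.
Let S1 := sip_h1ip oO bO.

Lemma nrm_le3 (mu : {measure set E -> \bar R}) (A : set E) q f g h (c d : R) : measurable A ->
  measurable_fun A q -> Lp mu A 2%:E f -> Lp mu A 2%:E g -> Lp mu A 2%:E h -> 0 <= c -> 0 <= d ->
  (forall x, A x -> `|q x| <= `|f x| + c * `|g x| + d * `|h x|) ->
  Lp mu A 2%:E q /\
  snorm (ip mu A) q <= snorm (ip mu A) f + c * snorm (ip mu A) g + d * snorm (ip mu A) h.
Proof.
move=> mA mq Lf Lg Lh c0 d0 le.
have Sm := sip_ip mu mA.
have abs w : Lp mu A 2%:E w -> Lp mu A 2%:E (fun x => `|w x|) /\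
    snorm (ip mu A) (fun x => `|w x|) <= snorm (ip mu A) w.
  move=> Lw; have mw : measurable_fun A (fun x => `|w x|).
    by apply: measurableT_comp => //; exact: L2_measurable Lw.
  split; first by apply: (L2_le_bound mA (C := 1) mw Lw) => x _; rewrite normr_id mul1r.
  rewrite -[leRHS]mul1r; apply: (nrm_le_bound mA ler01 mw Lw) => x _.
  by rewrite normr_id mul1r.
have [Lf' f'] := abs _ Lf; have [Lg' g'] := abs _ Lg; have [Lh' h'] := abs _ Lh.
pose F := lcf d (fun x => `|h x|) (lcf c (fun x => `|g x|) (fun x => `|f x|)).
have LF1 : Lp mu A 2%:E (lcf c (fun x => `|g x|) (fun x => `|f x|)) by exact: L2_lc.
have LF : Lp mu A 2%:E F by exact: L2_lc.
have FE x : F x = `|f x| + c * `|g x| + d * `|h x| by rewrite /F /lcf; ring.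
have F0 x : 0 <= F x by rewrite FE !addr_ge0// mulr_ge0.
have leF x : A x -> `|q x| <= 1 * `|F x| by move=> Ax; rewrite mul1r (ger0_norm (F0 x)) FE; exact: le.
split; first exact: (L2_le_bound mA mq LF leF).
apply: (le_trans (nrm_le_bound mA ler01 mq LF leF)); rewrite mul1r.
apply: (le_trans (snorm_lc Sm d Lh' LF1)); rewrite ger0_norm// addrC.
apply: lerD; last exact: ler_wpM2l.
apply: (le_trans (snorm_lc Sm c Lg' Lf')); rewrite ger0_norm// addrC.
by apply: lerD => //; exact: ler_wpM2l.
Qed.

Lemma L2_sinf (mu : {measure set E -> \bar R}) (A : set E) M v : measurable A -> 0 < M ->
  Lp mu A 2%:E v -> Lp mu A 2%:E (sinf M 0 \o v).
Proof.
move=> mA M0 Lv; apply: (L2_le_bound mA (C := 1) _ Lv).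
  apply: measurableT_comp; last exact: L2_measurable Lv.
  exact: continuous_measurable_fun (continuous_sinf (M := M) (k := 0%N)).
by move=> x _; rewrite mul1r; exact: sinf_le.
Qed.

Lemma nrm_sinf_le (mu : {measure set E -> \bar R}) (A : set E) M v v' : measurable A -> 0 < M ->
  Lp mu A 2%:E v -> Lp mu A 2%:E v' ->
  snorm (ip mu A) (lcf (-1) (sinf M 0 \o v) (sinf M 0 \o v')) <= snorm (ip mu A) (lcf (-1) v v').
Proof.
move=> mA M0 Lv Lv'; rewrite -[leRHS]mul1r.
have Ld := L2_lc mA (-1) (L2_sinf mA M0 Lv) (L2_sinf mA M0 Lv').
apply: (nrm_le_bound mA ler01 (L2_measurable Ld) (L2_lc mA (-1) Lv Lv')).
move=> x _; rewrite mul1r /lcf /= !mulN1r -!(addrC _ (- _)) [leRHS]distrC distrC.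
exact: sinf_lip.
Qed.

Lemma L2_approx_bounded q (e : R) : L2 Omega q -> 0 < e ->
  exists b B, [/\ L2 Omega b, 0 <= B, forall x, Omega x -> `|b x| <= B & nO (lcf (-1) b q) <= e].
Proof.
move=> Lq e0; have [phi tphi h] := test_function_dense mO oO (@subset_refl _ _) lO Lq e0.
have cphi := smooth_continuous (test_function_smooth tphi).
have [B B0 hB] := continuous_bounded rho cphi.
by exists phi, B; split=> //; [exact: L2_smooth bO _ _|move=> x /bO; exact: hB].
Qed.

Lemma L2vec_approx_bounded (w : E -> E) (e : R) : L2vec Omega w -> 0 < e ->
  exists (b : 'I_n.+1 -> E -> R) B, [/\ forall i, L2 Omega (b i), 0 <= B,
    forall i x, Omega x -> `|b i x| <= B & forall i, nO (lcf (-1) (b i) (comp_rV w i)) <= e].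
Proof.
move=> Lw e0.
have /choice[b hb] : forall i, exists b, exists B, [/\ L2 Omega b, 0 <= B,
    forall x, Omega x -> `|b x| <= B & nO (lcf (-1) b (comp_rV w i)) <= e].
  by move=> i; exact: L2_approx_bounded (Lw i) e0.
have /choice[B hB] := hb.
have B0 i : 0 <= B i by have [] := hB i.
exists b, (\sum_i B i); split=> [i||i x Ox|i]; try by have [] := hB i.
  exact: sumr_ge0.
have [_ _ h _] := hB i; rewrite (le_trans (h x Ox))// (bigD1 i)//= lerDl.
by apply: sumr_ge0.
Qed.

Lemma measurable_comp_cos (A : set E) M v : measurable_fun A v ->
  measurable_fun A (fun x => cos (v x / M)).
Proof.
move=> mv; apply: (measurableT_comp (continuous_measurable_fun (@continuous_cos R))).
exact: measurable_funM.
Qed.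

Lemma L2vec_cosM (M : R) v (w : E -> E) : L2 Omega v -> L2vec Omega w ->
  L2vec Omega (fun x => cos (v x / M) *: w x).
Proof.
move=> Lv Lw i; rewrite (_ : (fun x => _) = (fun x => cos (v x / M) * comp_rV w i x)); last first.
  by apply/funext => x; rewrite /comp_rV mxE.
apply: (L2_le_bound mO (C := 1) _ (Lw i)).
  by apply: measurable_funM; [exact: measurable_comp_cos (L2_measurable Lv)|case: (Lw i)].
by move=> x _; rewrite normrM mul1r ler_piMl// ler_norml cos_geN1 cos_le1.
Qed.

(** The difference of the gradients contains (cos(v/M) - cos(phi/M)) w with w the gradient of v. The
    cosine factor is controlled by |phi - v| / M, which helps only against a bounded function, so w
    is split into a bounded part and a remainder of small norm. *)
Lemma sinf_close M v (e : R) : 0 < M -> H1 Omega v -> 0 < e ->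
  exists2 d, 0 < d & forall phi, smooth phi -> h1 (lcf (-1) phi v) <= d ->
    nO (lcf (-1) (sinf M 0 \o phi) (sinf M 0 \o v)) <= e /\
    forall i, nO (lcf (-1) (comp_rV (grad (sinf M 0 \o phi)) i)
      (comp_rV (fun x => cos (v x / M) *: wgrad Omega v x) i)) <= e.
Proof.
move=> M0 Hv e0; have Lv := H1_L2 Hv; have Lw := wgrad_L2 Hv.
set w := wgrad Omega v in Lw *.
have Lcw := L2vec_cosM M Lv Lw.
have e8 : 0 < e / 8 by rewrite divr_gt0.
have [b [B [Lb B0 hB bw]]] := L2vec_approx_bounded Lw e8.
(* This makes both d and (B / M) * d at most e / 4; the remainder of w, with norm e / 8 and factor
   2, gives another e / 4. *)
pose d := e / 4 / (1 + B / M).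
have D0 : 0 < 1 + B / M by rewrite ltr_wpDr// divr_ge0// ltW.
have d0 : 0 < d by rewrite !divr_gt0.
exists d => // phi sphi hphi.
have Hphi := H1_smooth oO bO sphi; have Lphi := H1_L2 Hphi.
have Hd := sip_lc S1 (-1) Hphi Hv.
have dle : d <= e / 4.
  by rewrite /d ler_pdivrMr// ler_peMr ?divr_ge0 ?(ltW e0)// lerDl divr_ge0// ltW.
have dB : B / M * d <= e / 4.
  rewrite /d mulrA ler_pdivrMr// [leRHS]mulrC ler_wpM2r ?divr_ge0 ?(ltW e0)// lerDr//.
have Lg i : L2 Omega (comp_rV (grad phi) i) := (is_wgrad_smooth oO bO sphi).1 i.
have ssp : smooth (sinf M 0 \o phi) := smooth_comp (is_derive_sinf M) sphi.
split=> [|i].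
  rewrite (le_trans (nrm_sinf_le _ _ _ _))// (le_trans (nO_le_h1 oO bO Hd))//.
  by rewrite (le_trans hphi)// (le_trans dle)//; lra.
have gE : comp_rV (grad (sinf M 0 \o phi)) i = (fun x => cos (phi x / M) * partial i phi x).
  apply/funext => x; rewrite /comp_rV /grad mxE (partial_comp _ _ (is_derive_sinf M))//.
  by rewrite sinf1 ?gt_eqF.
have [] := @nrm_le3 lambda Omega (lcf (-1) (comp_rV (grad (sinf M 0 \o phi)) i)
    (comp_rV (fun x => cos (v x / M) *: w x) i))
  (lcf (-1) (comp_rV (grad phi) i) (comp_rV w i)) (lcf (-1) (b i) (comp_rV w i))
  (lcf (-1) phi v) 2 (B / M) mO.
- apply: L2_measurable; apply: (L2_lc mO) (Lcw i).
  exact: (is_wgrad_smooth oO bO ssp).1 i.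
- exact: (L2_lc mO _ (Lg i) (Lw i)).
- exact: (L2_lc mO _ (Lb i) (Lw i)).
- exact: (L2_lc mO _ Lphi Lv).
- by [].
- by rewrite divr_ge0// ltW.
- move=> x Ox; rewrite gE /lcf /comp_rV mxE /grad mxE -/(comp_rV w i x) !mulN1r.
  set p := partial i phi x; set y := comp_rV w i x.
  have -> : - (cos (phi x / M) * p) + cos (v x / M) * y =
     cos (phi x / M) * (- p + y) + (cos (v x / M) - cos (phi x / M)) * ((- b i x + y) + b i x).
    by ring.
  rewrite [_ * (_ + b i x)]mulrDr addrA.
  have c1 (t : R) : `|cos t| <= 1 by rewrite ler_norml cos_geN1 cos_le1.
  rewrite (le_trans (ler_normD _ _))// lerD//.
    rewrite (le_trans (ler_normD _ _))// !normrM lerD ?ler_piMl//.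
    rewrite ler_wpM2r// (le_trans (ler_normB _ _))//.
    by have := c1 (v x / M); have := c1 (phi x / M); lra.
  rewrite normrM (mulrC B) -mulrA mulrC.
  apply: (le_trans (ler_pM _ _ (hB i x Ox) (cosM_lip _ _ M0))) => //.
  by rewrite (addrC (- phi x)) [leRHS]mulrCA (mulrC M^-1).
move=> _ h; apply: (le_trans h).
have i1 : nO (lcf (-1) (comp_rV (grad phi) i) (comp_rV w i)) <= d.
  have [Hl El] := H1_lc oO bO (-1) Hphi Hv.
  have Ll : L2vec Omega (lcv (-1) (grad phi) w) by apply: L2vec_lc => //; exact: Lg.
  have := comp_nrm_le oO i Ll; rewrite comp_lcv => /le_trans; apply.
  apply: le_trans hphi; apply: le_trans (wgrad_le_h1 oO bO Hd).
  have := is_wgrad_lc oO bO (-1) Lphi Lv (is_wgrad_smooth oO bO sphi) (wgradP Hv) => /(is_wgradP oO bO (L2_lc mO (-1) Lphi Lv))[_ Eg].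
  rewrite /snorm (ipvec_ae oO Ll (wgrad_L2 Hd) Ll (wgrad_L2 Hd))//; exact: ae_eq_sym.
have i2 := bw i.
have i3 : nO (lcf (-1) phi v) <= d by exact: le_trans (nO_le_h1 oO bO Hd) hphi.
have B1 : 0 <= B / M by rewrite divr_ge0// ltW.
have i3' := le_trans (ler_wpM2l B1 i3) dB.
have i2' := ler_wpM2l (ler0n R 2) i2.
apply: (le_trans (lerD (lerD (le_trans i1 dle) i2') i3')); lra.
Qed.

Lemma is_wgrad_sinf M v : 0 < M -> H1 Omega v ->
  is_wgrad Omega (sinf M 0 \o v) (fun x => cos (v x / M) *: wgrad Omega v x).
Proof.
move=> M0 Hv; have Lv := H1_L2 Hv; have Lw := wgrad_L2 Hv.
apply: (is_wgrad_lim oO bO (L2_sinf mO M0 Lv) (L2vec_cosM M Lv Lw)) => e e0.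
have [d d0 hd] := sinf_close M0 Hv e0.
have [phi sphi hphi] := smooth_dense_H1 oO bO lip Hv d0.
have [h2 h3] := hd phi sphi hphi.
exists (sinf M 0 \o phi), (grad (sinf M 0 \o phi)); split=> //.
- exact: (L2_sinf mO M0 (H1_L2 (H1_smooth oO bO sphi))).
- exact: (is_wgrad_smooth oO bO (smooth_comp (is_derive_sinf M) sphi)).
Qed.

Lemma H1_sinf M v : 0 < M -> H1 Omega v -> H1 Omega (sinf M 0 \o v).
Proof.
move=> M0 Hv; have := is_wgradP oO bO (L2_sinf mO M0 (H1_L2 Hv)) (is_wgrad_sinf M0 Hv).
by case.
Qed.

(** The errors of size v^2 / M in the function and |v| / M times the gradient are not integrable in
    the square as they stand. Bounded approximations of v and of its gradient replace one factor by
    a constant, and M is chosen last. *)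
Lemma sinf_approx v (e : R) : H1 Omega v -> 0 < e ->
  exists2 M, 0 < M & h1 (lcf (-1) (sinf M 0 \o v) v) <= e.
Proof.
move=> Hv e0; have Lv := H1_L2 Hv; have Lw := wgrad_L2 Hv.
set w := wgrad Omega v in Lw *.
pose c := e / (2 + n.+1%:R * 2).
have D0 : 0 < 2 + n.+1%:R * 2 :> R by rewrite ltr_wpDr// mulr_ge0.
have c0 : 0 < c by rewrite divr_gt0.
have c4 : 0 < c / 2 by rewrite divr_gt0.
have [b [B [Lb B0 hB bw]]] := L2vec_approx_bounded Lw c4.
have [b' [B' [Lb' B'0 hB' bv]]] := L2_approx_bounded Lv c4.
(* With M = N / c, both [M^-1 * B * nO v] and [M^-1 * B' * nO b'] are at most c. *)
pose N := B * nO v + B' * nO b' + 1.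
have v0 : 0 <= B * nO v by rewrite mulr_ge0// snorm_ge0.
have v0' : 0 <= B' * nO b' by rewrite mulr_ge0// snorm_ge0.
have N0 : 0 < N by rewrite ltr_wpDl// addr_ge0.
pose M := N / c; have M0 : 0 < M by rewrite divr_gt0.
have MN t : 0 <= t -> t <= N -> M^-1 * t <= c.
  move=> t0 tN; rewrite /M invf_div mulrAC ler_pdivrMr//; rewrite ler_wpM2l// ltW//.
exists M => //.
have Hd := sip_lc S1 (-1) (H1_sinf M0 Hv) Hv.
have [_ Eg] := is_wgradP oO bO (L2_lc mO (-1) (L2_sinf mO M0 Lv) Lv)
  (is_wgrad_lc oO bO (-1) (L2_sinf mO M0 Lv) Lv (is_wgrad_sinf M0 Hv) (wgradP Hv)).
have Lcw := (is_wgrad_sinf M0 Hv).1.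
have -> : e = 2 * c + n.+1%:R * (2 * c).
  by rewrite mulrA -mulrDl mulrC divfK// gt_eqF.
apply: (h1_le oO bO Hd Eg).
- exact: L2vec_lc.
- by rewrite mulr_ge0// ltW.
- by rewrite mulr_ge0// ltW.
- have [] := @nrm_le3 lambda Omega (lcf (-1) (sinf M 0 \o v) v) (fun=> 0) (lcf (-1) b' v) b' 2 (M^-1 * B') mO.
  + exact: L2_measurable (H1_L2 Hd).
  + exact: (L2_cst mO lO).
  + exact: (L2_lc mO).
  + exact: Lb'.
  + by [].
  + by rewrite mulr_ge0// invr_ge0 ltW.
  + move=> x Ox; rewrite /lcf /= !mulN1r normr0 add0r.
    have -> : - sinf M 0 (v x) + v x = (sinf M 0 (b' x) - sinf M 0 (v x)) +
       (- b' x + v x) - (sinf M 0 (b' x) - b' x) by ring.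
    rewrite (le_trans (ler_normB _ _))// lerD//.
      rewrite (le_trans (ler_normD _ _))// mulrDl mul1r lerD//.
      rewrite (le_trans (sinf_lip _ _ M0))// distrC addrC//.
    rewrite (le_trans (sinf_sub_le _ M0))// -normr_id -[X in X / _]real_normK ?num_real// expr2.
    rewrite normr_id mulrC -mulrA ler_wpM2l ?invr_ge0 ?(ltW M0)//.
    by rewrite ler_wpM2r// hB'.
  move=> _ h; apply: (le_trans h).
  rewrite [X in X + _ + _](_ : _ = 0); last first.
    rewrite /snorm /ip; under eq_Rintegral do rewrite mulr0.
    by rewrite /Rintegral integral0 sqrtr0.
  have h2 : M^-1 * B' * nO b' <= c by rewrite -mulrA MN// /N; move: v0; lra.
  by rewrite add0r; move: bv h2; lra.
move=> i; rewrite comp_lcv.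
have [] := @nrm_le3 lambda Omega (lcf (-1) (comp_rV (fun x => cos (v x / M) *: w x) i) (comp_rV w i))
  (fun=> 0) (lcf (-1) (b i) (comp_rV w i)) v 2 (M^-1 * B) mO.
+ apply: L2_measurable; apply: (L2_lc mO) (Lw i); exact: (Lcw i).
+ exact: (L2_cst mO lO).
+ exact: (L2_lc mO _ (Lb i) (Lw i)).
+ exact: Lv.
+ by [].
+ by rewrite mulr_ge0// invr_ge0 ltW.
+ move=> x Ox; rewrite /lcf /comp_rV mxE normr0 add0r -/(comp_rV w i x).
  set y := comp_rV w i x.
  have -> : -1 * (cos (v x / M) * y) + y = (1 - cos (v x / M)) * (-1 * b i x + y)
     + (1 - cos (v x / M)) * b i x by ring.
  rewrite (le_trans (ler_normD _ _))// !normrM lerD//.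
    rewrite ler_wpM2r// (le_trans (ler_normB _ _))// normr1.
    have : `|cos (v x / M)| <= 1 by rewrite ler_norml cos_geN1 cos_le1.
    lra.
  rewrite -mulrA mulrCA distrC mulrC ler_pM// ?hB//.
  rewrite (le_trans (cos_sub1_le _))// normrM mulrC (gtr0_norm (x := M^-1)) ?invr_gt0//.
move=> _ h; apply: (le_trans h).
rewrite [X in X + _ + _](_ : _ = 0); last first.
  rewrite /snorm /ip; under eq_Rintegral do rewrite mulr0.
  by rewrite /Rintegral integral0 sqrtr0.
have h2 : M^-1 * B * nO v <= c by rewrite -mulrA MN// /N; move: v0'; lra.
by rewrite add0r; move: (bw i) h2; lra.
Qed.

Lemma trace_sinf M v : 0 < M -> H1 Omega v ->
  ae_eq sigma bd (trace (sinf M 0 \o v)) (sinf M 0 \o trace v).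
Proof.
move=> M0 Hv; have Lv := trace_L2 oO bO lip simp Hv.
have Hs := H1_sinf M0 Hv; have Ls := L2_sinf mb M0 Lv.
apply: (is_trace_ae oO bO lip simp Hs); apply/(is_traceP oO bO Hs Ls) => e e0.
have D0 : 0 < 1 + n.+1%:R :> R by rewrite ltr_wpDl.
have e1 : 0 < e / (1 + n.+1%:R) by rewrite divr_gt0.
have [d d0 hd] := sinf_close M0 Hv e1.
have m0 : 0 < Num.min d e by rewrite lt_min d0.
have [phi [sphi p1 p2]] := (is_traceP oO bO Hv Lv).1 (traceP oO bO lip simp Hv) _ m0.
have Hphi := H1_smooth oO bO sphi; have Lphi := L2b_smooth T bO sphi.
rewrite (snorm_sym S1 Hv Hphi) in p1.
have [|h2 h3] := hd phi sphi; first by rewrite (le_trans p1)// ge_min lexx.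
have ssp : smooth (sinf M 0 \o phi) := smooth_comp (is_derive_sinf M) sphi.
exists (sinf M 0 \o phi); split; first exact: ssp.
- have Hsp := H1_smooth oO bO ssp; rewrite (snorm_sym S1 Hs Hsp).
  have [Hl El] := is_wgradP oO bO (L2_lc mO (-1) (H1_L2 Hsp) (H1_L2 Hs))
    (is_wgrad_lc oO bO (-1) (H1_L2 Hsp) (H1_L2 Hs) (is_wgrad_smooth oO bO ssp) (is_wgrad_sinf M0 Hv)).
  have -> : e = e / (1 + n.+1%:R) + n.+1%:R * (e / (1 + n.+1%:R)).
    by rewrite -{1}(mul1r (e / _)) -mulrDl mulrC divfK// gt_eqF.
  apply: (h1_le oO bO Hl El) => //; [|exact: ltW|exact: ltW|by move=> i; rewrite comp_lcv; exact: h3].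
  apply: L2vec_lc => //; first exact: (is_wgrad_smooth oO bO ssp).1.
  exact: (is_wgrad_sinf M0 Hv).1.
- apply: (le_trans (nrm_sinf_le mb M0 Lv Lphi)).
  by rewrite (le_trans p2)// ge_min lexx orbT.
Qed.

End truncation.

(** * Bounded functions and cutoffs *)

Section Linf.
Context {R : realType} {n : nat}.
Local Notation E := 'rV[R]_n.+1.
Variables (mu : {measure set E -> \bar R}) (G : set E).
Hypothesis mG : measurable G.
Hypothesis muG : (mu G < +oo)%E.
Implicit Types (q u v w : E -> R).
Local Notation L2s := (Lp mu G 2%:E).
Local Notation nrm := (snorm (ip mu G)).

Definition N1 w : R := \int[mu]_(x in G) `|w x|.

Lemma Lpnorm_ge0 p w : 0 <= Lpnorm mu G p w.
Proof. by apply: fine_ge0; exact: Lnorm_ge0. Qed.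

Lemma Lpnorm1E w : Lpnorm mu G 1%:E w = N1 w.
Proof.
rewrite /Lpnorm /eLpnorm Lnorm1 /N1 /Rintegral [in RHS]integral_mkcond; congr fine.
apply: eq_integral => x _; rewrite /= !patchE; case: ifP => //= _; by rewrite normr0.
Qed.

Lemma Linf_ae q : Lp mu G +oo%E q ->
  \forall x \ae mu, G x -> `|q x| <= Lpnorm mu G +oo%E q.
Proof.
move=> [mq]; have := Lnorm_ge0 mu +oo%E (EFin \o (q \_ G)).
rewrite /Lpnorm /eLpnorm unlock; case: ifPn => [_ h0 hoo|mu0 _ _].
  have fE : (fine (ess_sup mu (abse \o (EFin \o q \_ G))))%:E = ess_sup mu (abse \o (EFin \o q \_ G)).
    by apply: fineK; rewrite ge0_fin_numE.
  have := ess_sup_ge mu (abse \o (EFin \o q \_ G)).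
  by apply: filterS => x; rewrite -fE /= lee_fin => h Gx; move: h; rewrite patchE mem_set.
(* By definition the essential norm is 0 when the whole measure vanishes; then every property holds
   almost everywhere. *)
exists setT; split=> //; apply/eqP; rewrite eq_le measure_ge0 andbT leNgt//.
Qed.

Lemma Linf_bound q (c : R) : measurable_fun G q -> 0 <= c ->
  (\forall x \ae mu, G x -> `|q x| <= c) -> Lp mu G +oo%E q /\ Lpnorm mu G +oo%E q <= c.
Proof.
move=> mq c0 h.
have le : (eLpnorm mu G +oo%E q <= c%:E)%E.
  rewrite /eLpnorm unlock; case: ifPn => _; last by rewrite lee_fin.
  apply/ess_supP; apply: filterS h => x h /=; rewrite lee_fin patchE.
  by case: ifPn => [|_]; [rewrite inE => /h|rewrite normr0].
split; first by split=> //; rewrite (le_lt_trans le)// ltry.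
rewrite -lee_fin /Lpnorm fineK// ge0_fin_numE; last exact: Lnorm_ge0.
by rewrite (le_lt_trans le)// ltry.
Qed.

Lemma L2_ae_bounded q (c : R) : measurable_fun G q ->
  (\forall x \ae mu, G x -> `|q x| <= c) -> L2s q.
Proof.
move=> mq h; apply/L2P; split=> //.
apply: (@le_lt_trans _ _ (\int[mu]_(x in G) (c ^+ 2)%:E)%E).
  apply: ae_ge0_le_integral => //.
  - by move=> x _; rewrite lee_fin sqr_ge0.
  - exact: measurable_sqr.
  - by move=> x _; rewrite lee_fin sqr_ge0.
  - apply: filterS h => x h Gx; rewrite lee_fin -real_normK ?num_real//.
    by rewrite lerXn2r ?nnegrE ?h// (le_trans _ (h Gx)).
by rewrite integral_cst// lte_mul_pinfty// lee_fin sqr_ge0.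
Qed.

Lemma Linf_L2 q : Lp mu G +oo%E q -> L2s q.
Proof. by move=> Lq; apply: L2_ae_bounded (Linf_ae Lq); case: Lq. Qed.

Lemma L2_integrable1 w : L2s w -> mu.-integrable G (EFin \o w).
Proof.
move=> Lw; have := L2M mG Lw (L2_cst mG muG 1).
by apply: eq_integrable => // x _; rewrite /= mulr1.
Qed.

Lemma N1_le w : L2s w -> N1 w <= nrm w * nrm (fun=> 1).
Proof.
move=> Lw; apply: le_trans (ip_abs_le mG Lw (L2_cst mG muG 1)).
by rewrite /N1; under [leRHS]eq_Rintegral do rewrite mulr1.
Qed.

Lemma N1_ge0 w : 0 <= N1 w.
Proof. by apply: Rintegral_ge0. Qed.

Lemma N1_ae u v : measurable_fun G u -> measurable_fun G v -> ae_eq mu G u v -> N1 u = N1 v.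
Proof.
move=> mu' mv uv; rewrite /N1 /Rintegral; congr fine; apply: ae_eq_integral => //.
- by apply/measurable_EFinP; exact: measurableT_comp.
- by apply/measurable_EFinP; exact: measurableT_comp.
- by apply: filterS uv => x h Gx; rewrite h.
Qed.

Lemma N1_lc a u v : L2s u -> L2s v -> N1 (lcf a u v) <= `|a| * N1 u + N1 v.
Proof.
move=> Lu Lv; have iu := integrableRabs (L2_integrable1 Lu).
have iv := integrableRabs (L2_integrable1 Lv).
rewrite /N1 -RintegralZl// -RintegralD//; last exact: integrableRZ.
apply: le_Rintegral => //.
- by apply: integrableRabs => //; apply: L2_integrable1; exact: L2_lc.
- by apply: integrableRD => //; exact: integrableRZ.
- by move=> x _; rewrite /lcf (le_trans (ler_normD _ _))// normrM.
Qed.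

Lemma ip_abs_le_ae q w (c : R) : L2s q -> L2s w -> 0 <= c ->
  (\forall x \ae mu, G x -> `|q x| <= c) -> `|ip mu G q w| <= c * N1 w.
Proof.
move=> Lq Lw c0 h; have iw := integrableRabs (L2_integrable1 Lw).
have iqw := L2M mG Lq Lw.
rewrite /ip (le_trans (le_normr_Rintegral _ iqw))// /N1 -RintegralZl//.
rewrite /Rintegral fine_le//.
- by apply: integrable_fin_num => //; exact: integrableRabs.
- by apply: integrable_fin_num => //; exact: integrableRZ.
apply: ae_ge0_le_integral => //.
- by have /integrableP[] := integrableRabs iqw.
- by move=> x _; rewrite lee_fin mulr_ge0.
- by have /integrableP[] := integrableRZ mG c iw.
- by apply: filterS h => x h Gx; rewrite lee_fin normrM ler_wpM2r// h.
Qed.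

Lemma holder_ip q w : Lp mu G +oo%E q -> L2s w ->
  `|ip mu G q w| <= Lpnorm mu G +oo%E q * N1 w.
Proof.
move=> Lq Lw; apply: ip_abs_le_ae (Lpnorm_ge0 _ _) (Linf_ae Lq) => //.
exact: Linf_L2.
Qed.

End Linf.

Section supported.
Context {R : realType} {n : nat}.
Local Notation E := 'rV[R]_n.+1.
Local Notation lambda := (leb n.+1 : {measure set E -> \bar R}).

Lemma nrm_supported (A N : set E) (f : E -> R) (c a : R) : measurable A -> measurable N ->
  measurable_fun A f -> 0 <= c -> (lambda N <= a%:E)%E ->
  (forall x, A x -> `|f x| <= c) -> (forall x, A x -> ~ N x -> f x = 0) ->
  Lp lambda A 2%:E f /\ ip lambda A f f <= c ^+ 2 * a.
Proof.
move=> mA mN mf c0 Na fc f0.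
have le : (\int[lambda]_(x in A) (f x ^+ 2)%:E <= (c ^+ 2 * a)%:E)%E.
  apply: (@le_trans _ _ (\int[lambda]_(x in N) (c ^+ 2)%:E)%E); last first.
    by rewrite integral_cst// [leRHS]EFinM lee_wpmul2l// lee_fin sqr_ge0.
  rewrite integral_mkcond [leRHS]integral_mkcond; apply: ge0_le_integral => //.
  - by move=> x _; rewrite patchE; case: ifP => // _; rewrite lee_fin sqr_ge0.
  - by apply: (measurable_restrictT _ mA).1; exact: measurable_sqr.
  - by apply: (measurable_restrictT _ mN).1; exact: measurable_cst.
  move=> x _; rewrite !patchE; case: ifPn => [|_]; last by case: ifP => // _; rewrite lee_fin sqr_ge0.
  rewrite inE => Ax; case: ifPn; rewrite ?inE ?notin_setE => Nx.
    by rewrite lee_fin -real_normK ?num_real// lerXn2r ?nnegrE ?fc.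
  by rewrite f0// expr0n.
have Lf : Lp lambda A 2%:E f by apply/L2P; split=> //; rewrite (le_lt_trans le)// ltry.
by split=> //; move: le; rewrite L2_fin// lee_fin.
Qed.

End supported.

(** * Logarithmic cutoffs around sets of codimension 2 *)

Section cutoff.
Context {R : realType} {n : nat}.
Local Notation E := 'rV[R]_n.+1.
Local Notation lambda := (leb n.+1 : {measure set E -> \bar R}).
Variables (S : set E) (rho C : R).
Hypothesis Sb : forall x, S x -> `|x| <= rho.
Hypothesis C0 : 0 <= C.

Definition tube (eps : R) : set E := \bigcup_(x in S) ball x eps.

Hypothesis hS : forall eps : R, 0 < eps <= 1 -> (lambda (tube eps) <= (C * eps ^+ 2)%:E)%E.

Lemma tube_open eps : open (tube eps).
Proof. by apply: bigcup_open => x _; exact: ball_open_rV. Qed.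

Lemma tube_measurable eps : measurable (tube eps).
Proof. by apply: open_measurable_rV; exact: tube_open. Qed.

Lemma tube_le eps x : tube eps x -> `|x| <= rho + eps.
Proof.
move=> [y /Sb ys]; rewrite -ball_normE /= => h.
by rewrite -(subrK y x) (le_trans (ler_normD _ _))// addrC lerD// distrC ltW.
Qed.

Lemma tube_ball eps d x : tube eps x -> ball x d `<=` tube (eps + d).
Proof.
move=> [y Sy yx] z xz; exists y => //; move: yx xz; rewrite -!ball_normE /= => yx xz.
by rewrite -(subrKA x) (le_lt_trans (ler_normD _ _))// ltrD.
Qed.

Lemma tube_ballN eps d x z : ~ tube (eps + d) x -> ball x d z -> ~ tube eps z.
Proof.
move=> nx xz tz; apply: nx; apply: (tube_ball tz).
by rewrite -ball_normE /= distrC; move: xz; rewrite -ball_normE.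
Qed.

Lemma tube_mono eps d : eps <= d -> tube eps `<=` tube d.
Proof. by move=> ed x [y Sy h]; exists y => //; exact: le_ball h. Qed.

(** The tube of radius 2 eps is mollified at scale eps, so the cutoff is already 0 outside the tube
    of radius 3 eps. The margin up to 4 eps makes the derivatives vanish too, and the ratio 4 fits
    consecutive scales together. *)
Lemma tube_cutoff : exists2 C1 : R, 0 <= C1 & forall eps : R, 0 < eps -> exists zeta : E -> R,
  [/\ smooth zeta, forall x, 0 <= zeta x <= 1,
      forall x, tube eps x -> zeta x = 1 /\ forall i, partial i zeta x = 0,
      forall x, ~ tube (4 * eps) x -> zeta x = 0 /\ forall i, partial i zeta x = 0 &
      forall i x, `|partial i zeta x| <= C1 / eps].
Proof.
have [C1 C10 hC1] := @smooth_cutoff R n; exists C1 => // eps eps0.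
have [|z [sz z01 z1 z0 dz]] := hC1 (tube (2 * eps)) eps (rho + 2 * eps) (tube_measurable _) _ eps0.
  by move=> x; exact: tube_le.
have one x : tube eps x -> z x = 1.
  move=> tx; apply: z1; have := @tube_ball eps eps x tx.
  by rewrite (_ : eps + eps = 2 * eps)//; ring.
have zero x : ~ tube (3 * eps) x -> z x = 0.
  move=> tx; apply: z0 => y xy; apply: tube_ballN xy.
  by rewrite (_ : _ + eps = 3 * eps)//; ring.
exists z; split=> // x tx; split=> [|i].
- exact: one.
- rewrite (@partial_near _ _ _ (fun=> 1)) ?partial_cst//.
  have := @tube_open eps; rewrite openE => /(_ _ tx); apply: filterS => y; exact: one.
- by apply: zero => h; apply: tx; apply: tube_mono h; rewrite ler_wpM2r ?(ltW eps0)// ler_nat.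
- rewrite (@partial_near _ _ _ (fun=> 0)) ?partial_cst//.
  apply/nbhs_ballP; exists eps => //= y xy; apply: zero; apply: tube_ballN xy.
  by rewrite (_ : _ + eps = 4 * eps)//; ring.
Qed.

Variables (A : set E).
Hypothesis mA : measurable A.

(* Averaging k + 1 cutoffs at the scales 4^-J, 4^-(J + 1), ... divides the squared
   norm of the gradient by k + 1, since these gradients have disjoint supports:
   sets of codimension 2 have zero capacity. *)
Lemma log_cutoff : exists2 Q : R, 0 <= Q & forall (J k : nat), exists eta : E -> R,
  [/\ smooth eta, forall x, 0 <= eta x <= 1,
      exists2 eps, 0 < eps & forall x, tube eps x -> eta x = 0,
      forall x, ~ tube (4 ^- J) x -> eta x = 1 &
      forall i, Lp lambda A 2%:E (partial i eta) /\
        ip lambda A (partial i eta) (partial i eta) <= Q / k.+1%:R].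
Proof.
have [C1 C10 hC1] := tube_cutoff.
have /choice[ze hze] : forall j : nat, exists zeta : E -> R,
  [/\ smooth zeta, forall x, 0 <= zeta x <= 1,
      forall x, tube (4 ^- j.+1) x -> zeta x = 1 /\ forall i, partial i zeta x = 0,
      forall x, ~ tube (4 ^- j) x -> zeta x = 0 /\ forall i, partial i zeta x = 0 &
      forall i x, `|partial i zeta x| <= C1 / 4 ^- j.+1].
  move=> j; have p0 : 0 < 4 ^- j.+1 :> R by rewrite invr_gt0 exprn_gt0.
  have [z] := hC1 _ p0; exists z.
  by rewrite (_ : 4 ^- j = 4 * 4 ^- j.+1)// exprS invfM mulrA divff ?mul1r// pnatr_eq0.
have p1 j : 0 < (4 ^- j : R) <= 1.
  by rewrite invr_gt0 exprn_gt0//= invf_le1 ?exprn_gt0// exprn_ege1// ler1n.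
have sze j : smooth (ze j) by have [] := hze j.
have dec i j : (i <= j)%N -> 4 ^- j <= 4 ^- i :> R.
  by move=> ij; rewrite lef_pV2 ?posrE ?exprn_gt0// ler_weXn2l// ler1n.
(* The square of the gradient bound 4 C1 / 4^-j times the volume C (4^-j)^2 of the tube. Codimension
   2 is exactly what makes this independent of the scale. *)
pose Q := 16 * C1 ^+ 2 * C; have Q0 : 0 <= Q by rewrite !mulr_ge0// sqr_ge0.
have dzQ j i : Lp lambda A 2%:E (partial i (ze j)) /\ ip lambda A (partial i (ze j)) (partial i (ze j)) <= Q.
  have [_ _ _ h0 hd] := hze j.
  have /andP[pj0 pj1] := p1 j; have /andP[pk0 _] := p1 j.+1.
  have [|||||Lf] := @nrm_supported R n A (tube (4 ^- j)) (partial i (ze j)) (C1 / 4 ^- j.+1) (C * (4 ^- j) ^+ 2) mA (tube_measurable _).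
  - by apply: measurable_funTS; exact: continuous_measurable_rV (smooth_continuous (smooth_partial i (sze j))).
  - by rewrite divr_ge0// ltW.
  - exact: hS.
  - by move=> x _; exact: hd.
  - by move=> x _ /h0[_]; exact.
  move=> le; split=> //; rewrite (le_trans le)// le_eqVlt; apply/orP; left; apply/eqP.
  have gen (a : R) : 0 < a -> (C1 / (4^-1 * a)) ^+ 2 * (C * a ^+ 2) = Q.
    by move=> a0; rewrite /Q; field; rewrite gt_eqF.
  by rewrite (exprS (4 : R) j) invfM gen.
exists Q => // J k.
pose Z m x := \sum_(j < m) ze (J + j)%N x.
have sZ m : smooth (Z m) by apply: smooth_sum => j.
have ZS m : Z m.+1 = fun x => Z m x + ze (J + m)%N x.
  by apply/funext => x; rewrite /Z big_ord_recr.
have dZS m i x : partial i (Z m.+1) x = partial i (Z m) x + partial i (ze (J + m)%N) x.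
  by rewrite ZS partialD.
(* Where the gradient of the next cutoff may be nonzero, all earlier ones are constant. The cross
   terms therefore vanish and the squared norms add up. *)
have dZ0 m i x : tube (4 ^- (J + m)) x -> partial i (Z m) x = 0.
  elim: m => [|m IH] tx.
    by rewrite (_ : Z 0%N = fun=> 0) ?partial_cst//; apply/funext => y; rewrite /Z big_ord0.
  rewrite dZS IH; last by apply: tube_mono tx; apply: dec; rewrite leq_add2l.
  have [_ _ h1 _ _] := hze (J + m)%N; rewrite add0r.
  by rewrite addnS in tx; exact: (h1 x tx).2 i.
have dZQ m i : Lp lambda A 2%:E (partial i (Z m)) /\
    ip lambda A (partial i (Z m)) (partial i (Z m)) <= m%:R * Q.
  elim: m => [|m [L1 IH]].
    have -> : partial i (Z 0%N) = fun=> 0.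
      rewrite (_ : Z 0%N = fun=> 0); first by apply/funext => x; rewrite partial_cst.
      by apply/funext => y; rewrite /Z big_ord0.
    have i0 : (\int[lambda]_(x in A) ((0 : R) ^+ 2)%:E = 0)%E.
      by under eq_integral do rewrite expr0n; rewrite integral0.
    split; first by apply/L2P; rewrite i0.
    by rewrite mul0r /ip; under eq_Rintegral do rewrite mulr0; rewrite /Rintegral integral0.
  have [L2 IH2] := dzQ (J + m)%N i.
  have SA := sip_ip lambda mA.
  have -> : partial i (Z m.+1) = lcf 1 (partial i (Z m)) (partial i (ze (J + m)%N)).
    by apply/funext => x; rewrite dZS /lcf mul1r.
  split; first exact: L2_lc.
  rewrite (sip_lcE SA)// expr1n mul1r.
  have -> : ip lambda A (partial i (Z m)) (partial i (ze (J + m)%N)) = 0.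
    rewrite /ip (_ : (fun x => _) = fun=> 0); first by rewrite /Rintegral integral0.
    apply/funext => x; have [tx|ntx] := pselect (tube (4 ^- (J + m)) x).
      by rewrite dZ0// mul0r.
    by have [_ _ _ h0 _] := hze (J + m)%N; have [_ ->] := h0 _ ntx; rewrite mulr0.
  by rewrite mulr0 addr0 -natr1 mulrDl mul1r lerD.
have k0 : 0 < k.+1%:R :> R by [].
exists (fun x => 1 - k.+1%:R^-1 * Z k.+1 x).
have Z01 x : 0 <= Z k.+1 x <= k.+1%:R.
  have z01 (j : 'I_k.+1) : 0 <= ze (J + j)%N x <= 1 by have [_ h _ _ _] := hze (J + j)%N.
  apply/andP; split; first by apply: sumr_ge0 => j _; have /andP[] := z01 j.
  apply: (@le_trans _ _ (\sum_(j < k.+1) 1)); last by rewrite sumr_const card_ord.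
  by apply: ler_sum => j _; have /andP[] := z01 j.
split=> [|x||x ntx|i].
- by apply: smoothB; [exact: smooth_cst|exact: smoothZ].
- have /andP[z0 z1] := Z01 x; apply/andP; split.
    by rewrite subr_ge0 mulrC ler_pdivrMr// mul1r.
  by rewrite lerBlDr lerDl mulr_ge0// invr_ge0 ltW.
- exists (4 ^- (J + k).+1); first by have /andP[] := p1 (J + k).+1.
  move=> x tx; rewrite (_ : Z k.+1 x = k.+1%:R) ?mulVf ?gt_eqF// ?subrr//.
  rewrite /Z (eq_bigr (fun=> 1)) ?sumr_const ?card_ord// => j _.
  have [_ _ h1 _ _] := hze (J + j)%N; apply: (h1 x _).1.
  by apply: tube_mono tx; apply: dec; rewrite ltnS leq_add2l -ltnS.
- rewrite (_ : Z k.+1 x = 0) ?mulr0 ?subr0// /Z big1// => j _.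
  have [_ _ _ h0 _] := hze (J + j)%N; apply: (h0 x _).1 => h; apply: ntx.
  by apply: tube_mono h; apply: dec; rewrite leq_addr.
have [LZ hZ] := dZQ k.+1 i.
have E1 : partial i (fun x => 1 - k.+1%:R^-1 * Z k.+1 x) = lcf (- k.+1%:R^-1) (partial i (Z k.+1)) (fun=> 0).
  apply/funext => x; rewrite /lcf addr0.
  rewrite (_ : (fun x => _) = (fun x => 1 + (- k.+1%:R^-1) * Z k.+1 x)).
    by rewrite partialD ?partial_cst ?add0r ?partialZ//; [exact: smooth_cst|exact: smoothZ].
  by apply/funext => y; rewrite mulNr.
have E2 : lcf (- k.+1%:R^-1) (partial i (Z k.+1)) (fun=> 0) =
    lcf (- k.+1%:R^-1 - 1) (partial i (Z k.+1)) (partial i (Z k.+1)).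
  by apply/funext => x; rewrite /lcf; ring.
have SA := sip_ip lambda mA.
rewrite E1 E2; split; first exact: L2_lc.
rewrite (sip_lcE SA)//.
set D := ip _ _ _ _ in hZ *.
rewrite (_ : _ + _ + _ = k.+1%:R^-1 ^+ 2 * D); last by ring.
apply: le_trans (ler_wpM2l (sqr_ge0 _) hZ) _.
by rewrite le_eqVlt; apply/orP; left; apply/eqP; field; rewrite gt_eqF.
Qed.

End cutoff.

(** * Density of functions vanishing near the interface of G_I and G_N *)

Section interface.
Context {R : realType} {n : nat}.
Local Notation E := 'rV[R]_n.+1.
Local Notation lambda := (leb n.+1 : {measure set E -> \bar R}).
Variables (Omega : set E) (rho : R) (T : seq 'M[R]_n.+1) (G_I G_D G_N : set E).
Hypothesis oO : open Omega.
Hypothesis bO : forall x, Omega x -> `|x| <= rho.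
Hypothesis lip : lipschitz_boundary Omega.
Hypothesis simp : simplicial_boundary Omega T.
Hypothesis spl : boundary_splitting Omega G_I G_D G_N.
Implicit Types (phi psi eta u v w q f h : E -> R).
Local Notation h1 := (snorm (h1ip Omega)).
Local Notation nO := (snorm (ip lambda Omega)).
Local Notation sigma := (surface_measure T).
Local Notation bd := (bnd Omega).
Local Notation trace := (trace Omega T).
Local Notation H1_0 := (H1_0 Omega T).
Local Notation S := (closure G_I `&` closure G_N).

Let mO : measurable Omega := domain_measurable oO.
Let S1 := sip_h1ip oO bO.

Lemma relatively_open_sub G : relatively_open Omega G -> G `<=` bd.
Proof. by move=> [U _ ->] x []. Qed.

Lemma relatively_open_measurable G : relatively_open Omega G -> measurable G.
Proof.
by move=> [U oU ->]; apply: measurableI; [exact: open_measurable_rV|exact: bnd_measurable].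
Qed.

Lemma closed_bnd : closed bd.
Proof.
rewrite /bnd setDE; apply: closedI; first exact: closed_closure.
by apply: open_closedC; exact: open_interior.
Qed.

Lemma closure_sub_bnd G : G `<=` bd -> closure G `<=` bd.
Proof. by move=> Gb; rewrite [X in _ `<=` X](closure_id _).1; [exact: closure_subset|exact: closed_bnd]. Qed.

Section H1_0.
Variable G : set E.
Hypothesis Gb : G `<=` bd.

Lemma H1_0_lc a v v' : H1_0 G v -> H1_0 G v' -> H1_0 G (lcf a v v').
Proof.
move=> [Hv tv] [Hv' tv']; split; first exact: (sip_lc S1).
have := ae_eq_subset Gb (trace_lc oO bO lip simp a Hv Hv').
apply: filterS3 tv tv' => x h1 h2 h3 Gx.
by rewrite h3// /lcf h1// h2// mulr0 addr0.
Qed.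

Lemma H1_0M psi v : smooth psi -> H1_0 G v -> H1_0 G (fun x => psi x * v x).
Proof.
move=> spsi [Hv tv]; split; first exact: (H1M oO bO spsi Hv).
have := ae_eq_subset Gb (traceM oO bO lip simp spsi Hv).
by apply: filterS2 tv => x h1 h2 Gx; rewrite h2// h1// mulr0.
Qed.

Lemma H1_0_sinf M v : 0 < M -> H1_0 G v -> H1_0 G (sinf M 0 \o v).
Proof.
move=> M0 [Hv tv]; split; first exact: (H1_sinf oO bO lip M0 Hv).
have := ae_eq_subset Gb (trace_sinf oO bO lip simp M0 Hv).
by apply: filterS2 tv => x h1 h2 Gx; rewrite h2//= h1// sinf0 mul0r sin0 mulr0.
Qed.

Lemma H1_0_smooth phi : smooth phi -> (forall x, G x -> phi x = 0) -> H1_0 G phi.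
Proof.
move=> sphi p0; split; first exact: H1_smooth bO _ _.
have := ae_eq_subset Gb (trace_smooth oO bO lip simp sphi).
by apply: filterS => x h Gx; rewrite h// p0.
Qed.

Lemma H1_0_cut psi v : smooth psi -> H1 Omega v -> (forall x, G x -> psi x = 0) ->
  H1_0 G (fun x => psi x * v x).
Proof.
move=> spsi Hv p0; split; first exact: (H1M oO bO spsi Hv).
have := ae_eq_subset Gb (traceM oO bO lip simp spsi Hv).
by apply: filterS => x h Gx; rewrite h// p0// mul0r.
Qed.

Lemma H1_0_H1 v : H1_0 G v -> H1 Omega v. Proof. by case. Qed.

End H1_0.

Lemma sqrt_le_of_sqr (x y : R) : 0 <= y -> x <= y ^+ 2 -> Num.sqrt x <= y.
Proof. by move=> y0 h; rewrite -[leRHS]ger0_norm// -sqrtr_sqr ler_wsqrtr. Qed.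

(** The gradient of eta * w - w is (eta - 1) grad w + w grad eta. The first term is small because
    eta differs from 1 on a thin tube only, which fixes J; the second is small because w is bounded
    and the gradient of eta tends to 0 in L^2 as k grows, which fixes k. *)
Lemma bounded_cutoff w (M e : R) : H1 Omega w -> 0 <= M -> (forall x, `|w x| <= M) -> 0 < e ->
  exists eta eps, [/\ smooth eta, 0 < eps, forall x, tube S eps x -> eta x = 0 &
    h1 (lcf (-1) (fun x => eta x * w x) w) <= e].
Proof.
move=> Hw M0 wM e0; have Lw := H1_L2 Hw; have Lg := wgrad_L2 Hw.
have Sb x : S x -> `|x| <= rho.
  move=> [/(closure_sub_bnd (relatively_open_sub (split_openI spl))) bx _].
  exact: (bnd_le bO bx).
have [C C0 hC] : exists2 C, 0 <= C & forall eps : R, 0 < eps <= 1 ->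
    (lambda (tube S eps) <= (C * eps ^+ 2)%:E)%E.
  have [C hC] := split_interface spl; exists `|C| => // eps /hC /le_trans; apply.
  by rewrite lee_fin ler_wpM2r ?sqr_ge0// ler_norm.
have [Q Q0 hQ] := log_cutoff Sb C0 hC mO.
pose d := e / (1 + n.+1%:R).
have D0 : 0 < 1 + n.+1%:R :> R by rewrite ltr_wpDl.
have d0 : 0 < d by rewrite divr_gt0.
have d4 : 0 < d / 4 by rewrite divr_gt0.
have [b [B [Lb B0 hB bw]]] := L2_approx_bounded oO bO Lw d4.
have [g [B' [Lgb B'0 hB' gw]]] := L2vec_approx_bounded oO bO Lg d4.
pose N := (B + B') * Num.sqrt C + 1.
have N0 : 0 < N by rewrite ltr_wpDl// mulr_ge0 ?sqrtr_ge0// addr_ge0.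
have [J hJ] : exists J, N * 4 ^- J <= d / 4.
  have [J hJ] := inv_succ_le (divr_gt0 d4 N0).
  exists J.+1; rewrite mulrC -ler_pdivlMr//; apply: le_trans (hJ J (leqnn _)).
  rewrite lef_pV2 ?posrE ?exprn_gt0// -natrX ler_nat.
  by apply: ltnW; exact: ltn_expl.
pose t := d / 4 / (M + 1); have M1 : 0 < M + 1 by rewrite ltr_wpDl.
have t0 : 0 < t by rewrite divr_gt0.
have Q1 : 0 < Q + 1 by rewrite ltr_wpDl.
have t2 : 0 < t ^+ 2 / (Q + 1) by rewrite divr_gt0// exprn_gt0.
have [k hk] := inv_succ_le t2.
have [eta [seta eta01 [eps eps0 heps] eta1 deta]] := hQ J k.
exists eta, eps; split=> //.
have me : measurable_fun Omega (fun x => 1 - eta x).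
  apply: measurable_funTS; apply: measurable_funB => //.
  exact: continuous_measurable_rV (smooth_continuous seta).
have pJ : 0 < (4 ^- J : R) <= 1.
  by rewrite invr_gt0 exprn_gt0//= invf_le1 ?exprn_gt0// exprn_ege1// ler1n.
have e1 x : `|1 - eta x| <= 1.
  by have /andP[a0 a1] := eta01 x; rewrite ler_norml; apply/andP; split; lra.
have [] := @nrm_supported R n Omega (tube S (4 ^- J)) (fun x => 1 - eta x) 1 (C * (4 ^- J) ^+ 2)
   mO (tube_measurable _ _) me ler01 (hC _ pJ).
- by move=> x _; exact: e1.
- by move=> x _ /eta1 ->; rewrite subrr.
rewrite expr1n mul1r => Le ne.
have ne' : nO (fun x => 1 - eta x) <= Num.sqrt C * 4 ^- J.
  apply: sqrt_le_of_sqr; first by rewrite mulr_ge0 ?sqrtr_ge0//; case/andP: pJ => /ltW.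
  by rewrite exprMn sqr_sqrtr.
have nB (c : R) : 0 <= c -> c <= B + B' -> c * nO (fun x => 1 - eta x) <= d / 4.
  move=> c0 cB; apply: le_trans hJ; apply: le_trans (ler_wpM2l c0 ne') _.
  rewrite mulrA ler_wpM2r//.
  by rewrite (le_trans (ler_wpM2r (sqrtr_ge0 C) cB))// lerDl.
have nd i : nO (partial i eta) <= t.
  have [_ h] := deta i; apply: sqrt_le_of_sqr; first exact: ltW.
  apply: (le_trans h); apply: le_trans (ler_wpM2l Q0 (hk k (leqnn _))) _.
  rewrite mulrC mulrAC ler_pdivrMr// ler_wpM2l ?sqr_ge0// lerDl//.
have IG := is_wgradM oO bO seta Lw (wgradP Hw).
have Lew := L2_smoothM oO bO (smooth_continuous seta) Lw.
have [Hd El] := is_wgradP oO bO (L2_lc mO (-1) Lew Lw) (is_wgrad_lc oO bO (-1) Lew Lw IG (wgradP Hw)).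
have -> : e = d + n.+1%:R * d by rewrite -{1}(mul1r d) -mulrDl mulrC divfK// gt_eqF.
apply: (h1_le oO bO Hd El).
- by apply: L2vec_lc => //; case: IG.
- exact: ltW.
- exact: ltW.
- have [] := @nrm_le3 R n lambda Omega (lcf (-1) (fun x => eta x * w x) w) (lcf (-1) b w)
    (fun x => 1 - eta x) (fun x => 1 - eta x) B 0 mO.
  + exact: L2_measurable (H1_L2 Hd).
  + exact: (L2_lc mO).
  + exact: Le.
  + exact: Le.
  + exact: B0.
  + by [].
  + move=> x Ox; rewrite mul0r addr0 /lcf.
    have -> : -1 * (eta x * w x) + w x = (1 - eta x) * (-1 * b x + w x) + b x * (1 - eta x) by ring.
    rewrite (le_trans (ler_normD _ _))// lerD//; first by rewrite normrM ler_piMl.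
    by rewrite normrM ler_wpM2r// hB.
  move=> _ h; apply: (le_trans h); rewrite mul0r addr0.
  by have := nB B B0; rewrite lerDl => /(_ B'0); move: bw d0; lra.
move=> i; have [] := @nrm_le3 R n lambda Omega
    (comp_rV (lcv (-1) (fun x => eta x *: wgrad Omega w x + w x *: grad eta x) (wgrad Omega w)) i)
    (lcf (-1) (g i) (comp_rV (wgrad Omega w) i)) (fun x => 1 - eta x) (partial i eta) B' M mO.
+ by apply: L2_measurable; apply: L2vec_lc => //; case: IG.
+ exact: (L2_lc mO _ (Lgb i) (Lg i)).
+ exact: Le.
+ by case: (deta i).
+ exact: B'0.
+ exact: M0.
+ move=> x Ox; rewrite comp_lcv /lcf; set y := comp_rV (wgrad Omega w) i x.
  have -> : comp_rV (fun x => eta x *: wgrad Omega w x + w x *: grad eta x) i x =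
      eta x * y + w x * partial i eta x.
    by rewrite /y /comp_rV /grad mxE [in LHS]mxE [X in _ + X]mxE mxE.
  have -> : -1 * (eta x * y + w x * partial i eta x) + y =
    (1 - eta x) * (-1 * g i x + y) + g i x * (1 - eta x) - w x * partial i eta x by ring.
  rewrite (le_trans (ler_normB _ _))// lerD//; last by rewrite normrM ler_wpM2r.
  rewrite (le_trans (ler_normD _ _))// lerD//; first by rewrite normrM ler_piMl.
  by rewrite normrM ler_wpM2r// hB'.
move=> _ h; apply: (le_trans h).
have h2 := nB B' B'0; rewrite lerDr in h2; have h2' := h2 B0.
have h3 : M * nO (partial i eta) <= d / 4.
  apply: le_trans (ler_wpM2l M0 (nd i)) _; rewrite /t mulrCA ler_piMr ?(ltW d4)//.
  by rewrite ler_pdivrMr// mul1r lerDl.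
by move: (gw i) h2' h3 d0; lra.
Qed.

(** Density is phrased for a bounded linear functional. A function of H^1_D is truncated first,
    because the cutoff requires a bounded one; truncation and multiplication keep the zero trace on
    [G_D]. *)
Lemma interface_density (Lam : (E -> R) -> R) :
  (forall a v v', H1 Omega v -> H1 Omega v' -> Lam (lcf a v v') = a * Lam v + Lam v') ->
  (exists2 K, 0 <= K & forall v, H1 Omega v -> `|Lam v| <= K * h1 v) ->
  (forall v eta eps, H1_0 G_D v -> smooth eta -> 0 < eps ->
     (forall x, tube S eps x -> eta x = 0) -> Lam (fun x => eta x * v x) = 0) ->
  forall v, H1_0 G_D v -> Lam v = 0.
Proof.
move=> lin [K K0 hK] h0 v Hv.
have Db := relatively_open_sub (split_openD spl).
have Hv1 := H1_0_H1 Hv.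
apply/eqP; rewrite -normr_le0; apply/ler_addgt0Pr => e e0; rewrite add0r.
have K1 : 0 < 2 * K + 1 by rewrite ltr_wpDl// mulr_ge0.
pose d := e / (2 * K + 1); have d0 : 0 < d by rewrite divr_gt0.
have [M M0 hM] := sinf_approx oO bO lip Hv1 d0.
have Hs := H1_0_sinf Db M0 Hv; have Hs1 := H1_0_H1 Hs.
have [eta [eps [seta eps0 heps he]]] := bounded_cutoff Hs1 (ltW M0) (fun x => sinf_bound (v x) M0) d0.
have He := H1M oO bO seta Hs1.
have a1 := hK _ (sip_lc S1 (-1) Hs1 Hv1).
have a2 := hK _ (sip_lc S1 (-1) He Hs1).
rewrite !lin// (h0 _ _ _ Hs seta eps0 heps) mulr0 add0r in a1 a2.
have -> : Lam v = (-1 * Lam (sinf M 0 \o v) + Lam v) + Lam (sinf M 0 \o v) by ring.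
rewrite (le_trans (ler_normD _ _))//.
have b1 := le_trans a1 (ler_wpM2l K0 hM).
have b2 := le_trans a2 (ler_wpM2l K0 he).
apply: (le_trans (lerD b1 b2)); rewrite -mulrDl -mulr2n -(mulr_natl _ 2) /d mulrCA ler_piMr ?(ltW e0)//.
by rewrite ler_pdivrMr// mul1r lerDl.
Qed.

End interface.

(** * Normal fluxes *)

Section separation.
Context {R : realType} {n : nat}.
Local Notation E := 'rV[R]_n.+1.

Lemma separation (A B : set E) : compact A -> closed B -> A `&` B = set0 ->
  exists2 r : R, 0 < r & forall a b, A a -> B b -> ~ ball a r b.
Proof.
move=> cA cB AB0.
have [r r0 hr] : exists2 r : R, 0 < r & forall a b, A a -> B b -> ~ ball a r b.
  apply: (@compact_ind _ _ (fun A : set E => exists2 r : R, 0 < r &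
     forall a b, A a -> B b -> ~ ball a r b) cA).
  - by exists 1.
  - move=> A1 A2 [r1 r10 h1] [r2 r20 h2]; exists (Num.min r1 r2); first by rewrite lt_min r10.
    move=> a b [A1a|A2a] Bb ab; [apply: (h1 a b)|apply: (h2 a b)] => //;
      by apply: le_ball ab; rewrite ge_min lexx ?orbT.
  - by move=> A1 A2 A12 [r r0 h]; exists r => // a b /A12; exact: h.
  - move=> x Ax; have nBx : (~` B) x by move=> Bx; have : (A `&` B) x by []; rewrite AB0.
    have := closed_openC cB; rewrite openE => /(_ _ nBx)/nbhs_ballP[r /= r0 hr].
    exists (ball x (r / 2)); first exact: ball_open_rV.
    split; first by apply: ballxx; rewrite divr_gt0.
    exists (r / 2); first by rewrite divr_gt0.
    move=> a b xa Bb ab; apply: (hr b) => //; move: xa ab; rewrite -!ball_normE /= => xa ab.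
    by rewrite -(subrKA a) (le_lt_trans (ler_normD _ _))// [ltRHS]splitr ltrD.
by exists r.
Qed.

Lemma smooth_urysohn (A B : set E) (rho : R) : closed A -> (forall x, A x -> `|x| <= rho) ->
  closed B -> A `&` B = set0 ->
  exists psi, [/\ smooth psi, forall x, A x -> psi x = 1 & forall x, B x -> psi x = 0].
Proof.
move=> cA Ar cB AB0.
have cpA : compact A by apply: (subclosed_compact cA (@compact_le_norm R n rho)) => x /Ar.
have [r r0 hr] := separation cpA cB AB0.
have r2 : 0 < r / 2 by rewrite divr_gt0.
have [C _ hC] := @smooth_cutoff R n.
have [|psi [sp _ p1 p0 _]] := hC (tube A (r / 2)) (r / 2) (rho + r / 2) (tube_measurable _ _) _ r2.
  by move=> x; exact: tube_le.
exists psi; split=> // x Hx.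
  by apply: p1 => y xy; exists x.
apply: p0 => y xy; apply: (tube_ballN _ xy) => -[a Aa].
by rewrite -splitr; exact: hr.
Qed.

End separation.

(** * Representation of bounded functionals on test functions *)

Section riesz.
Context {R : realType} {n : nat}.
Local Notation E := 'rV[R]_n.+1.
Variables (mu : {measure set E -> \bar R}) (U A : set E).
Hypothesis mA : measurable A.
Hypothesis oU : open U.
Hypothesis AU : A `<=` U.
Hypothesis muA : (mu A < +oo)%E.
Implicit Types (phi psi q w : E -> R).
Local Notation L2s := (Lp mu A 2%:E).
Local Notation nrm := (snorm (ip mu A)).
Local Notation N1 := (N1 mu A).
Let Sm := sip_ip mu mA.

Variable L : (E -> R) -> R.
Hypothesis Llin : forall a phi psi, test_function U phi -> test_function U psi ->
  L (lcf a phi psi) = a * L phi + L psi.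

Let tL2 phi : test_function U phi -> L2s phi.
Proof. exact: L2_test_function. Qed.

(** The quadratic functional J is minimized over test functions: a minimizing sequence is Cauchy,
    and its limit in L^2 satisfies the Euler equation, which is the representation. *)
Lemma riesz_L2 c : 0 <= c -> (forall phi, test_function U phi -> `|L phi| <= c * nrm phi) ->
  exists2 w, L2s w & forall phi, test_function U phi -> L phi = ip mu A w phi.
Proof.
move=> c0 Lb.
pose J phi := ip mu A phi phi / 2 - L phi.
pose im := [set J phi | phi in test_function U].
have lb : lbound im (- (c ^+ 2 / 2)).
  move=> _ [phi tphi <-]; rewrite /J -(sqr_snorm Sm (tL2 tphi)).
  have := Lb phi tphi; rewrite ler_norml => /andP[_ h].
  by have := sqr_ge0 (nrm phi - c); rewrite sqrrB; lra.
have hl : has_lbound im by exists (- (c ^+ 2 / 2)).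
have im0 : im !=set0 by exists (J (fun=> 0)); exists (fun=> 0) => //; exact: test_function_cst0.
have ge phi : test_function U phi -> inf im <= J phi.
  by move=> tphi; apply: ge_inf => //; exists phi.
have /choice[phi hphi] : forall k : nat, exists phi, test_function U phi /\ J phi <= inf im + k.+1%:R^-1.
  move=> k; have k0 : 0 < k.+1%:R^-1 :> R by rewrite invr_gt0.
  have [_ [phi tphi <-] h] := inf_adherent k0 (conj im0 hl).
  by exists phi; split=> //; exact: ltW.
have tphi k : test_function U (phi k) by have [] := hphi k.
have Lphi k : L2s (phi k) := tL2 (tphi k).
(* Parallelogram identity: J at the midpoint is the mean of the two values minus an eighth of the
   squared distance, and it is not below the infimum. The term [fun=> 0] only serves to write the
   midpoint with [lcf]. *)
have par i j : ip mu A (lcf (-1) (phi i) (phi j)) (lcf (-1) (phi i) (phi j)) <=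
    4 * (i.+1%:R^-1 + j.+1%:R^-1).
  have t0 := test_function_cst0 U.
  have t1 := test_function_lc 1 (tphi i) (tphi j).
  have t2 := test_function_lc (2^-1) t1 t0.
  have := ge _ t2; have [_] := hphi i; have [_] := hphi j.
  rewrite /J (sip_lcE Sm (2^-1) (tL2 t1) (tL2 t0)) Llin// Llin//.
  rewrite (sip_lcE Sm 1 (Lphi i) (Lphi j)) (sip_lcE Sm (-1) (Lphi i) (Lphi j)).
  have L00 : L (fun=> 0) = 0.
    have := Llin (-1) t0 t0; rewrite (_ : lcf _ _ _ = fun=> 0) ?mulN1r ?addNr//.
    by apply/funext => x; rewrite /lcf mulr0 addr0.
  have i00 : ip mu A (fun=> 0) (fun=> 0) = 0.
    by rewrite /ip; under eq_Rintegral do rewrite mulr0; rewrite /Rintegral integral0.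
  have i01 : ip mu A (lcf 1 (phi i) (phi j)) (fun=> 0) = 0.
    by rewrite /ip; under eq_Rintegral do rewrite mulr0; rewrite /Rintegral integral0.
  rewrite L00 i00 i01.
  move: (inf im) (ip mu A (phi i) (phi i)) (ip mu A (phi i) (phi j)) (ip mu A (phi j) (phi j)) => m Ai B Aj.
  by move: (L (phi i)) (L (phi j)) (i.+1%:R^-1 : R) (j.+1%:R^-1 : R) => Li Lj ri rj; lra.
have [e e0|w Lw hw] := Riesz_Fischer mA Lphi.
  have e8 : 0 < e ^+ 2 / 8 by rewrite divr_gt0// exprn_gt0.
  have [K hK] := inv_succ_le e8; exists K => i j /hK hi /hK hj.
  apply: sqrt_le_of_sqr; [exact: ltW|apply: (le_trans (par i j))].
  by move: hi hj; move: (i.+1%:R^-1 : R) (j.+1%:R^-1 : R) => ri rj; lra.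
exists w => // psi tpsi; have Lpsi := tL2 tpsi.
pose D := ip mu A w psi - L psi; pose N := ip mu A psi psi.
have N0 : 0 <= N := sip_ge0 Sm Lpsi.
(* Comparison of J at [phi k] and at [phi k] + t psi; as k tends to infinity the gap to the infimum
   disappears and [phi k] may be replaced by w in the pairing. *)
have key t : 0 <= t * D + t ^+ 2 * N / 2.
  apply/ler_addgt0Pr => e e0.
  have M0 : 0 < `|t| * nrm psi + 1 by rewrite ltr_wpDl// mulr_ge0// snorm_ge0.
  have e2 : 0 < e / 2 by rewrite divr_gt0.
  have [K1 hK1] := hw _ (divr_gt0 e2 M0); have [K2 hK2] := inv_succ_le e2.
  pose k := maxn K1 K2.
  have h1 := hK1 k (leq_maxl _ _); have h2 := hK2 k (leq_maxr _ _).
  have tk := test_function_lc t tpsi (tphi k).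
  have := ge _ tk; have [_] := hphi k.
  rewrite /J (sip_lcE Sm t Lpsi (Lphi k)) Llin// (sip_sym Sm Lpsi (Lphi k)) -/N => h3 h4.
  have h5 : `|t * (ip mu A (phi k) psi - ip mu A w psi)| <= e / 2.
    rewrite (_ : _ - _ = - ip mu A (lcf (-1) (phi k) w) psi); last by rewrite (sip_lin Sm)//; ring.
    rewrite normrM normrN.
    apply: le_trans (ler_wpM2l (normr_ge0 t) (cauchy_schwarz Sm (L2_lc mA _ (Lphi k) Lw) Lpsi)) _.
    apply: (@le_trans _ _ (`|t| * (e / 2 / (`|t| * nrm psi + 1) * nrm psi))).
      by rewrite ler_wpM2l// ler_wpM2r// snorm_ge0.
    rewrite (_ : `|t| * _ = e / 2 * (`|t| * nrm psi) / (`|t| * nrm psi + 1)).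
      by rewrite ler_pdivrMr// ler_wpM2l ?(ltW e2)// lerDl.
    by field; rewrite gt_eqF.
  move: h5; rewrite ler_norml => /andP[h5 h6].
  rewrite /D; move: h2 h3 h4 h5 h6; rewrite (mulr2n t); clearbody N k.
  move: (inf im) (ip mu A (phi k) (phi k)) (ip mu A (phi k) psi) (ip mu A w psi) => I0 a b d.
  by move: (L psi) (L (phi k)) (k.+1%:R^-1 : R) => l l' r; lra.
apply/esym/eqP; rewrite -subr_eq0 -/D -sqrf_eq0 eq_le sqr_ge0 andbT.
have N1 : 0 < N + 1 by rewrite ltr_wpDl.
(* At this t the quadratic is a negative multiple of D^2, which forces D = 0; the denominator is N +
   1 because N may vanish. *)
have := key (- D / (N + 1)).
rewrite (_ : _ + _ = - (D ^+ 2 * ((N + 2) / (2 * (N + 1) ^+ 2)))); last by field; rewrite gt_eqF.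
rewrite oppr_ge0 pmulr_lle0// divr_gt0// ?ltr_wpDl// mulr_gt0// exprn_gt0//.
Qed.

Lemma L1_dual_bound c w : 0 <= c -> L2s w -> (forall q, L2s q -> `|ip mu A w q| <= c * N1 q) ->
  Lp mu A +oo%E w /\ Lpnorm mu A +oo%E w <= c.
Proof.
move=> c0 Lw ext.
have half w' : L2s w' -> (forall q, L2s q -> ip mu A w' q <= c * N1 q) ->
    \forall x \ae mu, A x -> w' x <= c.
  (* Tested with the positive part q of w' - c, the hypothesis says that the integral of q^2, which
     equals (w', q) - c N1(q), is not positive. *)
  move=> Lw' h; pose q x := Num.max (w' x - c) 0.
  have Lwc : L2s (fun x => w' x - c).
    have := L2_lc mA (-1) (L2_cst mA muA c) Lw'; congr (Lp _ _ _ _).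
    by apply/funext => x; rewrite /lcf mulN1r addrC.
  have mq : measurable_fun A q.
    by apply: measurable_maxr; [case: Lwc|exact: measurable_cst].
  have q0 x : 0 <= q x by rewrite le_max lexx orbT.
  have Lq : L2s q.
    apply: (L2_le_bound mA (C := 1) mq Lwc) => x _; rewrite mul1r /q.
    by have [|w0] := leP (w' x - c) 0; rewrite ?normr0.
  have : ip mu A q q <= 0.
    have -> : ip mu A q q = ip mu A w' q - c * N1 q.
      rewrite /ip /N1 -RintegralZl//; last by apply: integrableRabs; exact: L2_integrable1.
      rewrite -RintegralB//; [|exact: (L2M mA Lw' Lq)|]; last first.
        by apply: integrableRZ => //; apply: integrableRabs; exact: L2_integrable1.
      apply: eq_Rintegral => x _; rewrite ger0_norm// -mulrBl /q.
      by have [|w0] := leP (w' x - c) 0; rewrite ?mulr0.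
    by rewrite subr_le0 h.
  move=> qq; have : ip mu A q q = 0 by apply/eqP; rewrite eq_le qq (sip_ge0 Sm).
  move=> /(ip_eq0_ae mA Lq); apply: filterS => x hx /hx; rewrite /q => h0.
  by rewrite -subr_le0 -h0 le_max lexx.
have [LN ip'] : L2s (fun x => - w x) /\ forall q, L2s q -> ip mu A (fun x => - w x) q = - ip mu A w q.
  have E1 : (fun x => - w x) = lcf (-1) w (fun=> 0) by apply/funext => x; rewrite /lcf; ring.
  rewrite E1; split=> [|q Lq]; first exact: L2_lc (L2_cst mA muA 0).
  rewrite (sip_lin Sm)//; last exact: L2_cst.
  rewrite [X in _ + X](_ : _ = 0); first by ring.
  by rewrite /ip; under eq_Rintegral do rewrite mul0r; rewrite /Rintegral integral0.
have h1 := half w Lw (fun q Lq => le_trans (ler_norm _) (ext q Lq)).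
have h2 : \forall x \ae mu, A x -> - w x <= c.
  by apply: half => // q Lq; rewrite ip'// (le_trans _ (ext q Lq))// -normrN ler_norm.
apply: Linf_bound => //; first by case: Lw.
by apply: filterS2 h1 h2 => x h1 h2 Ax; rewrite ler_norml h1// lerNl h2.
Qed.

(** On a set of finite measure an L^1 bound is also an L^2 bound, so the representative comes from
    L^2. Density extends the L^1 bound to all of L^2, and [L1_dual_bound] turns it into an essential
    bound with the same constant. *)
Lemma riesz_Linf c : 0 <= c -> (forall phi, test_function U phi -> `|L phi| <= c * N1 phi) ->
  exists w, [/\ Lp mu A +oo%E w, Lpnorm mu A +oo%E w <= c &
    forall phi, test_function U phi -> L phi = ip mu A w phi].
Proof.
move=> c0 Lb; pose m := nrm (fun=> 1); have m0 : 0 <= m := snorm_ge0 _ _.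
have [||w Lw hw] := @riesz_L2 (c * m); first exact: mulr_ge0.
  move=> phi tphi; apply: (le_trans (Lb phi tphi)).
  by rewrite -mulrA ler_wpM2l// mulrC; apply: N1_le => //; exact: tL2.
have ext q : L2s q -> `|ip mu A w q| <= c * N1 q.
  move=> Lq; apply/ler_addgt0Pr => e e0.
  pose M := nrm w + c * m + 1.
  have M0 : 0 < M by rewrite ltr_wpDl// addr_ge0// ?snorm_ge0// mulr_ge0.
  have [phi tphi hphi] := test_function_dense mA oU AU muA Lq (divr_gt0 e0 M0).
  have Lphi := tL2 tphi; have Ld := L2_lc mA (-1) Lphi Lq.
  have -> : ip mu A w q = ip mu A (lcf (-1) phi q) w + ip mu A w phi.
    by rewrite (sip_lin Sm)// (sip_sym Sm Lq Lw) (sip_sym Sm Lphi Lw); ring.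
  rewrite (le_trans (ler_normD _ _))// -hw//.
  have b1 := le_trans (cauchy_schwarz Sm Ld Lw) (ler_wpM2r (snorm_ge0 _ w) hphi).
  have b2 := Lb phi tphi.
  have b3 : N1 phi <= N1 q + m * (e / M).
    have -> : phi = lcf (-1) (lcf (-1) phi q) q by apply/funext => x; rewrite /lcf; ring.
    apply: (le_trans (N1_lc mA muA (-1) Ld Lq)); rewrite normrN1 mul1r addrC lerD2l.
    apply: (le_trans (N1_le mA muA Ld)); rewrite mulrC ler_wpM2l//.
  have b4 := ler_wpM2l c0 b3.
  have b5 : e / M * nrm w + c * (m * (e / M)) <= e.
    rewrite (_ : _ + _ = e * (nrm w + c * m) / M); last by field; rewrite gt_eqF.
    by rewrite ler_pdivrMr// ler_wpM2l ?(ltW e0)// lerDl.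
  by move: b1 b2 b4 b5; lra.
have [] := L1_dual_bound c0 Lw ext; by exists w.
Qed.

End riesz.

Lemma ip0r {R : realType} {n : nat} (mu : {measure set 'rV[R]_n.+1 -> \bar R})
  (A : set 'rV[R]_n.+1) q : ip mu A q (fun=> 0) = 0.
Proof. by rewrite /ip; under eq_Rintegral do rewrite mulr0; rewrite /Rintegral integral0. Qed.

Lemma snorm_eq {R : realType} {V : Type} (b : V -> V -> R) u v : b u u = b v v -> snorm b u = snorm b v.
Proof. by rewrite /snorm => ->. Qed.

Lemma ip_lcr {R : realType} {n : nat} (mu : {measure set 'rV[R]_n.+1 -> \bar R})
    (A : set 'rV[R]_n.+1) q a t t' : measurable A -> Lp mu A 2%:E q ->
  Lp mu A 2%:E t -> Lp mu A 2%:E t' ->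
  ip mu A q (lcf a t t') = a * ip mu A q t + ip mu A q t'.
Proof.
move=> mA Lq Lt Lt'; have Sm := sip_ip mu mA; have Ll := L2_lc mA a Lt Lt'.
by rewrite (sip_sym Sm Lq Ll) (sip_lin Sm)// (sip_sym Sm Lt Lq) (sip_sym Sm Lt' Lq).
Qed.

Section linear_combinations.
Context {R : realType}.
Implicit Types a x z t : R.

Lemma addr_lc a x x' z z' X Z : X = a * x + x' -> Z = a * z + z' ->
  X + Z = a * (x + z) + (x' + z').
Proof. by move=> -> ->; ring. Qed.

Lemma subr_lc3 a x x' z z' t t' X Z W : X = a * x + x' -> Z = a * z + z' -> W = a * t + t' ->
  X - Z - W = a * (x - z - t) + (x' - z' - t').
Proof. by move=> -> -> ->; ring. Qed.

Lemma subr3_eq0l x z t : z = x -> t = 0 -> x - z - t = 0.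
Proof. by move=> -> ->; ring. Qed.

Lemma subr3_eq0r x z t : z = 0 -> x = t -> x - z - t = 0.
Proof. by move=> -> ->; ring. Qed.

End linear_combinations.

(** * Fluxes through G_I and the Neumann condition *)

Section flux.
Context {R : realType} {n : nat}.
Local Notation E := 'rV[R]_n.+1.
Local Notation lambda := (leb n.+1 : {measure set E -> \bar R}).
Variables (Omega : set E) (rho : R) (T : seq 'M[R]_n.+1) (G_I G_D G_N : set E).
Hypothesis oO : open Omega.
Hypothesis bO : forall x, Omega x -> `|x| <= rho.
Hypothesis lip : lipschitz_boundary Omega.
Hypothesis simp : simplicial_boundary Omega T.
Hypothesis spl : boundary_splitting Omega G_I G_D G_N.
Implicit Types (phi psi eta u v w q f h : E -> R) (y : E -> E).
Local Notation h1 := (snorm (h1ip Omega)).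
Local Notation nO := (snorm (ip lambda Omega)).
Local Notation sigma := (surface_measure T).
Local Notation bd := (bnd Omega).
Local Notation nb := (snorm (ip sigma bd)).
Local Notation L2I := (Lp sigma G_I 2%:E).
Local Notation trace := (trace Omega T).
Local Notation H1_0 := (H1_0 Omega T).
Local Notation S := (closure G_I `&` closure G_N).
Local Notation N1I := (N1 sigma G_I).
Local Notation nI := (snorm (ip sigma G_I)).

Let mO : measurable Omega := domain_measurable oO.
Let mb : measurable bd := bnd_measurable Omega.
Let S1 := sip_h1ip oO bO.
Let SO := sip_ip lambda mO.
Let Ib := relatively_open_sub (split_openI spl).
Let Db := relatively_open_sub (split_openD spl).
Let Nb := relatively_open_sub (split_openN spl).
Let mI := relatively_open_measurable (split_openI spl).
Let sI : (sigma G_I < +oo)%E := surface_finite T mI.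
Let SI := sip_ip sigma mI.

Lemma traceI_L2 v : H1 Omega v -> L2I (trace v).
Proof.
move=> Hv; have [] := nrm_subset mI mb Ib (trace_L2 oO bO lip simp Hv).
by [].
Qed.

(** Since [G_I] is relatively open, test functions of U vanish on every part of the boundary
    disjoint from it. They are the directions that reach [G_I] without violating the conditions on
    [G_D] and [G_N]. *)
Lemma test_part (U G : set E) phi : G_I = U `&` bd -> G `<=` bd -> G_I `&` G = set0 ->
  test_function U phi -> H1_0 G phi.
Proof.
move=> GU Gb G0 tphi; apply: (H1_0_smooth oO bO lip simp Gb (test_function_smooth tphi)) => x Gx.
apply: (test_function_supp tphi) => Ux; have : (G_I `&` G) x by split=> //; rewrite GU; split=> //; exact: Gb.
by rewrite G0.
Qed.

Lemma traceI_smooth phi : smooth phi -> ae_eq sigma G_I (trace phi) phi.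
Proof. by move=> sphi; exact: ae_eq_subset Ib (trace_smooth oO bO lip simp sphi). Qed.

Lemma L2I_smooth phi : smooth phi -> L2I phi.
Proof. by move=> sphi; have [] := nrm_subset mI mb Ib (L2b_smooth T bO sphi). Qed.

Lemma ip_trace_smooth q phi : L2I q -> smooth phi -> ip sigma G_I q (trace phi) = ip sigma G_I q phi.
Proof.
move=> Lq sphi; apply: ip_ae => //.
- exact: L2_measurable Lq.
- exact: L2_measurable Lq.
- exact: L2_measurable (traceI_L2 (H1_smooth oO bO sphi)).
- exact: L2_measurable (L2I_smooth sphi).
- exact: ae_eq_refl.
- exact: traceI_smooth.
Qed.

Lemma N1_trace_smooth phi : smooth phi -> N1I (trace phi) = N1I phi.
Proof.
move=> sphi; apply: N1_ae => //.
- exact: L2_measurable (traceI_L2 (H1_smooth oO bO sphi)).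
- exact: L2_measurable (L2I_smooth sphi).
- exact: traceI_smooth.
Qed.

(** The representation is found on test functions of U and extends to H^1_D because both sides are
    bounded by norms of the trace on [G_I]: it suffices to approximate this trace in L^2([G_I]),
    without control of v in H^1. *)
Lemma flux_rep (L : (E -> R) -> R) c : 0 <= c ->
  (forall a v v', H1_0 G_D v -> H1_0 G_D v' -> L (lcf a v v') = a * L v + L v') ->
  (forall v, H1_0 G_D v -> `|L v| <= c * N1I (trace v)) ->
  exists q, [/\ Lp sigma G_I +oo%E q, Lpnorm sigma G_I +oo%E q <= c &
    forall v, H1_0 G_D v -> L v = ip sigma G_I q (trace v)].
Proof.
move=> c0 Llin Lb; have [U oU GU] := split_openI spl.
have IU : G_I `<=` U by rewrite GU => x [].
have tD phi : test_function U phi -> H1_0 G_D phi := test_part GU Db (split_ID spl).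
have [||q [Lq qc hq]] := @riesz_Linf R n sigma U G_I mI oU IU sI L _ c c0.
- by move=> a phi psi tphi tpsi; apply: Llin; exact: tD.
- move=> phi tphi; rewrite -(N1_trace_smooth (test_function_smooth tphi)).
  by apply: Lb; exact: tD.
exists q; split=> // v Hv; have LqI := Linf_L2 mI sI Lq.
have Hv1 := H1_0_H1 Hv; have Lv := traceI_L2 Hv1.
apply/eqP; rewrite -subr_eq0 -normr_le0; apply/ler_addgt0Pr => e e0; rewrite add0r.
pose m := nI (fun=> 1); have m0 : 0 <= m := snorm_ge0 _ _.
pose M := c * m + nI q + 1.
have M0 : 0 < M by rewrite ltr_wpDl// addr_ge0// ?snorm_ge0// mulr_ge0.
have [phi tphi hphi] := test_function_dense mI oU IU sI Lv (divr_gt0 e0 M0).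
have sphi := test_function_smooth tphi; have Lphi := L2I_smooth sphi.
have Ld := L2_lc mI (-1) Lphi Lv.
have E1 : N1I (trace (lcf (-1) phi v)) = N1I (lcf (-1) phi (trace v)).
  apply: N1_ae => //.
  - by apply: L2_measurable; apply: traceI_L2; apply: (sip_lc S1) => //; exact: H1_smooth bO _ _.
  - exact: L2_measurable Ld.
  have := ae_eq_subset Ib (trace_lc oO bO lip simp (-1) (H1_smooth oO bO sphi) Hv1).
  by apply: filterS2 (traceI_smooth sphi) => x h1 h2 Gx; rewrite h2// /lcf h1.
have b1 := Lb _ (H1_0_lc oO bO lip simp Db (-1) (tD _ tphi) Hv).
rewrite E1 (Llin _ _ _ (tD _ tphi) Hv) (hq _ tphi) in b1.
have b2 := le_trans b1 (ler_wpM2l c0 (le_trans (N1_le mI sI Ld) (ler_wpM2r m0 hphi))).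
have b3 := le_trans (cauchy_schwarz SI LqI Ld) (ler_wpM2l (snorm_ge0 _ q) hphi).
rewrite (sip_sym SI LqI Ld) (sip_lin SI)// (sip_sym SI Lphi LqI) (sip_sym SI Lv LqI) in b3.
have -> : L v - ip sigma G_I q (trace v) =
    (-1 * ip sigma G_I q phi + L v) - (-1 * ip sigma G_I q phi + ip sigma G_I q (trace v)) by ring.
rewrite (le_trans (ler_normB _ _))//.
apply: (le_trans (lerD b2 b3)).
rewrite (_ : _ + _ = e * (c * m + nI q) / M); last by field; rewrite gt_eqF.
by rewrite ler_pdivrMr// ler_wpM2l ?(ltW e0)// lerDl.
Qed.

Lemma is_bflux_unique y q q' : is_bflux Omega T G_I G_D G_N y q ->
  is_bflux Omega T G_I G_D G_N y q' -> ae_eq sigma G_I q q'.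
Proof.
move=> [Lq hq] [Lq' hq']; have [U oU GU] := split_openI spl.
have IU : G_I `<=` U by rewrite GU => x [].
have LqI := Linf_L2 mI sI Lq; have LqI' := Linf_L2 mI sI Lq'.
have Ld := L2_lc mI (-1) LqI LqI'.
have := fundamental_lemma mI oU IU sI Ld => h.
suff : ae_eq sigma G_I (lcf (-1) q q') (fun=> 0).
  by apply: filterS => x k Gx; have := k Gx; rewrite /lcf mulN1r addrC => /eqP; rewrite subr_eq0 => /eqP.
apply: h => phi tphi; have sphi := test_function_smooth tphi.
have HD := test_part GU Db (split_ID spl) tphi.
have HN := test_part GU Nb (split_IN spl) tphi.
rewrite (sip_lin SI)//; last exact: L2I_smooth.
by rewrite -!(ip_trace_smooth _ sphi)// hq// hq'// mulN1r addNr.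
Qed.

Lemma bfluxP y : HbarI Omega T G_I G_D G_N y ->
  is_bflux Omega T G_I G_D G_N y (bflux Omega T G_I G_D G_N y).
Proof. by move=> [_ [q hq]]; exact: (xgetPex _ (ex_intro _ q hq)). Qed.

Lemma nflux_lc y a v v' : Hdiv Omega y -> H1 Omega v -> H1 Omega v' ->
  nflux Omega y (lcf a v v') = a * nflux Omega y v + nflux Omega y v'.
Proof.
move=> Hy Hv Hv'; have Ly : L2vec Omega y by case: Hy.
have Ld := wdiv_L2 Hy; have SV := sip_ipvec oO.
have [Hl El] := H1_lc oO bO a Hv Hv'.
apply: addr_lc (sip_lin SO a (H1_L2 Hv) (H1_L2 Hv') Ld).
apply: etrans (sip_lin SV a (wgrad_L2 Hv) (wgrad_L2 Hv') Ly).
exact: (ipvec_ae oO (wgrad_L2 Hl) (L2vec_lc oO a (wgrad_L2 Hv) (wgrad_L2 Hv')) Ly Ly El (ae_eq_refl _ _ _)).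
Qed.

Lemma nflux_le y : Hdiv Omega y -> exists2 K, 0 <= K & forall v, H1 Omega v ->
  `|nflux Omega y v| <= K * h1 v.
Proof.
move=> Hy; have Ly : L2vec Omega y by case: Hy.
have Ld := wdiv_L2 Hy; have SV := sip_ipvec oO.
exists (snorm (ipvec Omega) y + nO (wdiv Omega y)); first by rewrite addr_ge0// snorm_ge0.
move=> v Hv; rewrite /nflux (le_trans (ler_normD _ _))// mulrDl; apply: lerD.
  apply: le_trans (cauchy_schwarz SV (wgrad_L2 Hv) Ly) _; rewrite mulrC.
  exact: (ler_wpM2l (snorm_ge0 _ _) (wgrad_le_h1 oO bO Hv)).
apply: le_trans (cauchy_schwarz SO (H1_L2 Hv) Ld) _; rewrite mulrC.
exact: (ler_wpM2l (snorm_ge0 _ _) (nO_le_h1 oO bO Hv)).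
Qed.

Section neumann.
Variable g : (E -> R) -> R.
Hypothesis Hg : Hmhalf Omega T G_N g.

Lemma Hhalf_trace G v : H1 Omega v -> Hhalf Omega T G (trace v).
Proof. by move=> Hv; exists v => //; exact: ae_eq_refl. Qed.

Lemma g_lc a v v' : H1 Omega v -> H1 Omega v' ->
  g (trace (lcf a v v')) = a * g (trace v) + g (trace v').
Proof.
move=> Hv Hv'; rewrite -(Hmhalf_lin Hg)//; try exact: Hhalf_trace.
have Hl := sip_lc S1 a Hv Hv'.
have ae := ae_eq_subset Nb (trace_lc oO bO lip simp a Hv Hv').
apply: (Hmhalf_ae Hg) => //; first exact: Hhalf_trace.
by exists (lcf a v v').
Qed.

Lemma g_le : exists2 K, 0 <= K & forall v, H1 Omega v -> `|g (trace v)| <= K * h1 v.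
Proof.
have [C hC] := Hmhalf_bnd Hg; exists `|C| => // v Hv.
apply: (le_trans (hC _ (Hhalf_trace _ Hv))).
set I := Hhalf_norm _ _ _ _.
have lb : lbound [set H1norm Omega v0 | v0 in [set v0 | H1 Omega v0 /\ ae_eq sigma G_N (trace v0) (trace v)]] 0.
  by move=> _ [w _ <-]; exact: sqrtr_ge0.
have I0 : 0 <= I.
  apply: lb_le_inf => //; exists (H1norm Omega v); exists v => //; split=> //; exact: ae_eq_refl.
have I1 : I <= h1 v.
  rewrite -(H1normE oO Hv); apply: ge_inf; first by exists 0.
  by exists v => //; split=> //; exact: ae_eq_refl.
apply: le_trans (ler_wpM2r I0 (ler_norm C)) _; exact: ler_wpM2l.
Qed.

Lemma g_eq0 v : H1_0 G_N v -> g (trace v) = 0.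
Proof.
move=> [Hv tv].
have := Hmhalf_lin Hg (-1) (Hhalf_trace G_N Hv) (Hhalf_trace G_N Hv).
rewrite mulN1r addNr => <-; have H0 := sip_lc S1 (-1) Hv Hv.
have ae := ae_eq_subset Nb (trace_lc oO bO lip simp (-1) Hv Hv).
apply: (Hmhalf_ae Hg); first exact: Hhalf_trace.
  by exists (lcf (-1) v v).
by apply: filterS tv => x h Gx; rewrite h// mulr0 addr0.
Qed.

Lemma ip_trace_lc q a v v' : L2I q -> H1 Omega v -> H1 Omega v' ->
  ip sigma G_I q (trace (lcf a v v')) = a * ip sigma G_I q (trace v) + ip sigma G_I q (trace v').
Proof.
move=> Lq Hv Hv'; have Lv := traceI_L2 Hv; have Lv' := traceI_L2 Hv'.
have ae := ae_eq_subset Ib (trace_lc oO bO lip simp a Hv Hv').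
have Ll := L2_lc mI a Lv Lv'.
have mt := L2_measurable (traceI_L2 (sip_lc S1 a Hv Hv')).
have mq := L2_measurable Lq.
exact: etrans (ip_ae mI mq mq mt (L2_measurable Ll) (ae_eq_refl _ _ _) ae) (ip_lcr a mI Lq Lv Lv').
Qed.

Lemma ip_trace_le q : L2I q -> exists2 K, 0 <= K & forall v, H1 Omega v ->
  `|ip sigma G_I q (trace v)| <= K * h1 v.
Proof.
move=> Lq; have [C C0 hC] := trace_le oO bO lip simp.
exists (nI q * C); first by rewrite mulr_ge0// snorm_ge0.
move=> v Hv; have Lv := trace_L2 oO bO lip simp Hv.
have [LvI le] := nrm_subset mI mb Ib Lv.
apply: le_trans (cauchy_schwarz SI Lq LvI) _; rewrite -mulrA; apply: (ler_wpM2l (snorm_ge0 _ _)).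
apply: (le_trans le).
pose z : E -> R := fun=> 0; have sz : smooth z := smooth_cst 0.
have Hz := H1_smooth oO bO sz.
have := hC _ _ Hz Hv.
have -> : lcf (-1) z v = v by apply/funext => x; rewrite /lcf /z mulr0 add0r.
suff -> : nb (lcf (-1) (trace z) (trace v)) = nb (trace v) by [].
have Lz := trace_L2 oO bO lip simp Hz; have Ld := L2_lc mb (-1) Lz Lv.
have ae : ae_eq sigma bd (lcf (-1) (trace z) (trace v)) (trace v).
  by apply: filterS (trace_smooth oO bO lip simp sz) => x h bx; rewrite /lcf h// /z mulr0 add0r.
apply: snorm_eq.
exact: (ip_ae mb (L2_measurable Ld) (L2_measurable Lv) (L2_measurable Ld) (L2_measurable Lv) ae ae).
Qed.

Lemma flux_identity y q : Hdiv Omega y -> Lp sigma G_I +oo%E q ->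
  (forall v, H1_0 G_D v -> H1_0 G_N v -> ip sigma G_I q (trace v) = nflux Omega y v) ->
  (forall v, H1_0 G_I v -> H1_0 G_D v -> nflux Omega y v = g (trace v)) ->
  forall v, H1_0 G_D v -> nflux Omega y v - ip sigma G_I q (trace v) = g (trace v).
Proof.
move=> Hy Lq hN hI; have LqI := Linf_L2 mI sI Lq.
have [K1 K10 hK1] := nflux_le Hy; have [K2 K20 hK2] := ip_trace_le LqI; have [K3 K30 hK3] := g_le.
pose Lam v := nflux Omega y v - ip sigma G_I q (trace v) - g (trace v).
have Lam_lc a v v' : H1 Omega v -> H1 Omega v' -> Lam (lcf a v v') = a * Lam v + Lam v'.
  move=> Hv Hv'.
  exact: (subr_lc3 (nflux_lc a Hy Hv Hv') (ip_trace_lc a LqI Hv Hv') (g_lc a Hv Hv')).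
suff h v : H1_0 G_D v -> Lam v = 0.
  by move=> v /h /eqP; rewrite subr_eq0 => /eqP.
apply: (interface_density oO bO lip simp spl Lam_lc).
  exists (K1 + K2 + K3); first by rewrite !addr_ge0.
  move=> v0 Hv0; rewrite /Lam (le_trans (ler_normB _ _))// !mulrDl; apply: lerD; last exact: hK3.
  by rewrite (le_trans (ler_normB _ _))//; apply: lerD; [exact: hK1|exact: hK2].
move=> {}v eta eps Hv seta eps0 heta.
have cA : closed (closure G_I `\` tube S eps).
  by rewrite setDE; apply: closedI; [exact: closed_closure|apply: open_closedC; exact: tube_open].
have cB : closed (closure G_N `\` tube S eps).
  by rewrite setDE; apply: closedI; [exact: closed_closure|apply: open_closedC; exact: tube_open].
have AB0 : (closure G_I `\` tube S eps) `&` (closure G_N `\` tube S eps) = set0.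
  apply/seteqP; split=> // x [[Ix nx] [Nx _]]; apply: nx; exists x => //; exact: ballxx.
have Ar x : (closure G_I `\` tube S eps) x -> `|x| <= rho.
  by move=> [/(closure_sub_bnd Ib) bx _]; exact: (bnd_le bO bx).
(* Outside the tube the closures of [G_I] and [G_N] are disjoint closed sets, and inside it eta
   vanishes. Hence psi splits eta * v into a part that vanishes on [G_N], tested by [hN], and a part
   that vanishes on [G_I], tested by [hI]. *)
have [psi [spsi p1 p0]] := smooth_urysohn cA Ar cB AB0.
have Hv1 := H1_0_H1 Hv.
have s1 : smooth (fun x => psi x * eta x) by exact: smoothM.
have s2 : smooth (fun x => (1 - psi x) * eta x).
  by apply: smoothM => //; apply: smoothB => //; exact: smooth_cst.
have z1 x : G_N x -> psi x * eta x = 0.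
  move=> Nx; have [tx|ntx] := pselect (tube S eps x); first by rewrite heta// mulr0.
  by rewrite p0 ?mul0r//; split=> //; exact: subset_closure.
have z2 x : G_I x -> (1 - psi x) * eta x = 0.
  move=> Ix; have [tx|ntx] := pselect (tube S eps x); first by rewrite heta// mulr0.
  by rewrite p1 ?subrr ?mul0r//; split=> //; exact: subset_closure.
have A1 := H1_0M oO bO lip simp Db s1 Hv. have A2 := H1_0M oO bO lip simp Db s2 Hv.
have B1 := H1_0_cut oO bO lip simp Nb s1 Hv1 z1. have B2 := H1_0_cut oO bO lip simp Ib s2 Hv1 z2.
have -> : (fun x => eta x * v x) = lcf 1 (fun x => psi x * eta x * v x) (fun x => (1 - psi x) * eta x * v x).
  by apply/funext => x; rewrite /lcf; ring.
have L1 : Lam (fun x => psi x * eta x * v x) = 0 := subr3_eq0l (hN _ A1 B1) (g_eq0 B1).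
have L2 : Lam (fun x => (1 - psi x) * eta x * v x) = 0.
  apply: subr3_eq0r (hI _ B2 A2).
  have Lt := traceI_L2 (H1_0_H1 A2); have L0 := L2_cst mI sI (0 : R).
  have mq := L2_measurable LqI.
  exact: etrans (ip_ae mI mq mq (L2_measurable Lt) (L2_measurable L0) (ae_eq_refl _ _ _) B2.2) (ip0r _ _ _).
rewrite (Lam_lc 1 _ _ (H1_0_H1 A1) (H1_0_H1 A2)) L1 L2; ring.
Qed.

End neumann.
End flux.

(** * Duality *)

Section real_lemmas.
Context {R : realType}.
Implicit Types a b c d k l m s t x : R.

Lemma le_add_small x k c : (forall d, 0 < d -> d <= 1 -> x <= k + d * c) -> x <= k.
Proof.
move=> h; apply/ler_addgt0Pr => e e0.
have c1 : 0 < `|c| + 1 by rewrite ltr_wpDl.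
pose d := Num.min 1 (e / (`|c| + 1)).
have d0 : 0 < d by rewrite lt_min ltr01 divr_gt0.
have d1 : d <= 1 by rewrite ge_min lexx.
apply: (le_trans (h d d0 d1)); rewrite lerD2l.
apply: (@le_trans _ _ (d * `|c|)); first by rewrite ler_wpM2l ?(ltW d0)// ler_norm.
apply: (@le_trans _ _ (e / (`|c| + 1) * `|c|)).
  by rewrite ler_wpM2r// ge_min lexx orbT.
by rewrite mulrAC ler_pdivrMr// ler_wpM2l ?(ltW e0)// lerDl.
Qed.

Lemma young_le m s b : 0 < m -> s * b - (2 * m)^-1 * b ^+ 2 <= m / 2 * s ^+ 2.
Proof.
move=> m0; rewrite -subr_ge0 (_ : _ - _ = (m * s - b) ^+ 2 / (2 * m)).
  by rewrite divr_ge0 ?sqr_ge0// mulr_ge0// ltW.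
by field; rewrite gt_eqF.
Qed.

Lemma bounded_multiples l c : (forall t, t * l <= c) -> l = 0.
Proof.
move=> h; apply/eqP; apply: contraT => l0.
by have := h ((c + 1) / l); rewrite divfK// => ?; lra.
Qed.

Lemma quad_bound l b c m : 0 < m -> 0 <= b ->
  (forall t, t * l - (2 * m)^-1 * (`|t| * b) ^+ 2 <= c) ->
  `|l| <= Num.sqrt (2 * c / m) * b.
Proof.
move=> m0 b0 h.
have [bE|bn0] := eqVneq b 0.
  rewrite bE mulr0 normr_le0; apply/eqP; apply: (@bounded_multiples _ c) => t.
  by have := h t; rewrite bE mulr0 expr0n mulr0 subr0.
have b1 : 0 < b by rewrite lt_neqAle eq_sym bn0.
rewrite -ler_pdivrMr//.
(* This t maximizes the left-hand side of [h], and the maximum is (m / 2) (l / b)^2. *)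
have := h (m * l / b ^+ 2).
rewrite exprMn real_normK ?num_real//.
rewrite (_ : _ - _ = m / 2 * (l / b) ^+ 2); last by field; rewrite ?bn0 ?gt_eqF.
move=> h1; rewrite -(@ler_sqr _ (`|l| / b)) ?nnegrE ?sqrtr_ge0 ?divr_ge0// sqr_sqrtr.
  rewrite expr_div_n real_normK ?num_real// -expr_div_n ler_pdivlMr//.
  by move: h1; move: ((l / b) ^+ 2) => x h1; lra.
rewrite divr_ge0 ?(ltW m0)// mulr_ge0//; apply: le_trans h1.
by rewrite mulr_ge0 ?sqr_ge0// divr_ge0// ltW.
Qed.

(** Taking t = 1 / b and t = -1 / b freezes the quadratic term and leaves a bound linear in b. If b
    = 0, then l is bounded along all its multiples and vanishes. *)
Lemma affine_bound l b a c m : 0 < m -> 0 <= b ->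
  (forall t, t * l <= c + (2 * m)^-1 * (a + `|t| * b) ^+ 2) ->
  `|l| <= (`|c| + (2 * m)^-1 * (a + 1) ^+ 2) * b.
Proof.
move=> m0 b0 h.
have [bE|bn0] := eqVneq b 0.
  rewrite bE mulr0 normr_le0; apply/eqP; apply: (@bounded_multiples _ (c + (2 * m)^-1 * a ^+ 2)) => t.
  by have := h t; rewrite bE mulr0 addr0.
have b1 : 0 < b by rewrite lt_neqAle eq_sym bn0.
have hb : `|b^-1| * b = 1 by rewrite ger0_norm ?invr_ge0// mulVf.
have hc := ler_norm c.
rewrite -ler_pdivrMr// ler_pdivrMr// ler_norml -lerN2 opprK; apply/andP; split.
  have := h (- b^-1); rewrite normrN hb mulNr => h1; rewrite -ler_pdivrMr//.
  by move: h1; rewrite mulrC mulNr -mulrN; lra.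
have := h (b^-1); rewrite hb => h1; rewrite -ler_pdivrMr//.
by move: h1; rewrite mulrC; lra.
Qed.

(** This lemma and most of the following ones isolate the arithmetic of one step of the duality
    argument: norms and pairings become variables and their relations hypotheses, so that [ring] and
    [lra] see plain real numbers. *)
Lemma wdiv_of_residual (p p' i k e M : R) : - p + i + k = e -> e = 0 -> k = 0 -> p = p' -> M = - i -> p' = - M.
Proof. by move=> h h1 h2 <- ->; move: h; rewrite h1 h2 => h; lra. Qed.

Lemma flux_of_residual (p i k Q Q' N : R) : - p + i + k = Q -> k = 0 -> N = p - i -> Q' = - Q -> Q' = N.
Proof. by move=> h k0 -> ->; move: h; rewrite k0; lra. Qed.

Lemma nflux_of_residual (p i k Q N : R) : - p + i + k = Q -> Q = 0 -> N = p - i -> N = k.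
Proof. by move=> h h0 ->; move: h; rewrite h0; lra. Qed.

Lemma flux_shift (r r' q q' A B : R) : A = - 1 * r + r' -> B = - 1 * q + q' -> A = - B -> r' + q' = r + q.
Proof. by move=> -> ->; lra. Qed.

Lemma dual_value_eq (A B p i k q r' q' N : R) : r' + q' = - p + i + k + q -> N = p - i -> A - B + N - q - k = A - B - r' - q'.
Proof. by move=> h ->; lra. Qed.

Lemma gap_identity (a b c p i k Y Q D N : R) : D = - (2^-1 * Y) - b - (- p + i + k) - Q -> N = Y - 2 * p + a -> 2^-1 * a + c - i - k - D = 2^-1 * N + (c + b + Q).
Proof. by move=> -> ->; lra. Qed.

Lemma gap_ge0 (A B Q C : R) : `|Q| <= C -> C - B <= A -> 0 <= B + A + Q.
Proof. by rewrite ler_norml => /andP[]; lra. Qed.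

Lemma primal_expansion (t W F G K a b i k P I Q : R) :
  P = t * (t * W + b) + (t * b + a) -> I = t * i + F -> Q = t * k + G ->
  2^-1 * P + K - I - Q =
  2^-1 * a + K - F - G + (t ^+ 2 / 2 * W - t * (- b + i + k)).
Proof. by move=> -> -> ->; field. Qed.

Lemma lc_eq (t x y x' y' : R) : x = x' -> y = y' -> t * x + y = t * x' + y'.
Proof. by move=> -> ->. Qed.

Lemma primal_regroup (p1 p2 p3 p4 p5 p6 : R) : p1 + p5 - p2 - p3 <= p1 + p6 - p2 - p3 + p4 ->
  (p1 - p2 - p3) + p5 <= (p1 - p2 - p3) + p6 + p4.
Proof. by move=> h; lra. Qed.

Lemma abs_residual_le (a b m r r' r0 : R) : r <= a * b / m -> r' <= a * b / m ->
  r' = - 1 * r + r0 -> r0 = 0 -> `|r| <= a / m * b.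
Proof.
move=> h1 h2 h3 h4; rewrite mulrAC ler_norml h1 andbT.
by move: h2; rewrite h3 h4; lra.
Qed.

Lemma leC_trans (x y a b : R) : x = y -> y <= b + a -> x <= a + b.
Proof. by move=> -> ; rewrite addrC. Qed.

Lemma convex_pert_le (x y y' t q s a dc : R) : x = y -> y = y' -> y' <= t * q + s -> s <= (1 - t) * a ->
  0 < t -> q <= dc -> x <= a + t * (- a + dc).
Proof.
move=> -> -> h h1 t0 /(ler_wpM2l (ltW t0)) h2; apply: le_trans h _.
by move: h2 h1; move: (t * q) => p h2; lra.
Qed.

Lemma flux_pairing_le (a m r p p' i Q s q d c : R) : 0 < m -> 0 <= a -> 0 <= q ->
  r <= a * (- a + d * c) / m -> r = - p -> p = p' -> Q = 1 * p' + i -> `|Q| <= s * q ->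
  s <= a / m -> q <= d * c -> i <= - (a ^+ 2 / m) + d * (2 * a / m * c).
Proof.
move=> m0 a0 q0 h1 h2 h3 h4 h5 h6 h7.
have h8 : s * q <= a / m * (d * c).
  by apply: le_trans (ler_wpM2r q0 h6) _; apply: ler_wpM2l => //; rewrite divr_ge0// ltW.
have h9 := le_trans (ler_norm Q) h5.
have -> : - (a ^+ 2 / m) + d * (2 * a / m * c) = a * (- a + d * c) / m + a / m * (d * c).
  by field; rewrite gt_eqF.
by move: h1 h2 h3 h4 h9 h8; clear; move: (a * _ / m) (s * q) (a / m * (d * c)) => x y w; lra.
Qed.

Lemma gap_closed (m s a i : R) : 0 < m -> 0 <= s -> 0 <= a -> s <= a / m ->
  0 <= (2 * m)^-1 * a ^+ 2 + m / 2 * s ^+ 2 + i -> i <= - (a ^+ 2 / m) ->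
  - i = m / 2 * s ^+ 2 + (2 * m)^-1 * a ^+ 2.
Proof.
move=> m0 s0 a0 sam h1 h2.
have h3 : s ^+ 2 <= (a / m) ^+ 2 by rewrite ler_sqr ?nnegrE// (le_trans s0).
have m2 : 0 <= m / 2 by rewrite divr_ge0// ltW.
have := ler_wpM2l m2 h3.
rewrite (_ : m / 2 * (a / m) ^+ 2 = (2 * m)^-1 * a ^+ 2); last by field; rewrite gt_eqF.
have E : a ^+ 2 / m = (2 * m)^-1 * a ^+ 2 + (2 * m)^-1 * a ^+ 2 by field; rewrite gt_eqF.
rewrite E in h2; move: h1 h2; move: ((2 * m)^-1 * a ^+ 2) (m / 2 * s ^+ 2) => x y h1 h2 h4.
by apply/eqP; rewrite eq_le; apply/andP; split; lra.
Qed.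

Lemma gap_zero (P D N Z B S J i : R) : P - D = 2^-1 * N + (B + S + J) -> N = Z - 2 * i + Z ->
  Z = i -> - J = S + B -> P = D.
Proof. by move=> h h1 h2 h3; move: h; rewrite h1 h2; lra. Qed.

Lemma gap_norm_le0 (N P D : R) : 2 * (2^-1 * N) <= 2 * (P - D) -> P <= D -> N <= 0.
Proof. lra. Qed.

Lemma pairing_pert_le (m d c q s k j J i N M e r : R) : 0 < m -> 0 < d -> d <= 1 -> 0 <= c -> 0 <= q ->
  0 <= N -> 0 <= s -> - j - (2 * m)^-1 * N ^+ 2 <= k -> N = M -> j = J -> e = - 1 * J + i ->
  `|e| <= s * r -> r <= d * c -> M <= d * c + q ->
  - i - (2 * m)^-1 * q ^+ 2 <= k + d * ((2 * m)^-1 * (2 * q * c + c ^+ 2) + s * c).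
Proof.
move=> m0 d0 d1 c0 q0 N0 s0 h NM jJ h1 h2 h3 h4; rewrite NM in h N0; rewrite jJ in h.
have m2 : 0 <= (2 * m)^-1 by rewrite invr_ge0 mulr_ge0// ltW.
have h5 : M ^+ 2 <= q ^+ 2 + d * (2 * q * c + c ^+ 2).
  apply: (@le_trans _ _ ((d * c + q) ^+ 2)); first by rewrite ler_sqr ?nnegrE ?(le_trans N0).
  rewrite (_ : (d * c + q) ^+ 2 = q ^+ 2 + d * (2 * q * c + d * c ^+ 2)); last by ring.
  by rewrite lerD2l ler_wpM2l ?(ltW d0)// lerD2l ler_piMl ?sqr_ge0.
have h6 := ler_wpM2l m2 h5.
have h7 := ler_wpM2l s0 h3.
have := h2; rewrite ler_norml => /andP[h8 h9].
have -> : k + d * ((2 * m)^-1 * (2 * q * c + c ^+ 2) + s * c) =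
  k + (2 * m)^-1 * (q ^+ 2 + d * (2 * q * c + c ^+ 2)) + s * (d * c) - (2 * m)^-1 * q ^+ 2 by ring.
move: h h6 h7 h8 h9; rewrite h1.
move: ((2 * m)^-1 * q ^+ 2) ((2 * m)^-1 * M ^+ 2) (s * (d * c)) (s * r) ((2 * m)^-1 * (_ + _)) => x1 x2 x3 x4 x5.
by clear; lra.
Qed.

Lemma pairing_scale_le (m t i k j M b : R) : 0 < m -> 0 <= M -> - j - (2 * m)^-1 * M ^+ 2 <= k ->
  j = - t * i -> M <= `|t| * b -> t * i - (2 * m)^-1 * (`|t| * b) ^+ 2 <= k.
Proof.
move=> m0 M0 h jE h1; rewrite jE in h.
have m2 : 0 <= (2 * m)^-1 by rewrite invr_ge0 mulr_ge0// ltW.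
have h2 : M ^+ 2 <= (`|t| * b) ^+ 2 by rewrite ler_sqr ?nnegrE ?(le_trans M0).
have := ler_wpM2l m2 h2; move: h; rewrite mulNr opprK.
by move: ((2 * m)^-1 * _) ((2 * m)^-1 * _) (t * i) => x y z'; clear; lra.
Qed.

Lemma residual_scale_le (m M r t p q c a b : R) : 0 < m -> 0 <= M -> r - (2 * m)^-1 * M ^+ 2 <= c ->
  r = t * p + q -> M <= a + `|t| * b -> t * p <= c - q + (2 * m)^-1 * (a + `|t| * b) ^+ 2.
Proof.
move=> m0 M0 h rE h1; rewrite rE in h.
have m2 : 0 <= (2 * m)^-1 by rewrite invr_ge0 mulr_ge0// ltW.
have h2 : M ^+ 2 <= (a + `|t| * b) ^+ 2 by rewrite ler_sqr ?nnegrE ?(le_trans M0).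
have := ler_wpM2l m2 h2; move: h.
by move: ((2 * m)^-1 * _) ((2 * m)^-1 * _) (t * p) => x y z'; clear; lra.
Qed.

Lemma conj_regroup (p i k n : R) : - p - (- i - k + n) = - p + i + k - n.
Proof. ring. Qed.

Lemma conj_upper (r i r0 n s : R) : r + i = r0 -> 0 <= n + s + i -> r - n <= r0 + s.
Proof. lra. Qed.

Lemma conj_lower (r i r0 n c : R) : r + i = r0 -> r - n <= c -> - i - n <= c - r0.
Proof. lra. Qed.

Lemma conj_young (p i y w Y W : R) : Y = y -> W = w -> p = (-1) ^+ 2 * y + (-1) *+ 2 * i + w ->
  0 <= p -> i - 2^-1 * W <= 2^-1 * Y.
Proof. by move=> -> -> ->; lra. Qed.

Lemma half_sub (y Y : R) : Y = y -> 2^-1 * Y = y - 2^-1 * Y.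
Proof. by move=> ->; lra. Qed.

Lemma conj_sum (d y s r i : R) : d = - y - s - r - i -> - y - (r + i + s) = d.
Proof. by move=> ->; lra. Qed.

Lemma primal_split (a b c d : R) : a + b - c - d = a + (- c - d + b).
Proof. ring. Qed.

Lemma lee_finE (x y : \bar R) (a b : R) : x = a%:E -> y = b%:E -> (x <= y)%E = (a <= b).
Proof. by move=> -> ->; rewrite lee_fin. Qed.

Lemma variation_bound (K1 a b W m t x r : R) : 0 < m -> 0 < t -> 0 <= x -> x <= a + t * b ->
  K1 + (2 * m)^-1 * a ^+ 2 <= K1 + (2 * m)^-1 * x ^+ 2 + (t ^+ 2 / 2 * W - t * r) ->
  r <= a * b / m + t * (W / 2 + (2 * m)^-1 * b ^+ 2).
Proof.
move=> m0 t0 x0 xab h.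
have h1 : x ^+ 2 <= (a + t * b) ^+ 2 by rewrite ler_sqr ?nnegrE ?(le_trans x0).
have m2 : 0 <= (2 * m)^-1 by rewrite invr_ge0 mulr_ge0// ltW.
have h2 := ler_wpM2l m2 h1.
rewrite -(ler_pM2l t0).
have -> : t * (a * b / m + t * (W / 2 + (2 * m)^-1 * b ^+ 2)) =
    t ^+ 2 / 2 * W + ((2 * m)^-1 * (a + t * b) ^+ 2 - (2 * m)^-1 * a ^+ 2).
  by field; rewrite gt_eqF.
by move: h h2; move: ((2 * m)^-1 * x ^+ 2) ((2 * m)^-1 * (a + t * b) ^+ 2) ((2 * m)^-1 * a ^+ 2) => p1 p2 p3;
  move: (t ^+ 2 / 2 * W) (t * r) => p4 p5; lra.
Qed.

End real_lemmas.

Lemma N1_0 {R : realType} {n : nat} (mu : {measure set 'rV[R]_n.+1 -> \bar R})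
  (G : set 'rV[R]_n.+1) : N1 mu G (fun=> 0) = 0.
Proof. by rewrite /N1; under eq_Rintegral do rewrite normr0; rewrite /Rintegral integral0. Qed.

(** * Residuals, the duality gap and the conjugates *)

Section duality.
Context {R : realType} {n : nat}.
Local Notation E := 'rV[R]_n.+1.
Local Notation lambda := (leb n.+1 : {measure set E -> \bar R}).
Variables (Omega : set E) (rho : R) (T : seq 'M[R]_n.+1) (G_I G_D G_N : set E).
Hypothesis oO : open Omega.
Hypothesis bO : forall x, Omega x -> `|x| <= rho.
Hypothesis lip : lipschitz_boundary Omega.
Hypothesis simp : simplicial_boundary Omega T.
Hypothesis spl : boundary_splitting Omega G_I G_D G_N.
Variables (m : R) (f : E -> R) (g : (E -> R) -> R) (uD uhat : E -> R).
Hypothesis m0 : 0 < m.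
Hypothesis Lf : L2 Omega f.
Hypothesis Hg : Hmhalf Omega T G_N g.
Hypothesis Huhat : H1 Omega uhat.
Hypothesis uhatD : ae_eq (surface_measure T) G_D (trace Omega T uhat) uD.
Implicit Types (phi psi u v w q h : E -> R) (y z : E -> E).
Local Notation sigma := (surface_measure T).
Local Notation bd := (bnd Omega).
Local Notation L2I := (Lp sigma G_I 2%:E).
Local Notation trace := (trace Omega T).
Local Notation H1_0 := (H1_0 Omega T).
Local Notation H1 := (H1 Omega).
Local Notation N1I := (N1 sigma G_I).
Local Notation nI := (snorm (ip sigma G_I)).
Local Notation wgrad := (wgrad Omega).
Local Notation wdiv := (wdiv Omega).
Local Notation ipvec := (ipvec Omega).
Local Notation ipO := (ip lambda Omega).
Local Notation ipI := (ip sigma G_I).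
Local Notation nflux := (nflux Omega).
Local Notation dualK := (dualK Omega T G_I G_D G_N f g).
Local Notation bflux := (bflux Omega T G_I G_D G_N).
Local Notation Noo := (Lpnorm sigma G_I +oo%E).

Let mO : measurable Omega := domain_measurable oO.
Let lO := domain_leb oO bO.
Let S1 := sip_h1ip oO bO.
Let SO := sip_ip lambda mO.
Let SV := sip_ipvec oO.
Let Ib := relatively_open_sub (split_openI spl).
Let Db := relatively_open_sub (split_openD spl).
Let Nb := relatively_open_sub (split_openN spl).
Let mI := relatively_open_measurable (split_openI spl).
Let sI : (sigma G_I < +oo)%E := surface_finite T mI.
Let SI := sip_ip sigma mI.

Let trL2 v : H1 v -> L2I (trace v) := traceI_L2 oO bO lip simp spl (v := v).

Definition residual y v : R := - ipvec y (wgrad v) + ipO f v + g (trace v).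

(** The condition v - uhat in H^1_D, written with [lcf] so that the linearity lemmas apply to it. *)
Definition admissible v := H1_0 G_D (lcf (-1) uhat v).

Lemma admissibleP v : H1 v -> ae_eq sigma G_D (trace v) uD <-> admissible v.
Proof.
move=> Hv; have t := ae_eq_subset Db (trace_lc oO bO lip simp (-1) Huhat Hv).
split=> [vD|[_ hv]].
  split; first exact: (sip_lc S1).
  by apply: filterS3 t uhatD vD => x h1 h2 h3 Dx; rewrite h1// /lcf h2// h3// mulN1r addNr.
apply: filterS3 t uhatD hv => x h1 h2 h3 Dx; have := h1 Dx; rewrite h3// /lcf h2// mulN1r addrC.
by move/eqP; rewrite eq_sym subr_eq0 => /eqP.
Qed.

Lemma N1_trace_lc a v v' : H1 v -> H1 v' ->
  N1I (trace (lcf a v v')) = N1I (lcf a (trace v) (trace v')).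
Proof.
move=> Hv Hv'; apply: N1_ae => //.
- exact: L2_measurable (trL2 (sip_lc S1 a Hv Hv')).
- exact: L2_measurable (L2_lc mI a (trL2 Hv) (trL2 Hv')).
- exact: ae_eq_subset Ib (trace_lc oO bO lip simp a Hv Hv').
Qed.

Lemma ipvec_wgrad_lc y a v v' : L2vec Omega y -> H1 v -> H1 v' ->
  ipvec y (wgrad (lcf a v v')) = a * ipvec y (wgrad v) + ipvec y (wgrad v').
Proof.
move=> Ly Hv Hv'; have [Hl El] := H1_lc oO bO a Hv Hv'.
have Ll := L2vec_lc oO a (wgrad_L2 Hv) (wgrad_L2 Hv').
apply: etrans (ipvec_ae oO Ly Ly (wgrad_L2 Hl) Ll (ae_eq_refl _ _ _) El) _.
apply: etrans (sip_sym SV Ly Ll) _.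
apply: etrans (sip_lin SV a (wgrad_L2 Hv) (wgrad_L2 Hv') Ly) _.
by congr (_ * _ + _); [exact: (sip_sym SV (wgrad_L2 Hv) Ly)|exact: (sip_sym SV (wgrad_L2 Hv') Ly)].
Qed.

Lemma residual_lc y a v v' : L2vec Omega y -> H1 v -> H1 v' ->
  residual y (lcf a v v') = a * residual y v + residual y v'.
Proof.
move=> Ly Hv Hv'.
have E1 := ipvec_wgrad_lc a Ly Hv Hv'.
have E2 := ip_lcr a mO Lf (H1_L2 Hv) (H1_L2 Hv').
have E3 := g_lc oO bO lip simp spl Hg a Hv Hv'.
have gen (p p' i i' k k' P I K : R) : P = a * p + p' -> I = a * i + i' -> K = a * k + k' ->
    - P + I + K = a * (- p + i + k) + (- p' + i' + k') by move=> -> -> ->; ring.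
exact: gen E1 E2 E3.
Qed.

Lemma nflux_div y v : Hdiv Omega y -> ae_eq lambda Omega (wdiv y) (fun x => - f x) -> H1 v ->
  nflux y v = ipvec y (wgrad v) - ipO f v.
Proof.
move=> Hy dy Hv; have Ly : L2vec Omega y by case: Hy.
have gen (p p' i i' : R) : p = p' -> i = - i' -> p + i = p' - i' by move=> -> ->.
apply: gen; first exact: (sip_sym SV (wgrad_L2 Hv) Ly).
have Ld := wdiv_L2 Hy.
have Lmf : L2 Omega (fun x => - f x).
  have := L2_lc mO (-1) Lf (L2_cst mO lO 0); congr (Lp _ _ _ _).
  by apply/funext => x; rewrite /lcf addr0 mulN1r.
have E1 := ip_ae mO (L2_measurable (H1_L2 Hv)) (L2_measurable (H1_L2 Hv)) (L2_measurable Ld)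
  (L2_measurable Lmf) (ae_eq_refl _ _ _) dy.
apply: etrans E1 _; rewrite (sip_sym SO (H1_L2 Hv) Lmf).
have -> : (fun x => - f x) = lcf (-1) f (fun=> 0).
  by apply/funext => x; rewrite /lcf addr0 mulN1r.
have L0 := L2_cst mO lO (0 : R).
apply: etrans (sip_lin SO (-1) Lf L0 (H1_L2 Hv)) _.
by rewrite (sip_sym SO L0 (H1_L2 Hv)) ip0r addr0 mulN1r.
Qed.

Lemma dualK_nflux y v : dualK y -> H1 v -> nflux y v = ipvec y (wgrad v) - ipO f v.
Proof. by move=> [[Hy _] dy _]; exact: nflux_div Hy dy. Qed.

Lemma ip_trace0 q v : L2I q -> H1_0 G_I v -> ipI q (trace v) = 0.
Proof.
move=> Lq [Hv v0]; have L0 := L2_cst mI sI (0 : R); have mq := L2_measurable Lq.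
exact: etrans (ip_ae mI mq mq (L2_measurable (trL2 Hv)) (L2_measurable L0) (ae_eq_refl _ _ _) v0) (ip0r _ _ _).
Qed.

Lemma dualK_bflux y : dualK y -> Lp sigma G_I +oo%E (bflux y).
Proof. by move=> [HI _ _]; have [] := bfluxP HI. Qed.

Lemma dualK_identity y v : dualK y -> H1_0 G_D v ->
  nflux y v - ipI (bflux y) (trace v) = g (trace v).
Proof.
move=> Ky Hv; have [HI dy hI] := Ky; have [Hy _] := HI; have [Lq hq] := bfluxP HI.
exact: (flux_identity oO bO lip simp spl Hg Hy Lq hq hI Hv).
Qed.

Lemma dualK_residual y v : dualK y -> H1_0 G_D v ->
  residual y v = - ipI (bflux y) (trace v).
Proof.
move=> Ky Hv; have E1 := dualK_identity Ky Hv; have E2 := dualK_nflux Ky (H1_0_H1 Hv).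
have gen (p i k N q : R) : N - q = k -> N = p - i -> - p + i + k = - q by move=> <- ->; ring.
exact: gen E1 E2.
Qed.

(* By L^1-L^oo duality on G_I, dualK is the set of fields y with an L^1-bounded
   residual. *)
Lemma residual_bound_dualK y c : L2vec Omega y -> 0 <= c ->
  (forall v, H1_0 G_D v -> `|residual y v| <= c * N1I (trace v)) ->
  dualK y /\ Noo (bflux y) <= c.
Proof.
move=> Ly c0 hc.
have Llin a v v' : H1_0 G_D v -> H1_0 G_D v' -> residual y (lcf a v v') = a * residual y v + residual y v'.
  by move=> Hv Hv'; exact: (residual_lc a Ly (H1_0_H1 Hv) (H1_0_H1 Hv')).
have [q [Lq qc hq]] := flux_rep oO bO lip simp spl c0 Llin hc.
have LqI := Linf_L2 mI sI Lq.
have Lmf : L2 Omega (fun x => - f x).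
  have := L2_lc mO (-1) Lf (L2_cst mO lO 0); congr (Lp _ _ _ _).
  by apply/funext => x; rewrite /lcf addr0 mulN1r.
have dv : is_wdiv Omega y (fun x => - f x).
  split=> // phi tphi; have sphi := test_function_smooth tphi.
  have Hphi := H1_smooth oO bO sphi; have Lphi := H1_L2 Hphi.
  have b0 x : bd x -> phi x = 0.
    move=> [_ nx]; apply: (test_function_supp tphi) => Ox; apply: nx.
    by have := oO; rewrite openE; exact.
  have z G : G `<=` bd -> H1_0 G phi.
    by move=> Gb; apply: (H1_0_smooth oO bO lip simp Gb sphi) => x /Gb; exact: b0.
  have g0 : g (trace phi) = 0 := g_eq0 oO bO lip simp spl Hg (z _ Nb).
  have i0 : ipI q (trace phi) = 0 := ip_trace0 LqI (z _ Ib).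
  have E1 := hq _ (z _ Db).
  have [Lg _] := is_wgrad_smooth oO bO sphi.
  have E2 := ipvec_ae oO Ly Ly (wgrad_L2 Hphi) Lg (ae_eq_refl _ _ _) (wgrad_smooth oO bO sphi).
  have E3 : ipO (fun x => - f x) phi = - ipO f phi.
    have -> : (fun x => - f x) = lcf (-1) f (fun=> 0).
      by apply/funext => x; rewrite /lcf addr0 mulN1r.
    have L0 := L2_cst mO lO (0 : R).
    apply: etrans (sip_lin SO (-1) Lf L0 Lphi) _.
    by rewrite (sip_sym SO L0 Lphi) ip0r addr0 mulN1r.
  exact: wdiv_of_residual E1 i0 g0 E2 E3.
have [Hy dy] := is_wdivP oO bO Ly dv.
have L0 := L2_cst mI sI (0 : R).
pose q' := lcf (-1) q (fun=> 0).
have Lq' : L2I q' := L2_lc mI (-1) LqI L0.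
have [Loo le] : Lp sigma G_I +oo%E q' /\ Noo q' <= c.
  apply: Linf_bound c0 _; first exact: L2_measurable Lq'.
  apply: filterS (Linf_ae Lq) => x h Gx; rewrite /q' /lcf addr0 mulN1r normrN.
  exact: le_trans (h Gx) qc.
have bq' : is_bflux Omega T G_I G_D G_N y q'.
  split=> // v Dv Nv; have Hv := H1_0_H1 Dv; have Lv := trL2 Hv.
  have E1 := hq _ Dv; have E2 := g_eq0 oO bO lip simp spl Hg Nv.
  have E3 := nflux_div Hy dy Hv.
  have E4 : ipI q' (trace v) = - ipI q (trace v).
    apply: etrans (sip_lin SI (-1) LqI L0 Lv) _.
    by rewrite (sip_sym SI L0 Lv) ip0r addr0 mulN1r.
  exact: flux_of_residual E1 E2 E3 E4.
have HI : HbarI Omega T G_I G_D G_N y by split=> //; exists q'.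
split.
  split=> // v Iv Dv; have E1 := hq _ Dv; have E2 := ip_trace0 LqI Iv.
  have E3 := nflux_div Hy dy (H1_0_H1 Dv).
  exact: nflux_of_residual E1 E2 E3.
have ae := is_bflux_unique oO bO lip simp spl (bfluxP HI) bq'.
have [Lb _] := bfluxP HI.
have [] // : Lp sigma G_I +oo%E (bflux y) /\ Noo (bflux y) <= c.
apply: Linf_bound c0 _; first by case: Lb.
apply: filterS2 ae (Linf_ae Loo) => x h h' Gx; rewrite (h Gx).
exact: le_trans (h' Gx) le.
Qed.

Lemma snormvec y : L2vec Omega y -> normvec Omega y ^+ 2 = ipvec y y.
Proof. by move=> Ly; rewrite /normvec sqr_sqrtr// (sip_ge0 SV). Qed.

(** Differences of admissible functions lie in H^1_D, where the residual and the flux pairing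
    cancel. Hence the affine part of the conjugate of F is a constant for y in [dualK], and the dual
    value can be computed with any admissible function in place of the lift. *)
Lemma dualK_flux y v : dualK y -> admissible v -> H1 v ->
  residual y v + ipI (bflux y) (trace v) = residual y uhat + ipI (bflux y) (trace uhat).
Proof.
move=> Ky Av Hv; have [[[Ly _] _] _ _] := Ky.
have E1 := residual_lc (-1) Ly Huhat Hv.
have LqI := Linf_L2 mI sI (dualK_bflux Ky).
have E2 := ip_trace_lc oO bO lip simp spl (-1) LqI Huhat Hv.
have E3 := dualK_residual Ky Av.
exact: flux_shift E1 E2 E3.
Qed.

Definition primal v : R := 2^-1 * normvec Omega (wgrad v) ^+ 2
     + (2 * m)^-1 * N1I (trace v) ^+ 2 - ipO f v - g (trace v).

Definition dual y : R := - (2^-1 * normvec Omega y ^+ 2) - m / 2 * Noo (bflux y) ^+ 2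
     + nflux y uhat - ipI (bflux y) (trace uhat) - g (trace uhat).

Lemma dualE y v : dualK y -> admissible v -> H1 v ->
  dual y = - (2^-1 * normvec Omega y ^+ 2) - m / 2 * Noo (bflux y) ^+ 2
    - residual y v - ipI (bflux y) (trace v).
Proof.
move=> Ky Av Hv; have E1 := dualK_flux Ky Av Hv; have E2 := dualK_nflux Ky Huhat.
exact: dual_value_eq E1 E2.
Qed.

Lemma ipvec_sub y v : L2vec Omega y -> H1 v ->
  normvec Omega (lcv (-1) y (wgrad v)) ^+ 2 =
  normvec Omega y ^+ 2 - 2 * ipvec y (wgrad v) + normvec Omega (wgrad v) ^+ 2.
Proof.
move=> Ly Hv; have Lw := wgrad_L2 Hv.
rewrite !snormvec//; last exact: (L2vec_lc oO).
rewrite (sip_lcE SV (-1) Ly Lw); ring.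
Qed.

Lemma duality_gap y v : dualK y -> admissible v -> H1 v ->
  primal v - dual y = 2^-1 * normvec Omega (lcv (-1) y (wgrad v)) ^+ 2
    + ((2 * m)^-1 * N1I (trace v) ^+ 2 + m / 2 * Noo (bflux y) ^+ 2 + ipI (bflux y) (trace v)).
Proof.
move=> Ky Av Hv; have [[[Ly _] _] _ _] := Ky.
have E1 := dualE Ky Av Hv; have E2 := ipvec_sub Ly Hv.
exact: gap_identity E1 E2.
Qed.

Lemma bflux_gap y v : dualK y -> H1 v ->
  0 <= (2 * m)^-1 * N1I (trace v) ^+ 2 + m / 2 * Noo (bflux y) ^+ 2 + ipI (bflux y) (trace v).
Proof.
move=> Ky Hv; have h := holder_ip mI sI (dualK_bflux Ky) (trL2 Hv).
have h2 := young_le (Noo (bflux y)) (N1I (trace v)) m0.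
exact: gap_ge0 h h2.
Qed.

Lemma weak_duality y v : dualK y -> admissible v -> H1 v ->
  2^-1 * normvec Omega (lcv (-1) y (wgrad v)) ^+ 2 <= primal v - dual y.
Proof.
by move=> Ky Av Hv; rewrite (duality_gap Ky Av Hv) lerDl; exact: bflux_gap.
Qed.

Lemma primal_lc t w u : H1 w -> H1 u ->
  primal (lcf t w u) = 2^-1 * normvec Omega (wgrad u) ^+ 2
    + (2 * m)^-1 * N1I (trace (lcf t w u)) ^+ 2 - ipO f u - g (trace u)
    + (t ^+ 2 / 2 * normvec Omega (wgrad w) ^+ 2 - t * residual (wgrad u) w).
Proof.
move=> Hw Hu; have Hl := sip_lc S1 t Hw Hu.
have Lw := wgrad_L2 Hw; have Lu := wgrad_L2 Hu; have Ll := wgrad_L2 Hl.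
have E2 := ip_lcr t mO Lf (H1_L2 Hw) (H1_L2 Hu).
have E3 := g_lc oO bO lip simp spl Hg t Hw Hu.
have E1 : normvec Omega (wgrad (lcf t w u)) ^+ 2 =
    t * (t * normvec Omega (wgrad w) ^+ 2 + ipvec (wgrad u) (wgrad w))
    + (t * ipvec (wgrad u) (wgrad w) + normvec Omega (wgrad u) ^+ 2).
  apply: etrans (snormvec Ll) _; apply: etrans (ipvec_wgrad_lc t Ll Hw Hu) _.
  apply: lc_eq.
    apply: etrans (sip_sym SV Ll Lw) _; apply: etrans (ipvec_wgrad_lc t Lw Hw Hu) _.
    exact: (lc_eq _ (esym (snormvec Lw)) (sip_sym SV Lw Lu)).
  apply: etrans (sip_sym SV Ll Lu) _; apply: etrans (ipvec_wgrad_lc t Lu Hw Hu) _.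
  exact: (lc_eq _ erefl (esym (snormvec Lu))).
exact: (primal_expansion _ E1 E2 E3).
Qed.

Lemma admissible_lc t w v : H1_0 G_D w -> admissible v -> admissible (lcf t w v).
Proof.
move=> Dw Av; have := H1_0_lc oO bO lip simp Db t Dw Av; rewrite /admissible.
congr (H1_0 G_D _); apply/funext => x; rewrite /lcf; ring.
Qed.

(** * First variation and strong duality at a minimizer *)

Section minimizer.
Variable u : E -> R.
Hypothesis Hu : H1 u.
Hypothesis Au : admissible u.
Hypothesis umin : forall v, H1 v -> admissible v -> primal u <= primal v.
Local Notation z := (wgrad u).
Local Notation a := (N1I (trace u)).

(** The L^1 norm is not differentiable, so its one-sided derivative along w is replaced by any slope
    b that bounds its growth on ]0, 1]. A negative b is allowed and is what the direction close to
    -u uses. *)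
Lemma first_variation w b : H1_0 G_D w ->
  (forall t, 0 < t -> t <= 1 -> N1I (trace (lcf t w u)) <= a + t * b) ->
  residual z w <= a * b / m.
Proof.
move=> Dw hb; have Hw := H1_0_H1 Dw; apply: le_add_small => t t0 t1.
have h := umin (sip_lc S1 t Hw Hu) (admissible_lc t Dw Au).
rewrite (primal_lc t Hw Hu) in h.
exact: (variation_bound m0 t0 (N1_ge0 _ _ _) (hb t t0 t1) (primal_regroup h)).
Qed.

Lemma N1_trace_pert t w : H1 w -> N1I (trace (lcf t w u)) <= a + `|t| * N1I (trace w).
Proof.
move=> Hw; have E1 := N1_trace_lc t Hw Hu.
exact: (leC_trans E1 (N1_lc mI sI t (trL2 Hw) (trL2 Hu))).
Qed.

Lemma residual_minimizer w : H1_0 G_D w -> `|residual z w| <= a / m * N1I (trace w).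
Proof.
move=> Dw; have Hw := H1_0_H1 Dw.
have Lz := wgrad_L2 Hu.
have h1 : residual z w <= a * N1I (trace w) / m.
  apply: first_variation => // t t0 _.
  by have := N1_trace_pert t Hw; rewrite (ger0_norm (ltW t0)).
pose w0 : E -> R := fun=> 0.
have D0 : H1_0 G_D w0 by apply: (H1_0_smooth oO bO lip simp Db) => //; exact: smooth_cst.
have H0 := H1_0_H1 D0.
have R0 : residual z w0 = 0.
  have := residual_lc (-1) Lz H0 H0; rewrite mulN1r addNr => <-; congr (residual z _).
  by apply/funext => x; rewrite /lcf /w0 mulr0 addr0.
have N0 : N1I (trace w0) = 0.
  apply: etrans (N1_trace_smooth oO bO lip simp spl (smooth_cst 0)) _; exact: N1_0.
have Dm := H1_0_lc oO bO lip simp Db (-1) Dw D0; have Hm := H1_0_H1 Dm.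
have h2 : residual z (lcf (-1) w w0) <= a * N1I (trace w) / m.
  apply: first_variation => // t t0 _.
  have -> : lcf t (lcf (-1) w w0) u = lcf (- t) w u.
    by apply/funext => x; rewrite /lcf /w0; ring.
  by have := N1_trace_pert (- t) Hw; rewrite normrN (ger0_norm (ltW t0)).
have E1 := residual_lc (-1) Lz Hw H0.
exact: (abs_residual_le h1 h2 E1 R0).
Qed.

Lemma dualK_minimizer : dualK z /\ Noo (bflux z) <= a / m.
Proof.
apply: residual_bound_dualK; first exact: wgrad_L2.
- by rewrite divr_ge0 ?(ltW m0)// N1_ge0.
- exact: residual_minimizer.
Qed.

(** A test function phi close to -u in L^2([G_I]) lowers the L^1 norm at the full rate: the slope is
    -a + d * c. As the residual of phi is minus its pairing with the flux, this bounds the pairing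
    of the flux with u from above, up to errors of order d. *)
Lemma ip_bflux_minimizer : ipI (bflux z) (trace u) <= - (a ^+ 2 / m).
Proof.
have [Kz zle] := dualK_minimizer.
have Lq := dualK_bflux Kz; have LqI := Linf_L2 mI sI Lq.
have [U oU GU] := split_openI spl.
have IU : G_I `<=` U by rewrite GU => x [].
have Lu := trL2 Hu.
have L0 := L2_cst mI sI (0 : R).
have Lmu := L2_lc mI (-1) Lu L0.
set c := nI (fun=> 1); have c0 : 0 <= c := snorm_ge0 _ _.
apply: (@le_add_small _ _ _ ((2 * a / m) * c)) => d d0 _.
have [phi tphi hphi] := test_function_dense mI oU IU sI Lmu d0.
have sphi := test_function_smooth tphi; have Lphi := L2I_smooth T bO spl sphi.
have Dphi : H1_0 G_D phi := test_part oO bO lip simp GU Db (split_ID spl) tphi.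
have Hphi := H1_0_H1 Dphi.
pose q := lcf 1 phi (trace u).
have Lq2 : L2I q := L2_lc mI 1 Lphi Lu.
have Nq : N1I q <= d * c.
  have -> : q = lcf (-1) (lcf (-1) phi (lcf (-1) (trace u) (fun=> 0))) (fun=> 0).
    by apply/funext => x; rewrite /q /lcf; ring.
  apply: le_trans (N1_lc mI sI (-1) (L2_lc mI (-1) Lphi Lmu) L0) _.
  rewrite N1_0 addr0 normrN1 mul1r.
  exact: (le_trans (N1_le mI sI (L2_lc mI (-1) Lphi Lmu)) (ler_wpM2r c0 hphi)).
have hv : residual z phi <= a * (- a + d * c) / m.
  apply: first_variation => // t t0 t1.
  have E0 : N1I (lcf t (trace phi) (trace u)) = N1I (lcf t phi (trace u)).
    apply: N1_ae => //.
    - exact: L2_measurable (L2_lc mI t (trL2 Hphi) Lu).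
    - exact: L2_measurable (L2_lc mI t Lphi Lu).
    - by apply: filterS (traceI_smooth oO bO lip simp spl sphi) => x h Gx; rewrite /lcf h.
  have L1 := L2_lc mI (- t) Lu Lu.
  (* On [G_I], u + t phi = t q + (1 - t) u with q = phi + u small; t <= 1 keeps the second weight
     nonnegative. *)
  have E1 : N1I (lcf t phi (trace u)) <= t * N1I q + N1I (lcf (- t) (trace u) (trace u)).
    have -> : lcf t phi (trace u) = lcf t q (lcf (- t) (trace u) (trace u)).
      by apply/funext => x; rewrite /q /lcf; ring.
    apply: le_trans (N1_lc mI sI t Lq2 L1) _; rewrite (ger0_norm (ltW t0)); exact: lexx.
  have E2 : N1I (lcf (- t) (trace u) (trace u)) <= (1 - t) * a.
    have -> : lcf (- t) (trace u) (trace u) = lcf (1 - t) (trace u) (fun=> 0).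
      by apply/funext => x; rewrite /lcf; ring.
    have := N1_lc mI sI (1 - t) Lu L0; rewrite N1_0 addr0 ger0_norm ?subr_ge0//.
  exact: (convex_pert_le (N1_trace_lc t Hphi Hu) E0 E1 E2 t0 Nq).
have E1 := dualK_residual Kz Dphi.
have E2 := ip_trace_smooth oO bO lip simp spl LqI sphi.
have E3 := ip_lcr 1 mI LqI Lphi Lu.
have E4 := holder_ip mI sI Lq Lq2.
exact: (flux_pairing_le m0 (N1_ge0 _ _ _) (N1_ge0 _ _ _) hv E1 E2 E3 E4 zle Nq).
Qed.

Lemma flux_relation :
  - ipI (bflux z) (trace u) = m / 2 * Noo (bflux z) ^+ 2 + (2 * m)^-1 * a ^+ 2.
Proof.
have [Kz zle] := dualK_minimizer.
exact: (gap_closed m0 (Lpnorm_ge0 _ _ _ _) (N1_ge0 _ _ _) zle (bflux_gap Kz Hu) ip_bflux_minimizer).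
Qed.

Lemma strong_duality : primal u = dual z.
Proof.
have [Kz _] := dualK_minimizer; have Lz := wgrad_L2 Hu.
exact: (gap_zero (duality_gap Kz Au Hu) (ipvec_sub Lz Hu) (snormvec Lz) flux_relation).
Qed.

Lemma dual_le y : dualK y -> dual y <= dual z.
Proof.
move=> Ky; rewrite -strong_duality -subr_ge0; apply: le_trans (weak_duality Ky Au Hu).
by rewrite mulr_ge0 ?sqr_ge0// invr_ge0.
Qed.

Lemma dual_unique y : dualK y -> dual z <= dual y -> ae_eq lambda Omega y z.
Proof.
move=> Ky le; have [[[Ly _] _] _ _] := Ky; have Lz := wgrad_L2 Hu.
have Ld := L2vec_lc oO (-1) Ly Lz.
have h := weak_duality Ky Au Hu; rewrite strong_duality in h.
have h0 : ipvec (lcv (-1) y z) (lcv (-1) y z) = 0.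
  apply/eqP; rewrite eq_le (sip_ge0 SV Ld) andbT; rewrite -snormvec//.
  move: h; rewrite -(ler_pM2l (ltr0n R 2 : 0 < 2)) => h; exact: (gap_norm_le0 h le).
apply: filterS (ipvec_eq0_ae oO Ld h0) => x hx Ox; have := hx Ox.
rewrite /lcv scaleN1r addrC => /eqP; rewrite subr_eq0 => /eqP; exact: esym.
Qed.

End minimizer.

(** * The conjugates of F and G *)

Lemma admissible_uhat : admissible uhat.
Proof. by apply/(admissibleP Huhat). Qed.

(** The supremum over admissible functions controls the one over all of L^2([G_I]), because the
    traces of uhat + phi with phi a test function of U are dense there. Scaling then separates the
    linear pairing from the quadratic term, and L^1-L^oo duality recovers the norm of the flux. *)
Lemma dual_sup_bound y k : dualK y ->
  (forall v, H1 v -> admissible v -> - ipI (bflux y) (trace v) - (2 * m)^-1 * N1I (trace v) ^+ 2 <= k) ->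
  m / 2 * Noo (bflux y) ^+ 2 <= k.
Proof.
move=> Ky hk; have Lq := dualK_bflux Ky; have LqI := Linf_L2 mI sI Lq.
have [U oU GU] := split_openI spl.
have IU : G_I `<=` U by rewrite GU => x [].
have Lu := trL2 Huhat; have L0 := L2_cst mI sI (0 : R).
set c := nI (fun=> 1); have c0 : 0 <= c := snorm_ge0 _ _.
have ext q : L2I q -> - ipI (bflux y) q - (2 * m)^-1 * N1I q ^+ 2 <= k.
  move=> L; apply: (@le_add_small _ _ _
    ((2 * m)^-1 * (2 * N1I q * c + c ^+ 2) + Noo (bflux y) * c)) => d d0 d1.
  have [phi tphi hphi] := test_function_dense mI oU IU sI (L2_lc mI (-1) Lu L) d0.
  have sphi := test_function_smooth tphi; have Lphi := L2I_smooth T bO spl sphi.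
  have Dphi : H1_0 G_D phi := test_part oO bO lip simp GU Db (split_ID spl) tphi.
  have Hphi := H1_0_H1 Dphi.
  have Hv := sip_lc S1 1 Hphi Huhat.
  have h := hk _ Hv (admissible_lc 1 Dphi admissible_uhat).
  have Ld := L2_lc mI (-1) Lphi (L2_lc mI (-1) Lu L).
  have N1d := le_trans (N1_le mI sI Ld) (ler_wpM2r c0 hphi).
  have Lt := L2_lc mI 1 Lphi Lu.
  have dE : lcf (-1) phi (lcf (-1) (trace uhat) q) = lcf (-1) (lcf 1 phi (trace uhat)) q.
    by apply/funext => x; rewrite /lcf; ring.
  rewrite dE in N1d Ld.
  have E0 : N1I (trace (lcf 1 phi uhat)) = N1I (lcf 1 phi (trace uhat)).
    apply: etrans (N1_trace_lc 1 Hphi Huhat) _; apply: N1_ae => //.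
    - exact: L2_measurable (L2_lc mI 1 (trL2 Hphi) Lu).
    - exact: L2_measurable Lt.
    - by apply: filterS (traceI_smooth oO bO lip simp spl sphi) => x k' Gx; rewrite /lcf k'.
  have E1 : ipI (bflux y) (trace (lcf 1 phi uhat)) = ipI (bflux y) (lcf 1 phi (trace uhat)).
    apply: etrans (ip_trace_lc oO bO lip simp spl 1 LqI Hphi Huhat) _.
    apply: etrans _ (esym (ip_lcr 1 mI LqI Lphi Lu)).
    exact: lc_eq (ip_trace_smooth oO bO lip simp spl LqI sphi) erefl.
  have E2 := ip_lcr (-1) mI LqI Lt L.
  have h2 := holder_ip mI sI Lq Ld.
  have h3 : N1I (lcf 1 phi (trace uhat)) <= d * c + N1I q.
    have -> : lcf 1 phi (trace uhat) = lcf (-1) (lcf (-1) (lcf 1 phi (trace uhat)) q) q.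
      by apply/funext => x; rewrite /lcf; ring.
    apply: le_trans (N1_lc mI sI (-1) Ld L) _.
    by rewrite normrN1 mul1r lerD2r.
  exact: (pairing_pert_le m0 d0 d1 c0 (N1_ge0 _ _ _) (N1_ge0 _ _ _) (Lpnorm_ge0 _ _ _ _) h E0 E1 E2 h2 N1d h3).
have k0 : 0 <= k by have := ext _ L0; rewrite ip0r N1_0 expr0n mulr0 subr0 oppr0.
(* Inserting -t q and optimizing over t bounds |(yn, q)| by this constant times the L^1 norm of q; m
   / 2 times its square is k. *)
have b0 : 0 <= Num.sqrt (2 * k / m) := sqrtr_ge0 _.
have [|_ le] := L1_dual_bound mI sI b0 LqI.
  move=> q L; apply: quad_bound m0 (N1_ge0 _ _ _) _ => t.
  have h := ext _ (L2_lc mI (- t) L L0).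
  have E1 := ip_lcr (- t) mI LqI L L0.
  have h2 := N1_lc mI sI (- t) L L0.
  rewrite N1_0 addr0 normrN in h2; rewrite ip0r addr0 in E1.
  exact: (pairing_scale_le m0 (N1_ge0 _ _ _) h E1 h2).
have h : Noo (bflux y) ^+ 2 <= 2 * k / m.
  rewrite -(@sqr_sqrtr _ (2 * k / m)); last by rewrite divr_ge0 ?(ltW m0)// mulr_ge0.
  by rewrite ler_sqr ?nnegrE// Lpnorm_ge0.
have -> : k = m / 2 * (2 * k / m) by field; rewrite gt_eqF.
by rewrite ler_wpM2l// divr_ge0// ltW.
Qed.

(** Along the lines uhat + t w with w in H^1_D the hypothesis holds for every real t, which by
    [affine_bound] bounds the residual of w linearly by the L^1 norm of its trace. *)
Lemma residual_sup_dualK y c : L2vec Omega y ->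
  (forall v, H1 v -> admissible v -> residual y v - (2 * m)^-1 * N1I (trace v) ^+ 2 <= c) ->
  dualK y.
Proof.
move=> Ly hc.
pose K := `|c - residual y uhat| + (2 * m)^-1 * (N1I (trace uhat) + 1) ^+ 2.
have K0 : 0 <= K by rewrite addr_ge0// mulr_ge0 ?sqr_ge0// invr_ge0 mulr_ge0// ltW.
apply: (proj1 (residual_bound_dualK Ly K0 _)).
move=> w Dw; have Hw := H1_0_H1 Dw; apply: affine_bound m0 (N1_ge0 _ _ _) _ => t.
have h := hc _ (sip_lc S1 t Hw Huhat) (admissible_lc t Dw admissible_uhat).
have E1 := residual_lc t Ly Hw Huhat.
have h1 : N1I (trace (lcf t w uhat)) <= N1I (trace uhat) + `|t| * N1I (trace w).
  exact: (leC_trans (N1_trace_lc t Hw Huhat) (N1_lc mI sI t (trL2 Hw) (trL2 Huhat))).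
exact: (residual_scale_le m0 (N1_ge0 _ _ _) h E1 h1).
Qed.

Lemma funcFE v : H1 v -> admissible v ->
  funcF Omega T G_I G_D m f g uD v = (- ipO f v - g (trace v) + (2 * m)^-1 * N1I (trace v) ^+ 2)%:E.
Proof.
move=> Hv Av; have aD := (admissibleP Hv).2 Av.
by rewrite /funcF (asboolT aD) Lpnorm1E.
Qed.

Lemma funcF_oo v : H1 v -> ~ admissible v -> funcF Omega T G_I G_D m f g uD v = +oo%E.
Proof.
move=> Hv nAv; have nD := contra_not (admissibleP Hv).1 nAv.
by rewrite /funcF (asboolF nD).
Qed.

Lemma primalIE v : H1 v -> admissible v -> primalI Omega T G_I G_D m f g uD v = (primal v)%:E.
Proof.
move=> Hv Av; have aD := (admissibleP Hv).2 Av.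
by rewrite /primalI (asboolT aD) Lpnorm1E.
Qed.

Local Notation conjF y := (fenchel H1 (funcF Omega T G_I G_D m f g uD) (fun v => - grad_adjoint Omega y v)%R).

Lemma conjF_le y v : H1 v -> admissible v ->
  ((residual y v - (2 * m)^-1 * N1I (trace v) ^+ 2)%:E <= conjF y)%E.
Proof.
move=> Hv Av; apply: ereal_sup_ubound; exists v => //; rewrite (funcFE Hv Av) -EFinB.
congr EFin; exact: conj_regroup.
Qed.

Lemma conjF_lub y (c : \bar R) :
  (forall v, H1 v -> admissible v -> ((residual y v - (2 * m)^-1 * N1I (trace v) ^+ 2)%:E <= c)%E) ->
  (conjF y <= c)%E.
Proof.
move=> h; apply: ge_ereal_sup => _ [v Hv <-].
have [Av|nAv] := pselect (admissible v); last by rewrite (funcF_oo Hv nAv) leNye.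
apply: le_trans (h _ Hv Av); rewrite (funcFE Hv Av) -EFinB lee_fin.
rewrite le_eqVlt; apply/orP; left; apply/eqP; exact: conj_regroup.
Qed.

(** The value -oo is excluded because the lift [uhat] is admissible. *)
Lemma conjF_real y : conjF y != +oo%E -> exists c : R, conjF y = c%:E.
Proof.
have := conjF_le y Huhat admissible_uhat.
by case: (conjF y) => // c _ _; exists c.
Qed.

Lemma conjF_dualK y : dualK y ->
  conjF y = (residual y uhat + ipI (bflux y) (trace uhat) + m / 2 * Noo (bflux y) ^+ 2)%:E.
Proof.
move=> Ky; set r0 := residual y uhat + _; set s2 := m / 2 * _.
have up : (conjF y <= (r0 + s2)%:E)%E.
  apply: conjF_lub => v Hv Av; rewrite lee_fin.
  exact: (conj_upper (dualK_flux Ky Av Hv) (bflux_gap Ky Hv)).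
have [|c cE] := @conjF_real y.
  by apply: contraTneq up => ->; rewrite leye_eq.
apply/eqP; rewrite eq_le up /= cE lee_fin -lerBrDl; apply: (dual_sup_bound Ky) => v Hv Av.
have := conjF_le y Hv Av; rewrite cE lee_fin => h.
exact: (conj_lower (dualK_flux Ky Av Hv) h).
Qed.

Lemma conjF_oo y : L2vec Omega y -> ~ dualK y -> conjF y = +oo%E.
Proof.
move=> Ly nK; apply/eqP; apply: contra_notT nK => /conjF_real[c cE].
apply: (@residual_sup_dualK y c Ly) => v Hv Av.
by have := conjF_le y Hv Av; rewrite cE lee_fin.
Qed.

Lemma conjG y : L2vec Omega y ->
  fenchel (L2vec Omega) (funcG Omega) (ipvec y) = (2^-1 * normvec Omega y ^+ 2)%:E.
Proof.
move=> Ly; apply/eqP; rewrite eq_le; apply/andP; split.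
  apply: ge_ereal_sup => _ [w Lw <-]; rewrite /funcG -EFinB lee_fin.
  have h := sip_ge0 SV (L2vec_lc oO (-1) Ly Lw).
  have E1 := sip_lcE SV (-1) Ly Lw.
  exact: (conj_young (snormvec Ly) (snormvec Lw) E1 h).
apply: ereal_sup_ubound; exists y => //; rewrite /funcG -EFinB.
congr EFin; exact: esym (half_sub (snormvec Ly)).
Qed.

Lemma dualDE y : dualK y -> dualD Omega T G_I G_D G_N m f g uhat y = (dual y)%:E.
Proof. by move=> Ky; rewrite /dualD asboolT. Qed.

Lemma dualD_oo y : ~ dualK y -> dualD Omega T G_I G_D G_N m f g uhat y = -oo%E.
Proof. by move=> nK; rewrite /dualD asboolF. Qed.

Lemma fenchel_dual_dualK y : dualK y ->
  fenchel_dual Omega T G_I G_D m f g uD y = (dual y)%:E.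
Proof.
move=> Ky; have [[[Ly _] _] _ _] := Ky.
rewrite /fenchel_dual (conjF_dualK Ky) (conjG Ly) -EFinN -EFinB; congr EFin.
exact: (conj_sum (dualE Ky admissible_uhat Huhat)).
Qed.

Lemma fenchel_dual_oo y : L2vec Omega y -> ~ dualK y ->
  fenchel_dual Omega T G_I G_D m f g uD y = -oo%E.
Proof. by move=> Ly nK; rewrite /fenchel_dual (conjF_oo Ly nK) (conjG Ly). Qed.

End duality.

Theorem theorem3p1 (R : realType) (n : nat)
  (Omega : set 'rV[R]_n.+1) (T : seq 'M[R]_n.+1)
  (G_I G_D G_N : set 'rV[R]_n.+1)
  (m : R) (f : 'rV[R]_n.+1 -> R) (g : ('rV[R]_n.+1 -> R) -> R)
  (uD uhatD u : 'rV[R]_n.+1 -> R) :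
  simplicial_lipschitz_domain Omega T ->
  boundary_splitting Omega G_I G_D G_N ->
  G_I !=set0 ->
  0 < m ->
  L2 Omega f ->
  Hmhalf Omega T G_N g ->
  Hhalf Omega T G_D uD ->
  H1 Omega uhatD ->
  ae_eq (surface_measure T) G_D (trace Omega T uhatD) uD ->
  let I := primalI Omega T G_I G_D m f g uD in
  let D := dualD Omega T G_I G_D G_N m f g uhatD in
  let HI := HbarI Omega T G_I G_D G_N in
  let sigma := surface_measure T in
  let lambda := leb n.+1 in
  primalK Omega T G_D uhatD u ->
  (forall v, H1 Omega v -> (I u <= I v)%E) ->
  [/\ (forall v, H1 Omega v ->
         I v = (funcG Omega (wgrad Omega v)
                + funcF Omega T G_I G_D m f g uD v)%E),
      (forall y, L2vec Omega y ->
         (HI y -> fenchel_dual Omega T G_I G_D m f g uD y = D y) /\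
         (~ HI y -> fenchel_dual Omega T G_I G_D m f g uD y = -oo%E)) &
      exists z : 'rV[R]_n.+1 -> 'rV[R]_n.+1,
        let zn := bflux Omega T G_I G_D G_N z in
        [/\ (HI z /\ forall y, HI y -> (D y <= D z)%E),
            (forall z', HI z' -> (forall y, HI y -> (D y <= D z')%E) ->
               ae_eq lambda Omega z' z),
            (ae_eq lambda Omega (wdiv Omega z) (fun x => - f x) /\
             forall v, H1_0 Omega T G_D v ->
               nflux Omega z v - ip sigma G_I zn (trace Omega T v)
               = g (trace Omega T v)),
            I u = D z &
            (ae_eq lambda Omega z (wgrad Omega u) /\
             - ip sigma G_I zn (trace Omega T u)
             = m / 2 * Lpnorm sigma G_I +oo%E zn ^+ 2
               + (2 * m)^-1 * Lpnorm sigma G_I 1%:E (trace Omega T u) ^+ 2)]].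
Proof.
move=> [oO _ bndO lip simp] spl _ m0 Lf Hg _ Huhat uDae I D HI sigma lambda [Hu Au0] umin.
have [rho bO] : exists rho : R, forall x, Omega x -> `|x| <= rho.
  have [M [_ hM]] := bndO; exists (M + 1) => x Ox; apply: hM Ox; by rewrite ltrDl.
have Au : admissible Omega T G_D uhatD u.
  move: Au0; rewrite /admissible; congr (H1_0 Omega T G_D _).
  by apply/funext => x; rewrite /lcf /= mulN1r addrC.
have IE v := @primalIE _ _ Omega rho T G_I G_D G_N oO bO lip simp spl m f g uD uhatD Huhat uDae v.
have umin' v : H1 Omega v -> admissible Omega T G_D uhatD v ->
    primal Omega T G_I m f g u <= primal Omega T G_I m f g v.
  by move=> Hv Av; have := umin v Hv; rewrite /I (IE _ Hu Au) (IE _ Hv Av) lee_fin.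
have [Kz _] := dualK_minimizer oO bO lip simp spl m0 Lf Hg Hu Au umin'.
have Dz := dualDE m uhatD Kz.
have IuE : I u = D (wgrad Omega u).
  apply: etrans (IE _ Hu Au) (etrans _ (esym Dz)).
  exact: f_equal (strong_duality oO bO lip simp spl m0 Lf Hg Huhat Hu Au umin').
split.
- move=> v Hv; rewrite /I /primalI /funcG /funcF; case: ifPn => [_|_]; last by [].
  rewrite -EFinD; congr EFin; exact: primal_split.
(* The case distinction is on [dualK] rather than on [HI]: [dualK] is contained in [HI], and outside
   [dualK] both functionals are -oo. *)
- move=> y Ly; have [Ky|nKy] := pselect (dualK Omega T G_I G_D G_N f g y).
    have E := fenchel_dual_dualK oO bO lip simp spl m0 Lf Hg Huhat uDae Ky.
    split=> [_|nHI]; first exact: etrans E (esym (dualDE m uhatD Ky)).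
    by case: Ky => /nHI.
  have E := fenchel_dual_oo oO bO lip simp spl m0 Lf Hg Huhat uDae Ly nKy.
  by split=> _; [exact: etrans E (esym (dualD_oo m uhatD nKy))|exact: E].
exists (wgrad Omega u); split.
- split; first by case: Kz.
  move=> y _; have [Ky|nKy] := pselect (dualK Omega T G_I G_D G_N f g y).
    rewrite (lee_finE (dualDE m uhatD Ky) Dz).
    exact: (dual_le oO bO lip simp spl m0 Lf Hg Huhat Hu Au umin' Ky).
  by rewrite /D (dualD_oo m uhatD nKy) leNye.
- move=> y _ /(_ (wgrad Omega u) (let: And3 h _ _ := Kz in h)) h.
  have [Ky|nKy] := pselect (dualK Omega T G_I G_D G_N f g y); last first.
    by move: h; rewrite /D Dz (dualD_oo m uhatD nKy).
  move: h; rewrite (lee_finE Dz (dualDE m uhatD Ky)).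
  exact: (dual_unique oO bO lip simp spl m0 Lf Hg Huhat Hu Au umin' Ky).
- split; first by case: Kz.
  by move=> v Dv; exact: (dualK_identity oO bO lip simp spl Hg Kz Dv).
- exact: IuE.
- split; first exact: ae_eq_refl.
  rewrite Lpnorm1E.
  exact: (flux_relation oO bO lip simp spl m0 Lf Hg Hu Au umin').
Qed.
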